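(* Let $a>b>0$, let $Q=\{(x,y)\in\mathbb{R}^2: x^2/a^2+y^2/b^2=1\}$, and let $Q_\epsilon$ be a smooth perturbation of $Q$ given in the elliptic coordinates $(\mu,\varphi)$ associated with $Q$ by $$\mu=\mu_\epsilon(\varphi)=\mu_0+\epsilon\mu_1(\varphi)+O(\epsilon^2),$$ where $\mu_\epsilon(\varphi)$ is a real-valued smooth function, $2\pi$-periodic in $\varphi$. Assume that $\mu_1(\varphi)$ is a $2\pi$-periodic entire function (that is, it extends to an entire function on $\mathbb{C}$). (1) If $\mu_1(\varphi)$ is not constant, then none of the $(m,n)$-resonant elliptical caustics of $Q$ with $n$ odd persists under the perturbation $Q_\epsilon$. (2) If $\mu_1'(\varphi)$ is not $\pi$-antiperiodic, then none of the $(m,n)$-resonant elliptical caustics of $Q$ with $n$ even persists under the perturbation $Q_\epsilon$. Here $m,n$ range over the relatively prime integers with $1\le m<n/2$.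
   Context: Billiards: a particle moves freely inside the region enclosed by a closed convex smooth curve and is reflected at the curve so that the angle of incidence equals the angle of reflection. A caustic is a curve such that a billiard trajectory, once tangent to it, stays tangent after every reflection. Elliptic coordinates: with $c=\sqrt{a^2-b^2}$, they are given by $x=c\cosh\mu\cos\varphi$, $y=c\sinh\mu\sin\varphi$. The ellipse $Q$ is $\mu\equiv\mu_0$, where $\cosh\mu_0=a/c$ and $\sinh\mu_0=b/c$. Smooth means $C^\infty$, and dependence on $\epsilon$ is also smooth. The elliptical (convex) caustics of the billiard inside $Q$ are the confocal ellipses $C_\lambda=\{x^2/(a^2-\lambda^2)+y^2/(b^2-\lambda^2)=1\}$, $0<\lambda<b$. An $(m,n)$-gon is a closed polygon with $n$ sides that makes $m$ turns around its caustic. A caustic is $(m,n)$-resonant if all billiard trajectories tangent to it are $(m,n)$-gons. For any relatively prime integers $m,n$ with $1\le m<n/2$ there is a unique $(m,n)$-resonant elliptical caustic of $Q$. Persistence: an $(m,n)$-resonant caustic $C$ of $Q$ persists under a perturbation $Q_\epsilon=Q+O(\epsilon)$ if, for every small enough $\epsilon$, the perturbed billiard curve $Q_\epsilon$ has an $(m,n)$-resonant caustic $C_\epsilon$ with $C_\epsilon=C+O(\epsilon)$. A function $g$ is $\pi$-antiperiodic if $g(\varphi+\pi)=-g(\varphi)$ for all $\varphi$. *)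

(* Defs.v *)
From Stdlib Require Import Reals Lra ZArith Arith.
From Coquelicot Require Import Coquelicot.
Open Scope R_scope.

(* The plane is identified with Coquelicot's C (= R * R), whose subtraction
   and modulus serve as vector subtraction and Euclidean length. *)
Definition dot (u v : C) : R := fst u * fst v + snd u * snd v.
Definition cross (u v : C) : R := fst u * snd v - snd u * fst v.

(* A closed curve is represented by a 2 PI-periodic parametrization. *)
Definition curve := R -> C.

Definition velocity (g : curve) (t : R) : C :=
  (Derive (fun s => fst (g s)) t, Derive (fun s => snd (g s)) t).

Definition periodic (T : R) (f : R -> R) : Prop := forall x, f (x + T) = f x.

Definition antiperiodic (T : R) (f : R -> R) : Prop :=
  forall x, f (x + T) = - f x.

(* Counterclockwise parametrization of a regular simple closed curve which lies
   on one side (the left) of each of its tangent lines. *)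
Record closed_convex_curve (g : curve) : Prop := {
  ccc_smooth : forall k t, ex_derive_n (fun s => fst (g s)) k t /\
                           ex_derive_n (fun s => snd (g s)) k t;
  ccc_periodic : forall t, g (t + 2 * PI) = g t;
  ccc_regular : forall t, velocity g t <> RtoC 0;
  ccc_simple : forall s t, g s = g t -> exists k : Z, t = s + 2 * PI * IZR k;
  ccc_convex : forall s t, 0 <= cross (velocity g s) (g t - g s)%C
}.

(* Meaningful for [closed_convex_curve]s only. *)
Definition inside (g : curve) (o : C) : Prop :=
  forall s, 0 < cross (velocity g s) (o - g s)%C.

(* The unit vector w / |w| is the mirror image of v / |v| in the line spanned
   by T. *)
Definition reflected (T v w : C) : Prop :=
  dot T v / Cmod v = dot T w / Cmod w /\
  cross T v / Cmod v = - (cross T w / Cmod w).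

(* A trajectory is given by the parameters of its successive impact points. *)
Definition billiard_trajectory (q : curve) (t : nat -> R) : Prop :=
  forall j : nat,
    q (t j) <> q (t (S j)) /\
    reflected (velocity q (t (S j)))
              (q (t (S j)) - q (t j))%C
              (q (t (S (S j))) - q (t (S j)))%C.

Definition segment_tangent (g : curve) (p p' : C) : Prop :=
  exists th s : R,
    0 <= s <= 1 /\
    g th = (p + RtoC s * (p' - p))%C /\
    cross (velocity g th) (p' - p)%C = 0.

Definition caustic (q g : curve) : Prop :=
  closed_convex_curve g /\
  forall t : nat -> R, billiard_trajectory q t ->
  forall j : nat,
    segment_tangent g (q (t j)) (q (t (S j))) ->
    segment_tangent g (q (t (S j))) (q (t (S (S j)))).

(* The closed polygon p 0, ..., p n = p 0 has winding number m or -m about o: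
   alpha lifts the polar angle about o along the polygon, and along each side
   (which misses o) the angle varies by less than PI. *)
Definition turns_around (m n : nat) (p : nat -> C) (o : C) : Prop :=
  exists alpha rho : nat -> R,
    (forall j : nat, 0 < rho j /\
       (p j - o)%C = (rho j * cos (alpha j), rho j * sin (alpha j))) /\
    (forall j : nat, Rabs (alpha (S j) - alpha j) < PI) /\
    Rabs (alpha n - alpha 0%nat) = 2 * PI * INR m.

(* A closed polygon with n sides, traversed periodically, which makes m turns
   around the convex curve g, in either direction. *)
Definition mn_gon (m n : nat) (g : curve) (p : nat -> C) : Prop :=
  (forall j : nat, p (j + n)%nat = p j) /\
  (forall o : C, inside g o -> turns_around m n p o).

Definition resonant_caustic (m n : nat) (q g : curve) : Prop :=
  caustic q g /\
  forall t : nat -> R, billiard_trajectory q t ->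
    (forall j : nat, segment_tangent g (q (t j)) (q (t (S j)))) ->
    mn_gon m n g (fun j => q (t j)).

(* C_eps = C + O(eps) is uniform closeness of suitable parametrizations; no
   regularity of C_eps with respect to eps is required. *)
Definition persists (m n : nat) (Q : R -> curve) (g : curve) : Prop :=
  exists (geps : R -> curve) (K e0 : R),
    0 < e0 /\
    forall eps, Rabs eps < e0 ->
      resonant_caustic m n (Q eps) (geps eps) /\
      forall th, Cmod (geps eps th - g th)%C <= K * Rabs eps.

Definition ellipse (A B : R) : curve := fun th => (A * cos th, B * sin th).

Lemma ellipse_equation (A B x y : R) : 0 < A -> 0 < B ->
  x ^ 2 / A ^ 2 + y ^ 2 / B ^ 2 = 1 <-> exists th, ellipse A B th = (x, y).
Proof.
intros HA HB; split.
- intros H.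
  set (u := x / A); set (v := y / B).
  assert (Huv : u * u + v * v = 1).
  { rewrite <- H; unfold u, v; field; lra. }
  assert (Hu : -1 <= u <= 1) by (split; nra).
  assert (Hx : A * u = x) by (unfold u; field; lra).
  assert (Hy : B * v = y) by (unfold v; field; lra).
  assert (Hs : sqrt (1 - Rsqr u) = Rabs v).
  { rewrite <- sqrt_Rsqr_abs; f_equal; unfold Rsqr; lra. }
  destruct (Rle_dec 0 v) as [Hv | Hv].
  + exists (acos u); unfold ellipse.
    rewrite cos_acos, sin_acos, Hs, Rabs_pos_eq by lra.
    now rewrite Hx, Hy.
  + exists (- acos u); unfold ellipse.
    rewrite cos_neg, sin_neg, cos_acos, sin_acos, Hs, Rabs_left by lra.
    now rewrite Ropp_involutive, Hx, Hy.
- intros [th H]; injection H as <- <-.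
  replace (_ + _) with (Rsqr (sin th) + Rsqr (cos th))
    by (unfold Rsqr; field; lra).
  apply sin2_cos2.
Qed.

Definition confocal_ellipse (a b lambda : R) : curve :=
  ellipse (sqrt (a ^ 2 - lambda ^ 2)) (sqrt (b ^ 2 - lambda ^ 2)).

Definition elliptic_point (c mu phi : R) : C :=
  (c * cosh mu * cos phi, c * sinh mu * sin phi).

(* mu eps phi = mu0 + eps * mu1 phi + O(eps ^ 2), jointly smooth for small eps;
   the remainder is uniform in phi. *)
Definition smooth_perturbation (mu : R -> R -> R) (mu0 : R) (mu1 : R -> R)
  : Prop :=
  exists e0 K : R,
    0 < e0 /\
    (forall (k : nat) (eps phi : R), Rabs eps < e0 -> ex_diff_n mu k eps phi) /\
    (forall eps : R, Rabs eps < e0 -> periodic (2 * PI) (mu eps)) /\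
    (forall eps phi : R, Rabs eps < e0 ->
       Rabs (mu eps phi - (mu0 + eps * mu1 phi)) <= K * eps ^ 2).

Definition extends_to_entire (f : R -> R) : Prop :=
  exists F : C -> C,
    (forall z : C, @ex_derive C_AbsRing C_NormedModule F z) /\
    (forall x : R, F (RtoC x) = RtoC (f x)).

(* Main.v *)
Require Import Defs.
From Stdlib Require Import Reals Psatz ZArith ClassicalEpsilon.
From Coquelicot Require Import Coquelicot.
Open Scope R_scope.

(* If the caustic persists, then for every small eps and every orbit of the ellipse tangent to
   the unperturbed caustic there is a periodic billiard polygon of the perturbed curve within
   O(eps). Polygons of this kind are critical for the perimeter, so two of them at distance eta
   have perimeters differing by O(eta^3); joining two orbits by 1/eps polygons shows that the
   perimeter is constant along the family up to O(eps^2). Its first-order term in eps is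
   proportional to the sum of mu1 over the impact points, which is therefore the same for all
   orbits (Melnikov condition). The impact points are PI / 2 + am (t + j delta), where am is the
   Jacobi amplitude and n delta = 2 m P, P being the period of am modulo PI. As a function of
   z = exp (i am t), the term j = 0 of the sum is holomorphic on the punctured plane with an
   isolated singularity at z = 0, near which the other terms are bounded unless am (j delta) is
   a multiple of PI. For n odd this does not happen for 0 < j < n; for n even it happens for
   j = n / 2 only, whose term is grouped with the term j = 0. By Liouville's
   theorem mu1, resp. mu1 + mu1 (. + PI), is constant. *)

(** * Complex differentiability *)

(** Persistence gives no regularity of C_eps in eps, so there is no family of polygons to
    differentiate in eps; instead, polygons of one and the same table are compared with each other.
    The cubic gain is Rolle's theorem: on the segment between two critical polygons the derivative
    of the perimeter vanishes at both ends, so its second derivative vanishes in between. With steps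
    of size O(eps) the 1 / eps errors O(eps^3) add up to O(eps^2), below the first-order term. On
    the complex side the obstacle is branching. By the addition theorem exp (i am (t + u)) is an
    algebraic function of z = exp (i am t) that contains the square root of a quartic in z, so the
    identity between the terms of the sum is not global in z. The quartic has positive real part in
    a sector about the positive axis and also near z = 0, and the principal root serves in both
    regions; the identity is carried from an arc of the unit circle along the sector to z = 0 and
    then around it. Infinity is handled by complex conjugation, since mu1 is real on the real
    axis. *)

Lemma Cmod_sub_sym (z w : C) : Cmod (z - w)%C = Cmod (w - z)%C.
Proof. rewrite <- Cmod_opp; f_equal; ring. Qed.

Lemma Cmod_triangle_rev (z w : C) : Cmod z - Cmod w <= Cmod (z - w)%C.
Proof.
pose proof (Cmod_triangle (z - w)%C w) as H.
replace (z - w + w)%C with z in H by ring; lra.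
Qed.

Lemma Cmod_pair (x y : R) : Cmod (x, y) <= Rabs x + Rabs y.
Proof.
replace ((x, y) : C) with (RtoC x + RtoC y * Ci)%C.
2:{ unfold Cplus, Cmult, RtoC, Ci; simpl; f_equal; ring. }
eapply Rle_trans; [apply Cmod_triangle|].
rewrite Cmod_mult, Cmod_Ci, !Cmod_R; lra.
Qed.

Lemma im_le_Cmod (z : C) : Rabs (Im z) <= Cmod z.
Proof. eapply Rle_trans; [apply Rmax_r | apply Rmax_Cmod]. Qed.

Definition ccont (f : C -> C) (z : C) : Prop :=
  forall eps : R, 0 < eps -> exists delta : R, 0 < delta /\
    forall w : C, Cmod (w - z)%C < delta -> Cmod (f w - f z)%C < eps.

Lemma ccont_const (c z : C) : ccont (fun _ => c) z.
Proof.
intros e He; exists 1; split; [lra|]; intros w _.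
replace (c - c)%C with (RtoC 0) by ring; rewrite Cmod_0; lra.
Qed.

Lemma ccont_id (z : C) : ccont (fun w => w) z.
Proof. intros e He; exists e; split; auto. Qed.

Lemma ccont_plus (f g : C -> C) (z : C) :
  ccont f z -> ccont g z -> ccont (fun w => f w + g w)%C z.
Proof.
intros Hf Hg e He.
destruct (Hf (e / 2)) as [d1 [Hd1 H1]]; [lra|].
destruct (Hg (e / 2)) as [d2 [Hd2 H2]]; [lra|].
exists (Rmin d1 d2); split; [now apply Rmin_pos|]; intros w Hw.
replace (f w + g w - (f z + g z))%C with ((f w - f z) + (g w - g z))%C by ring.
eapply Rle_lt_trans; [apply Cmod_triangle|].
specialize (H1 w (Rlt_le_trans _ _ _ Hw (Rmin_l _ _))).
specialize (H2 w (Rlt_le_trans _ _ _ Hw (Rmin_r _ _))); lra.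
Qed.

Lemma ccont_bounded (f : C -> C) (z : C) : ccont f z ->
  exists delta : R, 0 < delta /\
    forall w : C, Cmod (w - z)%C < delta -> Cmod (f w) < Cmod (f z) + 1.
Proof.
intros Hf; destruct (Hf 1) as [d [Hd H]]; [lra|].
exists d; split; [easy|]; intros w Hw; specialize (H w Hw).
pose proof (Cmod_triangle_rev (f w) (f z)); lra.
Qed.

Lemma ccont_mult (f g : C -> C) (z : C) :
  ccont f z -> ccont g z -> ccont (fun w => f w * g w)%C z.
Proof.
intros Hf Hg e He.
destruct (ccont_bounded g z Hg) as [d0 [Hd0 H0]].
set (M := Cmod (g z) + 1) in *; set (N := Cmod (f z) + 1).
assert (HM : 0 < M) by (pose proof (Cmod_ge_0 (g z)); unfold M; lra).
assert (HN : 0 < N) by (pose proof (Cmod_ge_0 (f z)); unfold N; lra).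
destruct (Hf (e / 2 / M)) as [d1 [Hd1 H1]]; [repeat apply Rdiv_lt_0_compat; lra|].
destruct (Hg (e / 2 / N)) as [d2 [Hd2 H2]]; [repeat apply Rdiv_lt_0_compat; lra|].
exists (Rmin d0 (Rmin d1 d2)); split; [repeat apply Rmin_pos; easy|]; intros w Hw.
assert (Hw0 : Cmod (w - z)%C < d0) by (eapply Rlt_le_trans; [exact Hw | apply Rmin_l]).
assert (Hw' : Cmod (w - z)%C < Rmin d1 d2) by (eapply Rlt_le_trans; [exact Hw | apply Rmin_r]).
specialize (H0 w Hw0).
specialize (H1 w (Rlt_le_trans _ _ _ Hw' (Rmin_l _ _))).
specialize (H2 w (Rlt_le_trans _ _ _ Hw' (Rmin_r _ _))).
replace (f w * g w - f z * g z)%C with ((f w - f z) * g w + f z * (g w - g z))%C by ring.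
eapply Rle_lt_trans; [apply Cmod_triangle|]; rewrite !Cmod_mult.
assert (A1 : Cmod (f w - f z)%C * Cmod (g w) <= e / 2 / M * M).
{ apply Rmult_le_compat; try apply Cmod_ge_0; lra. }
assert (A2 : Cmod (f z) * Cmod (g w - g z)%C <= Cmod (f z) * (e / 2 / N)).
{ apply Rmult_le_compat_l; [apply Cmod_ge_0 | lra]. }
assert (A3 : Cmod (f z) * (e / 2 / N) < N * (e / 2 / N)).
{ apply Rmult_lt_compat_r; [repeat apply Rdiv_lt_0_compat; lra | unfold N; lra]. }
replace (e / 2 / M * M) with (e / 2) in A1 by (field; lra).
replace (N * (e / 2 / N)) with (e / 2) in A3 by (field; lra); lra.
Qed.

Lemma ccont_inv (f : C -> C) (z : C) :
  ccont f z -> f z <> RtoC 0 -> ccont (fun w => / f w)%C z.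
Proof.
intros Hf Hz e He.
apply Cmod_gt_0 in Hz as Hm; set (m := Cmod (f z)) in *.
destruct (Hf (Rmin (m / 2) (e * (m * m) / 2))) as [d [Hd H]].
{ apply Rmin_pos; [lra|]; apply Rdiv_lt_0_compat; [|lra]; repeat apply Rmult_lt_0_compat; lra. }
exists d; split; [easy|]; intros w Hw; specialize (H w Hw).
assert (H1 : Cmod (f w - f z)%C < m / 2) by (eapply Rlt_le_trans; [exact H | apply Rmin_l]).
assert (H2 : Cmod (f w - f z)%C < e * (m * m) / 2) by (eapply Rlt_le_trans; [exact H | apply Rmin_r]).
pose proof (Cmod_triangle_rev (f z) (f w)) as H3; rewrite Cmod_sub_sym in H3; fold m in H3.
assert (Hfw : f w <> RtoC 0) by (apply Cmod_gt_0; lra).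
replace (/ f w - / f z)%C with ((f z - f w) / (f w * f z))%C by (field; easy).
rewrite Cmod_div by (apply Cmult_neq_0; easy).
rewrite Cmod_mult, Cmod_sub_sym; fold m.
apply Rmult_lt_reg_r with (Cmod (f w) * m); [apply Rmult_lt_0_compat; lra|].
unfold Rdiv; rewrite Rmult_assoc, Rinv_l, Rmult_1_r.
2:{ apply Rmult_integral_contrapositive; split; lra. }
assert (e * (m / 2 * m) <= e * (Cmod (f w) * m)); [|lra].
apply Rmult_le_compat_l; [lra|]; apply Rmult_le_compat_r; lra.
Qed.

Lemma ccont_comp (f g : C -> C) (z : C) :
  ccont g z -> ccont f (g z) -> ccont (fun w => f (g w)) z.
Proof.
intros Hg Hf e He.
destruct (Hf e He) as [d [Hd H]]; destruct (Hg d Hd) as [d' [Hd' H']].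
exists d'; split; auto.
Qed.

(* Caratheodory's form of complex differentiability. *)
Definition cdiff (f : C -> C) (z : C) : Prop :=
  exists phi : C -> C, ccont phi z /\
    exists delta : R, 0 < delta /\
      forall w : C, Cmod (w - z)%C < delta -> f w = (f z + phi w * (w - z))%C.

Lemma cdiff_ext_loc (f g : C -> C) (z : C) (delta : R) : 0 < delta ->
  (forall w, Cmod (w - z)%C < delta -> f w = g w) -> cdiff f z -> cdiff g z.
Proof.
intros Hd H [phi [Hphi [d [Hd' H']]]]; exists phi; split; [easy|].
exists (Rmin delta d); split; [now apply Rmin_pos|]; intros w Hw.
rewrite <- H, <- H.
- apply H'; eapply Rlt_le_trans; [exact Hw | apply Rmin_r].
- replace (z - z)%C with (RtoC 0) by ring; rewrite Cmod_0; lra.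
- eapply Rlt_le_trans; [exact Hw | apply Rmin_l].
Qed.

Lemma cdiff_ext (f g : C -> C) (z : C) :
  (forall w, f w = g w) -> cdiff f z -> cdiff g z.
Proof. intros H; apply (cdiff_ext_loc f g z 1); [lra | auto]. Qed.

Lemma cdiff_const (c z : C) : cdiff (fun _ => c) z.
Proof.
exists (fun _ => RtoC 0); split; [apply ccont_const|].
exists 1; split; [lra|]; intros; ring.
Qed.

Lemma cdiff_id (z : C) : cdiff (fun w => w) z.
Proof.
exists (fun _ => RtoC 1); split; [apply ccont_const|].
exists 1; split; [lra|]; intros; ring.
Qed.

Lemma ccont_ext_loc (f g : C -> C) (z : C) (delta : R) : 0 < delta ->
  (forall w, Cmod (w - z)%C < delta -> f w = g w) -> ccont f z -> ccont g z.
Proof.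
intros Hd H Hf e He; destruct (Hf e He) as [d [Hd' H']].
exists (Rmin delta d); split; [now apply Rmin_pos|]; intros w Hw.
rewrite <- H, <- H.
- apply H'; eapply Rlt_le_trans; [exact Hw | apply Rmin_r].
- replace (z - z)%C with (RtoC 0) by ring; rewrite Cmod_0; lra.
- eapply Rlt_le_trans; [exact Hw | apply Rmin_l].
Qed.

Lemma cdiff_ccont (f : C -> C) (z : C) : cdiff f z -> ccont f z.
Proof.
intros [phi [Hphi [d [Hd H]]]].
apply (ccont_ext_loc (fun w => f z + phi w * (w + - z))%C _ _ d); [easy| |].
- intros w Hw; symmetry; rewrite (H w Hw) at 1; ring.
- apply ccont_plus; [apply ccont_const|].
  apply ccont_mult; [easy|]; apply ccont_plus; [apply ccont_id | apply ccont_const].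
Qed.

Lemma cdiff_plus (f g : C -> C) (z : C) :
  cdiff f z -> cdiff g z -> cdiff (fun w => f w + g w)%C z.
Proof.
intros [p [Hp [d [Hd H]]]] [q [Hq [d' [Hd' H']]]].
exists (fun w => p w + q w)%C; split; [now apply ccont_plus|].
exists (Rmin d d'); split; [now apply Rmin_pos|]; intros w Hw.
rewrite (H w), (H' w).
- ring.
- eapply Rlt_le_trans; [exact Hw | apply Rmin_r].
- eapply Rlt_le_trans; [exact Hw | apply Rmin_l].
Qed.

Lemma cdiff_mult (f g : C -> C) (z : C) :
  cdiff f z -> cdiff g z -> cdiff (fun w => f w * g w)%C z.
Proof.
intros [p [Hp [d [Hd H]]]] Hg'; pose proof (cdiff_ccont g z Hg') as Hg.
destruct Hg' as [q [Hq [d' [Hd' H']]]].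
exists (fun w => p w * g w + f z * q w)%C; split.
{ apply ccont_plus; apply ccont_mult; auto; apply ccont_const. }
exists (Rmin d d'); split; [now apply Rmin_pos|]; intros w Hw.
rewrite (H w), (H' w).
- ring.
- eapply Rlt_le_trans; [exact Hw | apply Rmin_r].
- eapply Rlt_le_trans; [exact Hw | apply Rmin_l].
Qed.

Lemma cdiff_opp (f : C -> C) (z : C) : cdiff f z -> cdiff (fun w => - f w)%C z.
Proof.
intros H; apply (cdiff_ext (fun w => - RtoC 1 * f w)%C).
- intros w; ring.
- apply cdiff_mult; [apply cdiff_const | easy].
Qed.

Lemma cdiff_minus (f g : C -> C) (z : C) :
  cdiff f z -> cdiff g z -> cdiff (fun w => f w - g w)%C z.
Proof. intros Hf Hg; apply cdiff_plus; [easy | now apply cdiff_opp]. Qed.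

Lemma cdiff_comp (f g : C -> C) (z : C) :
  cdiff g z -> cdiff f (g z) -> cdiff (fun w => f (g w)) z.
Proof.
intros Hg' [p [Hp [d [Hd H]]]]; pose proof (cdiff_ccont g z Hg') as Hg.
destruct Hg' as [q [Hq [d' [Hd' H']]]].
exists (fun w => p (g w) * q w)%C; split.
{ apply ccont_mult; [now apply ccont_comp | easy]. }
destruct (Hg d Hd) as [d2 [Hd2 H2]].
exists (Rmin d' d2); split; [now apply Rmin_pos|]; intros w Hw.
rewrite (H (g w)).
- replace (g w - g z)%C with (q w * (w - z))%C; [ring|].
  rewrite (H' w) by (eapply Rlt_le_trans; [exact Hw | apply Rmin_l]); ring.
- apply H2; eapply Rlt_le_trans; [exact Hw | apply Rmin_r].
Qed.

Lemma ccont_neq_0 (f : C -> C) (z : C) : ccont f z -> f z <> RtoC 0 ->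
  exists delta, 0 < delta /\ forall w, Cmod (w - z)%C < delta -> f w <> RtoC 0.
Proof.
intros Hf Hz; apply Cmod_gt_0 in Hz.
destruct (Hf _ Hz) as [d [Hd H]]; exists d; split; [easy|]; intros w Hw E.
specialize (H w Hw); rewrite E, Cmod_sub_sym in H.
replace (f z - 0)%C with (f z) in H by ring; lra.
Qed.

Lemma cdiff_inv (f : C -> C) (z : C) :
  cdiff f z -> f z <> RtoC 0 -> cdiff (fun w => / f w)%C z.
Proof.
intros Hf' Hz; pose proof (cdiff_ccont f z Hf') as Hf.
destruct Hf' as [p [Hp [d [Hd H]]]].
destruct (ccont_neq_0 f z Hf Hz) as [d' [Hd' H']].
exists (fun w => - / f z * (p w * / f w))%C; split.
{ apply ccont_mult; [apply ccont_const|]; apply ccont_mult; [easy | now apply ccont_inv]. }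
exists (Rmin d d'); split; [now apply Rmin_pos|]; intros w Hw.
assert (Hw1 : f w <> RtoC 0) by (apply H'; eapply Rlt_le_trans; [exact Hw | apply Rmin_r]).
assert (Hw2 : f w = (f z + p w * (w - z))%C)
  by (apply H; eapply Rlt_le_trans; [exact Hw | apply Rmin_l]).
replace (/ f z + - / f z * (p w * / f w) * (w - z))%C
  with (/ f z * / f w * (f w - p w * (w - z)))%C by (field; easy).
rewrite Hw2 at 3; field; easy.
Qed.

Lemma cdiff_div (f g : C -> C) (z : C) :
  cdiff f z -> cdiff g z -> g z <> RtoC 0 -> cdiff (fun w => f w / g w)%C z.
Proof. intros Hf Hg Hz; apply cdiff_mult; [easy | now apply cdiff_inv]. Qed.

(* The Cauchy-Riemann equations are built into the two differentials. *)
Lemma cdiff_differentiable (f : C -> C) (x y : R) : cdiff f (x, y) ->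
  exists p q : R,
    differentiable_pt_lim (fun u v => Re (f (u, v))) x y p (- q) /\
    differentiable_pt_lim (fun u v => Im (f (u, v))) x y q p.
Proof.
intros [phi [Hphi [d [Hd H]]]].
assert (Main : forall eps : posreal, exists d' : posreal, forall u v,
  Rabs (u - x) < d' -> Rabs (v - y) < d' ->
  Cmod (f (u, v) - f (x, y) - phi (x, y) * ((u, v) - (x, y)))%C <=
    eps * Rmax (Rabs (u - x)) (Rabs (v - y))).
{ intros [e He]; simpl.
  destruct (Hphi (e / 2)) as [d' [Hd' H']]; [lra|].
  assert (Hm : 0 < Rmin d d' / 2) by (apply Rdiv_lt_0_compat; [now apply Rmin_pos | lra]).
  exists (mkposreal _ Hm); simpl; intros u v Hu Hv.
  assert (E : ((u, v) - (x, y))%C = (u - x, v - y)) by reflexivity.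
  assert (B : Cmod ((u, v) - (x, y))%C <= 2 * Rmax (Rabs (u - x)) (Rabs (v - y))).
  { rewrite E; eapply Rle_trans; [apply Cmod_pair|].
    pose proof (Rmax_l (Rabs (u - x)) (Rabs (v - y))).
    pose proof (Rmax_r (Rabs (u - x)) (Rabs (v - y))); lra. }
  assert (B' : Cmod ((u, v) - (x, y))%C < Rmin d d').
  { rewrite E; eapply Rle_lt_trans; [apply Cmod_pair|]; lra. }
  rewrite (H (u, v)) by (eapply Rlt_le_trans; [exact B' | apply Rmin_l]).
  replace (f (x, y) + phi (u, v) * ((u, v) - (x, y)) - f (x, y) -
    phi (x, y) * ((u, v) - (x, y)))%C
    with ((phi (u, v) - phi (x, y)) * ((u, v) - (x, y)))%C by ring.
  rewrite Cmod_mult.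
  assert (B2 : Cmod (phi (u, v) - phi (x, y))%C < e / 2).
  { apply H'; eapply Rlt_le_trans; [exact B' | apply Rmin_r]. }
  apply Rle_trans with (e / 2 * (2 * Rmax (Rabs (u - x)) (Rabs (v - y)))); [|lra].
  apply Rmult_le_compat; try apply Cmod_ge_0; lra. }
exists (Re (phi (x, y))), (Im (phi (x, y))).
split; intros eps; destruct (Main eps) as [d' H']; exists d'; intros u v Hu Hv;
  (eapply Rle_trans; [|apply (H' u v Hu Hv)]).
- eapply Rle_trans; [|apply re_le_Cmod]; right; f_equal.
  unfold Re, Im, Cminus, Cplus, Copp, Cmult; simpl; ring.
- eapply Rle_trans; [|apply im_le_Cmod]; right; f_equal.
  unfold Im, Re, Cminus, Cplus, Copp, Cmult; simpl; ring.
Qed.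

(** The slope function is the difference quotient, completed at z by the derivative l. *)
Lemma cdiff_of_ex_derive (f : C -> C) (z : C) :
  @ex_derive C_AbsRing C_NormedModule f z -> cdiff f z.
Proof.
intros [l [_ H]].
specialize (H z (fun P HP => HP)); unfold is_domin in H.
exists (fun w => if Ceq_dec w z then l else (f w - f z) / (w - z))%C; split.
- intros e He.
  assert (He2 : 0 < e / 2) by lra.
  destruct (H (mkposreal _ He2)) as [[d Hd] Hd']; simpl in Hd'.
  exists d; split; [easy|]; intros w Hw.
  destruct (Ceq_dec z z) as [_ | N]; [|easy].
  destruct (Ceq_dec w z) as [E | N].
  { replace (l - l)%C with (RtoC 0) by ring; rewrite Cmod_0; easy. }
  assert (N' : (w - z)%C <> RtoC 0).
  { intros E; apply N; replace w with (w - z + z)%C by ring; rewrite E; ring. }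
  assert (B : Cmod (f w - f z - (w - z) * l)%C <= e / 2 * Cmod (w - z)%C).
  { apply (Hd' w); exact Hw. }
  replace ((f w - f z) / (w - z) - l)%C with ((f w - f z - (w - z) * l) / (w - z))%C
    by (field; easy).
  rewrite Cmod_div by easy.
  apply Cmod_gt_0 in N'.
  apply Rle_lt_trans with (e / 2); [|lra].
  apply Rmult_le_reg_r with (Cmod (w - z)%C); [easy|].
  unfold Rdiv at 1; rewrite Rmult_assoc, Rinv_l by lra; lra.
- exists 1; split; [lra|]; intros w _.
  destruct (Ceq_dec w z) as [-> | N]; [ring|].
  field; intros E; apply N; replace w with (w - z + z)%C by ring; rewrite E; ring.
Qed.

(** * Cauchy's theorem on rectangles *)

Lemma continuity_2d_1 (f : R -> R -> R) (x y : R) :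
  continuity_2d_pt f x y -> continuous (fun u => f u y) x.
Proof.
intros H; apply continuity_pt_filterlim; intros e He.
destruct (H (mkposreal e He)) as [d Hd]; exists d; split; [apply cond_pos|].
intros u [_ Hu]; apply Hd; [exact Hu|].
rewrite Rminus_diag, Rabs_R0; apply cond_pos.
Qed.

Lemma continuity_2d_2 (f : R -> R -> R) (x y : R) :
  continuity_2d_pt f x y -> continuous (fun v => f x v) y.
Proof.
intros H; apply continuity_pt_filterlim; intros e He.
destruct (H (mkposreal e He)) as [d Hd]; exists d; split; [apply cond_pos|].
intros u [_ Hu]; apply Hd; [|exact Hu].
rewrite Rminus_diag, Rabs_R0; apply cond_pos.
Qed.

(** The counterclockwise line integral of P dx + Q dy round the rectangle [a, b] x [c, d]. *)
Definition circulation (P Q : R -> R -> R) (a b c d : R) : R :=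
  RInt (fun x => P x c) a b + RInt (fun y => Q b y) c d
  - RInt (fun x => P x d) a b - RInt (fun y => Q a y) c d.

Definition cont_on (P : R -> R -> R) (a b c d : R) : Prop :=
  forall x y, a <= x <= b -> c <= y <= d -> continuity_2d_pt P x y.

Lemma ex_RInt_h (P : R -> R -> R) (a b c d a' b' y : R) : cont_on P a b c d ->
  a <= a' -> a' <= b' -> b' <= b -> c <= y <= d -> ex_RInt (fun x => P x y) a' b'.
Proof.
intros H H1 H2 H3 Hy; apply (ex_RInt_continuous (V := R_CompleteNormedModule)).
rewrite Rmin_left, Rmax_right by lra; intros x Hx.
apply continuity_2d_1, H; lra.
Qed.

Lemma ex_RInt_v (P : R -> R -> R) (a b c d c' d' x : R) : cont_on P a b c d ->
  c <= c' -> c' <= d' -> d' <= d -> a <= x <= b -> ex_RInt (fun y => P x y) c' d'.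
Proof.
intros H H1 H2 H3 Hy; apply (ex_RInt_continuous (V := R_CompleteNormedModule)).
rewrite Rmin_left, Rmax_right by lra; intros y Hx.
apply continuity_2d_2, H; lra.
Qed.

Lemma RInt_split (f : R -> R) (a b c : R) :
  ex_RInt f a b -> ex_RInt f b c -> RInt f a c = RInt f a b + RInt f b c.
Proof. intros H1 H2; symmetry; apply (RInt_Chasles (V := R_CompleteNormedModule)); easy. Qed.

(** Inner sides are traversed twice, in opposite directions. *)
Lemma circulation_quarters (P Q : R -> R -> R) (a b c d x y : R) :
  a <= x <= b -> c <= y <= d -> cont_on P a b c d -> cont_on Q a b c d ->
  circulation P Q a b c d =
    circulation P Q a x c y + circulation P Q x b c y +
    circulation P Q a x y d + circulation P Q x b y d.
Proof.
intros Hx Hy HP HQ; unfold circulation.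
rewrite (RInt_split (fun u => P u c) a x b).
2, 3: apply (ex_RInt_h P a b c d); auto; lra.
rewrite (RInt_split (fun u => P u d) a x b).
2, 3: apply (ex_RInt_h P a b c d); auto; lra.
rewrite (RInt_split (fun v => Q b v) c y d).
2, 3: apply (ex_RInt_v Q a b c d); auto; lra.
rewrite (RInt_split (fun v => Q a v) c y d).
2, 3: apply (ex_RInt_v Q a b c d); auto; lra.
ring.
Qed.

Lemma RInt_affine (k l x0 a b : R) :
  is_RInt (fun x => k + l * (x - x0)) a b
    ((k * b + l * (b - x0) ^ 2 / 2) - (k * a + l * (a - x0) ^ 2 / 2)).
Proof.
apply (is_RInt_derive (V := R_CompleteNormedModule)
  (fun x => k * x + l * (x - x0) ^ 2 / 2) (fun x => k + l * (x - x0))).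
- intros x _; auto_derive; [easy | field].
- intros x _; apply (ex_derive_continuous (V := R_NormedModule)); auto_derive; easy.
Qed.

(** The coefficient q, shared by P and Q, makes the affine part a closed form, so that only the
    errors are integrated, over a boundary of length 2 ((b - a) + (d - c)). *)
Lemma circulation_affine (P Q : R -> R -> R) (a b c d x0 y0 P0 p q Q0 r e : R) :
  a <= x0 <= b -> c <= y0 <= d -> 0 <= e ->
  cont_on P a b c d -> cont_on Q a b c d ->
  (forall x y, a <= x <= b -> c <= y <= d ->
     Rabs (P x y - P0 - (p * (x - x0) + q * (y - y0))) <= e * ((b - a) + (d - c)) /\
     Rabs (Q x y - Q0 - (q * (x - x0) + r * (y - y0))) <= e * ((b - a) + (d - c))) ->
  Rabs (circulation P Q a b c d) <= 2 * e * ((b - a) + (d - c)) ^ 2.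
Proof.
intros Hx Hy He HP HQ H.
assert (HH : forall y, c <= y <= d ->
  Rabs (RInt (fun x => P x y) a b -
     (((P0 + q * (y - y0)) * b + p * (b - x0) ^ 2 / 2) -
      ((P0 + q * (y - y0)) * a + p * (a - x0) ^ 2 / 2)))
    <= (b - a) * (e * ((b - a) + (d - c)))).
{ intros y Hy'.
  pose proof (RInt_affine (P0 + q * (y - y0)) p x0 a b) as HA.
  assert (HE : ex_RInt (fun x => P x y) a b) by (apply (ex_RInt_h _ a b c d); auto; lra).
  rewrite <- (is_RInt_unique _ _ _ _ HA).
  change (Rabs (minus (RInt (fun x => P x y) a b)
    (RInt (fun x => P0 + q * (y - y0) + p * (x - x0)) a b)) <=
    (b - a) * (e * (b - a + (d - c)))).
  rewrite <- RInt_minus by (auto; eexists; exact HA).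
  apply abs_RInt_le_const; [lra | apply (ex_RInt_minus (V := R_NormedModule)); auto; eexists; exact HA |].
  intros t Ht; destruct (H t y Ht Hy') as [H1 _].
  eapply Rle_trans; [|exact H1]; right; f_equal; unfold minus, plus, opp; simpl; ring. }
assert (HV : forall x, a <= x <= b ->
  Rabs (RInt (fun y => Q x y) c d -
     (((Q0 + q * (x - x0)) * d + r * (d - y0) ^ 2 / 2) -
      ((Q0 + q * (x - x0)) * c + r * (c - y0) ^ 2 / 2)))
    <= (d - c) * (e * ((b - a) + (d - c)))).
{ intros x Hx'.
  pose proof (RInt_affine (Q0 + q * (x - x0)) r y0 c d) as HA.
  assert (HE : ex_RInt (fun y => Q x y) c d) by (apply (ex_RInt_v _ a b c d); auto; lra).
  rewrite <- (is_RInt_unique _ _ _ _ HA).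
  change (Rabs (minus (RInt (fun y => Q x y) c d)
    (RInt (fun y => Q0 + q * (x - x0) + r * (y - y0)) c d)) <=
    (d - c) * (e * (b - a + (d - c)))).
  rewrite <- RInt_minus by (auto; eexists; exact HA).
  apply abs_RInt_le_const; [lra | apply (ex_RInt_minus (V := R_NormedModule)); auto; eexists; exact HA |].
  intros t Ht; destruct (H x t Hx' Ht) as [_ H1].
  eapply Rle_trans; [|exact H1]; right; f_equal; unfold minus, plus, opp; simpl; ring. }
unfold circulation.
pose proof (HH c) as A1; pose proof (HH d) as A2; pose proof (HV b) as A3; pose proof (HV a) as A4.
specialize (A1 ltac:(lra)); specialize (A2 ltac:(lra)); specialize (A3 ltac:(lra)); specialize (A4 ltac:(lra)).
set (I1 := RInt _ a b) in *; set (I2 := RInt (fun x => P x d) a b) in *; set (J1 := RInt _ c d) in *; set (J2 := RInt (fun y => Q a y) c d) in *.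
apply Rabs_le_between in A1, A2, A3, A4; apply Rabs_le_between.
set (w := e * (b - a + (d - c))) in *.
replace (2 * e * (b - a + (d - c)) ^ 2) with (2 * ((b - a) * w + (d - c) * w)) by (unfold w; ring).
split; lra.
Qed.

Section Goursat.

Context (P Q : R -> R -> R).

Let circ (s : R * R * (R * R)) : R :=
  let '((x, y), (w, h)) := s in circulation P Q x (x + w) y (y + h).

Let quarter (i j : R) (s : R * R * (R * R)) : R * R * (R * R) :=
  let '((x, y), (w, h)) := s in ((x + i * (w / 2), y + j * (h / 2)), (w / 2, h / 2)).

(** The last quarter is the default: if the other three carry less than a quarter of the circulation
    each, the triangle inequality leaves enough for it. *)
Let next (s : R * R * (R * R)) : R * R * (R * R) :=
  if Rle_dec (Rabs (circ s) / 4) (Rabs (circ (quarter 0 0 s))) then quarter 0 0 s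
  else if Rle_dec (Rabs (circ s) / 4) (Rabs (circ (quarter 1 0 s))) then quarter 1 0 s
  else if Rle_dec (Rabs (circ s) / 4) (Rabs (circ (quarter 0 1 s))) then quarter 0 1 s
  else quarter 1 1 s.

Let within (s s' : R * R * (R * R)) : Prop :=
  let '((x, y), (w, h)) := s in let '((x', y'), (w', h')) := s' in
  x <= x' /\ x' + w' <= x + w /\ y <= y' /\ y' + h' <= y + h /\ 0 < w' /\ 0 < h'.

(** Goursat's subdivision, which works from pointwise differentiability alone. Rectangles halved in
    size, each carrying at least a quarter of the circulation of its predecessor, shrink to a point,
    where the affine approximation makes the circulation small compared with the square of the
    size. *)
Lemma goursat (a b c d : R) : a < b -> c < d ->
  (forall x y, a <= x <= b -> c <= y <= d -> exists p q r,
     differentiable_pt_lim P x y p q /\ differentiable_pt_lim Q x y q r) ->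
  circulation P Q a b c d = 0.
Proof.
intros Hab Hcd H.
assert (HP : cont_on P a b c d).
{ intros x y Hx Hy; destruct (H x y Hx Hy) as [p [q [r [H1 _]]]].
  apply differentiable_continuity_pt; exists p, q; exact H1. }
assert (HQ : cont_on Q a b c d).
{ intros x y Hx Hy; destruct (H x y Hx Hy) as [p [q [r [_ H1]]]].
  apply differentiable_continuity_pt; exists q, r; exact H1. }
set (s0 := ((a, c), (b - a, d - c)) : R * R * (R * R)).
set (s := fun n => Nat.iter n next s0).
assert (W0 : within s0 s0) by (simpl; lra).
assert (Wn : forall t, within s0 t -> within t (next t) /\ within s0 (next t) /\
   Rabs (circ t) <= 4 * Rabs (circ (next t)) /\ snd (next t) = (fst (snd t) / 2, snd (snd t) / 2)).
{ intros [[x y] [w h]] Ht; simpl in Ht.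
  assert (S : Rabs (circ ((x, y), (w, h))) <=
    Rabs (circ (quarter 0 0 ((x, y), (w, h)))) + Rabs (circ (quarter 1 0 ((x, y), (w, h)))) +
    Rabs (circ (quarter 0 1 ((x, y), (w, h)))) + Rabs (circ (quarter 1 1 ((x, y), (w, h))))).
  { simpl; rewrite (circulation_quarters P Q x (x + w) y (y + h) (x + w / 2) (y + h / 2)).
    - replace (x + 0 * (w / 2)) with x by ring.
      replace (y + 0 * (h / 2)) with y by ring.
      replace (x + 1 * (w / 2)) with (x + w / 2) by ring.
      replace (y + 1 * (h / 2)) with (y + h / 2) by ring.
      replace (x + w / 2 + w / 2) with (x + w) by field.
      replace (y + h / 2 + h / 2) with (y + h) by field.
      eapply Rle_trans; [apply Rabs_triang|]; apply Rplus_le_compat_r.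
      eapply Rle_trans; [apply Rabs_triang|]; apply Rplus_le_compat_r.
      apply Rabs_triang.
    - lra.
    - lra.
    - intros u v Hu Hv; apply HP; lra.
    - intros u v Hu Hv; apply HQ; lra. }
  unfold next.
  set (t := ((x, y), (w, h)) : R * R * (R * R)) in *.
  destruct (Rle_dec _ _) as [L1 | L1]; [|destruct (Rle_dec _ _) as [L2 | L2];
    [|destruct (Rle_dec _ _) as [L3 | L3]]];
  (split; [simpl; lra | split; [simpl; lra | split; [lra | reflexivity]]]). }
assert (Ws : forall n, within s0 (s n) /\ Rabs (circ s0) <= 4 ^ n * Rabs (circ (s n)) /\
   snd (s n) = ((b - a) / 2 ^ n, (d - c) / 2 ^ n)).
{ induction n as [|n [I1 [I2 I3]]].
  - split; [exact W0|]; split; [simpl; lra|]; simpl; f_equal; field.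
  - destruct (Wn (s n) I1) as [_ [J2 [J3 J4]]].
    change (s (S n)) with (next (s n)); split; [exact J2|]; split.
    + eapply Rle_trans; [exact I2|]; simpl.
      assert (0 < 4 ^ n) by (apply pow_lt; lra); nra.
    + rewrite J4, I3; simpl; assert (0 < 2 ^ n) by (apply pow_lt; lra).
      f_equal; field; lra. }
set (xn := fun n => fst (fst (s n))); set (yn := fun n => snd (fst (s n))).
assert (Wsn : forall n, within (s n) (s (S n))).
{ intros n; apply (Wn (s n)), Ws. }
assert (Wm : forall n k, within (s n) (s (n + k)%nat)).
{ intros n; induction k as [|k IH].
  - rewrite Nat.add_0_r; destruct (Ws n) as [W _]; destruct (s n) as [[x y] [w h]].
    simpl in W |- *; lra.
  - rewrite Nat.add_succ_r; specialize (Wsn (n + k)%nat).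
    destruct (s n) as [[x y] [w h]], (s (n + k)%nat) as [[x' y'] [w' h']],
      (s (S (n + k))) as [[x2 y2] [w2 h2]]; simpl in *; lra. }
assert (Gx : Un_growing xn).
{ intros n; unfold xn; specialize (Wsn n).
  destruct (s n) as [[x y] [w h]], (s (S n)) as [[x' y'] [w' h']]; simpl in *; lra. }
assert (Gy : Un_growing yn).
{ intros n; unfold yn; specialize (Wsn n).
  destruct (s n) as [[x y] [w h]], (s (S n)) as [[x' y'] [w' h']]; simpl in *; lra. }
assert (Ux : forall n k, xn k <= xn n + (b - a) / 2 ^ n).
{ intros n k; destruct (Ws n) as [_ [_ E]].
  pose proof (Wm n k) as W1.
  assert (xn k <= xn (n + k)%nat) by (apply tech9; [exact Gx | lia]).
  unfold xn in *.
  destruct (s n) as [[x y] [w h]], (s (n + k)%nat) as [[x' y'] [w' h']].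
  simpl in *; injection E as -> ->; lra. }
assert (Uy : forall n k, yn k <= yn n + (d - c) / 2 ^ n).
{ intros n k; destruct (Ws n) as [_ [_ E]].
  pose proof (Wm n k) as W1.
  assert (yn k <= yn (n + k)%nat) by (apply tech9; [exact Gy | lia]).
  unfold yn in *.
  destruct (s n) as [[x y] [w h]], (s (n + k)%nat) as [[x' y'] [w' h']].
  simpl in *; injection E as -> ->; lra. }
assert (LIM : forall (u : nat -> R) L, Un_growing u ->
   (forall n k, u k <= u n + L / 2 ^ n) -> exists l, forall n, u n <= l <= u n + L / 2 ^ n).
{ intros u L G U.
  destruct (growing_cv u G) as [l Hl].
  { exists (u O + L / 2 ^ 0); intros x [i ->]; apply U. }
  exists l; intros n; split; [now apply growing_ineq|].
  destruct (Rle_dec l (u n + L / 2 ^ n)) as [|N]; [easy|].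
  destruct (Hl (l - (u n + L / 2 ^ n))) as [k Hk]; [lra|].
  specialize (Hk k (Nat.le_refl _)); unfold Rdist in Hk; apply Rabs_def2 in Hk.
  specialize (U n k); lra. }
destruct (LIM xn (b - a) Gx Ux) as [x0 Hx0]; destruct (LIM yn (d - c) Gy Uy) as [y0 Hy0].
assert (Ix : a <= x0 <= b).
{ specialize (Hx0 O); unfold xn in Hx0; simpl in Hx0; lra. }
assert (Iy : c <= y0 <= d).
{ specialize (Hy0 O); unfold yn in Hy0; simpl in Hy0; lra. }
destruct (H x0 y0 Ix Iy) as [p [q [r [DP DQ]]]].
destruct (Req_dec (circulation P Q a b c d) 0) as [|N]; [easy|exfalso].
set (w := (b - a) + (d - c)); assert (Hw : 0 < w) by (unfold w; lra).
set (C0 := Rabs (circ s0)).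
assert (HC0 : 0 < C0).
{ apply Rabs_pos_lt; simpl; replace (a + (b - a)) with b by ring.
  replace (c + (d - c)) with d by ring; exact N. }
(* With this e the bound 2 e (w / 2^n)^2 on the n-th rectangle, multiplied by 4^n, is C0 / 2. *)
set (e := C0 / (4 * w ^ 2)).
assert (Hw2 : 0 < w ^ 2) by (apply pow_lt; easy).
assert (He : 0 < e) by (apply Rdiv_lt_0_compat; lra).
destruct (DP (mkposreal e He)) as [d1 HD1]; destruct (DQ (mkposreal e He)) as [d2 HD2].
simpl in HD1, HD2.
assert (Hd : 0 < Rmin d1 d2) by (apply Rmin_pos; apply cond_pos).
destruct (pow_lt_1_zero (/ 2) ltac:(rewrite Rabs_pos_eq; lra) (Rmin d1 d2 / w)) as [n Hn].
{ apply Rdiv_lt_0_compat; easy. }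
specialize (Hn n (Nat.le_refl _)).
assert (H2n : 0 < 2 ^ n) by (apply pow_lt; lra).
rewrite pow_inv, Rabs_pos_eq in Hn by (left; now apply Rinv_0_lt_compat).
assert (Hwn : w / 2 ^ n < Rmin d1 d2).
{ apply Rmult_lt_compat_r with (r := w) in Hn; [|easy].
  replace (Rmin d1 d2 / w * w) with (Rmin d1 d2) in Hn by (field; lra).
  unfold Rdiv; lra. }
assert (E2 : (b - a) / 2 ^ n + (d - c) / 2 ^ n = w / 2 ^ n) by (unfold w; field; lra).
assert (P1 : 0 < (b - a) / 2 ^ n) by (apply Rdiv_lt_0_compat; lra).
assert (P2 : 0 < (d - c) / 2 ^ n) by (apply Rdiv_lt_0_compat; lra).
pose proof (Rmin_l d1 d2); pose proof (Rmin_r d1 d2).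
destruct (Ws n) as [W1 [W2 W3]].
specialize (Hx0 n); specialize (Hy0 n); unfold xn, yn in Hx0, Hy0.
fold C0 in W2.
destruct (s n) as [[x y] [w' h']]; simpl in W1, W3, Hx0, Hy0; injection W3 as -> ->.
simpl in W2.
assert (B : Rabs (circulation P Q x (x + (b - a) / 2 ^ n) y (y + (d - c) / 2 ^ n)) <=
  2 * e * ((x + (b - a) / 2 ^ n - x) + (y + (d - c) / 2 ^ n - y)) ^ 2).
{ apply (circulation_affine _ _ _ _ _ _ x0 y0 (P x0 y0) p q (Q x0 y0) r).
  - lra.
  - lra.
  - lra.
  - intros u v Hu Hv; apply HP; lra.
  - intros u v Hu Hv; apply HQ; lra.
  - intros u v Hu Hv.
    assert (Au : Rabs (u - x0) <= (b - a) / 2 ^ n) by (apply Rabs_le; lra).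
    assert (Av : Rabs (v - y0) <= (d - c) / 2 ^ n) by (apply Rabs_le; lra).
    assert (Am : Rmax (Rabs (u - x0)) (Rabs (v - y0)) <=
       x + (b - a) / 2 ^ n - x + (y + (d - c) / 2 ^ n - y)).
    { apply Rmax_lub; lra. }
    split; (eapply Rle_trans; [| apply Rmult_le_compat_l; [lra | exact Am]]).
    + apply HD1; lra.
    + apply HD2; lra. }
replace ((x + (b - a) / 2 ^ n - x) + (y + (d - c) / 2 ^ n - y)) with (w / 2 ^ n) in B by lra.
assert (E4 : 4 ^ n = 2 ^ n * 2 ^ n) by (rewrite <- Rpow_mult_distr; f_equal; lra).
assert (C0 <= C0 / 2); [|lra].
eapply Rle_trans; [exact W2|].
eapply Rle_trans; [apply Rmult_le_compat_l; [apply pow_le; lra | exact B]|].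
right; rewrite E4; unfold e; field; lra.
Qed.

End Goursat.

(* Cauchy's theorem on a period strip, where the two vertical sides cancel. *)
Lemma RInt_period_shift (f : C -> C) (p y1 y2 : R) : 0 < p -> y1 <= y2 ->
  (forall x y, y1 <= y <= y2 -> cdiff f (x, y)) ->
  (forall y, y1 <= y <= y2 -> f (p, y) = f (0, y)) ->
  RInt (fun x => Re (f (x, y1))) 0 p = RInt (fun x => Re (f (x, y2))) 0 p /\
  RInt (fun x => Im (f (x, y1))) 0 p = RInt (fun x => Im (f (x, y2))) 0 p.
Proof.
intros Hp [Hy | ->] Hf Hper; [|easy].
(* These two circulations are the real and the imaginary part of the integral of f dz. *)
assert (A1 : circulation (fun x y => Re (f (x, y))) (fun x y => - Im (f (x, y))) 0 p y1 y2 = 0).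
{ apply goursat; [easy | easy |]; intros x y _ Hy'.
  destruct (cdiff_differentiable f x y (Hf x y Hy')) as [q [r [H1 H2]]].
  exists q, (- r), (- q); split; [exact H1|].
  intros e; destruct (H2 e) as [d' Hd]; exists d'; intros u v Hu Hv.
  eapply Rle_trans; [|apply (Hd u v Hu Hv)]; right.
  rewrite <- Rabs_Ropp; f_equal; ring. }
assert (A2 : circulation (fun x y => Im (f (x, y))) (fun x y => Re (f (x, y))) 0 p y1 y2 = 0).
{ apply goursat; [easy | easy |]; intros x y _ Hy'.
  destruct (cdiff_differentiable f x y (Hf x y Hy')) as [q [r [H1 H2]]].
  exists r, q, (- r); split; [exact H2 | exact H1]. }
unfold circulation in A1, A2.
rewrite (RInt_ext (fun y => - Im (f (p, y))) (fun y => - Im (f (0, y)))) in A1.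
2:{ intros y; rewrite Rmin_left, Rmax_right by lra; intros; rewrite Hper; [easy | lra]. }
rewrite (RInt_ext (fun y => Re (f (p, y))) (fun y => Re (f (0, y)))) in A2.
2:{ intros y; rewrite Rmin_left, Rmax_right by lra; intros; rewrite Hper; [easy | lra]. }
split; lra.
Qed.

(** * Exponential, logarithm and square root *)

Definition cexp (z : C) : C := (exp (Re z) * cos (Im z), exp (Re z) * sin (Im z)).

Lemma cexp_plus (z w : C) : cexp (z + w)%C = (cexp z * cexp w)%C.
Proof.
unfold cexp, Cmult, Cplus, Re, Im; simpl.
rewrite exp_plus, cos_plus, sin_plus; f_equal; ring.
Qed.

Lemma cexp_0 : cexp 0%C = 1%C.
Proof. unfold cexp, Re, Im, RtoC; simpl; rewrite exp_0, cos_0, sin_0; f_equal; ring. Qed.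

Lemma Cmod_polar (r t : R) : 0 <= r -> Cmod (r * cos t, r * sin t) = r.
Proof.
intros Hr; unfold Cmod; simpl fst; simpl snd.
replace ((r * cos t) ^ 2 + (r * sin t) ^ 2) with (Rsqr r * (Rsqr (sin t) + Rsqr (cos t)))
  by (unfold Rsqr; ring).
rewrite sin2_cos2, Rmult_1_r; now apply sqrt_Rsqr.
Qed.

Lemma Cmod_cexp (z : C) : Cmod (cexp z) = exp (Re z).
Proof. apply Cmod_polar; left; apply exp_pos. Qed.

Lemma cexp_neq_0 (z : C) : cexp z <> RtoC 0.
Proof. apply Cmod_gt_0; rewrite Cmod_cexp; apply exp_pos. Qed.

Lemma derivable_pt_lim_bound (f : R -> R) (x l e : R) : derivable_pt_lim f x l -> 0 < e ->
  exists d, 0 < d /\ forall h, Rabs h < d -> Rabs (f (x + h) - f x - l * h) <= e * Rabs h.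
Proof.
intros H He; destruct (H e He) as [[d Hd] H']; simpl in H'; exists d; split; [easy|].
intros h Hh; destruct (Req_dec h 0) as [-> | N].
{ rewrite Rplus_0_r; replace (f x - f x - l * 0) with 0 by ring; rewrite Rabs_R0; lra. }
specialize (H' h N Hh).
replace (f (x + h) - f x - l * h) with (((f (x + h) - f x) / h - l) * h) by (field; easy).
rewrite Rabs_mult; apply Rmult_le_compat_r; [apply Rabs_pos | lra].
Qed.

Lemma cexp_bound_0 (e : R) : 0 < e -> exists d, 0 < d /\
  forall h : C, Cmod h < d -> Cmod (cexp h - 1 - h)%C <= e * Cmod h.
Proof.
(* The error terms below add up to at most 8 e' |h|. *)
intros He; set (e' := Rmin 1 (e / 8)).
assert (He' : 0 < e') by (apply Rmin_pos; lra).
assert (E1 : e' <= 1) by apply Rmin_l; assert (E2 : e' <= e / 8) by apply Rmin_r. clearbody e'.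
destruct (derivable_pt_lim_bound exp 0 (exp 0) e' (derivable_pt_lim_exp 0) He') as [d1 [Hd1 H1]].
destruct (derivable_pt_lim_bound cos 0 (- sin 0) e' (derivable_pt_lim_cos 0) He') as [d2 [Hd2 H2]].
destruct (derivable_pt_lim_bound sin 0 (cos 0) e' (derivable_pt_lim_sin 0) He') as [d3 [Hd3 H3]].
exists (Rmin e' (Rmin d1 (Rmin d2 d3))); split; [repeat apply Rmin_pos; easy|].
intros [x y] Hh.
pose proof (re_le_Cmod (x, y)) as Bx; pose proof (im_le_Cmod (x, y)) as By; simpl in Bx, By.
pose proof (Rmin_l e' (Rmin d1 (Rmin d2 d3))); pose proof (Rmin_r e' (Rmin d1 (Rmin d2 d3))).
pose proof (Rmin_l d1 (Rmin d2 d3)); pose proof (Rmin_r d1 (Rmin d2 d3)).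
pose proof (Rmin_l d2 d3); pose proof (Rmin_r d2 d3).
set (m := Cmod (x, y)) in *.
specialize (H1 x ltac:(lra)); specialize (H2 y ltac:(lra)); specialize (H3 y ltac:(lra)).
rewrite Rplus_0_l in H1, H2, H3; rewrite exp_0 in H1; rewrite cos_0, sin_0 in H2, H3.
assert (Hm : 0 <= m) by apply Cmod_ge_0.
pose proof (Rabs_pos x); pose proof (Rabs_pos y).
replace (cexp (x, y) - 1 - (x, y))%C with (((exp x - 1 - x) * cos y + (1 + x) * (cos y - 1),
   (exp x - 1) * sin y + (sin y - y)) : C).
2:{ unfold cexp, Cminus, Cplus, Copp, RtoC, Re, Im; simpl; f_equal; ring. }
eapply Rle_trans; [apply Cmod_pair|].
replace (exp x - 1 - 1 * x) with (exp x - 1 - x) in H1 by ring.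
replace (cos y - 1 - - 0 * y) with (cos y - 1) in H2 by ring.
replace (sin y - 0 - 1 * y) with (sin y - y) in H3 by ring.
assert (K1 : Rabs (exp x - 1 - x) <= e' * m) by (apply (Rle_trans _ _ _ H1), Rmult_le_compat_l; lra).
assert (K2 : Rabs (cos y - 1) <= e' * m) by (apply (Rle_trans _ _ _ H2), Rmult_le_compat_l; lra).
assert (K3 : Rabs (sin y - y) <= e' * m) by (apply (Rle_trans _ _ _ H3), Rmult_le_compat_l; lra).
assert (K4 : Rabs (cos y) <= 1) by (apply Rabs_le, COS_bound).
assert (K5 : Rabs (1 + x) <= 2) by (apply Rabs_le; apply Rabs_le_between in Bx; lra).
assert (K6 : Rabs (exp x - 1) <= 2 * m).
{ replace (exp x - 1) with ((exp x - 1 - x) + x) by ring.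
  eapply Rle_trans; [apply Rabs_triang|]; nra. }
assert (K7 : Rabs (sin y) <= 2 * m).
{ replace (sin y) with ((sin y - y) + y) by ring.
  eapply Rle_trans; [apply Rabs_triang|]; nra. }
assert (L1 : Rabs ((exp x - 1 - x) * cos y + (1 + x) * (cos y - 1)) <= e' * m + 2 * (e' * m)).
{ eapply Rle_trans; [apply Rabs_triang|]; rewrite !Rabs_mult; apply Rplus_le_compat.
  - rewrite <- (Rmult_1_r (e' * m)); apply Rmult_le_compat; try apply Rabs_pos; easy.
  - apply Rmult_le_compat; try apply Rabs_pos; easy. }
assert (L2 : Rabs ((exp x - 1) * sin y + (sin y - y)) <= 2 * m * (2 * m) + e' * m).
{ eapply Rle_trans; [apply Rabs_triang|]; rewrite !Rabs_mult; apply Rplus_le_compat; [|easy].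
  apply Rmult_le_compat; try apply Rabs_pos; easy. }
assert (m * m <= e' * m) by nra.
nra.
Qed.

(** The factorization holds for every w, as [cdiff_inverse] requires of the function to be inverted.
    Since [cexp] is multiplicative, continuity of the slope at z reduces to the estimate at 0. *)
Lemma cexp_caratheodory (z : C) : exists phi, ccont phi z /\ phi z = cexp z /\
  forall w, cexp w = (cexp z + phi w * (w - z))%C.
Proof.
exists (fun w => if Ceq_dec w z then cexp z else (cexp w - cexp z) / (w - z))%C.
assert (NZ : forall w, w <> z -> (w - z)%C <> RtoC 0).
{ intros w N E; apply N; replace w with (w - z + z)%C by ring; rewrite E; ring. }
split; [|split].
- intros e He.
  pose proof (proj1 (Cmod_gt_0 _) (cexp_neq_0 z)) as HM; set (M := Cmod (cexp z)) in *.
  destruct (cexp_bound_0 (e / 2 / M)) as [d [Hd H]]; [repeat apply Rdiv_lt_0_compat; lra|].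
  exists d; split; [easy|]; intros w Hw.
  destruct (Ceq_dec z z) as [_|]; [|easy].
  destruct (Ceq_dec w z) as [->|N].
  { replace (cexp z - cexp z)%C with (RtoC 0) by ring; rewrite Cmod_0; lra. }
  apply NZ in N.
  replace ((cexp w - cexp z) / (w - z) - cexp z)%C
    with (cexp z * (cexp (w - z) - 1 - (w - z)) / (w - z))%C.
  2:{ replace (cexp w) with (cexp z * cexp (w - z))%C by (rewrite <- cexp_plus; f_equal; ring).
      field; easy. }
  rewrite Cmod_div, Cmod_mult by easy; fold M.
  specialize (H (w - z)%C Hw); apply Cmod_gt_0 in N.
  apply Rle_lt_trans with (e / 2); [|lra].
  apply Rmult_le_reg_r with (Cmod (w - z)%C); [easy|].
  unfold Rdiv at 1; rewrite Rmult_assoc, Rinv_l, Rmult_1_r by lra.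
  apply Rmult_le_compat_l with (r := M) in H; [|lra].
  eapply Rle_trans; [exact H|]; right; field; lra.
- destruct (Ceq_dec z z); easy.
- intros w; destruct (Ceq_dec w z) as [->|N]; [ring|]; apply NZ in N; field; easy.
Qed.

Lemma cdiff_cexp (z : C) : cdiff cexp z.
Proof.
destruct (cexp_caratheodory z) as [phi [H1 [_ H2]]]; exists phi; split; [easy|].
exists 1; split; [lra | auto].
Qed.

(** Inverse function rule in Caratheodory's form: if phi is the slope function of f at g z, then 1 /
    phi (g w) is that of the continuous right inverse g. *)
Lemma cdiff_inverse (f g : C -> C) (z : C) (delta : R) (phi : C -> C) :
  0 < delta -> (forall w, Cmod (w - z)%C < delta -> f (g w) = w) ->
  ccont g z -> ccont phi (g z) -> phi (g z) <> RtoC 0 ->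
  (forall w, f w = f (g z) + phi w * (w - g z))%C -> cdiff g z.
Proof.
intros Hd Hfg Hg Hphi N Hf.
exists (fun w => / phi (g w))%C; split.
{ apply ccont_inv; [apply (ccont_comp phi g); easy | easy]. }
destruct (ccont_neq_0 (fun w => phi (g w)) z) as [d [Hd' H]].
{ apply (ccont_comp phi g); easy. }
{ easy. }
exists (Rmin d delta); split; [now apply Rmin_pos|]; intros w Hw.
assert (N' : phi (g w) <> RtoC 0) by (apply H; eapply Rlt_le_trans; [exact Hw | apply Rmin_l]).
specialize (Hf (g w)).
rewrite !Hfg in Hf.
2:{ replace (z - z)%C with (RtoC 0) by ring; rewrite Cmod_0; lra. }
2:{ eapply Rlt_le_trans; [exact Hw | apply Rmin_r]. }
replace (w - z)%C with (phi (g w) * (g w - g z))%C by (rewrite Hf at 3; ring).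
field; easy.
Qed.

Lemma ccont_of_2d (f : C -> C) (x y : R) :
  continuity_2d_pt (fun u v => Re (f (u, v))) x y ->
  continuity_2d_pt (fun u v => Im (f (u, v))) x y -> ccont f (x, y).
Proof.
intros H1 H2 e He.
assert (He2 : 0 < e / 2) by lra.
destruct (H1 (mkposreal _ He2)) as [[d1 Hd1] K1]; destruct (H2 (mkposreal _ He2)) as [[d2 Hd2] K2].
simpl in K1, K2; exists (Rmin d1 d2); split; [now apply Rmin_pos|]; intros [u v] Hw.
pose proof (re_le_Cmod ((u, v) - (x, y))%C) as Bx.
pose proof (im_le_Cmod ((u, v) - (x, y))%C) as By.
change (Rabs (u - x) <= Cmod ((u, v) - (x, y))%C) in Bx.
change (Rabs (v - y) <= Cmod ((u, v) - (x, y))%C) in By.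
pose proof (Rmin_l d1 d2); pose proof (Rmin_r d1 d2).
specialize (K1 u v ltac:(lra) ltac:(lra)); specialize (K2 u v ltac:(lra) ltac:(lra)).
replace (f (u, v) - f (x, y))%C with
  ((Re (f (u, v)) - Re (f (x, y)), Im (f (u, v)) - Im (f (x, y))) : C) by reflexivity.
eapply Rle_lt_trans; [apply Cmod_pair|]; lra.
Qed.

Lemma continuity_pt_ex_derive (f : R -> R) (x : R) : ex_derive f x -> continuity_pt f x.
Proof. intros H; apply continuity_pt_filterlim; now apply (ex_derive_continuous (V := R_NormedModule)). Qed.

(* Branches on the right half-plane. *)
Definition clog (z : C) : C := (ln (Cmod z), atan (Im z / Re z)).

Lemma cexp_clog (z : C) : 0 < Re z -> cexp (clog z) = z.
Proof.
destruct z as [x y]; simpl; intros Hx.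
unfold cexp, clog; simpl Re; simpl Im.
assert (Hm : 0 < Cmod (x, y)).
{ eapply Rlt_le_trans; [|apply re_le_Cmod]; simpl; rewrite Rabs_pos_eq; lra. }
rewrite exp_ln by easy; rewrite cos_atan, sin_atan.
replace (sqrt (1 + Rsqr (y / x))) with (Cmod (x, y) / x).
{ f_equal; field; lra. }
unfold Cmod; simpl fst; simpl snd.
apply Rsqr_inj; [apply Rdiv_le_0_compat; [apply sqrt_pos | easy] | apply sqrt_pos |].
rewrite Rsqr_div', !Rsqr_sqrt; try (unfold Rsqr; field; lra); try nra.
pose proof (Rle_0_sqr (y / x)); lra.
Qed.

Lemma cdiff_clog (z : C) : 0 < Re z -> cdiff clog z.
Proof.
intros Hz; destruct (cexp_caratheodory (clog z)) as [phi [H1 [H2 H3]]].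
apply (cdiff_inverse cexp clog z (Re z) phi); auto.
- intros w Hw; apply cexp_clog.
  pose proof (re_le_Cmod (w - z)%C) as B.
  change (Re (w - z)%C) with (Re w - Re z) in B.
  apply Rabs_le_between in B; lra.
- destruct z as [x y]; simpl in Hz.
  assert (Hm : 0 < x ^ 2 + y ^ 2) by nra.
  apply ccont_of_2d; simpl.
  + unfold Cmod; simpl fst; simpl snd.
    apply (continuity_1d_2d_pt_comp (fun t => ln (sqrt t)) (fun u v => u ^ 2 + v ^ 2)).
    * apply continuity_pt_ex_derive; auto_derive; repeat split; [exact Hm|].
      now apply sqrt_lt_R0.
    * apply (continuity_2d_pt_ext (fun u v => u * u + v * v)); [intros; ring|].
      apply continuity_2d_pt_plus; apply continuity_2d_pt_mult;
        try apply continuity_2d_pt_id1; apply continuity_2d_pt_id2.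
  + apply (continuity_1d_2d_pt_comp atan (fun u v => v / u)).
    * apply continuity_pt_ex_derive; auto_derive; easy.
    * apply continuity_2d_pt_mult; [apply continuity_2d_pt_id2|].
      apply continuity_2d_pt_inv; [apply continuity_2d_pt_id1 | lra].
- rewrite H2; apply cexp_neq_0.
Qed.

Definition csqrt (z : C) : C := cexp (/ 2 * clog z)%C.

Lemma csqrt_sqr (z : C) : 0 < Re z -> (csqrt z * csqrt z)%C = z.
Proof.
intros Hz; unfold csqrt; rewrite <- cexp_plus.
rewrite <- (cexp_clog z Hz) at 3; f_equal; field.
Qed.

Lemma Re_csqrt_pos (z : C) : 0 < Re z -> 0 < Re (csqrt z).
Proof.
intros Hz; unfold csqrt, cexp; simpl.
apply Rmult_lt_0_compat; [apply exp_pos|].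
pose proof (atan_bound (Im z / Re z)).
apply cos_gt_0; simpl; nra.
Qed.

Lemma cdiff_csqrt (z : C) : 0 < Re z -> cdiff csqrt z.
Proof.
intros Hz; unfold csqrt; apply (cdiff_comp cexp (fun w => / 2 * clog w)%C); [|apply cdiff_cexp].
apply cdiff_mult; [apply cdiff_const | now apply cdiff_clog].
Qed.

(** * Functions vanishing on part of a disc *)

(** Along the segment from the corner (a, c), steps no longer than e / 2 in each coordinate change f
    by less than 1; the induction on k counts these steps. *)
Lemma bounded_2d (f : R -> R -> R) (a b c d : R) : a <= b -> c <= d ->
  cont_on f a b c d ->
  exists M, forall x y, a <= x <= b -> c <= y <= d -> Rabs (f x y) <= M.
Proof.
intros Hab Hcd Hf.
destruct (uniform_continuity_2d f a b c d Hf (mkposreal 1 Rlt_0_1)) as [[e He] H]; simpl in H.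
assert (K : forall k x y, a <= x <= b -> c <= y <= d ->
  x - a <= INR k * (e / 2) -> y - c <= INR k * (e / 2) -> Rabs (f x y) <= Rabs (f a c) + INR k).
{ induction k as [|k IH]; intros x y Hx Hy Kx Ky.
  - simpl in Kx, Ky; replace x with a by lra; replace y with c by lra; simpl; lra.
  - set (q := INR k / INR (S k)).
    rewrite S_INR in *; pose proof (pos_INR k) as Hk.
    assert (Hq : 0 <= q <= 1).
    { unfold q; rewrite S_INR; split; [apply Rdiv_le_0_compat; lra|].
      apply Rmult_le_reg_r with (INR k + 1); [lra|].
      unfold Rdiv; rewrite Rmult_assoc, Rinv_l; lra. }
    assert (Eq : forall t, t <= (INR k + 1) * (e / 2) -> t * q <= INR k * (e / 2) /\ t - t * q <= e / 2).
    { intros t Ht; unfold q; rewrite S_INR.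
      replace (t * (INR k / (INR k + 1))) with (t / (INR k + 1) * INR k) by (field; lra).
      assert (t / (INR k + 1) <= e / 2).
      { apply Rmult_le_reg_r with (INR k + 1); [lra|].
        unfold Rdiv at 1; rewrite Rmult_assoc, Rinv_l; lra. }
      split; [nra|].
      replace (t - t / (INR k + 1) * INR k) with (t / (INR k + 1)) by (field; lra); easy. }
    destruct (Eq _ Kx) as [E1 E2]; destruct (Eq _ Ky) as [E3 E4].
    assert (0 <= (x - a) * q <= x - a) by nra.
    assert (0 <= (y - c) * q <= y - c) by nra.
    assert (B := IH (a + (x - a) * q) (c + (y - c) * q) ltac:(lra) ltac:(lra) ltac:(lra) ltac:(lra)).
    assert (B2 : Rabs (f x y - f (a + (x - a) * q) (c + (y - c) * q)) < 1).
    { apply H; try lra; rewrite Rabs_pos_eq; lra. }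
    pose proof (Rabs_triang_inv (f x y) (f (a + (x - a) * q) (c + (y - c) * q))); lra. }
destruct (INR_unbounded (Rmax ((b - a) / (e / 2)) ((d - c) / (e / 2)))) as [k Hk].
exists (Rabs (f a c) + INR k); intros x y Hx Hy; apply K; auto.
- apply Rle_trans with ((b - a) / (e / 2) * (e / 2));
  [replace ((b - a) / (e / 2) * (e / 2)) with (b - a) by (field; lra); lra|].
  pose proof (Rmax_l ((b - a) / (e / 2)) ((d - c) / (e / 2))).
  apply Rmult_le_compat_r; lra.
- apply Rle_trans with ((d - c) / (e / 2) * (e / 2));
  [replace ((d - c) / (e / 2) * (e / 2)) with (d - c) by (field; lra); lra|].
  pose proof (Rmax_r ((b - a) / (e / 2)) ((d - c) / (e / 2))).
  apply Rmult_le_compat_r; lra.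
Qed.

Lemma ccont_2d (f : C -> C) (x y : R) : ccont f (x, y) ->
  continuity_2d_pt (fun u v => Cmod (f (u, v))) x y.
Proof.
intros H [e He]; simpl; destruct (H e He) as [d [Hd H']].
assert (Hd2 : 0 < d / 2) by lra.
exists (mkposreal _ Hd2); simpl; intros u v Hu Hv.
assert (B : Cmod (f (u, v) - f (x, y))%C < e).
{ apply H'; eapply Rle_lt_trans; [apply (Cmod_pair (u - x) (v - y))|]; lra. }
pose proof (Cmod_triangle_rev (f (u, v)) (f (x, y))).
pose proof (Cmod_triangle_rev (f (x, y)) (f (u, v))) as H2; rewrite Cmod_sub_sym in H2.
apply Rabs_lt_between; lra.
Qed.

Lemma ccont_bounded_rect (f : C -> C) (a b c d : R) : a <= b -> c <= d ->
  (forall x y, a <= x <= b -> c <= y <= d -> ccont f (x, y)) ->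
  exists M, 0 <= M /\ forall x y, a <= x <= b -> c <= y <= d -> Cmod (f (x, y)) <= M.
Proof.
intros Hab Hcd H.
destruct (bounded_2d (fun x y => Cmod (f (x, y))) a b c d Hab Hcd) as [M HM].
{ intros x y Hx Hy; apply ccont_2d; auto. }
exists M; split.
- specialize (HM a c ltac:(lra) ltac:(lra)).
  eapply Rle_trans; [apply Rabs_pos | exact HM].
- intros x y Hx Hy; eapply Rle_trans; [apply Rle_abs | now apply HM].
Qed.

Lemma cdiff_continuous_Re (f : C -> C) (x y : R) : cdiff f (x, y) ->
  continuous (fun u => Re (f (u, y))) x /\ continuous (fun u => Im (f (u, y))) x.
Proof.
intros H; destruct (cdiff_differentiable f x y H) as [p [q [H1 H2]]].
split; [apply (continuity_2d_1 (fun u v => Re (f (u, v)))) | apply (continuity_2d_1 (fun u v => Im (f (u, v))))];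
  apply differentiable_continuity_pt; eexists; eexists; eassumption.
Qed.

(* Applied to a function of exp (i zeta), this is the mean value inequality at the
   center of a disc; L plays the role of the value at the center. *)
Lemma period_limit_bound (f : C -> C) (y1 B : R) (L : C) :
  (forall x y, y1 <= y -> cdiff f (x, y)) ->
  (forall y, y1 <= y -> f (2 * PI, y) = f (0, y)) ->
  (forall e, 0 < e -> exists Y, forall x y, Y <= y -> Cmod (f (x, y) - L)%C <= e) ->
  (forall x, 0 <= x <= 2 * PI -> Cmod (f (x, y1)) <= B) ->
  Cmod L <= 2 * B.
Proof.
intros Hf Hper Hlim HB.
assert (HP : 0 < 2 * PI) by (pose proof PI_RGT_0; lra).
(* Used for g = Re and for g = Im; adding the two bounds produces the factor 2 of the conclusion. *)
assert (K : forall g : C -> R, (forall z w, g (z - w)%C = g z - g w) ->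
  (forall z, Rabs (g z) <= Cmod z) ->
  (forall x y, y1 <= y -> continuous (fun u => g (f (u, y))) x) ->
  (forall y, y1 <= y -> RInt (fun x => g (f (x, y1))) 0 (2 * PI) = RInt (fun x => g (f (x, y))) 0 (2 * PI)) ->
  Rabs (g L) <= B).
{ intros g Hg1 Hg2 Hg3 Hg4.
  assert (EX : forall y, y1 <= y -> ex_RInt (fun x => g (f (x, y))) 0 (2 * PI)).
  { intros y Hy; apply (ex_RInt_continuous (V := R_CompleteNormedModule)); auto. }
  assert (A : Rabs (RInt (fun x => g (f (x, y1))) 0 (2 * PI)) <= 2 * PI * B).
  { replace (2 * PI * B) with ((2 * PI - 0) * B) by ring.
    apply abs_RInt_le_const; [lra | apply EX; lra |].
    intros t Ht; eapply Rle_trans; [apply Hg2 | now apply HB]. }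
  apply le_epsilon; intros e He.
  destruct (Hlim e He) as [Y HY].
  set (y := Rmax Y y1); assert (Hy1 : y1 <= y) by apply Rmax_r; assert (HYy : Y <= y) by apply Rmax_l.
  assert (D : Rabs (RInt (fun x => g (f (x, y))) 0 (2 * PI) - 2 * PI * g L) <= 2 * PI * e).
  { replace (2 * PI * g L) with (RInt (fun _ => g L) 0 (2 * PI)).
    2:{ rewrite RInt_const; unfold scal; simpl; unfold mult; simpl; ring. }
    change (Rabs (minus (RInt (fun x => g (f (x, y))) 0 (2 * PI)) (RInt (fun _ => g L) 0 (2 * PI)))
      <= 2 * PI * e).
    rewrite <- RInt_minus; [| now apply EX | apply ex_RInt_const].
    replace (2 * PI * e) with ((2 * PI - 0) * e) by ring.
    apply abs_RInt_le_const; [lra | |].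
    - apply (ex_RInt_minus (V := R_NormedModule)); [now apply EX | apply ex_RInt_const].
    - intros t Ht; eapply Rle_trans; [|apply (HY t y HYy)].
      eapply Rle_trans; [|apply Hg2]; rewrite Hg1; right; reflexivity. }
  rewrite <- (Hg4 y Hy1) in D.
  set (I := RInt _ _ _) in *.
  apply Rmult_le_reg_l with (2 * PI); [easy|].
  replace (2 * PI * Rabs (g L)) with (Rabs (2 * PI * g L)).
  2:{ rewrite Rabs_mult, (Rabs_pos_eq (2 * PI)); lra. }
  replace (2 * PI * g L) with (I - (I - 2 * PI * g L)) by ring.
  pose proof (Rabs_triang I (- (I - 2 * PI * g L))) as T; rewrite Rabs_Ropp in T.
  unfold Rminus at 1; lra. }
assert (S : forall y, y1 <= y ->
  RInt (fun x => Re (f (x, y1))) 0 (2 * PI) = RInt (fun x => Re (f (x, y))) 0 (2 * PI) /\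
  RInt (fun x => Im (f (x, y1))) 0 (2 * PI) = RInt (fun x => Im (f (x, y))) 0 (2 * PI)).
{ intros y Hy; apply RInt_period_shift; auto; intros; [apply Hf | apply Hper]; lra. }
assert (K1 : Rabs (Re L) <= B).
{ apply (K Re); auto; [intros; apply re_le_Cmod | | intros; now apply S].
  intros; now apply cdiff_continuous_Re, Hf. }
assert (K2 : Rabs (Im L) <= B).
{ apply (K Im); auto; [intros; apply im_le_Cmod | | intros; now apply S].
  intros; now apply cdiff_continuous_Re, Hf. }
destruct L as [l1 l2]; simpl in K1, K2.
eapply Rle_trans; [apply Cmod_pair | lra].
Qed.

Lemma cexp_Ci (x y : R) : cexp (Ci * (x, y))%C = (exp (- y) * cos x, exp (- y) * sin x).
Proof.
unfold cexp, Re, Im, Ci, Cmult; simpl.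
replace (0 * x - 1 * y) with (- y) by ring; replace (0 * y + 1 * x) with x by ring; easy.
Qed.

Lemma Cmod_cexp_Ci (x y : R) : Cmod (cexp (Ci * (x, y))%C) = exp (- y).
Proof. rewrite cexp_Ci; apply Cmod_polar; left; apply exp_pos. Qed.

Lemma cdiff_cexp_Ci (z : C) : cdiff (fun w => cexp (Ci * w)%C) z.
Proof.
apply (cdiff_comp cexp (fun w => Ci * w)%C); [|apply cdiff_cexp].
apply cdiff_mult; [apply cdiff_const | apply cdiff_id].
Qed.

Lemma cexp_Ci_period (y : R) : cexp (Ci * ((2 * PI)%R, y))%C = cexp (Ci * (0, y))%C.
Proof. rewrite !cexp_Ci, cos_2PI, sin_2PI, cos_0, sin_0; easy. Qed.

Lemma small_circle (f : C -> C) (L : C) :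
  ccont f 0%C -> f 0%C = L -> forall e, 0 < e -> exists Y, forall x y, Y <= y ->
    Cmod (f (cexp (Ci * (x, y))) - L)%C <= e.
Proof.
intros Hf <- e He; destruct (Hf e He) as [d [Hd H]].
exists (1 - ln d); intros x y Hy; left; apply H.
replace (cexp (Ci * (x, y)) - 0)%C with (cexp (Ci * (x, y))) by ring.
rewrite Cmod_cexp_Ci; rewrite <- (exp_ln d) by easy; apply exp_increasing; lra.
Qed.

(** Since |exp (i z)| = exp (- Im z), the punctured disc of radius r is the image of the half-plane
    Im z >= - ln r. *)
Lemma disc_mean_bound (H : C -> C) (r R0 B : R) : 0 < r -> r < R0 ->
  (forall z, Cmod z < R0 -> cdiff H z) ->
  (forall x, 0 <= x <= 2 * PI -> Cmod (H (r * cos x, r * sin x)) <= B) ->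
  Cmod (H 0%C) <= 2 * B.
Proof.
intros Hr HrR HH HB.
apply (period_limit_bound (fun z => H (cexp (Ci * z))%C) (- ln r)).
- intros x y Hy; apply (cdiff_comp H); [apply cdiff_cexp_Ci|].
  apply HH; rewrite Cmod_cexp_Ci; apply Rle_lt_trans with r; [|easy].
  rewrite <- (exp_ln r) by easy.
  destruct (Req_dec (- y) (ln r)) as [-> | N]; [lra|].
  left; apply exp_increasing; lra.
- intros y _; now rewrite cexp_Ci_period.
- apply (small_circle H); [|easy].
  apply cdiff_ccont, HH; rewrite Cmod_0; lra.
- intros x Hx; rewrite cexp_Ci, Ropp_involutive, exp_ln by easy; auto.
Qed.

(* On the part sin t >= - 1/4 of the circle, the harmonic function
   Re (i z - z^2 / 2) = - sin t - cos (2 t) / 2 is at most - 3/16, while it vanishes at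
   the center; so exp (N (i z - z^2 / 2)) with N large forces H to vanish there. *)
Lemma disc_zero_0 (H : C -> C) (R0 : R) : 1 < R0 ->
  (forall z, Cmod z < R0 -> cdiff H z) ->
  (forall z, Cmod z < R0 -> Im z <= - (1 / 4) -> H z = 0%C) -> H 0%C = 0%C.
Proof.
intros HR HH HZ.
assert (HM : exists M, 0 <= M /\ forall x, 0 <= x <= 2 * PI -> Cmod (H (cos x, sin x)) <= M).
{ destruct (ccont_bounded_rect (fun z => H (cexp (Ci * z))%C) 0 (2 * PI) 0 0) as [M [HM0 HM]].
  - pose proof PI_RGT_0; lra.
  - lra.
  - intros x y Hx Hy; apply cdiff_ccont, (cdiff_comp H); [apply cdiff_cexp_Ci|].
    apply HH; rewrite Cmod_cexp_Ci; replace (- y) with 0 by lra; rewrite exp_0; easy.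
  - exists M; split; [easy|]; intros x Hx; specialize (HM x 0 Hx ltac:(lra)).
    rewrite cexp_Ci, Ropp_0, exp_0, !Rmult_1_l in HM; exact HM. }
destruct HM as [M [HM0 HM]].
assert (B : forall n : nat, Cmod (H 0%C) <= 2 * (M * exp (- (3 / 16) * INR n))).
{ intros n.
  set (g := fun z => (RtoC (INR n) * (Ci * z + - / 2 * (z * z)))%C).
  set (K := fun z => (H z * cexp (g z))%C).
  assert (Hg : forall z, cdiff g z).
  { intros z; unfold g; apply cdiff_mult; [apply cdiff_const|]; apply cdiff_plus.
    - apply cdiff_mult; [apply cdiff_const | apply cdiff_id].
    - apply cdiff_mult; [apply cdiff_const|]; apply cdiff_mult; apply cdiff_id. }
  replace (H 0%C) with (K 0%C).
  2:{ unfold K; replace (g 0%C) with (RtoC 0) by (unfold g; ring); rewrite cexp_0; ring. }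
  apply (disc_mean_bound K 1 R0); [lra | easy | |].
  - intros z Hz; apply cdiff_mult; [now apply HH|].
    apply (cdiff_comp cexp g); [apply Hg | apply cdiff_cexp].
  - intros x Hx; rewrite !Rmult_1_l; unfold K; rewrite Cmod_mult, Cmod_cexp.
    destruct (Rle_dec (sin x) (- (1 / 4))) as [L | L].
    { rewrite HZ, Cmod_0, Rmult_0_l.
      - apply Rmult_le_pos; [easy | left; apply exp_pos].
      - pose proof (Cmod_polar 1 x ltac:(lra)) as E; rewrite !Rmult_1_l in E; lra.
      - exact L. }
    apply Rmult_le_compat; [apply Cmod_ge_0 | left; apply exp_pos | now apply HM |].
    assert (E : Re (g (cos x, sin x)) <= - (3 / 16) * INR n).
    { replace (Re (g (cos x, sin x))) with (INR n * (- sin x - (cos x * cos x - sin x * sin x) / 2)).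
      2:{ unfold g, Re; simpl; field. }
      pose proof (sin2_cos2 x) as T; unfold Rsqr in T.
      pose proof (SIN_bound x); pose proof (pos_INR n).
      (* With s = sin x the left-hand side is s^2 - s - 1/2, a convex function equal to - 3/16 at s
         = - 1/4 and to - 1/2 at s = 1. *)
      assert (- sin x - (cos x * cos x - sin x * sin x) / 2 <= - (3 / 16)) by nra.
      nra. }
    destruct E as [E | ->]; [left; now apply exp_increasing | lra]. }
destruct (classic (H 0%C = 0%C)) as [|N]; [easy|exfalso].
apply Cmod_gt_0 in N.
destruct (Req_dec M 0) as [E | E].
{ specialize (B O); rewrite E in B; lra. }
destruct (INR_unbounded ((ln (2 * M) - ln (Cmod (H 0%C))) / (3 / 16))) as [n Hn].
specialize (B n).
assert (exp (- (3 / 16) * INR n) < Cmod (H 0%C) / (2 * M)); [|].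
{ rewrite <- (exp_ln (Cmod (H 0%C) / (2 * M))) by (apply Rdiv_lt_0_compat; lra).
  apply exp_increasing; rewrite ln_div by lra.
  apply Rmult_lt_compat_r with (r := 3 / 16) in Hn; [|lra].
  unfold Rdiv at 1 in Hn; rewrite Rmult_assoc, Rinv_l in Hn by lra; lra. }
apply Rmult_lt_compat_l with (r := 2 * M) in H0; [|lra].
replace (2 * M * (Cmod (H 0%C) / (2 * M))) with (Cmod (H 0%C)) in H0 by (field; lra).
lra.
Qed.

Lemma disc_zero (H : C -> C) (w : C) (r R0 : R) : 0 < r -> r < R0 ->
  (forall z, Cmod (z - w)%C < R0 -> cdiff H z) ->
  (forall z, Cmod (z - w)%C < R0 -> Im z <= Im w - r / 4 -> H z = 0%C) -> H w = 0%C.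
Proof.
intros Hr HR HH HZ.
assert (E0 : forall z, Cmod z < R0 / r -> Cmod (w + RtoC r * z - w)%C < R0).
{ intros z Hz; replace (w + RtoC r * z - w)%C with (RtoC r * z)%C by ring.
  rewrite Cmod_mult, Cmod_R, Rabs_pos_eq by lra.
  apply Rmult_lt_compat_l with (r := r) in Hz; [|easy].
  replace (r * (R0 / r)) with R0 in Hz by (field; lra); easy. }
replace (H w) with ((fun z => H (w + RtoC r * z)%C) 0%C) by (f_equal; ring).
apply (disc_zero_0 (fun z => H (w + RtoC r * z)%C) (R0 / r)).
- apply Rmult_lt_reg_r with r; [easy|]; unfold Rdiv; rewrite Rmult_assoc, Rinv_l; lra.
- intros z Hz; apply (cdiff_comp H (fun z => w + RtoC r * z)%C); [|apply HH; now apply E0].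
  apply cdiff_plus; [apply cdiff_const|]; apply cdiff_mult; [apply cdiff_const | apply cdiff_id].
- intros z Hz Hi; apply HZ; [now apply E0|].
  unfold Im, Cplus, Cmult, RtoC; simpl; unfold Im in Hi; nra.
Qed.

(** * The identity theorem and Liouville's theorem *)

(** The zero set climbs. If H = 0 up to distance q below the line Im = Y, a point higher by at most
    q / 6 is the center of a disc whose radius is four times its excess height; this disc stays
    below Y, and its part lower than the center by a quarter of the radius is in the zero set. So
    the distance to Y shrinks by the factor 5 / 6. *)
Lemma half_plane_zero (H : C -> C) (y0 Y : R) : y0 < Y ->
  (forall z, Im z < Y -> cdiff H z) -> (forall z, Im z <= y0 -> H z = 0%C) ->
  forall z, Im z < Y -> H z = 0%C.
Proof.
intros HY HH HZ.
assert (P : forall n z, Im z <= Y - (5 / 6) ^ n * (Y - y0) -> H z = 0%C).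
{ induction n as [|n IH]; intros w Hw.
  - apply HZ; simpl in Hw; lra.
  - set (q := (5 / 6) ^ n * (Y - y0)) in *.
    assert (Hq : 0 < q) by (apply Rmult_lt_0_compat; [apply pow_lt; lra | lra]).
    replace ((5 / 6) ^ S n * (Y - y0)) with (5 / 6 * q) in Hw by (unfold q; simpl; ring).
    destruct (Rle_dec (Im w) (Y - q)) as [L | L]; [now apply IH|].
    apply (disc_zero H w (4 * (Im w - (Y - q))) (Y - Im w)); try lra.
    + intros z Hz; apply HH.
      pose proof (im_le_Cmod (z - w)%C) as B; change (Im (z - w)%C) with (Im z - Im w) in B.
      apply Rabs_le_between in B; lra.
    + intros z Hz Hi; apply IH; lra. }
intros z Hz.
destruct (pow_lt_1_zero (5 / 6) ltac:(rewrite Rabs_pos_eq; lra) ((Y - Im z) / (Y - y0))) as [n Hn].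
{ apply Rdiv_lt_0_compat; lra. }
specialize (Hn n (Nat.le_refl _)); rewrite Rabs_pos_eq in Hn by (apply pow_le; lra).
apply (P n); apply Rmult_lt_compat_r with (r := Y - y0) in Hn; [|lra].
unfold Rdiv at 2 in Hn; rewrite Rmult_assoc, Rinv_l in Hn; lra.
Qed.

Lemma polar (z : C) : z <> 0%C -> exists t, z = (Cmod z * cos t, Cmod z * sin t).
Proof.
intros N; apply Cmod_gt_0 in N; set (r := Cmod z) in *.
destruct (proj1 (ellipse_equation 1 1 (fst z / r) (snd z / r) Rlt_0_1 Rlt_0_1)) as [t Ht].
{ assert (E : r ^ 2 = fst z ^ 2 + snd z ^ 2).
  { unfold r, Cmod; rewrite pow2_sqrt; [easy | nra]. }
  replace ((fst z / r) ^ 2 / 1 ^ 2 + (snd z / r) ^ 2 / 1 ^ 2)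
    with ((fst z ^ 2 + snd z ^ 2) / r ^ 2) by (field; lra).
  rewrite <- E; field; lra. }
exists t; unfold ellipse in Ht; injection Ht as E1 E2.
rewrite Rmult_1_l in E1, E2; rewrite E1, E2; destruct z as [x y]; simpl; f_equal; field; lra.
Qed.

Lemma cexp_Ci_surj (z : C) : z <> 0%C -> exists t, z = cexp (Ci * (t, (- ln (Cmod z))%R))%C.
Proof.
intros N; destruct (polar z N) as [t Ht]; exists t.
rewrite cexp_Ci, Ropp_involutive, exp_ln; [easy | now apply Cmod_gt_0].
Qed.

(** In the coordinate w with z = p + exp (- i w) the punctured ball of radius R0 is the half-plane
    Im w < ln R0, and the small ball is a lower half-plane in it. *)
Lemma ball_zero (H : C -> C) (p : C) (e R0 : R) : 0 < e ->
  (forall z, Cmod (z - p)%C < R0 -> cdiff H z) ->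
  (forall z, Cmod (z - p)%C < e -> H z = 0%C) ->
  forall z, Cmod (z - p)%C < R0 -> H z = 0%C.
Proof.
intros He HH HZ z Hz.
destruct (Rlt_dec (Cmod (z - p)%C) e) as [L | L]; [now apply HZ|].
assert (N : (z - p)%C <> 0%C) by (apply Cmod_gt_0; lra).
destruct (cexp_Ci_surj _ N) as [t Ht]; set (r := Cmod (z - p)%C) in *.
assert (Er : forall w : C, Cmod (p + cexp (Ci * - w) - p)%C = exp (Im w)).
{ intros [x y]; replace (p + cexp (Ci * - (x, y)) - p)%C with (cexp (Ci * - (x, y))%C) by ring.
  change (- (x, y))%C with ((- x, - y) : C); rewrite Cmod_cexp_Ci; simpl; f_equal; ring. }
assert (A : (fun w => H (p + cexp (Ci * - w))%C) (- t, ln r) = 0%C).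
{ apply (half_plane_zero (fun w => H (p + cexp (Ci * - w))%C) (ln e - 1) (ln R0)).
  - assert (ln e < ln R0) by (apply ln_increasing; lra); lra.
  - intros w Hw; apply (cdiff_comp H (fun w => p + cexp (Ci * - w))%C).
    + apply cdiff_plus; [apply cdiff_const|].
      apply (cdiff_comp (fun w => cexp (Ci * w)%C)); [apply cdiff_opp, cdiff_id | apply cdiff_cexp_Ci].
    + apply HH; rewrite Er, <- (exp_ln R0) by lra; now apply exp_increasing.
  - intros w Hw; apply HZ; rewrite Er, <- (exp_ln e) by lra; apply exp_increasing; lra.
  - simpl; apply ln_increasing; lra. }
rewrite <- A; f_equal.
change (- ((- t)%R, ln r))%C with ((- - t, - ln r) : C).
rewrite Ropp_involutive, <- Ht; ring.
Qed.

(** Continuation along a chain of discs: each disc contains the ball of half the radius about the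
    next center. *)
Lemma chain_zero (H : C -> C) (p : nat -> C) (e R0 : R) : 0 < e -> 0 < R0 ->
  (forall n z, Cmod (z - p n)%C < R0 -> cdiff H z) ->
  (forall n, Cmod (p (S n) - p n)%C <= R0 / 2) ->
  (forall z, Cmod (z - p O)%C < e -> H z = 0%C) ->
  forall n z, Cmod (z - p n)%C < R0 -> H z = 0%C.
Proof.
intros He HR HH HS HZ; induction n as [|n IH].
- exact (ball_zero H (p O) e R0 He (HH O) HZ).
- apply (ball_zero H (p (S n)) (R0 / 2)); [lra | apply HH |].
  intros z Hz; apply IH.
  replace (z - p n)%C with ((z - p (S n)) + (p (S n) - p n))%C by ring.
  specialize (HS n); eapply Rle_lt_trans; [apply Cmod_triangle | lra].
Qed.

(* Extending H by 0 below the line keeps it complex differentiable, because the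
   derivative of H vanishes on the line. *)
Lemma diameter_zero (H : C -> C) (p : C) (R0 : R) : 0 < R0 ->
  (forall z, Cmod (z - p)%C < R0 -> cdiff H z) ->
  (forall x : R, Rabs x < R0 -> H (p + RtoC x)%C = 0%C) ->
  forall z, Cmod (z - (p + (0%R, (R0 / 40)%R)))%C < R0 / 40 -> H z = 0%C.
Proof.
intros HR HH HZ.
set (G := fun z => if Rle_dec (Im z) (Im p) then RtoC 0 else H z).
assert (HG : forall z, Cmod (z - p)%C < R0 -> cdiff G z).
{ intros z Hz; destruct (Rtotal_order (Im z) (Im p)) as [L | [E | L]].
  - apply (cdiff_ext_loc (fun _ => RtoC 0) G z (Im p - Im z)); [lra | | apply cdiff_const].
    intros w Hw; unfold G; destruct (Rle_dec (Im w) (Im p)) as [|N]; [easy|].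
    pose proof (im_le_Cmod (w - z)%C) as B; change (Im (w - z)%C) with (Im w - Im z) in B.
    apply Rabs_le_between in B; lra.
  - destruct (HH z Hz) as [phi [Hphi [d [Hd Hf]]]].
    assert (Z0 : forall x : R, Rabs x < R0 - Cmod (z - p)%C -> H (z + RtoC x)%C = 0%C).
    { intros x Hx.
      assert (Ez : z = (p + RtoC (Re z - Re p))%C).
      { destruct z as [z1 z2], p as [p1 p2]; simpl in E |- *; rewrite E.
        unfold Cplus, RtoC; simpl; f_equal; ring. }
      replace (z + RtoC x)%C with (p + RtoC (Re z - Re p + x))%C.
      2:{ rewrite Ez at 2; rewrite RtoC_plus; ring. }
      apply HZ.
      pose proof (re_le_Cmod (z - p)%C) as B; change (Re (z - p)%C) with (Re z - Re p) in B.
      eapply Rle_lt_trans; [apply Rabs_triang | lra]. }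
    assert (Hz0 : H z = 0%C).
    { replace z with (z + RtoC 0)%C by ring; apply Z0; rewrite Rabs_R0; lra. }
    (* Otherwise H would be non-zero at z + x for small real x > 0, that is, on the line. *)
    assert (P0 : phi z = 0%C).
    { destruct (classic (phi z = 0%C)) as [|N]; [easy|exfalso].
      destruct (ccont_neq_0 phi z Hphi N) as [d' [Hd' H']].
      set (x := Rmin (Rmin d d') (R0 - Cmod (z - p)%C) / 2).
      assert (Hx : 0 < Rmin (Rmin d d') (R0 - Cmod (z - p)%C)) by (repeat apply Rmin_pos; lra).
      pose proof (Rmin_l (Rmin d d') (R0 - Cmod (z - p)%C)).
      pose proof (Rmin_r (Rmin d d') (R0 - Cmod (z - p)%C)).
      pose proof (Rmin_l d d'); pose proof (Rmin_r d d').
      assert (Hx' : Rabs x = x) by (apply Rabs_pos_eq; unfold x; lra).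
      assert (Em : Cmod (z + RtoC x - z)%C = x).
      { replace (z + RtoC x - z)%C with (RtoC x) by ring; rewrite Cmod_R; easy. }
      assert (E1 := Hf (z + RtoC x)%C ltac:(rewrite Em; unfold x; lra)).
      rewrite Hz0, Z0 in E1 by (rewrite Hx'; unfold x; lra).
      specialize (H' (z + RtoC x)%C ltac:(rewrite Em; unfold x; lra)).
      apply H'; replace (phi (z + RtoC x)%C) with ((0 + phi (z + RtoC x) * (z + RtoC x - z)) / RtoC x)%C.
      - rewrite <- E1; unfold Cdiv; ring.
      - field; intros E3; apply RtoC_inj in E3; unfold x in E3; lra. }
    exists (fun w => if Rle_dec (Im w) (Im p) then RtoC 0 else phi w); split.
    + intros e He; destruct (Hphi e He) as [d' [Hd' H']]; exists d'; split; [easy|].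
      intros w Hw; specialize (H' w Hw).
      destruct (Rle_dec (Im z) (Im p)) as [_|]; [|lra]; rewrite P0 in H'.
      destruct (Rle_dec (Im w) (Im p)); [|easy].
      replace (0 - 0)%C with (RtoC 0) by ring; rewrite Cmod_0; easy.
    + exists d; split; [easy|]; intros w Hw; unfold G.
      destruct (Rle_dec (Im z) (Im p)) as [_|]; [|lra].
      destruct (Rle_dec (Im w) (Im p)); [ring|].
      rewrite (Hf w Hw), Hz0; ring.
  - apply (cdiff_ext_loc H G z (Im z - Im p)); [lra | | now apply HH].
    intros w Hw; unfold G; destruct (Rle_dec (Im w) (Im p)) as [N|]; [|easy].
    pose proof (im_le_Cmod (w - z)%C) as B; change (Im (w - z)%C) with (Im w - Im z) in B.
    apply Rabs_le_between in B; lra. }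
intros z Hz.
pose proof (im_le_Cmod (z - (p + (0%R, (R0 / 40)%R)))%C) as B.
change (Im (z - (p + (0%R, (R0 / 40)%R)))%C) with (Im z - (Im p + R0 / 40)) in B.
apply Rabs_le_between in B.
assert (D : Cmod (z - p)%C < R0 / 10).
{ replace (z - p)%C with ((z - (p + (0%R, (R0 / 40)%R))) + (0%R, (R0 / 40)%R))%C by ring.
  eapply Rle_lt_trans; [apply Cmod_triangle|].
  pose proof (Cmod_pair 0 (R0 / 40)) as B2; rewrite Rabs_R0, Rabs_pos_eq in B2; lra. }
pose proof (im_le_Cmod (z - p)%C) as B'; change (Im (z - p)%C) with (Im z - Im p) in B'.
apply Rabs_le_between in B'.
replace (H z) with (G z).
2:{ unfold G; destruct (Rle_dec (Im z) (Im p)); [lra | easy]. }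
(* The factor 4 puts the points lower than the center by a quarter of the radius on the line or
   below it, where [G] is 0. *)
apply (disc_zero G z (4 * (Im z - Im p)) (R0 / 2)); [lra | lra | |].
- intros w Hw; apply HG; replace (w - p)%C with ((w - z) + (z - p))%C by ring.
  eapply Rle_lt_trans; [apply Cmod_triangle | lra].
- intros w Hw Hi; unfold G; destruct (Rle_dec (Im w) (Im p)); [easy | lra].
Qed.

Lemma entire_zero (H : C -> C) : (forall z, cdiff H z) ->
  (forall x : R, H (RtoC x) = 0%C) -> forall z, H z = 0%C.
Proof.
intros HH HZ z.
apply (ball_zero H (RtoC 0 + (0%R, (1 / 40)%R))%C (1 / 40) (Cmod (z - (RtoC 0 + (0%R, (1 / 40)%R)))%C + 1)).
- lra.
- auto.
- apply (diameter_zero H (RtoC 0) 1); [lra | auto |].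
  intros x _; replace (RtoC 0 + RtoC x)%C with (RtoC x) by ring; apply HZ.
- lra.
Qed.

(** Cauchy's estimate of the derivative: the quotient (F (w + z) - F w) / z has the limit phi w at z
    = 0 and is at most 2 M / |z| on the circle |z| = exp (- Y), whose radius may be taken
    arbitrarily large. The conclusion is restricted to real parts on the real axis because F extends
    a real function. *)
Lemma liouville (F : C -> C) (M : R) : (forall z, cdiff F z) ->
  (forall z, Cmod (F z) <= M) -> forall x y : R, Re (F (RtoC x)) = Re (F (RtoC y)).
Proof.
intros HF HM.
assert (K : forall (w : C) phi d, ccont phi w -> 0 < d ->
  (forall z, Cmod (z - w)%C < d -> F z = F w + phi z * (z - w))%C -> phi w = 0%C).
{ intros w phi d Hphi Hd Hf.
  set (g := fun z => if Ceq_dec z 0%C then phi w else ((F (w + z) - F w) / z)%C).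
  assert (B : forall Y, Cmod (phi w) <= 2 * (2 * M * exp Y)).
  { intros Y.
    apply (period_limit_bound (fun z => (F (w + cexp (Ci * z)) - F w) / cexp (Ci * z))%C Y).
    - intros x y _; apply cdiff_div; [| apply cdiff_cexp_Ci | apply cexp_neq_0].
      apply cdiff_minus; [|apply cdiff_const].
      apply (cdiff_comp F (fun z => w + cexp (Ci * z))%C); [|apply HF].
      apply cdiff_plus; [apply cdiff_const | apply cdiff_cexp_Ci].
    - intros y _; now rewrite cexp_Ci_period.
    - intros e He.
      destruct (small_circle g (phi w)) with (e := e) as [Y' HY]; [| | easy |].
      + apply (ccont_ext_loc (fun z => phi (w + z)%C) g 0%C d); [easy | |].
        * intros z Hz; unfold g; destruct (Ceq_dec z 0%C) as [-> | N]; [f_equal; ring|].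
          rewrite (Hf (w + z)%C).
          -- field; easy.
          -- replace (w + z - w)%C with (z - 0)%C by ring; easy.
        * apply (ccont_comp phi (fun z => w + z)%C).
          -- apply ccont_plus; [apply ccont_const | apply ccont_id].
          -- replace (w + 0)%C with w by ring; easy.
      + unfold g; destruct (Ceq_dec 0%C 0%C); easy.
      + exists Y'; intros x y Hy; specialize (HY x y Hy); unfold g in HY.
        destruct (Ceq_dec (cexp (Ci * (x, y))%C) 0%C) as [E | _]; [|easy].
        now apply cexp_neq_0 in E.
    - intros x _; rewrite Cmod_div by apply cexp_neq_0; rewrite Cmod_cexp_Ci.
      unfold Rdiv; rewrite exp_Ropp, Rinv_inv.
      apply Rmult_le_compat_r; [left; apply exp_pos|].
      unfold Cminus; eapply Rle_trans; [apply Cmod_triangle|]; rewrite Cmod_opp.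
      pose proof (HM (w + cexp (Ci * (x, Y)))%C); pose proof (HM w); lra. }
  destruct (classic (phi w = 0%C)) as [|N]; [easy|exfalso].
  apply Cmod_gt_0 in N.
  assert (HM0 : 0 <= M) by (eapply Rle_trans; [apply Cmod_ge_0 | apply (HM w)]).
  specialize (B (ln (Cmod (phi w) / (4 * M + 1) / 2))).
  assert (Q : 0 < Cmod (phi w) / (4 * M + 1) / 2) by (repeat apply Rdiv_lt_0_compat; lra).
  rewrite exp_ln in B by easy.
  assert (E : (4 * M + 1) * (Cmod (phi w) / (4 * M + 1) / 2) = Cmod (phi w) / 2) by (field; lra).
  nra. }
assert (D : forall x : R, is_derive (fun x => Re (F (RtoC x))) x 0).
{ intros x; destruct (HF (RtoC x)) as [phi [Hphi [d [Hd Hf]]]].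
  pose proof (K _ _ _ Hphi Hd Hf) as P0.
  apply is_derive_Reals; intros e He.
  destruct (Hphi e He) as [d' [Hd' H']]; rewrite P0 in H'.
  assert (Hm : 0 < Rmin d d') by (now apply Rmin_pos).
  exists (mkposreal _ Hm); simpl; intros h Nh Hh.
  pose proof (Rmin_l d d'); pose proof (Rmin_r d d').
  assert (Em : Cmod (RtoC (x + h) - RtoC x)%C = Rabs h).
  { rewrite <- RtoC_minus, Cmod_R; f_equal; ring. }
  specialize (H' (RtoC (x + h)) ltac:(rewrite Em; lra)).
  rewrite (Hf (RtoC (x + h))) by (rewrite Em; lra).
  replace (phi (RtoC (x + h)) - 0)%C with (phi (RtoC (x + h))) in H' by ring.
  replace ((Re (F (RtoC x) + phi (RtoC (x + h)) * (RtoC (x + h) - RtoC x))%C - Re (F (RtoC x))) / h - 0)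
    with (Re (phi (RtoC (x + h)))).
  2:{ unfold Re, Im, Cplus, Cmult, Cminus, Copp, RtoC; simpl; field; easy. }
  eapply Rle_lt_trans; [apply re_le_Cmod | easy]. }
intros x y; destruct (MVT_gen (fun x => Re (F (RtoC x))) x y (fun _ => 0)) as [c [_ Hc]].
- intros; apply D.
- intros; apply continuity_pt_ex_derive; eexists; apply D.
- lra.
Qed.

(** * The Jacobi amplitude *)

Lemma is_derive_0_const (f : R -> R) : (forall x, is_derive f x 0) -> forall x y, f x = f y.
Proof.
intros D x y; destruct (MVT_gen f x y (fun _ => 0)) as [c [_ Hc]].
- intros; apply D.
- intros; apply continuity_pt_ex_derive; eexists; apply D.
- lra.
Qed.

(** This is the Jacobi function dn in terms of the amplitude x; [ellF] is the incomplete elliptic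
    integral of the first kind, whose inverse is the amplitude. *)
Definition delta_am (k x : R) : R := sqrt (1 - (k * sin x) ^ 2).

Definition ellF (k x : R) : R := RInt (fun u => / delta_am k u) 0 x.

Section Amplitude.

Context (k : R) (Hk : 0 < k < 1).

Lemma delta_am_arg x : 0 < 1 - k ^ 2 <= 1 - (k * sin x) ^ 2.
Proof.
pose proof (SIN_bound x); assert (sin x ^ 2 <= 1) by nra.
rewrite Rpow_mult_distr; split; nra.
Qed.

Lemma delta_am_pos x : 0 < delta_am k x.
Proof. apply sqrt_lt_R0; pose proof (delta_am_arg x); lra. Qed.

Lemma delta_am_sqr x : delta_am k x ^ 2 = 1 - (k * sin x) ^ 2.
Proof. apply pow2_sqrt; pose proof (delta_am_arg x); lra. Qed.

Lemma delta_am_le_1 x : delta_am k x <= 1.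
Proof.
rewrite <- sqrt_1; apply sqrt_le_1_alt; pose proof (pow2_ge_0 (k * sin x)); lra.
Qed.

Lemma delta_am_ge x : sqrt (1 - k ^ 2) <= delta_am k x.
Proof. apply sqrt_le_1_alt, delta_am_arg. Qed.

Lemma delta_am_plus_PI x : delta_am k (x + PI) = delta_am k x.
Proof. unfold delta_am; rewrite neg_sin; f_equal; ring. Qed.

Lemma is_derive_delta_am x :
  is_derive (delta_am k) x (- (k ^ 2 * sin x * cos x / delta_am k x)).
Proof.
pose proof (delta_am_arg x); pose proof (delta_am_pos x).
unfold delta_am in *; auto_derive; [lra|].
replace (1 + - (k * sin x * (k * sin x * 1))) with (1 - (k * sin x) ^ 2) by ring.
field; lra.
Qed.

Lemma continuous_inv_delta_am x : continuous (fun u => / delta_am k u) x.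
Proof.
apply (ex_derive_continuous (V := R_NormedModule)).
pose proof (delta_am_pos x).
eexists; apply is_derive_inv; [apply is_derive_delta_am | lra].
Qed.

Lemma is_derive_ellF x : is_derive (ellF k) x (/ delta_am k x).
Proof.
apply (is_derive_RInt (V := R_NormedModule) (fun u => / delta_am k u) _ 0).
- exists (mkposreal 1 Rlt_0_1); intros y _.
  apply (RInt_correct (V := R_CompleteNormedModule)), (ex_RInt_continuous (V := R_CompleteNormedModule)).
  intros; apply continuous_inv_delta_am.
- apply continuous_inv_delta_am.
Qed.

Lemma ellF_0 : ellF k 0 = 0.
Proof. unfold ellF; rewrite RInt_point; reflexivity. Qed.

Lemma ellF_mvt x y : exists c, ellF k y - ellF k x = / delta_am k c * (y - x).
Proof.
destruct (MVT_gen (ellF k) x y (fun u => / delta_am k u)) as [c [_ Hc]].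
- intros; apply is_derive_ellF.
- intros; apply continuity_pt_ex_derive; eexists; apply is_derive_ellF.
- exists c; exact Hc.
Qed.

(** The integrand is at least 1. This inequality yields injectivity and surjectivity of [ellF] and
    the Lipschitz constant 1 of [am]. *)
Lemma ellF_expand x y : x <= y -> y - x <= ellF k y - ellF k x.
Proof.
intros H; destruct (ellF_mvt x y) as [c ->].
pose proof (delta_am_pos c); pose proof (delta_am_le_1 c).
assert (1 <= / delta_am k c); [|nra].
rewrite <- Rinv_1; apply Rinv_le_contravar; lra.
Qed.

Lemma ellF_lipschitz x y :
  Rabs (ellF k y - ellF k x) <= / sqrt (1 - k ^ 2) * Rabs (y - x).
Proof.
destruct (ellF_mvt x y) as [c ->]; rewrite Rabs_mult.
apply Rmult_le_compat_r; [apply Rabs_pos|].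
pose proof (delta_am_pos c); rewrite Rabs_pos_eq by (left; now apply Rinv_0_lt_compat).
apply Rinv_le_contravar; [|apply delta_am_ge].
apply sqrt_lt_R0; pose proof (delta_am_arg c); lra.
Qed.

Lemma ellF_inj x y : ellF k x = ellF k y -> x = y.
Proof.
intros E; destruct (Rle_dec x y) as [L | L].
- pose proof (ellF_expand x y L); lra.
- pose proof (ellF_expand y x ltac:(lra)); lra.
Qed.

Lemma ellF_surj t : exists x, ellF k x = t.
Proof.
assert (HA : - Rabs t <= t <= Rabs t) by (apply Rabs_le_between; lra).
pose proof (Rabs_pos t).
pose proof (ellF_expand 0 (Rabs t) ltac:(lra)) as H1.
pose proof (ellF_expand (- Rabs t) 0 ltac:(lra)) as H2.
rewrite ellF_0 in H1, H2.
destruct (IVT_gen (ellF k) (- Rabs t) (Rabs t) t) as [x [_ Hx]].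
- intros x; apply continuity_pt_ex_derive; eexists; apply is_derive_ellF.
- rewrite Rmin_left, Rmax_right by lra; lra.
- exists x; exact Hx.
Qed.

Definition am (t : R) : R := proj1_sig (constructive_indefinite_description _ (ellF_surj t)).

Lemma ellF_am t : ellF k (am t) = t.
Proof. unfold am; destruct (constructive_indefinite_description _ _) as [x Hx]; exact Hx. Qed.

Lemma am_ellF x : am (ellF k x) = x.
Proof. apply ellF_inj, ellF_am. Qed.

Lemma am_0 : am 0 = 0.
Proof. rewrite <- ellF_0 at 1; apply am_ellF. Qed.

Lemma am_lipschitz s t : Rabs (am t - am s) <= Rabs (t - s).
Proof.
destruct (Rle_dec (am s) (am t)) as [L | L].
- pose proof (ellF_expand _ _ L) as E; rewrite !ellF_am in E; rewrite !Rabs_pos_eq; lra.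
- pose proof (ellF_expand (am t) (am s) ltac:(lra)) as E; rewrite !ellF_am in E.
  rewrite !Rabs_left; lra.
Qed.

Lemma is_derive_am t : is_derive am t (delta_am k (am t)).
Proof.
apply is_derive_Reals; intros e He.
pose proof (delta_am_pos (am t)) as HD.
assert (HC : continuous (delta_am k) (am t)).
{ apply (ex_derive_continuous (V := R_NormedModule)); eexists; apply is_derive_delta_am. }
assert (HC2 := proj2 (continuity_pt_filterlim _ _) HC e He).
destruct HC2 as [d [Hd H]].
exists (mkposreal d Hd); simpl; intros h Nh Hh.
destruct (MVT_gen (ellF k) (am t) (am (t + h)) (fun u => / delta_am k u)) as [c [Hc E]].
- intros; apply is_derive_ellF.
- intros; apply continuity_pt_ex_derive; eexists; apply is_derive_ellF.
- rewrite !ellF_am in E.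
  pose proof (delta_am_pos c) as HDc.
  replace ((am (t + h) - am t) / h) with (delta_am k c).
  2:{ replace (am (t + h) - am t) with (delta_am k c * (t + h - t)); [field; easy|].
      rewrite E; field; lra. }
  destruct (Req_dec (am t) c) as [<- | N].
  { rewrite Rminus_diag, Rabs_R0; easy. }
  apply H; split; [split; [exact I | easy]|].
  pose proof (am_lipschitz t (t + h)) as Lp.
  replace (t + h - t) with h in Lp by ring.
  unfold dist; simpl; unfold Rdist.
  eapply Rle_lt_trans; [|exact Hh]; eapply Rle_trans; [|exact Lp].
  unfold Rmin, Rmax in Hc; destruct (Rle_dec (am t) (am (t + h))).
  + rewrite !Rabs_pos_eq; lra.
  + rewrite !Rabs_left1; lra.
Qed.

Lemma ellF_plus_PI x : ellF k (x + PI) = ellF k x + ellF k PI.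
Proof.
assert (E : ellF k (x + PI) - ellF k x = ellF k (0 + PI) - ellF k 0).
{ apply (is_derive_0_const (fun x => ellF k (x + PI) - ellF k x)); intros y.
  replace 0 with (1 * / delta_am k (y + PI) - / delta_am k y).
  2:{ rewrite delta_am_plus_PI; ring. }
  apply (is_derive_minus (V := R_NormedModule)); [|apply is_derive_ellF].
  apply (is_derive_comp (V := R_NormedModule) (ellF k) (fun x => x + PI)); [apply is_derive_ellF|].
  auto_derive; [easy | ring]. }
rewrite ellF_0, Rplus_0_l in E; lra.
Qed.

Lemma am_plus_period t : am (t + ellF k PI) = am t + PI.
Proof. apply ellF_inj; rewrite ellF_am, ellF_plus_PI, ellF_am; ring. Qed.

(* The left-hand side is a complex quotient N / D with N' D = N D'. *)
Lemma quotient_const (n1 n2 e1 e2 n1' n2' e1' e2' : R -> R) :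
  (forall t, is_derive n1 t (n1' t)) -> (forall t, is_derive n2 t (n2' t)) ->
  (forall t, is_derive e1 t (e1' t)) -> (forall t, is_derive e2 t (e2' t)) ->
  (forall t, 0 < e1 t ^ 2 + e2 t ^ 2) ->
  (forall t, n1' t * e1 t - n2' t * e2 t - (n1 t * e1' t - n2 t * e2' t) = 0) ->
  (forall t, n1' t * e2 t + n2' t * e1 t - (n1 t * e2' t + n2 t * e1' t) = 0) ->
  forall s t,
    (n1 s * e1 s + n2 s * e2 s) / (e1 s ^ 2 + e2 s ^ 2) =
      (n1 t * e1 t + n2 t * e2 t) / (e1 t ^ 2 + e2 t ^ 2) /\
    (n2 s * e1 s - n1 s * e2 s) / (e1 s ^ 2 + e2 s ^ 2) =
      (n2 t * e1 t - n1 t * e2 t) / (e1 t ^ 2 + e2 t ^ 2).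
Proof.
intros D1 D2 D3 D4 P E1 E2.
intros s t; split.
- apply (is_derive_0_const (fun t => (n1 t * e1 t + n2 t * e2 t) / (e1 t ^ 2 + e2 t ^ 2))).
  clear s t; intros t; specialize (P t); specialize (E1 t); specialize (E2 t).
  auto_derive.
  + repeat split; try (eexists; eauto; fail); simpl in P; lra.
  + replace (Derive (fun x : R => n1 x) t) with (n1' t) by (symmetry; apply is_derive_unique, D1).
    replace (Derive (fun x : R => n2 x) t) with (n2' t) by (symmetry; apply is_derive_unique, D2).
    replace (Derive (fun x : R => e1 x) t) with (e1' t) by (symmetry; apply is_derive_unique, D3).
    replace (Derive (fun x : R => e2 x) t) with (e2' t) by (symmetry; apply is_derive_unique, D4).
    match goal with |- ?L = 0 => replace L with
     (((n1' t * e1 t - n2' t * e2 t - (n1 t * e1' t - n2 t * e2' t)) * (e1 t ^ 2 - e2 t ^ 2) +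
      (n1' t * e2 t + n2' t * e1 t - (n1 t * e2' t + n2 t * e1' t)) * (2 * e1 t * e2 t))
      / (e1 t ^ 2 + e2 t ^ 2) ^ 2) end.
    * rewrite E1, E2; field; lra.
    * field; simpl in P |- *; lra.
- apply (is_derive_0_const (fun t => (n2 t * e1 t - n1 t * e2 t) / (e1 t ^ 2 + e2 t ^ 2))).
  clear s t; intros t; specialize (P t); specialize (E1 t); specialize (E2 t).
  auto_derive.
  + repeat split; try (eexists; eauto; fail); simpl in P; lra.
  + replace (Derive (fun x : R => n1 x) t) with (n1' t) by (symmetry; apply is_derive_unique, D1).
    replace (Derive (fun x : R => n2 x) t) with (n2' t) by (symmetry; apply is_derive_unique, D2).
    replace (Derive (fun x : R => e1 x) t) with (e1' t) by (symmetry; apply is_derive_unique, D3).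
    replace (Derive (fun x : R => e2 x) t) with (e2' t) by (symmetry; apply is_derive_unique, D4).
    match goal with |- ?L = 0 => replace L with
     (((n1' t * e2 t + n2' t * e1 t - (n1 t * e2' t + n2 t * e1' t)) * (e1 t ^ 2 - e2 t ^ 2) -
      (n1' t * e1 t - n2' t * e2 t - (n1 t * e1' t - n2 t * e2' t)) * (2 * e1 t * e2 t))
      / (e1 t ^ 2 + e2 t ^ 2) ^ 2) end.
    * rewrite E1, E2; field; lra.
    * field; simpl in P |- *; lra.
Qed.

(* Complex form: exp (i am (t + u)) (cn t - i dn u sn t) = cn u + i sn u dn t. *)
Lemma am_addition (t u : R) :
  cos (am (t + u)) * cos (am t) + sin (am (t + u)) * (sin (am t) * delta_am k (am u))
    = cos (am u) /\
  sin (am (t + u)) * cos (am t) - cos (am (t + u)) * (sin (am t) * delta_am k (am u))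
    = sin (am u) * delta_am k (am t).
Proof.
(* With A = t + u fixed, the quotient (cn u + i sn u dn t) / (cn t - i dn u sn t) is constant in t,
   and at t = 0 it is exp (i am A). *)
set (A := t + u); replace u with (A - t) by (unfold A; ring); clearbody A; clear u.
assert (Ds : forall x, is_derive (fun x => sin (am x)) x (cos (am x) * delta_am k (am x))).
{ intros x; evar_last.
  - apply (is_derive_comp (V := R_NormedModule) sin am x); [apply is_derive_sin | apply is_derive_am].
  - unfold scal; simpl; unfold mult; simpl; ring. }
assert (Dc : forall x, is_derive (fun x => cos (am x)) x (- (sin (am x) * delta_am k (am x)))).
{ intros x; evar_last.
  - apply (is_derive_comp (V := R_NormedModule) cos am x); [apply is_derive_cos | apply is_derive_am].
  - unfold scal; simpl; unfold mult; simpl; ring. }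
assert (Dd : forall x, is_derive (fun x => delta_am k (am x)) x (- (k ^ 2 * sin (am x) * cos (am x)))).
{ intros x; evar_last.
  - apply (is_derive_comp (V := R_NormedModule) (delta_am k) am x); [apply is_derive_delta_am | apply is_derive_am].
  - pose proof (delta_am_pos (am x)); unfold scal; simpl; unfold mult; simpl; field; lra. }
assert (R : forall f l, (forall x, is_derive f x (l x)) -> forall x, is_derive (fun x => f (A - x)) x (- l (A - x))).
{ intros f l H x; evar_last.
  - apply (is_derive_comp (V := R_NormedModule) f (fun x => A - x) x); [apply H|].
    apply (is_derive_minus (V := R_NormedModule)); [apply is_derive_const | apply is_derive_id].
  - unfold scal, minus, plus, opp, zero, one; simpl; unfold mult; simpl; ring. }
assert (Ds2 := R _ _ Ds); assert (Dc2 := R _ _ Dc); assert (Dd2 := R _ _ Dd); simpl in Ds2, Dc2, Dd2.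
assert (Rel : forall x, cos (am x) ^ 2 = 1 - sin (am x) ^ 2).
{ intros x; pose proof (sin2_cos2 (am x)) as E; unfold Rsqr in E; simpl; lra. }
assert (Rel2 : forall x, delta_am k (am x) ^ 2 = 1 - k ^ 2 * sin (am x) ^ 2).
{ intros x; rewrite delta_am_sqr; ring. }
assert (P : forall x, 0 < cos (am x) ^ 2 + (- (delta_am k (am (A - x)) * sin (am x))) ^ 2).
{ intros x; pose proof (delta_am_pos (am (A - x))) as H.
  destruct (Req_dec (sin (am x)) 0) as [E | E].
  - rewrite Rel, E; lra.
  - assert (0 < (- (delta_am k (am (A - x)) * sin (am x))) ^ 2); [|pose proof (pow2_ge_0 (cos (am x))); lra].
    apply pow2_gt_0; intros F; apply Ropp_eq_0_compat in F; rewrite Ropp_involutive in F.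
    apply Rmult_integral in F; destruct F; lra. }
destruct (quotient_const (fun x => cos (am (A - x))) (fun x => sin (am (A - x)) * delta_am k (am x))
  (fun x => cos (am x)) (fun x => - (delta_am k (am (A - x)) * sin (am x)))
  (fun x => sin (am (A - x)) * delta_am k (am (A - x)))
  (fun x => - (cos (am (A - x)) * delta_am k (am (A - x)) * delta_am k (am x)
     + k ^ 2 * sin (am (A - x)) * (sin (am x) * cos (am x))))
  (fun x => - (sin (am x) * delta_am k (am x)))
  (fun x => - (k ^ 2 * sin (am (A - x)) * cos (am (A - x)) * sin (am x)
     + delta_am k (am (A - x)) * (cos (am x) * delta_am k (am x))))) with (s := t) (t := 0) as [Q1 Q2].
- intros x; evar_last; [apply Dc2 | ring].
- intros x; evar_last; [apply (is_derive_mult (K := R_AbsRing)); [apply Ds2 | apply Dd | intros; apply Rmult_comm]|].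
  unfold plus, mult; simpl; ring.
- intros x; apply Dc.
- intros x; evar_last; [apply (is_derive_opp (V := R_NormedModule)); apply (is_derive_mult (K := R_AbsRing)); [apply Dd2 | apply Ds | intros; apply Rmult_comm]|].
  unfold plus, mult, opp; simpl; ring.
- exact P.
- intros x; generalize (Rel x) (Rel2 x) (Rel (A - x)) (Rel2 (A - x)).
  set (s1 := sin (am x)); set (c1 := cos (am x)); set (d1 := delta_am k (am x)).
  set (s2 := sin (am (A - x))); set (c2 := cos (am (A - x))); set (d2 := delta_am k (am (A - x))).
  intros F1 F2 F3 F4.
  transitivity (s2 * c1 * d2 * (1 - k ^ 2 * s1 ^ 2 - d1 ^ 2) + c2 * s1 * d1 * (1 - d2 ^ 2 - k ^ 2 * s2 ^ 2)); [ring|].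
  rewrite F2, F4; ring.
- intros x; generalize (Rel x) (Rel2 x) (Rel (A - x)) (Rel2 (A - x)).
  set (s1 := sin (am x)); set (c1 := cos (am x)); set (d1 := delta_am k (am x)).
  set (s2 := sin (am (A - x))); set (c2 := cos (am (A - x))); set (d2 := delta_am k (am (A - x))).
  intros F1 F2 F3 F4.
  transitivity (s1 * s2 * (d1 ^ 2 - d2 ^ 2 + k ^ 2 * c2 ^ 2 - k ^ 2 * c1 ^ 2)); [ring|].
  rewrite F1, F2, F3, F4; ring.
- specialize (P t).
  rewrite am_0, Rminus_0_r, cos_0, sin_0 in Q1, Q2.
  assert (D0 : delta_am k 0 = 1).
  { unfold delta_am; rewrite sin_0; replace (1 - (k * 0) ^ 2) with 1 by ring; apply sqrt_1. }
  rewrite D0 in Q1, Q2.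
  replace ((cos (am A) * 1 + sin (am A) * 1 * - (delta_am k (am A) * 0)) / (1 ^ 2 + (- (delta_am k (am A) * 0)) ^ 2))
    with (cos (am A)) in Q1 by field.
  replace ((sin (am A) * 1 * 1 - cos (am A) * - (delta_am k (am A) * 0)) / (1 ^ 2 + (- (delta_am k (am A) * 0)) ^ 2))
    with (sin (am A)) in Q2 by field.
  rewrite <- Q1, <- Q2; split; field; lra.
Qed.

End Amplitude.

(** * Periodic entire functions as functions of exp (i psi) *)

Fixpoint Rsum (n : nat) (f : nat -> R) : R :=
  match n with O => 0 | S n => Rsum n f + f n end.

Fixpoint Csum (n : nat) (f : nat -> C) : C :=
  match n with O => RtoC 0 | S n => (Csum n f + f n)%C end.

Lemma angle_unique (x y : R) : cos x = cos y -> sin x = sin y ->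
  exists n : Z, x = y + 2 * PI * IZR n.
Proof.
intros Hc Hs.
assert (E : cos (2 * ((x - y) / 2)) = 1).
{ replace (2 * ((x - y) / 2)) with (x - y) by field.
  rewrite cos_minus, Hc, Hs; pose proof (sin2_cos2 y) as T; unfold Rsqr in T; lra. }
rewrite cos_2a_sin in E.
destruct (sin_eq_0_0 ((x - y) / 2)) as [n Hn]; [nra|].
exists n; lra.
Qed.

Lemma reduce_2PI (x : R) : exists n : Z, 0 <= x + 2 * PI * IZR n < 2 * PI.
Proof.
pose proof PI_RGT_0 as HP.
destruct (archimed (x / (2 * PI))) as [A1 A2].
exists (1 - up (x / (2 * PI)))%Z; rewrite minus_IZR.
set (u := IZR (up (x / (2 * PI)))) in *.
assert (E : x = x / (2 * PI) * (2 * PI)) by (field; lra).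
set (v := x / (2 * PI)) in *; clearbody v u; subst x; split; nra.
Qed.

Section Entire.

Context (F : C -> C) (f : R -> R) (HF : forall z, cdiff F z)
  (Hf : forall x : R, F (RtoC x) = RtoC (f x)) (Hper : periodic (2 * PI) f).

(** Periodicity passes from the real axis to the plane by the identity theorem. *)
Lemma entire_period (z : C) : F (z + RtoC (2 * PI))%C = F z.
Proof.
assert (E : (F (z + RtoC (2 * PI)) - F z)%C = 0%C).
{ apply (entire_zero (fun z => F (z + RtoC (2 * PI)) - F z)%C).
  - intros w; apply cdiff_minus; [|apply HF].
    apply (cdiff_comp F (fun w => w + RtoC (2 * PI))%C); [|apply HF].
    apply cdiff_plus; [apply cdiff_id | apply cdiff_const].
  - intros x; rewrite <- RtoC_plus, !Hf, Hper; ring. }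
replace (F (z + RtoC (2 * PI))%C) with (F (z + RtoC (2 * PI)) - F z + F z)%C by ring.
rewrite E; ring.
Qed.

Lemma entire_period_Z (n : Z) (x y : R) : F (x + 2 * PI * IZR n, y) = F (x, y).
Proof.
assert (P : forall (k : nat) x, F (x + 2 * PI * INR k, y) = F (x, y)).
{ induction k as [|k IH]; intros u.
  - simpl; f_equal; f_equal; ring.
  - rewrite <- (IH u), <- (entire_period (u + 2 * PI * INR k, y)); f_equal.
    rewrite S_INR; unfold Cplus, RtoC; simpl; f_equal; ring. }
destruct (Z_le_dec 0 n) as [L | L].
- rewrite <- (Z2Nat.id n), <- INR_IZR_INZ by easy; apply P.
- rewrite <- (P (Z.to_nat (- n)) (x + 2 * PI * IZR n)), INR_IZR_INZ, Z2Nat.id, opp_IZR by lia.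
  f_equal; f_equal; ring.
Qed.

(** Reflection principle: the conjugate of F at the conjugate point is entire and agrees with F on
    the real axis, where F is real. *)
Lemma entire_conj (x y : R) : Cmod (F (x, - y)) = Cmod (F (x, y)).
Proof.
assert (HC : forall z, cdiff (fun w => Cconj (F (Cconj w))) z).
{ intros z; destruct (HF (Cconj z)) as [phi [Hphi [d [Hd H]]]].
  assert (Hm : forall u v : C, Cmod (Cconj u - Cconj v)%C = Cmod (u - v)%C).
  { intros u v; rewrite <- (Cmod_conj (u - v)%C); f_equal.
    destruct u, v; unfold Cconj, Cminus, Cplus, Copp; simpl; f_equal; ring. }
  exists (fun w => Cconj (phi (Cconj w))); split.
  - intros e He; destruct (Hphi e He) as [d' [Hd' H']]; exists d'; split; [easy|].
    intros w Hw; rewrite Hm; apply H'; rewrite Hm; easy.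
  - exists d; split; [easy|]; intros w Hw; rewrite (H (Cconj w)) by (rewrite Hm; easy).
    rewrite Cplus_conj, Cmult_conj, Cminus_conj, !Cconj_conj; easy. }
assert (E : (Cconj (F (Cconj (x, y))) - F (x, y))%C = 0%C).
{ apply (entire_zero (fun z => Cconj (F (Cconj z)) - F z)%C).
  - intros z; apply cdiff_minus; [apply HC | apply HF].
  - intros u; replace (Cconj (RtoC u)) with (RtoC u).
    + rewrite Hf; unfold Cconj, RtoC, Cminus, Cplus, Copp; simpl; f_equal; ring.
    + unfold Cconj, RtoC; simpl; f_equal; ring. }
rewrite <- (Cmod_conj (F (x, - y))).
f_equal; change (x, - y) with (Cconj (x, y)).
replace (Cconj (F (Cconj (x, y)))) with (Cconj (F (Cconj (x, y))) - F (x, y) + F (x, y))%C by ring.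
rewrite E; ring.
Qed.

Lemma strip_bound (Y : R) : 0 <= Y ->
  exists M, 0 <= M /\ forall x y, Rabs y <= Y -> Cmod (F (x, y)) <= M.
Proof.
intros HY; destruct (ccont_bounded_rect F 0 (2 * PI) (- Y) Y) as [M [HM0 HM]].
- pose proof PI_RGT_0; lra.
- lra.
- intros; apply cdiff_ccont, HF.
- exists M; split; [easy|]; intros x y Hy.
  destruct (reduce_2PI x) as [n Hn].
  rewrite <- (entire_period_Z n); apply HM; [lra | now apply Rabs_le_between].
Qed.

(* F descends to the punctured plane through z = exp (i zeta). *)
Lemma descend : exists G : C -> C,
  (forall z, G (cexp (Ci * z)%C) = F z) /\ (forall z : C, z <> 0%C -> cdiff G z).
Proof.
assert (HG0 : forall z, exists v, forall zeta, z = cexp (Ci * zeta)%C -> v = F zeta).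
{ intros z; destruct (classic (exists zeta, z = cexp (Ci * zeta)%C)) as [[[x y] E] | N].
  - exists (F (x, y)); intros [x' y'] E'; rewrite E in E'.
    assert (Ey : y = y').
    { apply (f_equal Cmod) in E'; rewrite !Cmod_cexp_Ci in E'.
      apply exp_inv in E'; lra. }
    subst y'; rewrite !cexp_Ci in E'; injection E' as E1 E2.
    pose proof (exp_pos (- y)).
    apply Rmult_eq_reg_l in E1; [|lra]; apply Rmult_eq_reg_l in E2; [|lra].
    destruct (angle_unique x x' E1 E2) as [n ->]; apply entire_period_Z.
  - exists 0%C; intros zeta E; exfalso; apply N; now exists zeta. }
destruct (choice _ HG0) as [G HG].
assert (HG1 : forall z, G (cexp (Ci * z)%C) = F z) by (intros z; now apply HG).
exists G; split; [easy|].
intros z Nz; destruct (cexp_Ci_surj z Nz) as [t Ht]; set (zeta := (t, _) : C) in Ht.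
assert (Mz := proj1 (Cmod_gt_0 _) Nz).
assert (Hre : forall w, Cmod (w - z)%C < Cmod z -> 0 < Re (w / z)%C).
{ intros w Hw.
  assert (B : Cmod (w / z - 1)%C < 1).
  { replace (w / z - 1)%C with ((w - z) / z)%C by (field; easy).
    rewrite Cmod_div by easy; apply Rmult_lt_reg_r with (Cmod z); [easy|].
    unfold Rdiv; rewrite Rmult_assoc, Rinv_l; lra. }
  pose proof (re_le_Cmod (w / z - 1)%C) as B'.
  change (Re (w / z - 1)%C) with (Re (w / z)%C - 1) in B'.
  apply Rabs_le_between in B'; lra. }
(* A local inverse of exp (i zeta) near z; the quotient w / z stays in the right half-plane, where
   [clog] is a branch of the logarithm. *)
apply (cdiff_ext_loc (fun w => F (zeta + - Ci * clog (w / z))%C) G z (Cmod z)); [easy | |].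
- intros w Hw; rewrite <- HG1; f_equal.
  replace (Ci * (zeta + - Ci * clog (w / z)))%C with (Ci * zeta + clog (w / z))%C.
  + rewrite cexp_plus, cexp_clog, <- Ht by now apply Hre.
    field; easy.
  + assert (I2 : (Ci * Ci)%C = (- (1))%C).
    { unfold Ci, Cmult, Copp, RtoC; simpl; f_equal; ring. }
    transitivity (Ci * zeta - (Ci * Ci) * clog (w / z))%C; [rewrite I2; ring | ring].
- apply (cdiff_comp F (fun w => zeta + - Ci * clog (w / z))%C); [|apply HF].
  apply cdiff_plus; [apply cdiff_const|]; apply cdiff_mult; [apply cdiff_const|].
  apply (cdiff_comp clog (fun w => w / z)%C).
  + apply cdiff_div; [apply cdiff_id | apply cdiff_const | easy].
  + apply cdiff_clog, Hre; replace (z - z)%C with (RtoC 0) by ring; rewrite Cmod_0; easy.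
Qed.

End Entire.

(* In terms of z = exp (i psi): quartic k z is (z delta_am k psi)^2, and shift k u z is
   the value of exp (i am (t + u)) at t = ellF psi. *)
Definition quartic (k : R) (z : C) : C :=
  (RtoC (k ^ 2 / 4) * (z * z * (z * z) + 1) + RtoC (1 - k ^ 2 / 2) * (z * z))%C.

Definition shift (k cu su du : R) (z : C) : C :=
  (2 * (RtoC cu * z + Ci * RtoC su * csqrt (quartic k z)) /
    (RtoC (1 - du) * (z * z) + RtoC (1 + du)))%C.

(** The denominator of [shift] and the half of its numerator are both factors of a multiple of the
    quartic of modulus k su, so neither vanishes where that quartic does not. The first
    factorization uses (k su)^2 = (1 - du) (1 + du), the second completes the square root by its
    conjugate. *)
Lemma quartic_factor (k cu su du : R) (z : C) :
  su ^ 2 + cu ^ 2 = 1 -> du ^ 2 + (k * su) ^ 2 = 1 -> 0 < Re (quartic k z) ->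
  ((RtoC (1 - du) * (z * z) + RtoC (1 + du)) * (RtoC (1 + du) * (z * z) + RtoC (1 - du)))%C
    = (4 * quartic (k * su) z)%C /\
  ((RtoC cu * z + Ci * RtoC su * csqrt (quartic k z)) *
   (RtoC cu * z - Ci * RtoC su * csqrt (quartic k z)))%C = quartic (k * su) z.
Proof.
intros H1 H2 Hre; split.
- assert (E : (k * su) ^ 2 = (1 - du) * (1 + du)) by lra.
  unfold quartic; rewrite E.
  destruct z as [x y]; unfold Cplus, Cmult, RtoC; simpl; f_equal; field.
- assert (I2 : (Ci * Ci)%C = (- (1))%C).
  { unfold Ci, Cmult, Copp, RtoC; simpl; f_equal; ring. }
  transitivity (RtoC cu * RtoC cu * (z * z) - Ci * Ci * (RtoC su * RtoC su) *
    (csqrt (quartic k z) * csqrt (quartic k z)))%C; [ring|].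
  rewrite I2, csqrt_sqr by easy; unfold quartic.
  assert (E : (RtoC cu * RtoC cu = 1 - RtoC su * RtoC su)%C).
  { rewrite <- !RtoC_mult, <- RtoC_minus; f_equal; lra. }
  rewrite E; destruct z as [x y]; unfold Cminus, Cplus, Copp, Cmult, RtoC; simpl; f_equal; field.
Qed.

(** The coefficients are positive, and the hypotheses hold in the sector |arg z| <= PI / 8 without
    its vertex; the principal square root of the quartic is therefore holomorphic there. *)
Lemma quartic_sector (k : R) (z : C) : 0 < k <= 1 ->
  0 < Re (z * z)%C -> 0 <= Re (z * z * (z * z))%C -> 0 < Re (quartic k z).
Proof.
intros Hk H1 H2; unfold quartic.
set (a := (z * z)%C) in *; set (b := (a * a)%C) in *; clearbody b.
destruct a as [a1 a2], b as [b1 b2]; simpl in *.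
assert (0 < k * k <= 1) by nra.
assert (0 < k * (k * 1) / 4 * (b1 + 1)) by (apply Rmult_lt_0_compat; lra).
assert (0 < (1 - k * (k * 1) / 2) * a1) by (apply Rmult_lt_0_compat; lra).
lra.
Qed.

(** Near 0 the constant term k^2 / 4 dominates; the radius k / 3 suffices because 2 / 9 < 1 / 4. *)
Lemma quartic_near_0 (k : R) (z : C) : 0 < k <= 1 -> Cmod z < k / 3 ->
  Cmod (quartic k z - RtoC (k ^ 2 / 4))%C <= 2 * Cmod z ^ 2 /\
  0 < Re (quartic k z) /\ k ^ 2 / 4 - 2 * Cmod z ^ 2 <= Cmod (quartic k z).
Proof.
intros Hk Hz; pose proof (Cmod_ge_0 z) as Hz0.
assert (B : Cmod (quartic k z - RtoC (k ^ 2 / 4))%C <= 2 * Cmod z ^ 2).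
{ unfold quartic.
  replace (RtoC (k ^ 2 / 4) * (z * z * (z * z) + 1) + RtoC (1 - k ^ 2 / 2) * (z * z) - RtoC (k ^ 2 / 4))%C
    with (RtoC (k ^ 2 / 4) * (z * z * (z * z)) + RtoC (1 - k ^ 2 / 2) * (z * z))%C by ring.
  eapply Rle_trans; [apply Cmod_triangle|]; rewrite !Cmod_mult, !Cmod_R.
  set (r := Cmod z) in *.
  rewrite !Rabs_pos_eq by nra.
  assert (0 <= r * r) by nra.
  assert (r * r <= 1) by nra.
  assert (r * r * (r * r) <= r * r) by nra.
  nra. }
split; [easy|].
assert (B2 : 2 * Cmod z ^ 2 < k ^ 2 / 4) by nra.
split.
- pose proof (re_le_Cmod (quartic k z - RtoC (k ^ 2 / 4))%C) as B'.
  change (Re (quartic k z - RtoC (k ^ 2 / 4))%C) with (Re (quartic k z) - k ^ 2 / 4) in B'.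
  apply Rabs_le_between in B'; lra.
- pose proof (Cmod_triangle_rev (RtoC (k ^ 2 / 4)) (quartic k z)) as T.
  rewrite Cmod_sub_sym, Cmod_R, Rabs_pos_eq in T by nra; lra.
Qed.

Lemma cdiff_quartic (k : R) (z : C) : cdiff (quartic k) z.
Proof.
assert (S : forall z, cdiff (fun z => z * z)%C z) by (intros; apply cdiff_mult; apply cdiff_id).
unfold quartic; apply cdiff_plus; (apply cdiff_mult; [apply cdiff_const|]); [|apply S].
apply cdiff_plus; [|apply cdiff_const]; apply (cdiff_mult _ _ z (S z) (S z)).
Qed.

Lemma shift_regular (k cu su du : R) (z : C) :
  su ^ 2 + cu ^ 2 = 1 -> du ^ 2 + (k * su) ^ 2 = 1 ->
  0 < Re (quartic k z) -> quartic (k * su) z <> 0%C ->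
  shift k cu su du z <> 0%C /\ cdiff (shift k cu su du) z.
Proof.
intros H1 H2 H3 H4; destruct (quartic_factor k cu su du z H1 H2 H3) as [E1 E2].
assert (ND : (RtoC (1 - du) * (z * z) + RtoC (1 + du))%C <> 0%C).
{ intros E; rewrite E in E1; apply H4.
  replace (quartic (k * su) z) with (/ 4 * (4 * quartic (k * su) z))%C by field.
  rewrite <- E1; ring. }
assert (NN : (RtoC cu * z + Ci * RtoC su * csqrt (quartic k z))%C <> 0%C).
{ intros E; rewrite E in E2; apply H4; rewrite <- E2; ring. }
split.
- intros E; apply NN; unfold shift in E.
  set (N := (RtoC cu * z + Ci * RtoC su * csqrt (quartic k z))%C) in *.
  set (D := (RtoC (1 - du) * (z * z) + RtoC (1 + du))%C) in *.
  replace N with (/ 2 * (2 * N / D) * D)%C by (field; easy).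
  rewrite E; ring.
- unfold shift; apply cdiff_div; [| |easy].
  + apply cdiff_mult; [apply cdiff_const|]; apply cdiff_plus.
    * apply cdiff_mult; [apply cdiff_const | apply cdiff_id].
    * apply cdiff_mult; [apply cdiff_const|].
      apply (cdiff_comp csqrt (quartic k)); [apply cdiff_quartic | now apply cdiff_csqrt].
  + apply cdiff_plus; [|apply cdiff_const]; apply cdiff_mult; [apply cdiff_const|].
    apply cdiff_mult; apply cdiff_id.
Qed.

(** On this arc of the unit circle z [delta_am k psi] is a square root of [quartic k z] with
    positive real part, hence the principal one. The denominator of [shift] is 2 z (cn t - i dn u sn
    t), so the formula is the addition theorem solved for exp (i am (t + u)). *)
Lemma shift_real (k : R) (Hk : 0 < k < 1) (u psi : R) : 0 < cos psi -> 0 < cos (2 * psi) ->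
  shift k (cos (am k Hk u)) (sin (am k Hk u)) (delta_am k (am k Hk u)) (cexp (Ci * (psi, 0%R))%C)
    = cexp (Ci * (am k Hk (ellF k psi + u), 0%R))%C.
Proof.
intros Hc Hc2; rewrite cos_2a in Hc2; destruct (am_addition k Hk (ellF k psi) u) as [A1 A2]; rewrite am_ellF in A1, A2.
set (cu := cos (am k Hk u)) in *; set (su := sin (am k Hk u)) in *.
set (du := delta_am k (am k Hk u)) in *; set (psi' := am k Hk (ellF k psi + u)) in *.
rewrite !cexp_Ci, !Ropp_0, !exp_0, !Rmult_1_l.
set (D := delta_am k psi) in *.
assert (HD : 0 < D) by apply (delta_am_pos k Hk).
assert (HD2 : D ^ 2 = 1 - (k * sin psi) ^ 2) by apply (delta_am_sqr k Hk).
assert (Tr := sin2_cos2 psi); unfold Rsqr in Tr.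
set (c := cos psi) in *; set (s := sin psi) in *.
set (z := (c, s) : C); set (w := (c * D, s * D) : C).
assert (Hw : (w * w)%C = quartic k z).
{ assert (Z2 : (z * z * (z * z) + 1)%C = ((2 * (1 - 2 * (s * s)))%R * (z * z))%C).
  { unfold z, Cmult, Cplus, RtoC; simpl.
    replace 1 with ((s * s + c * c) * (s * s + c * c)) at 1 by (rewrite Tr; ring).
    replace (1 - 2 * (s * s)) with (c * c - s * s) by lra.
    f_equal; ring. }
  unfold quartic; rewrite Z2.
  replace (w * w)%C with (RtoC (D ^ 2) * (z * z))%C.
  2:{ unfold w, z, Cmult, RtoC; simpl; f_equal; ring. }
  rewrite HD2.
  replace (1 - (k * s) ^ 2) with (k ^ 2 / 4 * (2 * (1 - 2 * (s * s))) + (1 - k ^ 2 / 2)) by field.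
  rewrite RtoC_plus, RtoC_mult; ring. }
assert (HP : 0 < Re (quartic k z)).
{ rewrite <- Hw; unfold w; simpl.
  assert (0 < D * D) by nra.
  replace (c * D * (c * D) - s * D * (s * D)) with ((c * c - s * s) * (D * D)) by ring.
  apply Rmult_lt_0_compat; easy. }
assert (Hsw : csqrt (quartic k z) = w).
{ pose proof (Re_csqrt_pos _ HP) as P1; pose proof (csqrt_sqr _ HP) as P2.
  set (v := csqrt (quartic k z)) in *.
  assert (NS : (v + w)%C <> 0%C).
  { intros E; apply (f_equal Re) in E; change (Re v + Re w = 0) in E.
    assert (0 < Re w) by (simpl; now apply Rmult_lt_0_compat); lra. }
  replace v with ((v * v - w * w) / (v + w) + w)%C by (field; easy).
  rewrite P2, <- Hw; field; easy. }
assert (Rel1 : su ^ 2 + cu ^ 2 = 1).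
{ pose proof (sin2_cos2 (am k Hk u)) as T; unfold Rsqr in T; fold su cu in T; lra. }
assert (Rel2 : du ^ 2 + (k * su) ^ 2 = 1).
{ unfold du; rewrite (delta_am_sqr k Hk); fold su; lra. }
unfold shift; rewrite Hsw.
assert (Hdu : 0 < du <= 1) by (split; [apply (delta_am_pos k Hk) | apply delta_am_le_1]).
assert (ND : (RtoC (1 - du) * (z * z) + RtoC (1 + du))%C <> 0%C).
{ intros E; apply (f_equal Re) in E; simpl in E.
  assert (0 <= (1 - du) * (c * c - s * s)) by (apply Rmult_le_pos; lra); lra. }
set (T := (cos psi', sin psi') : C).
assert (E : (2 * (RtoC cu * z + Ci * RtoC su * w))%C = (T * (RtoC (1 - du) * (z * z) + RtoC (1 + du)))%C).
{ assert (E1 : (RtoC (1 - du) * (z * z) + RtoC (1 + du))%C = (2 * z * (c, (- (du * s))%R))%C).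
  { unfold z, Cmult, Cplus, RtoC; simpl.
    replace (1 + du) with ((1 + du) * (s * s + c * c)) by (rewrite Tr; ring).
    f_equal; ring. }
  assert (E2 : (T * (c, (- (du * s))%R))%C = (cu, su * D)).
  { rewrite <- A1, <- A2; unfold T, Cmult; simpl; f_equal; ring. }
  rewrite E1; transitivity (2 * z * (T * (c, (- (du * s))%R)))%C; [|ring].
  rewrite E2; unfold w, z, Ci, Cmult, Cplus, RtoC; simpl; f_equal; ring. }
rewrite E; field; easy.
Qed.

(** Near z = 0 the denominator D lies between 1/2 and 2 in modulus, and N and N', the half numerator
    and its conjugate with respect to the root, are at most 3, which gives 12. For the lower bound,
    N N' is the quartic of modulus k su, at least q^2 / 4 - 2 q^2 / 9 = q^2 / 36. *)
Lemma shift_bounds (k su cu du q : R) (z : C) : 0 < k < 1 ->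
  su ^ 2 + cu ^ 2 = 1 -> du ^ 2 + (k * su) ^ 2 = 1 -> 0 < du <= 1 ->
  0 < q -> q <= k * Rabs su -> Cmod z < q / 3 ->
  q ^ 2 / 108 <= Cmod (shift k cu su du z) <= 12.
Proof.
intros Hk H1 H2 Hdu Hq Hqs Hz; pose proof (Cmod_ge_0 z) as Hz0.
assert (Hsu : Rabs su <= 1) by (apply Rabs_le; nra).
assert (Hcu : Rabs cu <= 1) by (apply Rabs_le; nra).
pose proof (Rabs_pos su) as Hsu0.
assert (Hqk : q <= k) by nra.
destruct (quartic_near_0 k z) as [B1 [B2 _]]; [lra | lra |].
assert (Hks : (k * su) ^ 2 = (k * Rabs su) ^ 2).
{ rewrite !Rpow_mult_distr, pow2_abs; easy. }
assert (Q : quartic (k * su) z = quartic (k * Rabs su) z) by (unfold quartic; rewrite Hks; easy).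
destruct (quartic_near_0 (k * Rabs su) z) as [_ [_ B3]]; [nra | lra |].
rewrite <- Q in B3.
destruct (quartic_factor k cu su du z H1 H2 B2) as [_ E].
set (w := csqrt (quartic k z)) in *.
assert (Hw : Cmod w <= 2).
{ assert (Ew : Cmod w * Cmod w = Cmod (quartic k z)).
  { rewrite <- Cmod_mult; unfold w; rewrite csqrt_sqr; easy. }
  assert (Cmod (quartic k z) <= 2 * Cmod z ^ 2 + k ^ 2 / 4).
  { replace (quartic k z) with ((quartic k z - RtoC (k ^ 2 / 4)) + RtoC (k ^ 2 / 4))%C by ring.
    eapply Rle_trans; [apply Cmod_triangle|]; rewrite Cmod_R, Rabs_pos_eq by nra; lra. }
  pose proof (Cmod_ge_0 w); nra. }
assert (K : forall sg, Rabs sg = 1 -> Cmod (RtoC cu * z + RtoC sg * (Ci * RtoC su * w))%C <= 3).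
{ intros sg Hsg; eapply Rle_trans; [apply Cmod_triangle|]; rewrite !Cmod_mult, !Cmod_R, Cmod_Ci, Hsg.
  pose proof (Cmod_ge_0 w); pose proof (Rabs_pos cu); nra. }
assert (K1 := K 1 Rabs_R1); assert (K2 := K (-1) ltac:(rewrite Rabs_left; lra)); clear K.
replace (RtoC cu * z + RtoC 1 * (Ci * RtoC su * w))%C with (RtoC cu * z + Ci * RtoC su * w)%C in K1 by ring.
replace (RtoC cu * z + RtoC (-1) * (Ci * RtoC su * w))%C with (RtoC cu * z - Ci * RtoC su * w)%C in K2.
2:{ replace (RtoC (-1)) with (- RtoC 1)%C by (unfold Copp, RtoC; simpl; f_equal; ring); ring. }
apply (f_equal Cmod) in E; rewrite Cmod_mult in E.
assert (D1 : Cmod (RtoC (1 - du) * (z * z))%C <= 1 - du).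
{ rewrite !Cmod_mult, Cmod_R, Rabs_pos_eq by lra; nra. }
assert (D2 : Cmod (RtoC (1 - du) * (z * z))%C <= 1 / 9).
{ rewrite !Cmod_mult, Cmod_R, Rabs_pos_eq by lra; nra. }
assert (DU : Cmod (RtoC (1 - du) * (z * z) + RtoC (1 + du))%C <= 2).
{ eapply Rle_trans; [apply Cmod_triangle|]; rewrite (Cmod_R (1 + du)), Rabs_pos_eq; lra. }
assert (DL : 1 / 2 <= Cmod (RtoC (1 - du) * (z * z) + RtoC (1 + du))%C).
{ pose proof (Cmod_triangle_rev (RtoC (1 + du)) (- (RtoC (1 - du) * (z * z)))%C) as T.
  rewrite Cmod_opp, Cmod_R, Rabs_pos_eq in T by lra.
  replace (RtoC (1 + du) - - (RtoC (1 - du) * (z * z)))%C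
    with (RtoC (1 - du) * (z * z) + RtoC (1 + du))%C in T by ring.
  lra. }
unfold shift; fold w.
set (N := (RtoC cu * z + Ci * RtoC su * w)%C) in *; set (N' := (RtoC cu * z - Ci * RtoC su * w)%C) in *.
set (D := (RtoC (1 - du) * (z * z) + RtoC (1 + du))%C) in *.
assert (ND : D <> 0%C) by (apply Cmod_gt_0; lra).
rewrite Cmod_div, Cmod_mult, Cmod_R, Rabs_pos_eq by (easy || lra).
assert (LN : q ^ 2 / 108 <= Cmod N).
{ assert (q ^ 2 / 36 <= Cmod N * Cmod N') by (rewrite E; nra).
  pose proof (Cmod_ge_0 N); nra. }
split.
- apply Rmult_le_reg_r with (Cmod D); [lra|].
  replace (2 * Cmod N / Cmod D * Cmod D) with (2 * Cmod N) by (field; lra).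
  nra.
- apply Rmult_le_reg_r with (Cmod D); [lra|].
  replace (2 * Cmod N / Cmod D * Cmod D) with (2 * Cmod N) by (field; lra).
  nra.
Qed.

Lemma cdiff_Csum (n : nat) (g : nat -> C -> C) (z : C) :
  (forall j, (j < n)%nat -> cdiff (g j) z) -> cdiff (fun w => Csum n (fun j => g j w)) z.
Proof.
induction n as [|n IH]; intros H; simpl; [apply cdiff_const|].
apply cdiff_plus; [apply IH; auto | apply H; lia].
Qed.

Lemma Csum_bound (n : nat) (g : nat -> C) (B : R) :
  (forall j, (j < n)%nat -> Cmod (g j) <= B) -> Cmod (Csum n g) <= INR n * B.
Proof.
induction n as [|n IH]; intros H.
- simpl; rewrite Cmod_0; lra.
- rewrite S_INR; change (Csum (S n) g) with (Csum n g + g n)%C.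
  eapply Rle_trans; [apply Cmod_triangle|].
  assert (Cmod (Csum n g) <= INR n * B) by (apply IH; auto).
  assert (Cmod (g n) <= B) by (apply H; lia); lra.
Qed.

Lemma Csum_RtoC (n : nat) (g : nat -> C) (h : nat -> R) :
  (forall j, (j < n)%nat -> g j = RtoC (h j)) -> Csum n g = RtoC (Rsum n h).
Proof.
induction n as [|n IH]; intros H; simpl; [easy|].
rewrite IH, H, RtoC_plus by auto; easy.
Qed.

Lemma positive_lower_bound (n : nat) (g : nat -> R) (b : R) : 0 < b ->
  (forall j, (j < n)%nat -> 0 < g j) ->
  exists q, 0 < q <= b /\ forall j, (j < n)%nat -> q <= g j.
Proof.
intros Hb; induction n as [|n IH]; intros H.
- exists b; split; [lra | intros; lia].
- destruct IH as [q [Hq Hj]]; [auto|].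
  exists (Rmin q (g n)); split.
  + split; [apply Rmin_pos; [lra | apply H; lia]|].
    eapply Rle_trans; [apply Rmin_l | lra].
  + intros j Hj'; destruct (Nat.eq_dec j n) as [-> | N]; [apply Rmin_r|].
    eapply Rle_trans; [apply Rmin_l | apply Hj; lia].
Qed.

(* A nonconstant f would have an essential singularity in z = exp (i psi) at z = 0 (or at
   infinity), whereas the other terms of the sum stay regular there, since
   sin (am (u j)) <> 0 moves z = 0 to a point of the punctured plane. *)
Theorem entire_shift_sum_const (k : R) (Hk : 0 < k < 1) (f : R -> R) (n : nat)
  (u : nat -> R) (c : R) :
  periodic (2 * PI) f ->
  (exists F, (forall z, cdiff F z) /\ forall x : R, F (RtoC x) = RtoC (f x)) ->
  (forall j, (j < n)%nat -> sin (am k Hk (u j)) <> 0) ->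
  (forall t, f (am k Hk t) + Rsum n (fun j => f (am k Hk (t + u j))) = c) ->
  forall x y, f x = f y.
Proof.
intros Hper [F [HF Hf]] Hu Hsum.
destruct (descend F f HF Hf Hper) as [G [HG1 HG2]].
set (cu := fun j => cos (am k Hk (u j))); set (su := fun j => sin (am k Hk (u j))).
set (du := fun j => delta_am k (am k Hk (u j))).
assert (Rel1 : forall j, su j ^ 2 + cu j ^ 2 = 1).
{ intros j; pose proof (sin2_cos2 (am k Hk (u j))) as T; unfold Rsqr in T; fold (su j) (cu j) in T; lra. }
assert (Rel2 : forall j, du j ^ 2 + (k * su j) ^ 2 = 1).
{ intros j; unfold du; rewrite (delta_am_sqr k Hk); fold (su j); lra. }
assert (Hdu : forall j, 0 < du j <= 1).
{ intros j; split; [apply (delta_am_pos k Hk) | apply delta_am_le_1]. }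
(* A common lower bound of the moduli of the quartics that occur; it sets the scale of the
   neighborhood of z = 0. *)
destruct (positive_lower_bound n (fun j => k * Rabs (su j)) k) as [q [Hq Hqj]]; [lra | |].
{ intros j Hj; apply Rmult_lt_0_compat; [lra|]; apply Rabs_pos_lt, Hu, Hj. }
set (E := fun z => cexp (Ci * z)%C).
set (H := fun z => (F z + Csum n (fun j => G (shift k (cu j) (su j) (du j) (E z))) - RtoC c)%C).
assert (HPI : 3 < PI) by (pose proof PI2_3_2; lra).
(* In the logarithmic coordinate the domain of [H] is a vertical strip, where exp (i zeta) is in the
   sector, joined to a high half-plane, where it is near 0. The vanishing of [H] on a real segment
   is carried up the strip and then sideways. *)
assert (Hreg : forall z, Cmod (E z) < q / 3 \/ Rabs (Re z) < 1 / 4 -> 0 < Re (quartic k (E z)) /\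
  forall j, (j < n)%nat -> quartic (k * su j) (E z) <> 0%C).
{ intros z Hz.
  assert (Key : forall k', q <= k' <= 1 -> 0 < Re (quartic k' (E z))).
  { intros k' Hk'; destruct Hz as [Hz | Hz].
    - apply (quartic_near_0 k' (E z)); lra.
    - destruct z as [x y]; unfold E; rewrite cexp_Ci; simpl in Hz; apply Rabs_lt_between in Hz.
      set (r := exp (- y)); assert (Hr : 0 < r) by apply exp_pos.
      assert (Hr2 : 0 < r ^ 2) by (apply pow_lt; easy); assert (Hr4 : 0 < r ^ 4) by (apply pow_lt; easy).
      assert (C2 : 0 < cos (2 * x)) by (apply cos_gt_0; lra).
      assert (C4 : 0 < cos (2 * (2 * x))) by (apply cos_gt_0; lra).
      apply quartic_sector; [lra | |].
      + replace (Re _) with (r ^ 2 * cos (2 * x)) by (rewrite cos_2a; simpl; ring).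
        now apply Rmult_lt_0_compat.
      + replace (Re _) with (r ^ 4 * cos (2 * (2 * x))).
        * left; now apply Rmult_lt_0_compat.
        * rewrite (cos_2a (2 * x)), cos_2a, sin_2a; simpl; ring. }
  split; [apply Key; lra|].
  intros j Hj; specialize (Hqj j Hj); simpl in Hqj.
  assert (Rabs (su j) <= 1) by (apply Rabs_le, SIN_bound).
  replace (quartic (k * su j) (E z)) with (quartic (k * Rabs (su j)) (E z)).
  - intros E0; specialize (Key (k * Rabs (su j)) ltac:(pose proof (Rabs_pos (su j)); nra)).
    rewrite E0 in Key; simpl in Key; lra.
  - unfold quartic; rewrite !Rpow_mult_distr, pow2_abs; easy. }
assert (HH : forall z, Cmod (E z) < q / 3 \/ Rabs (Re z) < 1 / 4 -> cdiff H z).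
{ intros z Hz; destruct (Hreg z Hz) as [R1 R2].
  unfold H; apply cdiff_minus; [|apply cdiff_const]; apply cdiff_plus; [apply HF|].
  apply (cdiff_Csum n (fun j z => G (shift k (cu j) (su j) (du j) (E z)))); intros j Hj.
  destruct (shift_regular k (cu j) (su j) (du j) (E z) (Rel1 j) (Rel2 j) R1 (R2 j Hj)) as [S1 S2].
  apply (cdiff_comp G (fun z => shift k (cu j) (su j) (du j) (E z))); [|now apply HG2].
  apply (cdiff_comp (shift k (cu j) (su j) (du j)) E); [apply cdiff_cexp_Ci | easy]. }
assert (HR : forall x : R, Rabs x < 1 / 4 -> H (RtoC x) = 0%C).
{ intros x Hx; apply Rabs_lt_between in Hx; unfold H.
  rewrite (Csum_RtoC n _ (fun j => f (am k Hk (ellF k x + u j)))).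
  - rewrite Hf; rewrite <- (Hsum (ellF k x)), am_ellF, RtoC_plus; ring.
  - intros j Hj; unfold E, cu, su, du.
    change (RtoC x) with ((x, 0) : C); rewrite shift_real by (apply cos_gt_0; lra).
    rewrite HG1; apply Hf. }
(* The radius and the height of the center of the ball that [diameter_zero] supplies for R0 = 1 /
   4. *)
set (y0 := 1 / 4 / 40).
assert (HZ0 : forall z, Cmod (z - (0, y0))%C < y0 -> H z = 0%C).
{ intros z Hz; apply (diameter_zero H (RtoC 0) (1 / 4)); [lra | | |].
  - intros w Hw; apply HH; right.
    replace (w - RtoC 0)%C with w in Hw by ring.
    eapply Rle_lt_trans; [apply re_le_Cmod | exact Hw].
  - intros x Hx; replace (RtoC 0 + RtoC x)%C with (RtoC x) by ring; now apply HR.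
  - replace (RtoC 0 + (0%R, (1 / 4 / 40)%R))%C with ((0, y0) : C); [exact Hz|].
    unfold y0, Cplus, RtoC; simpl; f_equal; ring. }
(* Upwards in the strip, by steps of half the radius 1 / 4. *)
assert (HZ1 : forall m z, Cmod (z - (0%R, (y0 + INR m / 8)%R))%C < 1 / 4 -> H z = 0%C).
{ apply (chain_zero H (fun m => (0, y0 + INR m / 8)) y0); [unfold y0; lra | lra | | |].
  - intros m z Hz; apply HH; right.
    eapply Rle_lt_trans; [|exact Hz].
    eapply Rle_trans; [|apply re_le_Cmod]; right; f_equal; destruct z as [z1 z2]; simpl; ring.
  - intros m; rewrite S_INR.
    replace ((0%R, (y0 + (INR m + 1) / 8)%R) - (0%R, (y0 + INR m / 8)%R))%C with ((0, 1 / 8) : C).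
    + eapply Rle_trans; [apply Cmod_pair|]; rewrite Rabs_R0, Rabs_pos_eq; lra.
    + unfold Cminus, Cplus, Copp; simpl; f_equal; field.
  - simpl INR; replace (y0 + 0 / 8) with y0 by field; exact HZ0. }
set (Y1 := 1 - ln (q / 3)).
assert (HE : forall x y, Y1 - 1 < y -> Cmod (E (x, y)) < q / 3).
{ intros x y Hy; unfold E; rewrite Cmod_cexp_Ci.
  rewrite <- (exp_ln (q / 3)) by lra; apply exp_increasing; unfold Y1 in Hy; lra. }
(* Sideways, to the right or to the left according to the sign sg, once the half-plane has been
   reached. *)
assert (HZ2 : forall sg m' m z, Rabs sg = 1 -> Y1 <= y0 + INR m / 8 ->
  Cmod (z - ((sg * INR m' / 8)%R, (y0 + INR m / 8)%R))%C < 1 / 4 -> H z = 0%C).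
{ intros sg m' m z Hsg Hm; revert m' z.
  apply (chain_zero H (fun m' => (sg * INR m' / 8, y0 + INR m / 8)) (1 / 4)); [lra | lra | | |].
  - intros m' [x y] Hz; apply HH; left; apply HE.
    pose proof (im_le_Cmod ((x, y) - ((sg * INR m' / 8)%R, (y0 + INR m / 8)%R))%C) as B.
    change (Rabs (y - (y0 + INR m / 8)) <= Cmod ((x, y) - ((sg * INR m' / 8)%R, (y0 + INR m / 8)%R))%C) in B.
    assert (B' := Rle_lt_trans _ _ _ B Hz); apply Rabs_lt_between in B'; lra.
  - intros m'; rewrite S_INR.
    replace (((sg * (INR m' + 1) / 8)%R, (y0 + INR m / 8)%R) - ((sg * INR m' / 8)%R, (y0 + INR m / 8)%R))%C
      with ((sg / 8, 0) : C).
    + eapply Rle_trans; [apply Cmod_pair|]; unfold Rdiv; rewrite Rabs_mult, Hsg, Rabs_R0, Rabs_pos_eq; lra.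
    + unfold Cminus, Cplus, Copp; simpl; f_equal; field.
  - simpl INR; replace (sg * 0 / 8) with 0 by field; apply HZ1. }
assert (HZ3 : forall x y, Rabs Y1 + 1 <= y -> H (x, y) = 0%C).
{ intros x y Hy; pose proof (Rle_abs Y1); pose proof (Rabs_pos Y1).
  assert (N8 : forall t, 0 <= t -> exists m, 0 <= t - INR m / 8 < 1 / 8).
  { intros t Ht; destruct (nfloor_ex (t * 8)) as [m Hm]; [lra|]; exists m; lra. }
  destruct (N8 (y - y0)) as [m Hm]; [unfold y0; lra|].
  destruct (N8 (Rabs x) (Rabs_pos x)) as [m' Hm'].
  assert (Hy0 : 0 < y0 < 1 / 8) by (unfold y0; lra).
  assert (Hs : exists sg, Rabs sg = 1 /\ x = sg * Rabs x).
  { destruct (Rle_dec 0 x); [exists 1; rewrite !Rabs_pos_eq; lra|].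
    exists (-1); rewrite !Rabs_left; lra. }
  destruct Hs as [sg [Hsg Hx]].
  apply (HZ2 sg m' m); [easy | lra |].
  replace ((x, y) - ((sg * INR m' / 8)%R, (y0 + INR m / 8)%R))%C
    with ((sg * (Rabs x - INR m' / 8), y - y0 - INR m / 8) : C).
  - eapply Rle_lt_trans; [apply Cmod_pair|].
    rewrite Rabs_mult, Hsg, (Rabs_pos_eq (Rabs x - INR m' / 8)), (Rabs_pos_eq (y - y0 - INR m / 8)); lra.
  - apply injective_projections; simpl; [|ring].
    transitivity (sg * Rabs x - sg * INR m' / 8); [field | rewrite <- Hx; ring]. }
(* The annulus of [shift_bounds] is the image of a part of the strip |Im| <= Y3, in which F is
   bounded. *)
set (Y3 := Rmax (Rabs (ln 12)) (Rabs (ln (q ^ 2 / 108)))).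
destruct (strip_bound F f HF Hf Hper Y3) as [B [HB0 HB]].
{ eapply Rle_trans; [apply Rabs_pos | apply Rmax_l]. }
assert (HU : forall x y, Rabs Y1 + 1 <= y -> Cmod (F (x, y)) <= INR n * B + Rabs c).
{ intros x y Hy; pose proof (Rle_abs Y1).
  replace (F (x, y)) with (H (x, y) - Csum n (fun j => G (shift k (cu j) (su j) (du j) (E (x, y)))) + RtoC c)%C
    by (unfold H; ring).
  rewrite HZ3 by easy.
  eapply Rle_trans; [apply Cmod_triangle|]; rewrite Cmod_R; apply Rplus_le_compat_r.
  replace (0 - Csum n (fun j => G (shift k (cu j) (su j) (du j) (E (x, y)))))%C
    with (- Csum n (fun j => G (shift k (cu j) (su j) (du j) (E (x, y)))))%C by ring.
  rewrite Cmod_opp; apply Csum_bound; intros j Hj.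
  destruct (shift_bounds k (su j) (cu j) (du j) q (E (x, y)) Hk (Rel1 j) (Rel2 j) (Hdu j)) as [L1 L2];
    [lra | now apply Hqj | apply HE; lra |].
  set (z := shift _ _ _ _ _) in *.
  assert (Hq2 : 0 < q ^ 2 / 108) by (apply Rdiv_lt_0_compat; [apply pow_lt|]; lra).
  assert (Nz : z <> 0%C) by (apply Cmod_gt_0; lra).
  destruct (cexp_Ci_surj z Nz) as [t Ht]; rewrite Ht, HG1; apply HB.
  rewrite Rabs_Ropp.
  assert (ln (q ^ 2 / 108) <= ln (Cmod z)) by (apply ln_le; lra).
  assert (ln (Cmod z) <= ln 12) by (apply ln_le; lra).
  pose proof (Rmax_l (Rabs (ln 12)) (Rabs (ln (q ^ 2 / 108)))).
  pose proof (Rmax_r (Rabs (ln 12)) (Rabs (ln (q ^ 2 / 108)))).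
  pose proof (Rle_abs (ln 12)); pose proof (Rle_abs (- ln (q ^ 2 / 108))) as A; rewrite Rabs_Ropp in A.
  fold Y3 in H3, H4; apply Rabs_le; lra. }
destruct (strip_bound F f HF Hf Hper (Rabs Y1 + 1)) as [B' [HB0' HB']].
{ pose proof (Rabs_pos Y1); lra. }
intros x y.
assert (HRe : Re (F (RtoC x)) = Re (F (RtoC y))).
{ apply (liouville F (INR n * B + Rabs c + B') HF); intros [a b].
  assert (0 <= INR n * B) by (apply Rmult_le_pos; [apply pos_INR | easy]).
  pose proof (Rabs_pos c).
  destruct (Rle_dec (Rabs b) (Rabs Y1 + 1)) as [L | L].
  - specialize (HB' a b L); lra.
  - destruct (Rle_dec 0 b) as [P | P].
    + rewrite Rabs_pos_eq in L by easy; specialize (HU a b ltac:(lra)); lra.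
    + rewrite Rabs_left in L by lra; rewrite <- (entire_conj F f HF Hf).
      specialize (HU a (- b) ltac:(lra)); lra. }
rewrite !Hf in HRe; exact HRe.
Qed.

(** * Chords of the ellipse tangent to a confocal ellipse *)

Section Chords.

Context (a b l : R) (Hl : 0 < l) (Hlb : l < b) (Hba : b < a).

(* The line <z, nu> = h whose unit normal nu is proportional to (cos beta / a, sin beta / b)
   is tangent to the confocal ellipse and meets the ellipse at the parameters
   beta - gam beta and beta + gam beta. *)
Definition rho (t : R) : R := cos t ^ 2 / a ^ 2 + sin t ^ 2 / b ^ 2.

(** The angle of the first quadrant whose sine is l sqrt (rho t). *)
Definition gam (t : R) : R := atan (sqrt (l ^ 2 * rho t / (1 - l ^ 2 * rho t))).

(** The eccentricity of the caustic, which has the foci of the ellipse. *)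
Definition modulus : R := sqrt ((a ^ 2 - b ^ 2) / (a ^ 2 - l ^ 2)).

(** The coordinate in which the billiard map along the caustic is a translation. The shift by PI / 2
    turns 1 - k^2 cos^2, which the geometry produces, into 1 - k^2 sin^2. *)
Definition Phi (t : R) : R := ellF modulus (t - PI / 2).

Lemma modulus_sqr : modulus ^ 2 = (a ^ 2 - b ^ 2) / (a ^ 2 - l ^ 2).
Proof. apply pow2_sqrt, Rdiv_le_0_compat; nra. Qed.

Lemma modulus_range : 0 < modulus < 1.
Proof.
assert (0 < a ^ 2 - b ^ 2) by nra; assert (0 < a ^ 2 - l ^ 2) by nra.
split; [apply sqrt_lt_R0, Rdiv_lt_0_compat; easy|].
rewrite <- sqrt_1; apply sqrt_lt_1_alt; split; [apply Rdiv_le_0_compat; lra|].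
apply Rmult_lt_reg_r with (a ^ 2 - l ^ 2); [easy|].
unfold Rdiv; rewrite Rmult_assoc, Rinv_l; nra.
Qed.

Lemma trig2 (t : R) : sin t ^ 2 = 1 - cos t ^ 2.
Proof. pose proof (sin2_cos2 t) as T; unfold Rsqr in T; lra. Qed.

Lemma rho_range (t : R) : / a ^ 2 <= rho t <= / b ^ 2.
Proof.
assert (Hi : / a ^ 2 <= / b ^ 2) by (apply Rinv_le_contravar; nra).
unfold rho, Rdiv; rewrite trig2.
pose proof (COS_bound t); assert (0 <= cos t ^ 2 <= 1) by nra; split; nra.
Qed.

Lemma rho_pos (t : R) : 0 < rho t.
Proof.
pose proof (rho_range t); assert (0 < / a ^ 2) by (apply Rinv_0_lt_compat; nra); lra.
Qed.

Lemma lrho_range (t : R) : 0 < l ^ 2 * rho t <= l ^ 2 / b ^ 2 /\ l ^ 2 / b ^ 2 < 1.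
Proof.
pose proof (rho_range t); pose proof (rho_pos t); assert (Hl2 : 0 < l ^ 2) by nra.
split; [split; [now apply Rmult_lt_0_compat | apply Rmult_le_compat_l; lra]|].
apply Rmult_lt_reg_r with (b ^ 2); [nra|].
unfold Rdiv; rewrite Rmult_assoc, Rinv_l; nra.
Qed.

Lemma gam_range (t : R) : 0 < gam t < PI / 2.
Proof.
destruct (lrho_range t); split; [|apply atan_bound].
rewrite <- atan_0; apply atan_increasing, sqrt_lt_R0, Rdiv_lt_0_compat; lra.
Qed.

Lemma gam_trig (t : R) : sin (gam t) ^ 2 = l ^ 2 * rho t /\ cos (gam t) ^ 2 = 1 - l ^ 2 * rho t /\
  0 < sin (gam t) /\ 0 < cos (gam t).
Proof.
destruct (lrho_range t) as [[G1 G2] G3]; pose proof (gam_range t).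
set (g := l ^ 2 * rho t) in *.
assert (S : sin (gam t) ^ 2 = g).
{ unfold gam; fold g; rewrite sin_atan; unfold Rsqr.
  assert (Q : 0 <= g / (1 - g)) by (apply Rdiv_le_0_compat; lra).
  rewrite sqrt_sqrt by easy; unfold Rdiv at 1; rewrite Rpow_mult_distr, pow_inv.
  rewrite !pow2_sqrt by lra; field; lra. }
split; [easy|]; split; [pose proof (trig2 (gam t)); lra|].
split; [apply sin_gt_0 | apply cos_gt_0]; lra.
Qed.

Lemma is_derive_gam (t : R) : is_derive gam t
  (l ^ 2 * (sin t * cos t * (/ b ^ 2 - / a ^ 2)) / (sin (gam t) * cos (gam t))).
Proof.
destruct (lrho_range t) as [[G1 G2] G3]; destruct (gam_trig t) as [S1 [S2 [S3 S4]]].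
set (g := fun t => l ^ 2 * rho t).
assert (Dg : is_derive g t (2 * (l ^ 2 * (sin t * cos t * (/ b ^ 2 - / a ^ 2))))).
{ unfold g, rho; auto_derive; [easy|]; field; lra. }
set (g' := 2 * _) in Dg.
assert (Q : 0 < g t / (1 - g t)) by (apply Rdiv_lt_0_compat; unfold g; lra).
assert (DQ : is_derive (fun t => g t / (1 - g t)) t (g' / (1 - g t) ^ 2)).
{ clearbody g'; auto_derive.
  - repeat split; try (eexists; exact Dg); unfold g; lra.
  - replace (Derive (fun x => g x) t) with g' by (symmetry; now apply is_derive_unique).
    field; unfold g; lra. }
evar_last.
- apply (is_derive_comp (V := R_NormedModule) atan (fun t => sqrt (g t / (1 - g t)))).
  + apply is_derive_atan.
  + exact (is_derive_sqrt _ _ _ DQ Q).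
- set (x := sqrt (g t / (1 - g t))).
  assert (Hx : 0 < x) by (apply sqrt_lt_R0, Q).
  assert (Ex : x ^ 2 = g t / (1 - g t)) by (apply pow2_sqrt; lra).
  assert (E : sin (gam t) * cos (gam t) = x * (1 - g t)).
  { apply Rsqr_inj; [nra | apply Rmult_le_pos; unfold g in *; lra |].
    unfold Rsqr; replace (sin (gam t) * cos (gam t) * (sin (gam t) * cos (gam t)))
      with (sin (gam t) ^ 2 * cos (gam t) ^ 2) by ring.
    replace (x * (1 - g t) * (x * (1 - g t))) with (x ^ 2 * (1 - g t) ^ 2) by ring.
    rewrite Ex, S1, S2; fold (g t); field; unfold g; lra. }
  rewrite E.
  replace (l ^ 2 * (sin t * cos t * (/ b ^ 2 - / a ^ 2))) with (g' / 2) by (unfold g'; field; lra).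
  unfold scal, minus, plus, opp, zero; simpl; unfold mult; simpl.
  replace (x * (x * 1)) with (g t / (1 - g t)) by (rewrite <- Ex; ring).
  unfold Rsqr; replace (x * x) with (g t / (1 - g t)) by (rewrite <- Ex; ring).
  field; unfold g in *; repeat split; lra.
Qed.

(** The left-hand side is the average of p (1 - l^2 p) and r (1 - l^2 r) with the weights cos^2 t
    and sin^2 t, where p = 1 / a^2 and r = 1 / b^2. Its positivity gives |gam'| < 1, and the
    explicit bound gives the sign in [approx_dot]. *)
Lemma tilt_bound (t : R) :
  rho t * (1 - l ^ 2 * rho t) - l ^ 2 * (sin t * cos t * (/ b ^ 2 - / a ^ 2)) ^ 2
    >= / a ^ 2 * (1 - l ^ 2 / b ^ 2).
Proof.
set (p := / a ^ 2); set (r := / b ^ 2).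
assert (Hp : 0 < p) by (apply Rinv_0_lt_compat; nra).
assert (Hpr : p <= r) by (apply Rinv_le_contravar; nra).
destruct (lrho_range t) as [_ G]; unfold Rdiv in G; fold r in G.
unfold rho, Rdiv; fold p r.
replace ((cos t ^ 2 * p + sin t ^ 2 * r) * (1 - l ^ 2 * (cos t ^ 2 * p + sin t ^ 2 * r))
   - l ^ 2 * (sin t * cos t * (r - p)) ^ 2)
  with (cos t ^ 2 * (p * (1 - l ^ 2 * p)) + sin t ^ 2 * (r * (1 - l ^ 2 * r))).
2:{ replace ((sin t * cos t * (r - p)) ^ 2) with (sin t ^ 2 * cos t ^ 2 * (r - p) ^ 2) by ring.
    rewrite trig2; ring. }
assert (Hc : 0 <= cos t ^ 2 <= 1) by (pose proof (COS_bound t); nra).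
assert (0 < l ^ 2) by nra.
assert (A1 : p * (1 - l ^ 2 * r) <= p * (1 - l ^ 2 * p)).
{ apply Rmult_le_compat_l; [lra|]; assert (l ^ 2 * p <= l ^ 2 * r) by (apply Rmult_le_compat_l; lra); lra. }
assert (A2 : p * (1 - l ^ 2 * r) <= r * (1 - l ^ 2 * r)) by (apply Rmult_le_compat_r; lra).
rewrite trig2; set (u := p * (1 - l ^ 2 * r)) in *; clearbody u; clear - Hc A1 A2; nra.
Qed.

Lemma gam_slope (t : R) :
  -1 < l ^ 2 * (sin t * cos t * (/ b ^ 2 - / a ^ 2)) / (sin (gam t) * cos (gam t)) < 1.
Proof.
destruct (gam_trig t) as [S1 [S2 [S3 S4]]]; destruct (lrho_range t) as [[G1 G2] G3].
set (y := sin t * cos t * (/ b ^ 2 - / a ^ 2)).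
set (S := sin (gam t)) in *; set (K := cos (gam t)) in *.
assert (HSK : 0 < S * K) by (now apply Rmult_lt_0_compat).
assert (B : (l ^ 2 * y) ^ 2 < (S * K) ^ 2).
{ replace ((S * K) ^ 2) with (S ^ 2 * K ^ 2) by ring; rewrite S1, S2.
  pose proof (tilt_bound t) as T; fold y in T.
  assert (0 < / a ^ 2 * (1 - l ^ 2 / b ^ 2)).
  { apply Rmult_lt_0_compat; [apply Rinv_0_lt_compat; nra | lra]. }
  assert (0 < l ^ 2) by nra.
  replace ((l ^ 2 * y) ^ 2) with (l ^ 2 * (l ^ 2 * y ^ 2)) by ring.
  rewrite Rmult_assoc; apply Rmult_lt_compat_l; lra. }
assert (-(S * K) < l ^ 2 * y < S * K) by (split; nra).
split; apply Rmult_lt_reg_r with (S * K); try easy;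
  unfold Rdiv; rewrite Rmult_assoc, Rinv_l by lra; lra.
Qed.

(** When the line turns, its endpoints t + gam t and t - gam t move with the speeds 1 + gam' and 1 -
    gam'; dn is proportional to these speeds, with the same factor at both ends, so in the
    coordinate [Phi] both ends move equally fast. *)
Lemma delta_am_gam (t : R) :
  let g' := l ^ 2 * (sin t * cos t * (/ b ^ 2 - / a ^ 2)) / (sin (gam t) * cos (gam t)) in
  let kap := a * b * cos (gam t) * sqrt (rho t) / sqrt (a ^ 2 - l ^ 2) in
  delta_am modulus (t + gam t - PI / 2) = kap * (1 + g') /\
  delta_am modulus (t - gam t - PI / 2) = kap * (1 - g').
Proof.
intros g' kap; pose proof (gam_slope t) as Sl; fold g' in Sl.
destruct (gam_trig t) as [S1 [S2 [S3 S4]]]; pose proof (rho_pos t) as Hr.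
assert (HA : 0 < a ^ 2 - l ^ 2) by nra.
assert (Hk : 0 < kap).
{ unfold kap; apply Rdiv_lt_0_compat; [|now apply sqrt_lt_R0].
  repeat apply Rmult_lt_0_compat; try lra; now apply sqrt_lt_R0. }
assert (Arg : forall y, 1 - (modulus * sin (y - PI / 2)) ^ 2 =
  (a ^ 2 * sin y ^ 2 + b ^ 2 * cos y ^ 2 - l ^ 2) / (a ^ 2 - l ^ 2)).
{ intros y; rewrite Rpow_mult_distr, modulus_sqr.
  replace (sin (y - PI / 2)) with (- cos y).
  2:{ rewrite sin_minus, sin_PI2, cos_PI2; ring. }
  rewrite (trig2 y); field; lra. }
(* The sign sg treats both endpoints at once; the comparison is made after squaring, all quantities
   being positive. *)
assert (Main : forall sg, sg ^ 2 = 1 ->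
  (kap * (1 + sg * g')) ^ 2 = 1 - (modulus * sin (t + sg * gam t - PI / 2)) ^ 2).
{ intros sg Hsg; rewrite Arg.
  assert (Sg : sin (sg * gam t) = sg * sin (gam t) /\ cos (sg * gam t) = cos (gam t)).
  { assert (F : sg = 1 \/ sg = -1) by (assert ((sg - 1) * (sg + 1) = 0) as F by lra;
      apply Rmult_integral in F; lra).
    destruct F as [-> | ->]; [rewrite !Rmult_1_l; easy|].
    replace (-1 * gam t) with (- gam t) by ring; rewrite sin_neg, cos_neg; split; ring. }
  destruct Sg as [Sg1 Sg2]; rewrite sin_plus, cos_plus, Sg1, Sg2.
  replace ((kap * (1 + sg * g')) ^ 2) with (kap ^ 2 * (1 + sg * g') ^ 2) by ring.
  replace (kap ^ 2) with (a ^ 2 * b ^ 2 * cos (gam t) ^ 2 * rho t / (a ^ 2 - l ^ 2)).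
  2:{ unfold kap; rewrite <- (pow2_sqrt (rho t)), <- (pow2_sqrt (a ^ 2 - l ^ 2)) at 1 by lra.
      field; apply Rgt_not_eq; now apply sqrt_lt_R0. }
  unfold g'; set (S := sin (gam t)) in *; set (K := cos (gam t)) in *.
  set (s := sin t) in *; set (c := cos t) in *.
  replace (a ^ 2 * b ^ 2 * K ^ 2 * rho t / (a ^ 2 - l ^ 2) *
    (1 + sg * (l ^ 2 * (s * c * (/ b ^ 2 - / a ^ 2)) / (S * K))) ^ 2)
   with (a ^ 2 * b ^ 2 * (rho t * K ^ 2 + 2 * sg * K * (l ^ 2 * rho t / S ^ 2) * S * (s * c * (/ b ^ 2 - / a ^ 2))
     + sg ^ 2 * (l ^ 2 * rho t / S ^ 2) * l ^ 2 * (s * c * (/ b ^ 2 - / a ^ 2)) ^ 2) / (a ^ 2 - l ^ 2))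
   by (field; repeat split; lra).
  replace (l ^ 2 * rho t / S ^ 2) with 1.
  2:{ rewrite <- S1; field; lra. }
  rewrite Hsg; apply Rdiv_eq_compat_r.
  transitivity (a ^ 2 * b ^ 2 * (rho t * K ^ 2 + 2 * sg * K * S * (s * c * (/ b ^ 2 - / a ^ 2))
    + l ^ 2 * (s * c * (/ b ^ 2 - / a ^ 2)) ^ 2)); [ring|].
  transitivity (K ^ 2 * (a ^ 2 * s ^ 2 + b ^ 2 * c ^ 2) + sg ^ 2 * S ^ 2 * (a ^ 2 * c ^ 2 + b ^ 2 * s ^ 2)
    + 2 * sg * s * c * K * S * (a ^ 2 - b ^ 2) - l ^ 2); [|ring].
  rewrite Hsg, S1; unfold rho; fold s c.
  assert (Es : s ^ 2 = 1 - c ^ 2) by apply trig2.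
  transitivity (K ^ 2 * (a ^ 2 * s ^ 2 + b ^ 2 * c ^ 2) + 2 * sg * s * c * K * S * (a ^ 2 - b ^ 2)
    + l ^ 2 * (s ^ 2 * c ^ 2 * (a ^ 2 - b ^ 2) ^ 2 / (a ^ 2 * b ^ 2))); [field; lra|].
  replace (s ^ 2 * c ^ 2 * (a ^ 2 - b ^ 2) ^ 2 / (a ^ 2 * b ^ 2))
    with ((c ^ 2 / a ^ 2 + s ^ 2 / b ^ 2) * (a ^ 2 * c ^ 2 + b ^ 2 * s ^ 2) - 1); [ring|].
  rewrite Es; field; lra. }
split.
- apply Rsqr_inj; [left; apply (delta_am_pos _ modulus_range) | apply Rmult_le_pos; lra |].
  pose proof (delta_am_sqr _ modulus_range (t + gam t - PI / 2)) as E.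
  pose proof (Main 1 ltac:(ring)) as E2; rewrite !Rmult_1_l in E2.
  unfold Rsqr; simpl in *; lra.
- apply Rsqr_inj; [left; apply (delta_am_pos _ modulus_range) | apply Rmult_le_pos; lra |].
  pose proof (delta_am_sqr _ modulus_range (t - gam t - PI / 2)) as E.
  pose proof (Main (-1) ltac:(ring)) as E2.
  replace (t + -1 * gam t - PI / 2) with (t - gam t - PI / 2) in E2 by ring.
  unfold Rsqr; simpl in *; lra.
Qed.

(** Poncelet's porism for confocal ellipses: both terms have the derivative 1 / kap. *)
Lemma chord_delta : exists delta, forall t, Phi (t + gam t) - Phi (t - gam t) = delta.
Proof.
exists (Phi (0 + gam 0) - Phi (0 - gam 0)); intros t.
apply (is_derive_0_const (fun t => Phi (t + gam t) - Phi (t - gam t))); clear t; intros t.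
destruct (delta_am_gam t) as [E1 E2]; pose proof (gam_slope t) as Sl.
pose proof (is_derive_gam t) as Dg.
set (g' := l ^ 2 * (sin t * cos t * (/ b ^ 2 - / a ^ 2)) / (sin (gam t) * cos (gam t))) in *.
pose proof (delta_am_pos _ modulus_range (t + gam t - PI / 2)) as P1; rewrite E1 in P1.
set (kap := a * b * cos (gam t) * sqrt (rho t) / sqrt (a ^ 2 - l ^ 2)) in *.
replace 0 with ((1 + g') * / (kap * (1 + g')) - (1 - g') * / (kap * (1 - g'))).
2:{ assert (kap <> 0) by (intros E; rewrite E in P1; lra); field; repeat split; lra. }
rewrite <- E1, <- E2; unfold Phi.
apply (is_derive_minus (V := R_NormedModule)).
- apply (is_derive_comp (V := R_NormedModule) (ellF modulus) (fun t => t + gam t - PI / 2)).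
  + apply (is_derive_ellF _ modulus_range).
  + auto_derive; [eexists; exact Dg|].
    replace (Derive (fun x => gam x) t) with g' by (symmetry; now apply is_derive_unique); ring.
- apply (is_derive_comp (V := R_NormedModule) (ellF modulus) (fun t => t - gam t - PI / 2)).
  + apply (is_derive_ellF _ modulus_range).
  + auto_derive; [eexists; exact Dg|].
    replace (Derive (fun x => gam x) t) with g' by (symmetry; now apply is_derive_unique); ring.
Qed.

Lemma chord_start (s : R) : exists t, t - gam t = s.
Proof.
pose proof (gam_range s); pose proof (gam_range (s + PI / 2)).
destruct (IVT_gen (fun t => t - gam t) s (s + PI / 2) s) as [t [_ Ht]].
- intros t; apply continuity_pt_ex_derive; pose proof (is_derive_gam t) as D.
  auto_derive; eexists; exact D.
- rewrite Rmin_left, Rmax_right by lra; lra.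
- exists t; exact Ht.
Qed.

End Chords.

(** * Products of plane vectors and small angles *)

Lemma Cmod_sqr (z : C) : Cmod z ^ 2 = fst z ^ 2 + snd z ^ 2.
Proof. apply pow2_sqrt; nra. Qed.

Lemma dot_cross_sqr (u v : C) : dot u v ^ 2 + cross u v ^ 2 = (Cmod u * Cmod v) ^ 2.
Proof. rewrite Rpow_mult_distr, !Cmod_sqr; unfold dot, cross; ring. Qed.

Lemma dot_bound (u v : C) : Rabs (dot u v) <= Cmod u * Cmod v.
Proof.
pose proof (dot_cross_sqr u v).
assert (0 <= Cmod u * Cmod v) by (apply Rmult_le_pos; apply Cmod_ge_0).
apply Rabs_le; split; nra.
Qed.

Lemma cross_bound (u v : C) : Rabs (cross u v) <= Cmod u * Cmod v.
Proof.
pose proof (dot_cross_sqr u v).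
assert (0 <= Cmod u * Cmod v) by (apply Rmult_le_pos; apply Cmod_ge_0).
apply Rabs_le; split; nra.
Qed.

Lemma sin_third_bound (x : R) : 0 <= x <= PI / 2 -> x / 3 <= sin x.
Proof.
intros Hx; pose proof PI_RGT_0; pose proof PI_4.
assert (M : forall y, 0 <= y <= PI / 3 -> y / 3 <= sin y).
{ intros y Hy; destruct (MVT_gen sin 0 y cos) as [c [Hc E]].
  - intros; apply is_derive_sin.
  - intros; apply continuity_sin.
  - rewrite Rmin_left, Rmax_right in Hc by lra; rewrite sin_0 in E.
    assert (cos (PI / 3) <= cos c).
    { destruct (Req_dec c (PI / 3)) as [-> | N]; [lra|].
      left; apply cos_decreasing_1; lra. }
    rewrite cos_PI3 in H1; nra. }
(* Beyond PI / 3 the sine is at least sqrt 3 / 2, while x / 3 <= PI / 6 <= 2 / 3. *)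
destruct (Rle_dec x (PI / 3)) as [L | L]; [apply M; lra|].
assert (sin (PI / 3) <= sin x) by (apply sin_incr_1; lra).
rewrite sin_PI3 in H1.
assert (1.7 < sqrt 3); [|lra].
rewrite <- (sqrt_pow2 1.7) by lra; apply sqrt_lt_1_alt; lra.
Qed.

Lemma small_angle (y e : R) : Rabs (sin y) <= e -> 0 < cos y ->
  exists n : Z, Rabs (y + 2 * PI * IZR n) <= 3 * e.
Proof.
intros Hs Hc; pose proof PI_RGT_0 as HP.
destruct (reduce_2PI (y + PI)) as [n Hn]; exists n.
set (y' := y + 2 * PI * IZR n).
assert (Es : sin y' = sin y /\ cos y' = cos y).
{ unfold y'; rewrite sin_plus, cos_plus.
  assert (T : forall m : Z, sin (2 * PI * IZR m) = 0 /\ cos (2 * PI * IZR m) = 1).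
  { intros m; replace (2 * PI * IZR m) with (2 * (IZR m * PI)) by ring.
    assert (S : sin (IZR m * PI) = 0) by (apply sin_eq_0_1; now exists m).
    rewrite cos_2a_sin, sin_2a, S; lra. }
  destruct (T n) as [-> ->]; split; ring. }
destruct Es as [Es Ec]; rewrite <- Es in Hs; rewrite <- Ec in Hc.
assert (Hy : - PI <= y' < PI) by (unfold y'; lra).
assert (Hy2 : - (PI / 2) < y' < PI / 2).
{ split.
  - destruct (Rlt_dec (- (PI / 2)) y') as [|N]; [easy|].
    assert (cos (- y') <= 0) by (apply cos_le_0; lra).
    rewrite cos_neg in H; lra.
  - destruct (Rlt_dec y' (PI / 2)) as [|N]; [easy|].
    assert (cos y' <= 0) by (apply cos_le_0; lra); lra. }
apply Rabs_le_between in Hs.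
destruct (Rle_dec 0 y') as [P | P].
- pose proof (sin_third_bound y' ltac:(lra)); rewrite Rabs_pos_eq; lra.
- pose proof (sin_third_bound (- y') ltac:(lra)) as S; rewrite sin_neg in S.
  rewrite Rabs_left; lra.
Qed.

(** * Lines nearly tangent to the confocal ellipse *)

Section Lines.

Context (a b l : R) (Hl : 0 < l) (Hlb : l < b) (Hba : b < a).

Let q0 := ellipse a b.
Let C0 := confocal_ellipse a b l.

Definition vel0 (s : R) : C := (- a * sin s, b * cos s).
(** [rad t] normalizes (cos t / a, sin t / b) to the unit normal [nrm t]; [dir t] is [nrm t] turned
    by a right angle, and [supp t] is the support function of the caustic in the direction [nrm t],
    by [confocal_support]. *)
Definition rad (t : R) : R := / sqrt (rho a b t).
Definition dir (t : R) : C := (- (rad t * sin t / b), rad t * cos t / a).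
Definition nrm (t : R) : C := (rad t * cos t / a, rad t * sin t / b).
Definition supp (t : R) : R := rad t * cos (gam a b l t).

Lemma rad_range (t : R) : b <= rad t <= a /\ rad t ^ 2 * rho a b t = 1.
Proof.
pose proof (rho_range a b l Hl Hlb Hba t) as [R1 R2]; pose proof (rho_pos a b l Hl Hlb Hba t) as R3.
assert (Hs : 0 < sqrt (rho a b t)) by (now apply sqrt_lt_R0).
assert (E : sqrt (rho a b t) ^ 2 = rho a b t) by (apply pow2_sqrt; lra).
assert (E2 : rad t ^ 2 * rho a b t = 1) by (unfold rad; rewrite <- E at 2; field; lra).
assert (Hr : 0 < rad t) by (now apply Rinv_0_lt_compat).
split; [|easy].
assert (B1 : b ^ 2 * rho a b t <= 1).
{ apply Rmult_le_compat_l with (r := b ^ 2) in R2; [|nra]; rewrite Rinv_r in R2; nra. }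
assert (B2 : 1 <= a ^ 2 * rho a b t).
{ apply Rmult_le_compat_l with (r := a ^ 2) in R1; [|nra]; rewrite Rinv_r in R1; nra. }
assert (b ^ 2 <= rad t ^ 2) by (apply Rmult_le_reg_r with (rho a b t); lra).
assert (rad t ^ 2 <= a ^ 2) by (apply Rmult_le_reg_r with (rho a b t); lra).
split; nra.
Qed.

(** This is where Joachimsthal's invariant comes from: the product depends on the caustic only, not
    on the tangent line. *)
Lemma rad_sin_gam (t : R) : rad t * sin (gam a b l t) = l.
Proof.
destruct (gam_trig a b l Hl Hlb Hba t) as [S1 [S2 [S3 S4]]]; destruct (rad_range t) as [R1 R2].
apply Rsqr_inj; [nra | lra|]; unfold Rsqr.
replace (rad t * sin (gam a b l t) * (rad t * sin (gam a b l t)))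
  with (rad t ^ 2 * sin (gam a b l t) ^ 2) by ring.
rewrite S1; transitivity (l ^ 2 * (rad t ^ 2 * rho a b t)); [ring | rewrite R2; ring].
Qed.

Lemma supp_sqr (t : R) : supp t ^ 2 = rad t ^ 2 - l ^ 2.
Proof.
destruct (gam_trig a b l Hl Hlb Hba t) as [S1 [S2 [S3 S4]]]; destruct (rad_range t) as [R1 R2].
unfold supp; rewrite Rpow_mult_distr, S2.
transitivity (rad t ^ 2 - l ^ 2 * (rad t ^ 2 * rho a b t)); [ring | rewrite R2; ring].
Qed.

Lemma supp_range (t : R) : sqrt (b ^ 2 - l ^ 2) <= supp t <= a /\ 0 < sqrt (b ^ 2 - l ^ 2).
Proof.
destruct (gam_trig a b l Hl Hlb Hba t) as [S1 [S2 [S3 S4]]]; destruct (rad_range t) as [R1 R2].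
assert (0 < supp t) by (apply Rmult_lt_0_compat; lra).
pose proof (supp_sqr t) as E.
split; [split|].
- rewrite <- (sqrt_pow2 (supp t)) by lra; apply sqrt_le_1_alt; rewrite E; nra.
- nra.
- apply sqrt_lt_R0; nra.
Qed.

Lemma dir_nrm_unit (t : R) : Cmod (dir t) = 1 /\ Cmod (nrm t) = 1.
Proof.
destruct (rad_range t) as [R1 R2].
assert (E : (rad t * cos t / a) ^ 2 + (rad t * sin t / b) ^ 2 = 1).
{ rewrite <- R2; unfold rho; field; lra. }
unfold Cmod; simpl fst; simpl snd; split; rewrite <- sqrt_1; f_equal; lra.
Qed.

Lemma dot_nrm (z : C) (t : R) : dot z (nrm t) = - cross (dir t) z.
Proof. unfold dot, cross, nrm, dir; simpl; ring. Qed.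

Lemma dot_q0_nrm (s t : R) : dot (q0 s) (nrm t) = rad t * cos (s - t).
Proof. unfold dot, q0, ellipse, nrm; simpl; rewrite cos_minus; field; lra. Qed.

Lemma cross_vel0_dir (s t : R) : cross (vel0 s) (dir t) = - (rad t * sin (s - t)).
Proof. unfold cross, vel0, dir; simpl; rewrite sin_minus; field; lra. Qed.

Lemma dot_vel0_dir (s t : R) : dot (vel0 s) (dir t) =
  a * b * (rho a b t * (rad t * cos (s - t)) +
    rad t * sin (s - t) * (sin t * cos t * (/ b ^ 2 - / a ^ 2))).
Proof.
unfold dot, vel0, dir, rho; simpl.
replace s with (t + (s - t)) at 1 2 by ring; rewrite sin_plus, cos_plus; field; lra.
Qed.

Lemma dir_surj (v : C) : v <> 0%C -> exists t, v = (RtoC (Cmod v) * dir t)%C.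
Proof.
intros N; assert (HM := proj1 (Cmod_gt_0 _) N).
set (z := (a * snd v, - (b * fst v)) : C).
assert (Nz : z <> 0%C).
{ intros E; injection E as E1 E2; apply N.
  destruct v as [x y]; simpl in *; unfold RtoC; f_equal; nra. }
destruct (polar z Nz) as [t Ht]; assert (Hz := proj1 (Cmod_gt_0 _) Nz).
exists t; injection Ht as E1 E2.
set (m := Cmod z) in *; set (r := Cmod v) in *.
assert (Er : r ^ 2 = fst v ^ 2 + snd v ^ 2) by apply Cmod_sqr.
assert (Erho : r ^ 2 = m ^ 2 * rho a b t).
{ rewrite Er; replace (snd v) with (m * cos t / a) by (rewrite <- E1; field; lra).
  replace (fst v) with (- (m * sin t / b)) by (rewrite <- E2; field; lra).
  unfold rho; field; lra. }
destruct (rad_range t) as [R1 R2].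
assert (Em : m = r * rad t).
{ apply Rsqr_inj; [lra | nra |]; unfold Rsqr.
  transitivity (m ^ 2 * (rad t ^ 2 * rho a b t)); [rewrite R2; ring|].
  transitivity (m ^ 2 * rho a b t * rad t ^ 2); [ring | rewrite <- Erho; ring]. }
rewrite Em in E1, E2.
unfold Cmult, dir, RtoC; simpl; destruct v as [x y]; simpl in *; f_equal.
- apply Rmult_eq_reg_l with b; [|lra].
  transitivity (- (r * rad t * sin t)); [lra | field; lra].
- apply Rmult_eq_reg_l with a; [|lra].
  transitivity (r * rad t * cos t); [lra | field; lra].
Qed.

Lemma dir_plus_PI (t : R) : dir (t + PI) = (- dir t)%C /\ nrm (t + PI) = (- nrm t)%C /\
  supp (t + PI) = supp t /\ rad (t + PI) = rad t.
Proof.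
assert (Er : rho a b (t + PI) = rho a b t).
{ unfold rho; rewrite neg_sin, neg_cos; f_equal; f_equal; ring. }
assert (Eg : gam a b l (t + PI) = gam a b l t) by (unfold gam; rewrite Er; easy).
unfold supp, dir, nrm, rad; rewrite Er, Eg, neg_sin, neg_cos.
repeat split; unfold Copp; simpl; f_equal; field; split; try lra.
all: apply Rgt_not_eq, sqrt_lt_R0, (rho_pos a b l Hl Hlb Hba).
Qed.

(** The support function of an ellipse with half-axes A and B is |(A n1, B n2)| at the unit normal
    (n1, n2); its square is here rad^2 - l^2. *)
Lemma confocal_support (t : R) :
  (forall s, Rabs (dot (C0 s) (nrm t)) <= supp t) /\ exists s, dot (C0 s) (nrm t) = supp t.
Proof.
destruct (rad_range t) as [R1 R2]; destruct (supp_range t) as [[H1 H2] H3].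
unfold C0, confocal_ellipse; set (A := sqrt (a ^ 2 - l ^ 2)); set (B := sqrt (b ^ 2 - l ^ 2)) in *.
assert (EA : A ^ 2 = a ^ 2 - l ^ 2) by (apply pow2_sqrt; nra).
assert (EB : B ^ 2 = b ^ 2 - l ^ 2) by (apply pow2_sqrt; nra).
set (z := (A * (rad t * cos t / a), B * (rad t * sin t / b)) : C).
assert (Ez : Cmod z = supp t).
{ apply Rsqr_inj; [apply Cmod_ge_0 | lra|]; rewrite !Rsqr_pow2, Cmod_sqr, supp_sqr; simpl fst; simpl snd.
  rewrite !(Rpow_mult_distr _ (_ / _)), EA, EB.
  transitivity (rad t ^ 2 * (cos t ^ 2 + sin t ^ 2) - l ^ 2 * (rad t ^ 2 * rho a b t)).
  - unfold rho; field; lra.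
  - rewrite R2, trig2; ring. }
assert (Ed : forall s, dot (ellipse A B s) (nrm t) = dot (cos s, sin s) z).
{ intros s; unfold dot, ellipse, nrm, z; simpl; ring. }
split.
- intros s; rewrite Ed; eapply Rle_trans; [apply dot_bound|].
  rewrite Ez; pose proof (Cmod_polar 1 s ltac:(lra)) as E; rewrite !Rmult_1_l in E; rewrite E; lra.
- destruct (polar z) as [s Hs].
  + apply Cmod_gt_0; lra.
  + exists s; rewrite Ed; rewrite Hs, Ez; unfold dot; simpl.
    transitivity (supp t * (cos s ^ 2 + sin s ^ 2)); [ring | rewrite trig2; ring].
Qed.

(** The sine of the angular error, times rad, is at most 4 a eta / l + 2 eta; 1 / b comes from rad
    >= b, and 3 from the passage from the sine to the angle in [small_angle]. *)
Definition approx_const : R := 3 * (4 * a / l + 2) / b.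

(* x is the angle from t to the parameter of an approximate intersection. *)
Lemma approx_sin (t x eta : R) : 0 <= eta -> 16 * a * eta <= 3 * l ^ 2 ->
  Rabs (rad t * cos x - supp t) <= 2 * eta ->
  l / 2 <= Rabs (rad t * sin x) /\ Rabs (Rabs (rad t * sin x) - l) <= 4 * a * eta / l.
Proof.
intros He Hs H; destruct (rad_range t) as [R1 R2]; destruct (supp_range t) as [[H1 H2] H3].
pose proof (supp_sqr t) as E.
assert (Hc : Rabs (rad t * cos x) <= a).
{ rewrite Rabs_mult, (Rabs_pos_eq (rad t)) by lra.
  assert (Rabs (cos x) <= 1) by (apply Rabs_le, COS_bound); pose proof (Rabs_pos (cos x)); nra. }
set (C := rad t * cos x) in *; set (S := rad t * sin x).
assert (ES : S ^ 2 = l ^ 2 + (supp t ^ 2 - C ^ 2)).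
{ unfold S, C; rewrite E, !Rpow_mult_distr, trig2; ring. }
assert (B : Rabs (S ^ 2 - l ^ 2) <= 4 * a * eta).
{ rewrite ES; replace (l ^ 2 + (supp t ^ 2 - C ^ 2) - l ^ 2) with (- ((C - supp t) * (C + supp t))) by ring.
  rewrite Rabs_Ropp, Rabs_mult.
  assert (Rabs (C + supp t) <= 2 * a).
  { eapply Rle_trans; [apply Rabs_triang|]; rewrite (Rabs_pos_eq (supp t)); lra. }
  replace (4 * a * eta) with (2 * eta * (2 * a)) by ring.
  apply Rmult_le_compat; try apply Rabs_pos; easy. }
rewrite <- (pow2_abs S) in B; pose proof (Rabs_pos S) as PS; set (T := Rabs S) in *.
apply Rabs_le_between in B.
split; [nra|].
apply Rmult_le_reg_r with l; [easy|].
replace (4 * a * eta / l * l) with (4 * a * eta) by (field; lra).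
destruct (Rle_dec l T) as [L | L].
- rewrite Rabs_pos_eq by lra; nra.
- rewrite Rabs_left by lra; nra.
Qed.

(** rad cos x and rad sin x agree with supp and sg l up to errors linear in eta, hence x agrees with
    sg gam modulo 2 PI. The sign of the sine selects one of the two intersections of the line with
    the ellipse. *)
Lemma approx_angle (sg t x eta : R) : sg ^ 2 = 1 -> 0 <= eta -> 16 * a * eta <= 3 * l ^ 2 ->
  4 * eta <= sqrt (b ^ 2 - l ^ 2) ->
  Rabs (rad t * cos x - supp t) <= 2 * eta -> 0 < sg * sin x ->
  exists n : Z, Rabs (x - sg * gam a b l t + 2 * PI * IZR n) <= approx_const * eta.
Proof.
intros Hsg He Hs1 Hs2 H Hsx.
destruct (approx_sin t x eta He Hs1 H) as [S1 S2].
destruct (rad_range t) as [R1 R2]; destruct (supp_range t) as [[H1 H2] H3].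
destruct (gam_trig a b l Hl Hlb Hba t) as [G1 [G2 [G3 G4]]].
set (y := x - sg * gam a b l t).
assert (F : sg = 1 \/ sg = -1).
{ assert ((sg - 1) * (sg + 1) = 0) as F by lra; apply Rmult_integral in F; lra. }
assert (Ey : sin y = sin x * cos (gam a b l t) - sg * (cos x * sin (gam a b l t)) /\
  cos y = cos x * cos (gam a b l t) + sg * (sin x * sin (gam a b l t))).
{ unfold y; destruct F as [-> | ->].
  - rewrite Rmult_1_l, sin_minus, cos_minus; split; ring.
  - replace (x - -1 * gam a b l t) with (x + gam a b l t) by ring.
    rewrite sin_plus, cos_plus; split; ring. }
destruct Ey as [Ey1 Ey2].
assert (RS : Rabs (rad t * sin x) = sg * (rad t * sin x)).
{ rewrite Rabs_mult, (Rabs_pos_eq (rad t)) by lra.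
  destruct F as [-> | ->]; [rewrite Rabs_pos_eq | rewrite Rabs_left]; lra. }
rewrite RS in S2.
assert (Cg : cos (gam a b l t) <= 1) by apply COS_bound.
assert (Sg : sin (gam a b l t) <= 1) by apply SIN_bound.
pose proof (rad_sin_gam t) as RG; unfold supp in *.
set (sn := sin (gam a b l t)) in *; set (cn := cos (gam a b l t)) in *.
set (X := rad t * cos x - rad t * cn) in *.
set (W := sg * (rad t * sin x) - l) in *.
assert (EW : rad t * sin x = sg * (W + l)).
{ unfold W; replace (sg * (sg * (rad t * sin x) - l + l)) with (sg ^ 2 * (rad t * sin x)) by ring.
  rewrite Hsg; ring. }
assert (Bsin : Rabs (rad t * sin y) <= 4 * a * eta / l + 2 * eta).
{ replace (rad t * sin y) with (sg * (W * cn - X * sn)).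
  2:{ rewrite Ey1; transitivity (rad t * sin x * cn - sg * (rad t * cos x) * sn); [|ring].
      rewrite EW; unfold X; rewrite <- RG; ring. }
  rewrite Rabs_mult; replace (Rabs sg) with 1.
  2:{ destruct F as [-> | ->]; [rewrite Rabs_pos_eq | rewrite Rabs_left]; lra. }
  rewrite Rmult_1_l; unfold Rminus at 1; eapply Rle_trans; [apply Rabs_triang|].
  rewrite Rabs_Ropp, !Rabs_mult, (Rabs_pos_eq sn), (Rabs_pos_eq cn) by lra.
  pose proof (Rabs_pos W); pose proof (Rabs_pos X); nra. }
assert (Hcy : 0 < cos y).
{ rewrite Ey2; assert (0 < cos x).
  { apply Rmult_lt_reg_l with (rad t); [lra|]; apply Rabs_le_between in H; unfold X in H; lra. }
  assert (0 < cos x * cn) by (now apply Rmult_lt_0_compat).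
  assert (0 < sg * sin x * sn) by (now apply Rmult_lt_0_compat); lra. }
destruct (small_angle y ((4 * a / l + 2) * eta / b)) as [n Hn]; [|easy|].
- apply Rmult_le_reg_l with b; [lra|].
  rewrite Rabs_mult, (Rabs_pos_eq (rad t)) in Bsin by lra.
  replace (b * ((4 * a / l + 2) * eta / b)) with (4 * a * eta / l + 2 * eta) by (field; lra).
  pose proof (Rabs_pos (sin y)); nra.
- exists n; eapply Rle_trans; [exact Hn|]; right; unfold approx_const; field; lra.
Qed.

(** The bound that [tilt_bound] yields for the exact case eta = 0 of [approx_dot]. *)
Definition kdot : R := b ^ 3 * (/ a ^ 2 * (1 - l ^ 2 / b ^ 2)) / 2.

(* The two lines through a point of the ellipse which are tangent to the caustic are
   distinguished by the sign of their component along the ellipse. *)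
Lemma approx_dot (s t eta : R) : 0 <= eta -> 16 * a * eta <= 3 * l ^ 2 ->
  Rabs (rad t * cos (s - t) - supp t) <= 2 * eta ->
  kdot - a / b * (2 + 4 * a / l) * eta <= dot (vel0 s) (dir t).
Proof.
intros He Hs1 H.
destruct (approx_sin t (s - t) eta He Hs1 H) as [S1 S2].
destruct (rad_range t) as [R1 R2]; destruct (supp_range t) as [[H1 H2] H3].
rewrite dot_vel0_dir; pose proof (tilt_bound a b l Hl Hlb Hba t) as TB.
pose proof (rho_range a b l Hl Hlb Hba t) as [R3 R4]; pose proof (rho_pos a b l Hl Hlb Hba t) as R5.
set (r := rho a b t) in *.
set (y := sin t * cos t * (/ b ^ 2 - / a ^ 2)) in *.
set (X := rad t * cos (s - t)) in *; set (Y := rad t * sin (s - t)) in *.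
assert (HY : Rabs y <= / b ^ 2).
{ unfold y; rewrite !Rabs_mult.
  assert (Rabs (sin t) <= 1) by (apply Rabs_le, SIN_bound).
  assert (Rabs (cos t) <= 1) by (apply Rabs_le, COS_bound).
  pose proof (Rabs_pos (sin t)); pose proof (Rabs_pos (cos t)).
  assert (0 < / a ^ 2) by (apply Rinv_0_lt_compat; nra).
  assert (/ a ^ 2 <= / b ^ 2) by (apply Rinv_le_contravar; nra).
  rewrite (Rabs_pos_eq (/ b ^ 2 - / a ^ 2)) by lra.
  assert (Rabs (sin t) * Rabs (cos t) <= 1) by nra.
  assert (0 <= Rabs (sin t) * Rabs (cos t)) by nra; nra. }
assert (E : (r * supp t) ^ 2 - (l * Rabs y) ^ 2 >= / a ^ 2 * (1 - l ^ 2 / b ^ 2)).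
{ rewrite !Rpow_mult_distr, pow2_abs, supp_sqr.
  replace (r ^ 2 * (rad t ^ 2 - l ^ 2)) with (r * (rad t ^ 2 * r) - l ^ 2 * r ^ 2) by ring.
  rewrite R2; lra. }
assert (Hib : 0 < / b ^ 2) by (apply Rinv_0_lt_compat; nra).
set (k1 := / a ^ 2 * (1 - l ^ 2 / b ^ 2)) in *.
assert (Hk1 : 0 < k1).
{ apply Rmult_lt_0_compat; [apply Rinv_0_lt_compat; nra|].
  pose proof (lrho_range a b l Hl Hlb Hba t); lra. }
pose proof (Rabs_pos y) as Py.
assert (Hrh : r * supp t <= / b ^ 2 * a) by (apply Rmult_le_compat; lra).
assert (Hly : 0 <= l * Rabs y) by nra.
assert (Hrh0 : 0 < r * supp t) by (apply Rmult_lt_0_compat; lra).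
(* The difference of squares is factored; the sum of the two terms is at most 2 a / b^2. *)
assert (D : k1 * b ^ 2 / (2 * a) <= r * supp t - l * Rabs y).
{ assert (Hlt : l * Rabs y < r * supp t) by nra.
  assert (k1 <= (r * supp t - l * Rabs y) * (2 * (/ b ^ 2 * a))).
  { apply Rle_trans with ((r * supp t - l * Rabs y) * (r * supp t + l * Rabs y)).
    - clear - E; nra.
    - apply Rmult_le_compat_l; lra. }
  apply Rmult_le_reg_r with (2 * (/ b ^ 2 * a)); [nra|].
  replace (k1 * b ^ 2 / (2 * a) * (2 * (/ b ^ 2 * a))) with k1 by (field; lra); easy. }
assert (M : r * X + Y * y >= r * supp t - l * Rabs y - / b ^ 2 * (2 * eta) - 4 * a * eta / l * / b ^ 2).
{ assert (A1 : r * X >= r * supp t - / b ^ 2 * (2 * eta)).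
  { apply Rabs_le_between in H.
    assert (r * (X - supp t) >= - (/ b ^ 2 * (2 * eta))) by nra; lra. }
  assert (A2 : Rabs (Y * y) <= l * Rabs y + 4 * a * eta / l * / b ^ 2).
  { rewrite Rabs_mult; apply Rabs_le_between in S2.
    assert (0 <= 4 * a * eta / l) by (apply Rdiv_le_0_compat; nra).
    assert (Rabs Y * Rabs y <= (l + 4 * a * eta / l) * Rabs y) by (apply Rmult_le_compat_r; lra).
    assert (4 * a * eta / l * Rabs y <= 4 * a * eta / l * / b ^ 2) by (apply Rmult_le_compat_l; lra).
    lra. }
  apply Rabs_le_between in A2; lra. }
assert (Hab : 0 < a * b) by nra.
apply Rle_trans with (a * b * (k1 * b ^ 2 / (2 * a) - / b ^ 2 * (2 * eta) - 4 * a * eta / l * / b ^ 2)).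
- right; unfold kdot; fold k1; field; lra.
- apply Rmult_le_compat_l; lra.
Qed.

End Lines.

(** * Billiards near the ellipse *)

Lemma dot_scal_r (r : R) (u v : C) : dot u (RtoC r * v)%C = r * dot u v.
Proof. unfold dot, Cmult, RtoC; simpl; ring. Qed.

Lemma cross_scal_r (r : R) (u v : C) : cross u (RtoC r * v)%C = r * cross u v.
Proof. unfold cross, Cmult, RtoC; simpl; ring. Qed.

Lemma dot_minus_l (u v w : C) : dot (u - v)%C w = dot u w - dot v w.
Proof. unfold dot, Cminus, Cplus, Copp; simpl; ring. Qed.

Lemma cross_minus_l (u v w : C) : cross (u - v)%C w = cross u w - cross v w.
Proof. unfold cross, Cminus, Cplus, Copp; simpl; ring. Qed.

Lemma cross_minus_r (u v w : C) : cross u (v - w)%C = cross u v - cross u w.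
Proof. unfold cross, Cminus, Cplus, Copp; simpl; ring. Qed.

Lemma dot_opp_r (u v : C) : dot u (- v)%C = - dot u v.
Proof. unfold dot, Copp; simpl; ring. Qed.

Lemma Cmod_scal_pos (r : R) (z : C) : 0 <= r -> Cmod (RtoC r * z)%C = r * Cmod z.
Proof. intros H; rewrite Cmod_mult, Cmod_R, Rabs_pos_eq; easy. Qed.

Lemma period_Z {X : Type} (f : R -> X) : (forall t, f (t + 2 * PI) = f t) ->
  forall (n : Z) (x : R), f (x + 2 * PI * IZR n) = f x.
Proof.
intros Hf.
assert (P : forall (k : nat) x, f (x + 2 * PI * INR k) = f x).
{ induction k as [|k IH]; intros u.
  - simpl; f_equal; ring.
  - rewrite <- (IH u), <- (Hf (u + 2 * PI * INR k)); f_equal; rewrite S_INR; ring. }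
intros n x; destruct (Z_le_dec 0 n) as [L | L].
- rewrite <- (Z2Nat.id n), <- INR_IZR_INZ by easy; apply P.
- rewrite <- (P (Z.to_nat (- n)) (x + 2 * PI * IZR n)), INR_IZR_INZ, Z2Nat.id, opp_IZR by lia.
  f_equal; ring.
Qed.

Lemma Derive_period (f : R -> R) (T x : R) : (forall y, f (y + T) = f y) ->
  ex_derive f (x + T) -> Derive f (x + T) = Derive f x.
Proof.
intros Hf D; symmetry; apply is_derive_unique.
apply (is_derive_ext (fun y => f (y + T))); [exact Hf|].
evar_last.
- apply (is_derive_comp (V := R_NormedModule) f (fun y => y + T)).
  + apply Derive_correct, D.
  + apply (is_derive_plus (V := R_NormedModule)); [apply is_derive_id | apply is_derive_const].
- unfold scal, plus, one, zero; simpl; unfold mult; simpl; ring.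
Qed.

(** A lower bound of the distance of the caustic from a tangent line of the ellipse, times the speed
    on the ellipse; see [caustic_inside]. *)
Definition inner_gap (a b l : R) : R :=
  a * b - Rmax (a * sqrt (b ^ 2 - l ^ 2)) (b * sqrt (a ^ 2 - l ^ 2)).

(** eta bounds the displacement of table and caustic, om that of the velocity of the table. They are
    separate because eta will be proportional to eps, as the conclusions must be, whereas om is only
    a fixed small number. *)
Record small (a b l eta om : R) : Prop := {
  small_eta : 0 <= eta;
  small_om : 0 <= om;
  small_supp : 4 * eta <= sqrt (b ^ 2 - l ^ 2);
  small_sin : 16 * a * eta <= 3 * l ^ 2;
  small_vel : 4 * om <= l;
  small_dot : a / b * (2 + 4 * a / l) * eta + om < kdot a b l;
  small_gap : om * (4 * a) + 2 * a * eta < inner_gap a b l;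
  small_angle_gap : approx_const a b l * eta < l / a;
}.

Lemma linear_small (p q c : R) : 0 < c -> exists e, 0 < e /\
  forall x y, 0 <= x <= e -> 0 <= y <= e -> p * x + q * y < c.
Proof.
intros Hc; set (m := Rabs p + Rabs q + 1).
assert (Hm : 0 < m) by (pose proof (Rabs_pos p); pose proof (Rabs_pos q); unfold m; lra).
exists (c / m / 2); split; [repeat apply Rdiv_lt_0_compat; lra|]; intros x y Hx Hy.
assert (E : m * (c / m / 2) = c / 2) by (field; lra).
pose proof (Rle_abs p); pose proof (Rle_abs q); pose proof (Rabs_pos p); pose proof (Rabs_pos q).
set (e := c / m / 2) in *.
assert (p * x <= Rabs p * e) by nra.
assert (q * y <= Rabs q * e) by nra.
unfold m in E; nra.
Qed.

Section Near.

Context (a b l : R) (Hl : 0 < l) (Hlb : l < b) (Hba : b < a).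

Lemma inner_gap_pos : 0 < inner_gap a b l.
Proof.
unfold inner_gap; apply Rlt_0_minus, Rmax_lub_lt.
- apply Rmult_lt_compat_l; [lra|]; rewrite <- (sqrt_pow2 b) at 2 by lra; apply sqrt_lt_1_alt; nra.
- rewrite (Rmult_comm a); apply Rmult_lt_compat_l; [lra|].
  rewrite <- (sqrt_pow2 a) at 2 by lra; apply sqrt_lt_1_alt; nra.
Qed.

Lemma small_exists : exists e, 0 < e /\
  forall eta om, 0 <= eta <= e -> 0 <= om <= e -> small a b l eta om.
Proof.
assert (P1 : 0 < sqrt (b ^ 2 - l ^ 2)) by (apply sqrt_lt_R0; nra).
assert (P2 : 0 < 3 * l ^ 2) by nra.
assert (P3 : 0 < kdot a b l).
{ unfold kdot; apply Rdiv_lt_0_compat; [|lra].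
  apply Rmult_lt_0_compat; [apply pow_lt; lra|]; apply Rmult_lt_0_compat.
  - apply Rinv_0_lt_compat; nra.
  - pose proof (lrho_range a b l Hl Hlb Hba 0); lra. }
pose proof inner_gap_pos as P4.
assert (P5 : 0 < l / a) by (apply Rdiv_lt_0_compat; lra).
destruct (linear_small 4 0 _ P1) as [e1 [E1 F1]].
destruct (linear_small (16 * a) 0 _ P2) as [e2 [E2 F2]].
destruct (linear_small 0 4 _ Hl) as [e3 [E3 F3]].
destruct (linear_small (a / b * (2 + 4 * a / l)) 1 _ P3) as [e4 [E4 F4]].
destruct (linear_small (2 * a) (4 * a) _ P4) as [e5 [E5 F5]].
destruct (linear_small (approx_const a b l) 0 _ P5) as [e6 [E6 F6]].
set (e := Rmin e1 (Rmin e2 (Rmin e3 (Rmin e4 (Rmin e5 e6))))).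
assert (M : 0 < e /\ e <= e1 /\ e <= e2 /\ e <= e3 /\ e <= e4 /\ e <= e5 /\ e <= e6).
{ unfold e; clear - E1 E2 E3 E4 E5 E6; unfold Rmin; repeat destruct (Rle_dec _ _); lra. }
clearbody e; exists e; split; [easy|]; intros eta om He Ho; constructor; try lra.
- specialize (F1 eta om ltac:(lra) ltac:(lra)); lra.
- specialize (F2 eta om ltac:(lra) ltac:(lra)); lra.
- specialize (F3 eta om ltac:(lra) ltac:(lra)); lra.
- specialize (F4 eta om ltac:(lra) ltac:(lra)); lra.
- specialize (F5 eta om ltac:(lra) ltac:(lra)); lra.
- specialize (F6 eta om ltac:(lra) ltac:(lra)); lra.
Qed.

Let q0 := ellipse a b.
Let C0 := confocal_ellipse a b l.

Context (q g : curve) (eta om : R) (Sm : small a b l eta om)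
  (q_per : forall t, q (t + 2 * PI) = q t)
  (q_diff : forall t, ex_derive (fun s => fst (q s)) t /\ ex_derive (fun s => snd (q s)) t)
  (q_near : forall t, Cmod (q t - q0 t)%C <= eta)
  (v_near : forall t, Cmod (velocity q t - vel0 a b t)%C <= om)
  (q_conv : forall s t, s < t < s + 2 * PI -> 0 < cross (velocity q s) (q t - q s)%C)
  (g_ccc : closed_convex_curve g)
  (g_near : forall t, Cmod (g t - C0 t)%C <= eta).

Lemma dot_near (u v w : C) (e : R) : Cmod w = 1 -> Cmod (u - v)%C <= e ->
  Rabs (dot u w - dot v w) <= e.
Proof.
intros Hw H; rewrite <- dot_minus_l; eapply Rle_trans; [apply dot_bound|]; rewrite Hw; lra.
Qed.

Lemma cross_near (u v w : C) (e : R) : Cmod w = 1 -> Cmod (u - v)%C <= e ->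
  Rabs (cross u w - cross v w) <= e.
Proof.
intros Hw H; rewrite <- cross_minus_l; eapply Rle_trans; [apply cross_bound|]; rewrite Hw; lra.
Qed.

Lemma dir_unit t : Cmod (dir a b t) = 1.
Proof. apply (dir_nrm_unit a b l Hl Hlb Hba). Qed.

Lemma nrm_unit t : Cmod (nrm a b t) = 1.
Proof. apply (dir_nrm_unit a b l Hl Hlb Hba). Qed.

Lemma dot_dir_nrm t : dot (dir a b t) (nrm a b t) = 0.
Proof. unfold dot, dir, nrm; simpl; ring. Qed.

Lemma chord_neq s t : s < t < s + 2 * PI -> q s <> q t.
Proof.
intros H E; specialize (q_conv s t H); rewrite E in q_conv.
replace (q t - q t)%C with (RtoC 0) in q_conv by ring.
unfold cross, RtoC in q_conv; simpl in q_conv; lra.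
Qed.

(* The curve g lies on the left of the chord, resp. on its right. *)
Definition ccw (t : R) (s s' : R) : Prop :=
  (exists r, 0 < r /\ (q s' - q s)%C = (RtoC r * dir a b t)%C) /\
  Rabs (dot (q s) (nrm a b t) - supp a b l t) <= eta.

Definition cw (t : R) (s s' : R) : Prop :=
  (exists r, 0 < r /\ (q s' - q s)%C = (RtoC r * dir a b t)%C) /\
  Rabs (dot (q s) (nrm a b t) + supp a b l t) <= eta.

(** By convexity the tangent line is a support line of g, and the support functions of two curves at
    distance eta differ by at most eta. *)
Lemma g_support_line (th t kap : R) : 0 < kap -> velocity g th = (RtoC kap * dir a b t)%C ->
  Rabs (dot (g th) (nrm a b t) - supp a b l t) <= eta.
Proof.
intros Hk Hv.
destruct (confocal_support a b l Hl Hlb Hba t) as [U [s Hs]].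
assert (L : forall x, dot (g x) (nrm a b t) <= dot (g th) (nrm a b t)).
{ intros x; pose proof (ccc_convex g g_ccc th x) as H; rewrite Hv in H.
  assert (E : cross (RtoC kap * dir a b t)%C (g x - g th)%C = kap * (dot (g th) (nrm a b t) - dot (g x) (nrm a b t))).
  { rewrite !dot_nrm; unfold dir, cross, Cmult, RtoC, Cminus, Cplus, Copp; simpl; ring. }
  rewrite E in H; nra. }
pose proof (dot_near (g s) (C0 s) (nrm a b t) eta (nrm_unit t) (g_near s)) as N1.
pose proof (dot_near (g th) (C0 th) (nrm a b t) eta (nrm_unit t) (g_near th)) as N2.
specialize (U th); specialize (L s); fold C0 in U, Hs.
apply Rabs_le_between in N1, N2, U; apply Rabs_le; lra.
Qed.

(** The velocity of g at the point of contact is parallel to the chord. If it is opposite to the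
    chord, the support line is the one of parameter t + PI. *)
Lemma tangent_ccw_or_cw (s s' : R) : q s <> q s' -> segment_tangent g (q s) (q s') ->
  exists t, ccw t s s' \/ cw t s s'.
Proof.
intros N [th [x [Hx [Eg Hc]]]].
assert (Nv : (q s' - q s)%C <> 0%C).
{ intros E; apply N; replace (q s') with (q s' - q s + q s)%C by ring; rewrite E; ring. }
destruct (dir_surj a b l Hl Hlb Hba _ Nv) as [t Ht]; exists t.
set (r := Cmod (q s' - q s)%C) in *; assert (Hr : 0 < r) by (now apply Cmod_gt_0).
assert (Nw := ccc_regular g g_ccc th).
destruct (dir_surj a b l Hl Hlb Hba _ Nw) as [t' Ht'].
set (k := Cmod (velocity g th)) in *; assert (Hk : 0 < k) by (now apply Cmod_gt_0).
assert (Hc0 : cross (dir a b t') (dir a b t) = 0).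
{ rewrite Ht', Ht in Hc.
  replace (cross (RtoC k * dir a b t')%C (RtoC r * dir a b t)%C) with (k * r * cross (dir a b t') (dir a b t)) in Hc.
  - apply Rmult_integral in Hc; destruct Hc as [Hc | Hc]; [|easy].
    apply Rmult_integral in Hc; lra.
  - unfold cross, Cmult, RtoC; simpl; ring. }
assert (Hd : dot (dir a b t') (dir a b t) = 1 \/ dot (dir a b t') (dir a b t) = -1).
{ pose proof (dot_cross_sqr (dir a b t') (dir a b t)) as E; rewrite Hc0, !dir_unit in E.
  assert ((dot (dir a b t') (dir a b t) - 1) * (dot (dir a b t') (dir a b t) + 1) = 0) as F by lra.
  apply Rmult_integral in F; lra. }
assert (Ed : dir a b t' = (RtoC (dot (dir a b t') (dir a b t)) * dir a b t)%C).
{ pose proof (Cmod_sqr (dir a b t)) as E2; rewrite dir_unit in E2.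
  revert Hc0 E2; destruct (dir a b t') as [p1 p2], (dir a b t) as [u1 u2]; unfold cross, dot, Cmult, RtoC; simpl.
  intros Hc0 E2; f_equal.
  - transitivity (p1 * (u1 * (u1 * 1) + u2 * (u2 * 1)) - u2 * (p1 * u2 - p2 * u1)); [rewrite <- E2, Hc0; ring | ring].
  - transitivity (p2 * (u1 * (u1 * 1) + u2 * (u2 * 1)) + u1 * (p1 * u2 - p2 * u1)); [rewrite <- E2, Hc0; ring | ring]. }
assert (Hline : dot (q s) (nrm a b t) = dot (g th) (nrm a b t)).
{ rewrite Eg, Ht; transitivity (dot (q s) (nrm a b t) + x * r * dot (dir a b t) (nrm a b t)).
  - rewrite dot_dir_nrm; ring.
  - unfold dot, Cplus, Cmult, RtoC; simpl; ring. }
destruct Hd as [Hd | Hd]; rewrite Hd in Ed; [left | right]; (split; [exists r; easy|]); rewrite Hline.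
- apply (g_support_line th t k Hk); rewrite Ht', Ed; ring.
- destruct (dir_plus_PI a b l Hl Hlb Hba t) as [D1 [D2 [D3 D4]]].
  assert (H := g_support_line th (t + PI) k Hk).
  rewrite D1, D2, D3, dot_opp_r in H.
  rewrite <- Rabs_Ropp.
  replace (- (dot (g th) (nrm a b t) + supp a b l t)) with (- dot (g th) (nrm a b t) - supp a b l t) by ring.
  apply H; rewrite Ht', Ed; f_equal; unfold Copp, Cmult, RtoC; destruct (dir a b t); simpl; f_equal; ring.
Qed.

Lemma chord_end_nrm (r t s s' : R) : (q s' - q s)%C = (RtoC r * dir a b t)%C ->
  dot (q s') (nrm a b t) = dot (q s) (nrm a b t).
Proof.
intros H; replace (q s') with (q s + RtoC r * dir a b t)%C by (rewrite <- H; ring).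
transitivity (dot (q s) (nrm a b t) + r * dot (dir a b t) (nrm a b t)).
- unfold dot, Cplus, Cmult, RtoC; simpl; ring.
- rewrite dot_dir_nrm; ring.
Qed.

Lemma near_cos (s t : R) : Rabs (dot (q s) (nrm a b t) - supp a b l t) <= eta ->
  Rabs (rad a b t * cos (s - t) - supp a b l t) <= 2 * eta.
Proof.
intros H; rewrite <- (dot_q0_nrm a b l Hl Hlb Hba); fold q0.
pose proof (dot_near (q s) (q0 s) (nrm a b t) eta (nrm_unit t) (q_near s)) as N.
apply Rabs_le_between in N, H; apply Rabs_le; lra.
Qed.

Lemma near_dot_pos (s t : R) : Rabs (dot (q s) (nrm a b t) - supp a b l t) <= eta ->
  0 < dot (velocity q s) (dir a b t).
Proof.
intros H; destruct Sm.
pose proof (approx_dot a b l Hl Hlb Hba s t eta small_eta0 small_sin0 (near_cos s t H)) as D.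
pose proof (dot_near (velocity q s) (vel0 a b s) (dir a b t) om (dir_unit t) (v_near s)) as N.
apply Rabs_le_between in N; lra.
Qed.

(** Reflection keeps the component of the direction along the table. By [near_dot_pos] this
    component is positive for [ccw] chords and, with the line reversed, negative for [cw] ones, so
    the orientation about g cannot change. *)
Lemma reflect_ccw (t t' s s' s'' : R) : ccw t s s' ->
  reflected (velocity q s') (q s' - q s)%C (q s'' - q s')%C ->
  ccw t' s' s'' \/ cw t' s' s'' -> ccw t' s' s''.
Proof.
intros [[r [Hr E]] H] [R1 _] [|[[r' [Hr' E']] H']]; [easy|exfalso].
assert (P1 : 0 < dot (velocity q s') (dir a b t)).
{ apply near_dot_pos; rewrite (chord_end_nrm r t s s' E); easy. }
destruct (dir_plus_PI a b l Hl Hlb Hba t') as [D1 [D2 [D3 D4]]].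
assert (P2 : 0 < dot (velocity q s') (dir a b (t' + PI))).
{ apply near_dot_pos; rewrite D2, D3, dot_opp_r, <- Rabs_Ropp.
  replace (- (- dot (q s') (nrm a b t') - supp a b l t')) with (dot (q s') (nrm a b t') + supp a b l t') by ring; easy. }
rewrite D1, dot_opp_r in P2.
rewrite E, E', !dot_scal_r, !Cmod_scal_pos, !dir_unit in R1 by lra.
assert (EE : dot (velocity q s') (dir a b t) = dot (velocity q s') (dir a b t')).
{ transitivity (r * dot (velocity q s') (dir a b t) / (r * 1)); [field; lra|].
  rewrite R1; field; lra. }
lra.
Qed.

(** For the exact ellipse the cross product is - rad sin (s - t), of modulus at least l / 2; a
    velocity error om <= l / 4 cannot change its sign. *)
Lemma near_cross (s t : R) : Rabs (dot (q s) (nrm a b t) - supp a b l t) <= eta ->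
  (0 < cross (velocity q s) (dir a b t) <-> sin (s - t) < 0) /\
  (cross (velocity q s) (dir a b t) < 0 <-> 0 < sin (s - t)).
Proof.
intros H; destruct Sm.
destruct (approx_sin a b l Hl Hlb Hba t (s - t) eta small_eta0 small_sin0 (near_cos s t H)) as [L _].
pose proof (cross_near (velocity q s) (vel0 a b s) (dir a b t) om (dir_unit t) (v_near s)) as N.
rewrite (cross_vel0_dir a b l Hl Hlb Hba) in N.
destruct (rad_range a b l Hl Hlb Hba t) as [R1 R2].
apply Rabs_le_between in N.
destruct (Rtotal_order (sin (s - t)) 0) as [P | [P | P]].
- rewrite Rabs_left in L by nra; lra.
- rewrite P, Rmult_0_r, Rabs_R0 in L; lra.
- rewrite Rabs_pos_eq in L by nra; lra.
Qed.

Lemma Phi_lipschitz x y :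
  Rabs (Phi a b l x - Phi a b l y) <= / sqrt (1 - modulus a b l ^ 2) * Rabs (x - y).
Proof.
unfold Phi; eapply Rle_trans; [apply (ellF_lipschitz _ (modulus_range a b l Hl Hlb Hba))|].
right; f_equal; f_equal; ring.
Qed.

(** Two endpoints, the Lipschitz constant of [Phi], and the angular error of each endpoint. *)
Definition step_const : R := 2 * / sqrt (1 - modulus a b l ^ 2) * approx_const a b l.

Lemma gam_period (t : R) (n : Z) : gam a b l (t + 2 * PI * IZR n) = gam a b l t.
Proof.
unfold gam; replace (rho a b (t + 2 * PI * IZR n)) with (rho a b t); [easy|].
assert (T : sin (2 * PI * IZR n) = 0 /\ cos (2 * PI * IZR n) = 1).
{ replace (2 * PI * IZR n) with (2 * (IZR n * PI)) by ring.
  assert (S : sin (IZR n * PI) = 0) by (apply sin_eq_0_1; now exists n).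
  rewrite cos_2a_sin, sin_2a, S; lra. }
unfold rho; rewrite sin_plus, cos_plus; destruct T as [-> ->]; f_equal; f_equal; ring.
Qed.

(** Together with [small_angle_gap] this makes gam larger than the angular error, which excludes a
    spurious multiple of 2 PI between the endpoints of a chord. *)
Lemma gam_ge (t : R) : l / a <= gam a b l t.
Proof.
destruct (gam_trig a b l Hl Hlb Hba t) as [G1 [G2 [G3 G4]]].
pose proof (gam_range a b l Hl Hlb Hba t) as G5.
pose proof (rad_sin_gam a b l Hl Hlb Hba t) as E.
destruct (rad_range a b l Hl Hlb Hba t) as [R1 R2].
apply Rle_trans with (sin (gam a b l t)); [|left; apply sin_lt_x; lra].
apply Rmult_le_reg_r with a; [lra|]; unfold Rdiv; rewrite Rmult_assoc, Rinv_l by lra; nra.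
Qed.

(** Both endpoints are close to those of the exact chord of parameter t, along which [Phi] advances
    by delta. Convexity of the table determines the sign of the sine at either end, and the same
    multiple of 2 PI has to be removed at both. *)
Lemma ccw_step (delta t s s' : R) :
  (forall t, Phi a b l (t + gam a b l t) - Phi a b l (t - gam a b l t) = delta) ->
  s < s' < s + 2 * PI -> ccw t s s' ->
  Rabs (Phi a b l s' - Phi a b l s - delta) <= step_const * eta.
Proof.
intros Hdelta Hs [[r [Hr E]] H]; pose proof Sm as [].
assert (H' : Rabs (dot (q s') (nrm a b t) - supp a b l t) <= eta).
{ rewrite (chord_end_nrm r t s s' E); easy. }
assert (S1 : sin (s - t) < 0).
{ apply (near_cross s t H); pose proof (q_conv s s' Hs) as Q; rewrite E, cross_scal_r in Q; nra. }
assert (S2 : 0 < sin (s' - t)).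
{ apply (near_cross s' t H').
  pose proof (q_conv s' (s + 2 * PI) ltac:(lra)) as Q; rewrite q_per in Q.
  replace (q s - q s')%C with (RtoC (- r) * dir a b t)%C in Q.
  2:{ rewrite RtoC_opp; replace (- RtoC r * dir a b t)%C with (- (RtoC r * dir a b t))%C by ring; rewrite <- E; ring. }
  rewrite cross_scal_r in Q; nra. }
destruct (approx_angle a b l Hl Hlb Hba (-1) t (s - t) eta) as [n Hn]; try easy; try lra.
{ apply (near_cos s t H). }
destruct (approx_angle a b l Hl Hlb Hba 1 t (s' - t) eta) as [n' Hn']; try easy; try lra.
{ apply (near_cos s' t H'). }
pose proof (gam_range a b l Hl Hlb Hba t) as G; pose proof (gam_ge t) as G'.
assert (HP := PI_RGT_0).
assert (En : n = n').
{ apply Rabs_le_between in Hn, Hn'.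
  assert (F1 : IZR n - IZR n' < 1) by nra.
  assert (F2 : -1 < IZR n - IZR n') by nra.
  rewrite <- minus_IZR in F1, F2.
  apply lt_IZR in F1; apply (lt_IZR (-1)) in F2; lia. }
subst n'.
set (t' := t + 2 * PI * IZR (- n)).
assert (Gt : gam a b l t' = gam a b l t) by apply gam_period.
rewrite <- (Hdelta t'), Gt.
replace (Phi a b l s' - Phi a b l s - (Phi a b l (t' + gam a b l t) - Phi a b l (t' - gam a b l t)))
  with ((Phi a b l s' - Phi a b l (t' + gam a b l t)) - (Phi a b l s - Phi a b l (t' - gam a b l t))) by ring.
unfold Rminus at 1; eapply Rle_trans; [apply Rabs_triang|]; rewrite Rabs_Ropp.
pose proof (Phi_lipschitz s' (t' + gam a b l t)) as L1; pose proof (Phi_lipschitz s (t' - gam a b l t)) as L2.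
replace (s' - (t' + gam a b l t)) with (s' - t - 1 * gam a b l t + 2 * PI * IZR n) in L1
  by (unfold t'; rewrite opp_IZR; ring).
replace (s - (t' - gam a b l t)) with (s - t - -1 * gam a b l t + 2 * PI * IZR n) in L2
  by (unfold t'; rewrite opp_IZR; ring).
assert (HL : 0 < / sqrt (1 - modulus a b l ^ 2)).
{ apply Rinv_0_lt_compat, sqrt_lt_R0.
  pose proof (delta_am_arg _ (modulus_range a b l Hl Hlb Hba) 0); lra. }
unfold step_const; set (L := / sqrt _) in *.
assert (L * Rabs (s' - t - 1 * gam a b l t + 2 * PI * IZR n) <= L * (approx_const a b l * eta)) by (apply Rmult_le_compat_l; lra).
assert (L * Rabs (s - t - -1 * gam a b l t + 2 * PI * IZR n) <= L * (approx_const a b l * eta)) by (apply Rmult_le_compat_l; lra).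
lra.
Qed.

Lemma reach (v : C) (t : R) : dot v (nrm a b t) = 0 -> v = (RtoC (dot v (dir a b t)) * dir a b t)%C.
Proof.
intros H; pose proof (Cmod_sqr (nrm a b t)) as E; rewrite nrm_unit in E.
revert H E; unfold nrm, dir.
set (n1 := rad a b t * cos t / a); set (n2 := rad a b t * sin t / b).
destruct v as [v1 v2]; unfold dot, Cmult, RtoC; simpl; intros H E.
assert (Ev1 : v1 = (- v1 * n2 + v2 * n1) * - n2).
{ transitivity (v1 * (n1 * (n1 * 1) + n2 * (n2 * 1)) - n1 * (v1 * n1 + v2 * n2)); [rewrite <- E, H; ring | ring]. }
assert (Ev2 : v2 = (- v1 * n2 + v2 * n1) * n1).
{ transitivity (v2 * (n1 * (n1 * 1) + n2 * (n2 * 1)) - n2 * (v1 * n1 + v2 * n2)); [rewrite <- E, H; ring | ring]. }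
f_equal; [rewrite Ev1 at 1 | rewrite Ev2 at 1]; ring.
Qed.

(** The point of g farthest in the direction [nrm t]. Its velocity is a multiple kap of [dir t]; a
    negative kap would make the same point the least far as well, by convexity, although g is close
    to an ellipse of definite width. *)
Lemma g_support_point (t : R) : exists th kap,
  0 < kap /\ velocity g th = (RtoC kap * dir a b t)%C.
Proof.
set (f := fun x => dot (g x) (nrm a b t)).
assert (Df : forall x, is_derive f x (dot (velocity g x) (nrm a b t))).
{ intros x; destruct (ccc_smooth g g_ccc 1 x) as [D1 D2]; simpl in D1, D2.
  unfold f, dot, velocity; simpl fst; simpl snd.
  apply (is_derive_plus (V := R_NormedModule)).
  - apply (is_derive_ext (fun x => fst (nrm a b t) * fst (g x))); [intros; apply Rmult_comm|].
    rewrite Rmult_comm; apply is_derive_scal, Derive_correct, D1.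
  - apply (is_derive_ext (fun x => snd (nrm a b t) * snd (g x))); [intros; apply Rmult_comm|].
    rewrite Rmult_comm; apply is_derive_scal, Derive_correct, D2. }
destruct (continuity_ab_maj f 0 (2 * PI)) as [th [Hth1 Hth2]].
{ pose proof PI_RGT_0; lra. }
{ intros; apply continuity_pt_ex_derive; eexists; apply Df. }
assert (Hmax : forall x, f x <= f th).
{ intros x; destruct (reduce_2PI x) as [n Hn].
  replace (f x) with (f (x + 2 * PI * IZR n)); [apply Hth1; lra|].
  unfold f; rewrite (period_Z g (ccc_periodic g g_ccc)); easy. }
assert (D0 : dot (velocity g th) (nrm a b t) = 0).
{ assert (L := proj1 (is_derive_Reals f th _) (Df th)).
  rewrite <- (deriv_maximum f (th - 1) (th + 1) th (exist _ _ L)); try lra.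
  - reflexivity.
  - intros; apply Hmax. }
pose proof (reach _ _ D0) as Ev; set (kap := dot (velocity g th) (dir a b t)) in *.
exists th, kap; split; [|easy].
destruct (Rtotal_order kap 0) as [N | [N | N]]; [exfalso | exfalso | easy].
- assert (Hmin : forall x, f th <= f x).
  { intros x; pose proof (ccc_convex g g_ccc th x) as H; rewrite Ev in H.
    assert (E : cross (RtoC kap * dir a b t)%C (g x - g th)%C = kap * (f th - f x)).
    { unfold f; rewrite !dot_nrm; unfold dir, cross, Cmult, RtoC, Cminus, Cplus, Copp; simpl; ring. }
    rewrite E in H; nra. }
  destruct (confocal_support a b l Hl Hlb Hba t) as [_ [s Hs]].
  destruct (confocal_support a b l Hl Hlb Hba (t + PI)) as [_ [s' Hs']].
  destruct (dir_plus_PI a b l Hl Hlb Hba t) as [D1 [D2 [D3 D4]]].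
  rewrite D2, D3, dot_opp_r in Hs'; fold C0 in Hs, Hs'.
  pose proof (dot_near (g s) (C0 s) (nrm a b t) eta (nrm_unit t) (g_near s)) as N1.
  pose proof (dot_near (g s') (C0 s') (nrm a b t) eta (nrm_unit t) (g_near s')) as N2.
  pose proof (Hmin s'); pose proof (Hmax s); unfold f in *.
  destruct (supp_range a b l Hl Hlb Hba t) as [[S1 S2] S3].
  destruct Sm; apply Rabs_le_between in N1, N2; lra.
- rewrite N in Ev; apply (ccc_regular g g_ccc th); rewrite Ev; ring.
Qed.

(** With the half-axes A and B of the caustic, the unperturbed value is a b - (a B sin s sin th + b
    A cos s cos th), at least [inner_gap]; [small_gap] says that the perturbation cannot use this
    up. *)
Lemma caustic_inside (s th : R) : 0 < cross (velocity q s) (g th - q s)%C.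
Proof.
destruct Sm.
set (A := sqrt (a ^ 2 - l ^ 2)); set (B := sqrt (b ^ 2 - l ^ 2)).
assert (HA : 0 <= A) by apply sqrt_pos; assert (HB : 0 <= B) by apply sqrt_pos.
assert (E0 : inner_gap a b l <= cross (vel0 a b s) (C0 th - q0 s)%C).
{ replace (cross (vel0 a b s) (C0 th - q0 s)%C)
    with (a * b - (a * B * (sin s * sin th) + b * A * (cos s * cos th))).
  2:{ unfold C0, confocal_ellipse; fold A B.
      unfold cross, vel0, q0, ellipse, Cminus, Cplus, Copp; simpl.
      transitivity (a * b * (sin s ^ 2 + cos s ^ 2) - (a * B * (sin s * sin th) + b * A * (cos s * cos th)));
        [rewrite trig2; ring | ring]. }
  unfold inner_gap; fold A B; apply Rplus_le_compat_l, Ropp_le_contravar.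
  set (M := Rmax (a * B) (b * A)).
  assert (M1 : a * B <= M) by apply Rmax_l; assert (M2 : b * A <= M) by apply Rmax_r.
  pose proof (COS_bound s); pose proof (COS_bound th); pose proof (SIN_bound s); pose proof (SIN_bound th).
  assert (P1 : 0 <= a * B) by nra; assert (P2 : 0 <= b * A) by nra.
  pose proof (trig2 s) as T1; pose proof (trig2 th) as T2.
  apply Rle_trans with (a * B * ((sin s ^ 2 + sin th ^ 2) / 2) + b * A * ((cos s ^ 2 + cos th ^ 2) / 2)).
  - apply Rplus_le_compat; apply Rmult_le_compat_l; try easy.
    + pose proof (pow2_ge_0 (sin s - sin th)); lra.
    + pose proof (pow2_ge_0 (cos s - cos th)); lra.
  - rewrite T1, T2; set (w := (cos s ^ 2 + cos th ^ 2) / 2).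
    replace ((1 - cos s ^ 2 + (1 - cos th ^ 2)) / 2) with (1 - w) by (unfold w; field).
    assert (0 <= w <= 1) by (unfold w; nra); nra. }
assert (HAa : A <= a).
{ unfold A; rewrite <- (sqrt_pow2 a) at 2 by lra; apply sqrt_le_1_alt; nra. }
assert (HBa : B <= a).
{ unfold B; rewrite <- (sqrt_pow2 a) by lra; apply sqrt_le_1_alt; nra. }
assert (Bd : forall p r x, 0 <= p <= a -> 0 <= r <= a -> Cmod (p * cos x, r * sin x) <= a).
{ intros p r x Hp Hr; apply Rsqr_incr_0_var; [|lra]; rewrite !Rsqr_pow2, Cmod_sqr; simpl fst; simpl snd.
  rewrite !Rpow_mult_distr, trig2.
  assert (0 <= cos x ^ 2 <= 1) by (pose proof (COS_bound x); nra).
  assert (p ^ 2 <= a ^ 2) by nra; assert (r ^ 2 <= a ^ 2) by nra; nra. }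
assert (B1 : Cmod (C0 th) <= a) by exact (Bd A B th (conj HA HAa) (conj HB HBa)).
assert (B2 : Cmod (q0 s) <= a) by (apply (Bd a b s); lra).
assert (B3 : Cmod (vel0 a b s) <= a).
{ replace (vel0 a b s) with ((a * cos (PI / 2 + s), b * sin (PI / 2 + s)) : C).
  - apply Bd; lra.
  - unfold vel0; rewrite <- cos_sin, cos_plus, sin_PI2, cos_PI2; f_equal; ring. }
assert (B4 : Cmod (g th - q s)%C <= 4 * a).
{ replace (g th - q s)%C with ((g th - C0 th) + (C0 th + (- q0 s + - (q s - q0 s))))%C by ring.
  eapply Rle_trans; [apply Cmod_triangle|].
  assert (Cmod (C0 th + (- q0 s + - (q s - q0 s)))%C <= a + (a + eta)).
  { eapply Rle_trans; [apply Cmod_triangle|]; apply Rplus_le_compat; [easy|].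
    eapply Rle_trans; [apply Cmod_triangle|]; rewrite !Cmod_opp; apply Rplus_le_compat; auto. }
  specialize (g_near th); fold B in small_supp0; lra. }
assert (N1 : Rabs (cross (velocity q s - vel0 a b s)%C (g th - q s)%C) <= om * (4 * a)).
{ eapply Rle_trans; [apply cross_bound|]; apply Rmult_le_compat; try apply Cmod_ge_0; auto. }
assert (N2 : Rabs (cross (vel0 a b s) ((g th - C0 th) - (q s - q0 s))%C) <= a * (eta + eta)).
{ eapply Rle_trans; [apply cross_bound|]; apply Rmult_le_compat; try apply Cmod_ge_0; auto.
  unfold Cminus at 1; eapply Rle_trans; [apply Cmod_triangle|]; rewrite Cmod_opp.
  apply Rplus_le_compat; auto. }
replace (cross (velocity q s) (g th - q s)%C) with
  (cross (vel0 a b s) (C0 th - q0 s)%C + cross (velocity q s - vel0 a b s)%C (g th - q s)%C +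
   cross (vel0 a b s) ((g th - C0 th) - (q s - q0 s))%C).
- apply Rabs_le_between in N1, N2; lra.
- rewrite !cross_minus_l, !cross_minus_r; ring.
Qed.

(** The line is taken tangent to g itself, so that the chord is exactly tangent. Its height in the
    direction [nrm t] is below that of the table at t and above it at t - PI and t + PI, and the
    intermediate value theorem gives one endpoint on either side of t. *)
Lemma ccw_chord_exists (t : R) : exists s s',
  s < s' < s + 2 * PI /\ ccw t s s' /\ segment_tangent g (q s) (q s') /\
  Rabs (s - (t - gam a b l t)) <= approx_const a b l * eta.
Proof.
pose proof PI_RGT_0 as HP; pose proof Sm as [].
destruct (g_support_point t) as [th [kap [Hkap Hv]]].
pose proof (g_support_line th t kap Hkap Hv) as HL; set (H := dot (g th) (nrm a b t)) in *.
destruct (rad_range a b l Hl Hlb Hba t) as [R1 R2]; destruct (supp_range a b l Hl Hlb Hba t) as [[S1 S2] S3].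
pose proof (supp_sqr a b l Hl Hlb Hba t) as SS.
(* rad - supp = l^2 / (rad + supp) >= l^2 / (2 a), whereas 2 eta <= 3 l^2 / (8 a) by [small_sin]. *)
assert (Gap : 2 * eta < rad a b t - supp a b l t).
{ assert (supp a b l t < rad a b t) by nra.
  assert (l ^ 2 <= (rad a b t - supp a b l t) * (2 * a)) by nra.
  apply Rmult_lt_reg_r with (16 * a); nra. }
apply Rabs_le_between in HL.
set (f := fun x => dot (q x) (nrm a b t)).
assert (Cf : continuity f).
{ intros x; destruct (q_diff x) as [D1 D2]; unfold f, dot.
  apply continuity_pt_plus; apply continuity_pt_mult; try (apply continuity_pt_const; easy);
    now apply continuity_pt_ex_derive. }
assert (V : forall x, Rabs (f x - rad a b t * cos (x - t)) <= eta).
{ intros x; rewrite <- (dot_q0_nrm a b l Hl Hlb Hba); fold q0.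
  apply dot_near; [apply nrm_unit | apply q_near]. }
assert (Vt := V t); rewrite Rminus_diag, cos_0 in Vt.
assert (Vp := V (t + PI)); replace (t + PI - t) with PI in Vp by ring; rewrite cos_PI in Vp.
assert (Vm := V (t - PI)); replace (t - PI - t) with (- PI) in Vm by ring; rewrite cos_neg, cos_PI in Vm.
apply Rabs_le_between in Vt, Vp, Vm.
assert (Ht : H < f t) by lra.
assert (Hp : f (t + PI) < H) by lra.
assert (Hm : f (t - PI) < H) by lra.
destruct (IVT_gen f (t - PI) t H) as [s [Hs Es]]; [easy | rewrite Rmin_left, Rmax_right; lra |].
destruct (IVT_gen f t (t + PI) H) as [s' [Hs' Es']]; [easy | rewrite Rmin_right, Rmax_left; lra |].
rewrite Rmin_left, Rmax_right in Hs, Hs' by lra.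
assert (s <> t - PI) by (intros ->; lra); assert (s <> t) by (intros ->; lra).
assert (s' <> t + PI) by (intros ->; lra); assert (s' <> t) by (intros ->; lra).
assert (Hss : s < s' < s + 2 * PI) by lra.
assert (Ns : Rabs (dot (q s) (nrm a b t) - supp a b l t) <= eta) by (fold (f s); rewrite Es; apply Rabs_le; lra).
assert (Ns' : Rabs (dot (q s') (nrm a b t) - supp a b l t) <= eta) by (fold (f s'); rewrite Es'; apply Rabs_le; lra).
assert (Sn : sin (s - t) < 0).
{ replace (s - t) with (- (t - s)) by ring; rewrite sin_neg.
  assert (0 < sin (t - s)) by (apply sin_gt_0; lra); lra. }
assert (Sn' : 0 < sin (s' - t)) by (apply sin_gt_0; lra).
pose proof (proj2 (proj1 (near_cross s t Ns)) Sn) as X1.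
pose proof (proj2 (proj2 (near_cross s' t Ns')) Sn') as X2.
assert (E1 : dot (q s' - q s)%C (nrm a b t) = 0) by (rewrite dot_minus_l; fold (f s) (f s'); lra).
assert (E2 : dot (g th - q s)%C (nrm a b t) = 0) by (rewrite dot_minus_l; fold (f s) H; lra).
assert (E3 : dot (g th - q s')%C (nrm a b t) = 0) by (rewrite dot_minus_l; fold (f s') H; lra).
apply reach in E1, E2, E3.
set (r := dot (q s' - q s)%C (dir a b t)) in *; set (r1 := dot (g th - q s)%C (dir a b t)) in *.
set (r2 := dot (g th - q s')%C (dir a b t)) in *.
assert (Hr : 0 < r).
{ pose proof (q_conv s s' Hss) as Q; rewrite E1, cross_scal_r in Q; nra. }
(* The point of contact is interior to the table, so it lies between the two endpoints. *)
assert (Hr1 : 0 < r1).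
{ pose proof (caustic_inside s th) as Q; rewrite E2, cross_scal_r in Q; nra. }
assert (Hr2 : r2 < 0).
{ pose proof (caustic_inside s' th) as Q; rewrite E3, cross_scal_r in Q; nra. }
assert (Er : r = r1 - r2).
{ unfold r, r1, r2; rewrite !dot_minus_l; ring. }
exists s, s'; split; [easy|]; split; [split; [exists r; easy | easy]|]; split.
- exists th, (r1 / r); split; [split|].
  + apply Rdiv_le_0_compat; lra.
  + apply Rmult_le_reg_r with r; [easy|]; unfold Rdiv; rewrite Rmult_assoc, Rinv_l; lra.
  + split.
    * rewrite E1; replace (RtoC (r1 / r) * (RtoC r * dir a b t))%C with (RtoC r1 * dir a b t)%C.
      -- rewrite <- E2; ring.
      -- rewrite RtoC_div by lra; field; intros E; apply RtoC_inj in E; lra.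
    * rewrite E1, Hv; unfold cross, Cmult, RtoC; simpl; ring.
- destruct (approx_angle a b l Hl Hlb Hba (-1) t (s - t) eta) as [n Hn]; try easy; try lra.
  { apply (near_cos s t Ns). }
  pose proof (gam_range a b l Hl Hlb Hba t) as G; pose proof (gam_ge t) as G'.
  assert (En : n = 0%Z).
  { apply Rabs_le_between in Hn.
    assert (F1 : IZR n < 1) by nra.
    assert (F2 : -1 < IZR n) by nra.
    apply lt_IZR in F1; apply (lt_IZR (-1)) in F2; lia. }
  subst n; eapply Rle_trans; [|exact Hn]; right; f_equal; ring.
Qed.

(** Let w be the reflected direction. The function cross w (q - q s') vanishes at s' and one turn
    later with the same negative slope, so it is negative just after s' and positive just before s'
    + 2 PI. Convexity puts the zero in between on the forward half of the line. *)
Lemma billiard_next (s s' : R) : s < s' < s + 2 * PI -> exists s'',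
  s' < s'' < s' + 2 * PI /\
  reflected (velocity q s') (q s' - q s)%C (q s'' - q s')%C.
Proof.
intros Hs; pose proof PI_RGT_0 as HP.
set (T := velocity q s'); set (v := (q s' - q s)%C).
assert (HT : cross T v < 0).
{ pose proof (q_conv s' (s + 2 * PI) ltac:(lra)) as Q; rewrite q_per in Q; fold T in Q.
  unfold v; rewrite cross_minus_r in Q |- *; lra. }
assert (HTm : 0 < dot T T).
{ assert (0 <= dot T T) by (unfold dot; nra).
  destruct (Req_dec (dot T T) 0) as [E | E]; [|lra].
  assert (fst T = 0) by (unfold dot in E; nra); assert (snd T = 0) by (unfold dot in E; nra).
  unfold cross in HT; nra. }
set (w := (RtoC (2 * dot T v / dot T T) * T - v)%C).
assert (W1 : dot T w = dot T v).
{ unfold w; transitivity (2 * dot T v / dot T T * dot T T - dot T v); [|field; lra].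
  unfold dot, Cminus, Cplus, Copp, Cmult, RtoC; simpl; ring. }
assert (W2 : cross T w = - cross T v).
{ unfold w, cross, Cminus, Cplus, Copp, Cmult, RtoC; simpl; ring. }
assert (HT0 : 0 < Cmod T).
{ apply Cmod_gt_0; intros E; rewrite E in HTm; unfold dot, RtoC in HTm; simpl in HTm; lra. }
assert (W3 : Cmod w = Cmod v).
{ apply Rmult_eq_reg_l with (Cmod T); [|lra].
  apply Rsqr_inj; try (apply Rmult_le_pos; apply Cmod_ge_0).
  rewrite !Rsqr_pow2, <- !dot_cross_sqr, W1, W2; ring. }
set (f := fun x => cross w (q x - q s')%C).
assert (Df : forall x, is_derive f x (cross w (velocity q x))).
{ intros x; destruct (q_diff x) as [D1 D2].
  apply Derive_correct in D1, D2.
  assert (D : forall (X : R -> R) k l y0 y, is_derive X y l -> is_derive (fun x => k * (X x - y0)) y (k * l)).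
  { intros X k k' y0 y D; apply is_derive_scal; evar_last.
    - apply (is_derive_minus (V := R_NormedModule)); [exact D | apply is_derive_const].
    - unfold minus, plus, opp, zero; simpl; ring. }
  apply (is_derive_minus (V := R_NormedModule) (fun x => fst w * (snd (q x) + - snd (q s')))
    (fun x => snd w * (fst (q x) + - fst (q s')))); apply D; [exact D2 | exact D1]. }
set (L := cross w T).
assert (HL : L < 0) by (unfold L; replace (cross w T) with (- cross T w) by (unfold cross; ring); lra).
assert (VP : velocity q (s' + 2 * PI) = T).
{ unfold T, velocity; f_equal; apply Derive_period; try apply q_diff; intros; now rewrite q_per. }
assert (F0 : f s' = 0).
{ unfold f; replace (q s' - q s')%C with (RtoC 0) by ring; unfold cross, RtoC; simpl; ring. }
assert (F1 : f (s' + 2 * PI) = 0).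
{ rewrite <- F0; unfold f; now rewrite q_per. }
assert (L1 := proj1 (is_derive_Reals _ _ _) (Df s')); fold T L in L1.
assert (L2 := proj1 (is_derive_Reals _ _ _) (Df (s' + 2 * PI))); rewrite VP in L2; fold L in L2.
destruct (derivable_pt_lim_bound f _ _ (- L / 2) L1) as [d1 [Hd1 K1']]; [lra|].
destruct (derivable_pt_lim_bound f _ _ (- L / 2) L2) as [d2 [Hd2 K2']]; [lra|].
set (h := Rmin (Rmin d1 d2) PI / 2).
assert (Hh : 0 < h /\ h < d1 /\ h < d2 /\ h < PI).
{ unfold h, Rmin; repeat destruct (Rle_dec _ _); lra. }
specialize (K1' h ltac:(rewrite Rabs_pos_eq; lra)); specialize (K2' (- h) ltac:(rewrite Rabs_Ropp, Rabs_pos_eq; lra)).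
rewrite F0, (Rabs_pos_eq h) in K1' by lra; rewrite F1, Rabs_Ropp, (Rabs_pos_eq h) in K2' by lra.
apply Rabs_le_between in K1', K2'.
assert (N1 : f (s' + h) < 0) by nra; assert (N2 : 0 < f (s' + 2 * PI + - h)) by nra.
destruct (IVT_gen f (s' + h) (s' + 2 * PI + - h) 0) as [x [Hx Ex]].
{ intros y; apply continuity_pt_ex_derive; eexists; apply Df. }
{ rewrite Rmin_left, Rmax_right; lra. }
rewrite Rmin_left, Rmax_right in Hx by lra.
assert (Hx' : s' < x < s' + 2 * PI) by lra.
exists x; split; [easy|].
pose proof (q_conv s' x Hx') as Q; fold T in Q; unfold f in Ex.
set (z := (q x - q s')%C) in *.
assert (Hw2 : 0 < dot w w).
{ replace (dot w w) with (Cmod w ^ 2) by (rewrite Cmod_sqr; unfold dot; ring).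
  rewrite W3; apply pow_lt, Cmod_gt_0; intros E; rewrite E in HT; unfold cross, RtoC in HT; simpl in HT; lra. }
set (kap := dot w z / dot w w).
assert (Ez : z = (RtoC kap * w)%C).
{ revert Ex Hw2; unfold kap; destruct z as [z1 z2], w as [w1 w2]; unfold cross, dot, Cmult, RtoC; simpl.
  intros Ex Hw2; f_equal.
  - apply Rmult_eq_reg_l with (w1 * w1 + w2 * w2); [|lra].
    transitivity (w1 * (w1 * z1 + w2 * z2) - w2 * (w1 * z2 - w2 * z1)); [ring | rewrite Ex; field; lra].
  - apply Rmult_eq_reg_l with (w1 * w1 + w2 * w2); [|lra].
    transitivity (w2 * (w1 * z1 + w2 * z2) + w1 * (w1 * z2 - w2 * z1)); [ring | rewrite Ex; field; lra]. }
rewrite Ez, cross_scal_r, W2 in Q.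
assert (Hkap : 0 < kap) by nra.
assert (Hv : 0 < Cmod v).
{ rewrite <- W3; apply Cmod_gt_0; intros E; rewrite E in Hw2; unfold dot, RtoC in Hw2; simpl in Hw2; lra. }
rewrite Ez; unfold reflected.
rewrite dot_scal_r, cross_scal_r, W1, W2, Cmod_scal_pos, W3 by lra.
split; field; lra.
Qed.

Lemma billiard_orbit (s s' : R) : s < s' < s + 2 * PI -> exists x : nat -> R,
  x 0%nat = s /\ x 1%nat = s' /\ (forall j, x j < x (S j) < x j + 2 * PI) /\ billiard_trajectory q x.
Proof.
intros Hs.
assert (N0 : forall p : R * R, exists s'', fst p < snd p < fst p + 2 * PI ->
  snd p < s'' < snd p + 2 * PI /\
  reflected (velocity q (snd p)) (q (snd p) - q (fst p))%C (q s'' - q (snd p))%C).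
{ intros p; destruct (classic (fst p < snd p < fst p + 2 * PI)) as [Hp | Hp].
  - destruct (billiard_next _ _ Hp) as [s'' H]; exists s''; easy.
  - exists 0; easy. }
destruct (choice _ N0) as [N HN].
set (P := fun n => Nat.iter n (fun p => (snd p, N p)) (s, s')).
assert (HP : forall n, fst (P n) < snd (P n) < fst (P n) + 2 * PI).
{ induction n as [|n IH]; [exact Hs|].
  change (P (S n)) with (snd (P n), N (P n)); simpl fst; simpl snd; apply (HN _ IH). }
exists (fun n => fst (P n)); split; [easy|]; split; [easy|]; split; [intros j; apply (HP j)|].
intros j; split.
- apply chord_neq, (HP j).
- exact (proj2 (HN _ (HP j))).
Qed.

(** The caustic property keeps all sides tangent to g and [reflect_ccw] keeps their orientation, so
    that [ccw_step] applies to every side. *)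
Lemma resonant_orbit (delta : R) (m n : nat) (t : R) :
  (forall t, Phi a b l (t + gam a b l t) - Phi a b l (t - gam a b l t) = delta) ->
  resonant_caustic m n q g -> exists x : nat -> R,
    Rabs (x 0%nat - (t - gam a b l t)) <= approx_const a b l * eta /\
    (forall j, Rabs (Phi a b l (x (S j)) - Phi a b l (x j) - delta) <= step_const * eta) /\
    (forall j, x j < x (S j) < x j + 2 * PI) /\
    billiard_trajectory q x /\ mn_gon m n g (fun j => q (x j)).
Proof.
intros Hdelta [[_ Hcau] Hres].
destruct (ccw_chord_exists t) as [s [s' [Hss [Hccw [Htan Hs0]]]]].
destruct (billiard_orbit s s' Hss) as [x [X0 [X1 [X2 X3]]]].
assert (Htanj : forall j, segment_tangent g (q (x j)) (q (x (S j)))).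
{ induction j as [|j IH]; [rewrite X0, X1; easy | apply Hcau; easy]. }
assert (Hccwj : forall j, exists t, ccw t (x j) (x (S j))).
{ induction j as [|j [t' IH]]; [exists t; rewrite X0, X1; easy|].
  destruct (tangent_ccw_or_cw (x (S j)) (x (S (S j))) (chord_neq _ _ (X2 (S j))) (Htanj (S j))) as [t2 H2].
  exists t2; apply (reflect_ccw t' t2 (x j)); [easy | apply X3 | easy]. }
exists x; split; [rewrite X0; easy|]; split; [|split; [easy|split; [easy | now apply Hres]]].
intros j; destruct (Hccwj j) as [t' H]; now apply (ccw_step delta t').
Qed.

End Near.

(** * The perturbed ellipses *)

Lemma Rabs_add_le (x y A B : R) : Rabs x <= A -> Rabs y <= B -> Rabs (x + y) <= A + B.
Proof. intros; eapply Rle_trans; [apply Rabs_triang | lra]. Qed.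

Lemma Rabs_sub_le (x y A B : R) : Rabs x <= A -> Rabs y <= B -> Rabs (x - y) <= A + B.
Proof. intros; apply Rabs_add_le; [easy | now rewrite Rabs_Ropp]. Qed.

Lemma Rabs_opp_le (x A : R) : Rabs x <= A -> Rabs (- x) <= A.
Proof. now rewrite Rabs_Ropp. Qed.

Lemma Rabs_mul_le (x y A B : R) : Rabs x <= A -> Rabs y <= B -> Rabs (x * y) <= A * B.
Proof. intros; rewrite Rabs_mult; apply Rmult_le_compat; try apply Rabs_pos; easy. Qed.

Lemma Rabs_cos_le (x : R) : Rabs (cos x) <= 1.
Proof. apply Rabs_le, COS_bound. Qed.

Lemma Rabs_sin_le (x : R) : Rabs (sin x) <= 1.
Proof. apply Rabs_le, SIN_bound. Qed.

(** Meant for a bound that is still an existential variable: it is assembled from the bounds of the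
    atoms. *)
Ltac Rabs_bound :=
  repeat match goal with
  | |- Rabs (_ - _) <= _ => apply Rabs_sub_le
  | |- Rabs (_ + _) <= _ => apply Rabs_add_le
  | |- Rabs (- _) <= _ => apply Rabs_opp_le
  | |- Rabs (_ * _) <= _ => apply Rabs_mul_le
  | |- Rabs (cos _) <= _ => apply Rabs_cos_le
  | |- Rabs (sin _) <= _ => apply Rabs_sin_le
  end.

Lemma cos_plus_2PI (x : R) : cos (x + 2 * PI) = cos x.
Proof. rewrite cos_plus, cos_2PI, sin_2PI; ring. Qed.

Lemma sin_plus_2PI (x : R) : sin (x + 2 * PI) = sin x.
Proof. rewrite sin_plus, cos_2PI, sin_2PI; ring. Qed.

Lemma exp_le_compat (x y : R) : x <= y -> exp x <= exp y.
Proof. intros [H | ->]; [left; now apply exp_increasing | lra]. Qed.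

Lemma cosh_sinh_le (m z : R) : Rabs z <= m -> Rabs (cosh z) <= exp m /\ Rabs (sinh z) <= exp m.
Proof.
intros H; apply Rabs_le_between in H; unfold cosh, sinh.
assert (exp z <= exp m) by (apply exp_le_compat; lra).
assert (exp (- z) <= exp m) by (apply exp_le_compat; lra).
pose proof (exp_pos z); pose proof (exp_pos (- z)).
split; apply Rabs_le; lra.
Qed.

Lemma is_derive_cosh (x : R) : is_derive cosh x (sinh x).
Proof. apply is_derive_Reals, derivable_pt_lim_cosh. Qed.

Lemma is_derive_sinh (x : R) : is_derive sinh x (cosh x).
Proof. apply is_derive_Reals, derivable_pt_lim_sinh. Qed.

Lemma mvt_bound (f f' : R -> R) (B x y : R) :
  (forall z, is_derive f z (f' z)) ->
  (forall z, Rmin x y <= z <= Rmax x y -> Rabs (f' z) <= B) ->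
  Rabs (f y - f x) <= B * Rabs (y - x).
Proof.
intros D H; destruct (MVT_gen f x y f') as [c [Hc ->]].
- intros; apply D.
- intros; apply continuity_pt_ex_derive; eexists; apply D.
- rewrite Rabs_mult; apply Rmult_le_compat_r; [apply Rabs_pos | now apply H].
Qed.

Lemma taylor_bound (f f' f'' : R -> R) (B x y : R) : 0 <= B ->
  (forall z, is_derive f z (f' z)) -> (forall z, is_derive f' z (f'' z)) ->
  (forall z, Rmin x y <= z <= Rmax x y -> Rabs (f'' z) <= B) ->
  Rabs (f y - f x - f' x * (y - x)) <= B * (y - x) ^ 2.
Proof.
intros HB D1 D2 H; destruct (MVT_gen f x y f') as [c [Hc ->]].
- intros; apply D1.
- intros; apply continuity_pt_ex_derive; eexists; apply D1.
- replace (f' c * (y - x) - f' x * (y - x)) with ((f' c - f' x) * (y - x)) by ring.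
  rewrite Rabs_mult, <- (pow2_abs (y - x)); simpl; rewrite Rmult_1_r, <- Rmult_assoc.
  apply Rmult_le_compat_r; [apply Rabs_pos|].
  assert (Hc' : forall z, Rmin x c <= z <= Rmax x c -> Rmin x y <= z <= Rmax x y).
  { revert Hc; unfold Rmin, Rmax; repeat destruct (Rle_dec _ _); intros; lra. }
  eapply Rle_trans; [apply (mvt_bound f' f'' B); [easy | intros; apply H; auto]|].
  apply Rmult_le_compat_l; [easy|].
  revert Hc; unfold Rmin, Rmax; destruct (Rle_dec x y); intros;
    [rewrite !Rabs_pos_eq | rewrite !Rabs_left1]; lra.
Qed.

Section Perturbation.

Context (a b c mu0 : R) (mu : R -> R -> R) (mu1 : R -> R)
  (hb : 0 < b) (hab : b < a) (hc : c = sqrt (a ^ 2 - b ^ 2))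
  (hcosh : cosh mu0 = a / c) (hsinh : sinh mu0 = b / c)
  (hmu : smooth_perturbation mu mu0 mu1).

Let d1 (e x : R) : R := Derive (mu e) x.
Let d2 (e x : R) : R := Derive (d1 e) x.
Let d3 (e x : R) : R := Derive (d2 e) x.

Lemma c_pos : 0 < c.
Proof. rewrite hc; apply sqrt_lt_R0; nra. Qed.

Lemma c_cosh_sinh : c * cosh mu0 = a /\ c * sinh mu0 = b.
Proof. pose proof c_pos; rewrite hcosh, hsinh; split; field; lra. Qed.

(** At eps = 0 the remainder estimate K eps^2 is 0. *)
Lemma mu_at_0 (x : R) : mu 0 x = mu0.
Proof.
destruct hmu as [e0 [K [He0 [_ [_ H]]]]].
specialize (H 0 x ltac:(rewrite Rabs_R0; easy)).
replace (K * 0 ^ 2) with 0 in H by ring; rewrite Rmult_0_l, Rplus_0_r in H.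
apply Rabs_le_between in H; lra.
Qed.

Lemma derivs_at_0 (x : R) : d1 0 x = 0 /\ d2 0 x = 0.
Proof.
assert (E : forall x, d1 0 x = 0).
{ intros y; unfold d1; rewrite (Derive_ext _ (fun _ => mu0)); [apply Derive_const | apply mu_at_0]. }
split; [easy|]; unfold d2; rewrite (Derive_ext _ (fun _ => 0)); [apply Derive_const | easy].
Qed.

(* The angular derivatives of mu up to order 3: existence, bounds, and continuity at eps = 0. *)
Lemma mu_bounds : exists e1 m K, 0 < e1 /\ 0 <= m /\ 0 <= K /\
  (forall e x, Rabs e <= e1 ->
     is_derive (mu e) x (d1 e x) /\ is_derive (d1 e) x (d2 e x) /\ is_derive (d2 e) x (d3 e x) /\
     Rabs (mu e x) <= m /\ Rabs (d1 e x) <= m /\ Rabs (d2 e x) <= m /\ Rabs (d3 e x) <= m /\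
     mu e (x + 2 * PI) = mu e x /\
     Rabs (mu e x - mu0) <= K * Rabs e /\ Rabs (mu e x - mu0 - e * mu1 x) <= K * e ^ 2) /\
  (forall w, 0 < w -> exists e2, 0 < e2 /\ forall e x, Rabs e < e2 ->
     Rabs (d1 e x) <= w /\ Rabs (d2 e x) <= w).
Proof.
pose proof PI_RGT_0 as HP.
destruct hmu as [e0 [K [He0 [Hs [Hper Hrem]]]]].
set (e1 := Rmin (e0 / 2) 1).
assert (He1 : 0 < e1 <= 1 /\ e1 < e0) by (unfold e1, Rmin; destruct (Rle_dec _ _); lra).
assert (Cd : forall e x, Rabs e < e0 ->
  (ex_derive (mu e) x /\ ex_derive (d1 e) x /\ ex_derive (d2 e) x) /\
  continuity_2d_pt mu e x /\ continuity_2d_pt d1 e x /\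
  continuity_2d_pt d2 e x /\ continuity_2d_pt d3 e x).
{ intros e x He; destruct (Hs 3%nat e x He) as [C0 [_ [E1 [_ [C1 [_ [E2 [_ [C2 [_ [E3 [_ [C3 _]]]]]]]]]]]]].
  repeat split; assumption. }
assert (E1 : forall e x, Rabs e < e0 -> ex_derive (mu e) x) by (intros e x He; exact (proj1 (proj1 (Cd e x He)))).
assert (E2 : forall e x, Rabs e < e0 -> ex_derive (d1 e) x) by (intros e x He; exact (proj1 (proj2 (proj1 (Cd e x He))))).
assert (E3 : forall e x, Rabs e < e0 -> ex_derive (d2 e) x) by (intros e x He; exact (proj2 (proj2 (proj1 (Cd e x He))))).
assert (C0 : forall e x, Rabs e < e0 -> continuity_2d_pt mu e x) by (intros e x He; exact (proj1 (proj2 (Cd e x He)))).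
assert (C1 : forall e x, Rabs e < e0 -> continuity_2d_pt d1 e x) by (intros e x He; exact (proj1 (proj2 (proj2 (Cd e x He))))).
assert (C2 : forall e x, Rabs e < e0 -> continuity_2d_pt d2 e x) by (intros e x He; exact (proj1 (proj2 (proj2 (proj2 (Cd e x He)))))).
assert (C3 : forall e x, Rabs e < e0 -> continuity_2d_pt d3 e x) by (intros e x He; exact (proj2 (proj2 (proj2 (proj2 (Cd e x He)))))).
clear Cd Hs.
assert (P0 : forall e, Rabs e < e0 -> forall x, mu e (x + 2 * PI) = mu e x) by (intros e He x; exact (Hper e He x)).
assert (P1 : forall e, Rabs e < e0 -> forall x, d1 e (x + 2 * PI) = d1 e x).
{ intros e He x; exact (Derive_period (mu e) (2 * PI) x (P0 e He) (E1 e _ He)). }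
assert (P2 : forall e, Rabs e < e0 -> forall x, d2 e (x + 2 * PI) = d2 e x).
{ intros e He x; exact (Derive_period (d1 e) (2 * PI) x (P1 e He) (E2 e _ He)). }
assert (P3 : forall e, Rabs e < e0 -> forall x, d3 e (x + 2 * PI) = d3 e x).
{ intros e He x; exact (Derive_period (d2 e) (2 * PI) x (P2 e He) (E3 e _ He)). }
assert (Bnd : forall f : R -> R -> R, (forall e x, Rabs e < e0 -> continuity_2d_pt f e x) ->
  (forall e, Rabs e < e0 -> forall x, f e (x + 2 * PI) = f e x) ->
  exists m, forall e x, Rabs e <= e1 -> Rabs (f e x) <= m).
{ intros f Cf Pf; destruct (bounded_2d f (- e1) e1 0 (2 * PI)) as [m Hm]; try lra.
  { intros e x He Hx; apply Cf, Rabs_lt_between; lra. }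
  exists m; intros e x He; destruct (reduce_2PI x) as [n Hn].
  rewrite <- (period_Z (f e) (Pf e ltac:(lra)) n).
  apply Hm; [now apply Rabs_le_between | lra]. }
destruct (Bnd mu C0 P0) as [m0 Hm0].
destruct (Bnd d1 C1 P1) as [m1 Hm1].
destruct (Bnd d2 C2 P2) as [m2 Hm2].
destruct (Bnd d3 C3 P3) as [m3 Hm3].
set (m := Rabs m0 + Rabs m1 + Rabs m2 + Rabs m3).
pose proof (Rabs_pos m0); pose proof (Rabs_pos m1); pose proof (Rabs_pos m2); pose proof (Rabs_pos m3).
pose proof (Rle_abs m0); pose proof (Rle_abs m1); pose proof (Rle_abs m2); pose proof (Rle_abs m3).
(* The expansion at the single value eps = e1 bounds mu1 by the bounded function mu e1. *)
assert (Hmu1 : exists B, 0 <= B /\ forall x, Rabs (mu1 x) <= B).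
{ exists ((m + Rabs mu0 + Rabs K * e1 ^ 2) / e1); split.
  - pose proof (Rabs_pos mu0); pose proof (Rabs_pos K).
    apply Rdiv_le_0_compat; [|lra].
    assert (0 <= Rabs K * e1 ^ 2) by (apply Rmult_le_pos; [easy | apply pow2_ge_0]); unfold m; lra.
  - intros x; apply Rmult_le_reg_r with e1; [lra|].
    replace ((m + Rabs mu0 + Rabs K * e1 ^ 2) / e1 * e1) with (m + Rabs mu0 + Rabs K * e1 ^ 2) by (field; lra).
    rewrite <- (Rabs_pos_eq e1) at 1 by lra; rewrite <- Rabs_mult.
    replace (mu1 x * e1) with (mu e1 x - mu0 - (mu e1 x - (mu0 + e1 * mu1 x))) by ring.
    apply Rabs_sub_le; [apply Rabs_sub_le; [|lra]|].
    + specialize (Hm0 e1 x ltac:(rewrite Rabs_pos_eq; lra)); unfold m; lra.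
    + eapply Rle_trans; [apply Hrem; rewrite Rabs_pos_eq; lra|].
      apply Rmult_le_compat_r; [apply pow2_ge_0 | apply Rle_abs]. }
destruct Hmu1 as [B [HB0 HB]].
exists e1, m, (B + Rabs K); pose proof (Rabs_pos K) as HK.
split; [lra|]; split; [unfold m; lra|]; split; [lra|]; split.
- intros e x He.
  assert (He' : Rabs e < e0) by lra.
  split; [exact (Derive_correct _ _ (E1 e x He'))|]; split; [exact (Derive_correct _ _ (E2 e x He'))|].
  split; [exact (Derive_correct _ _ (E3 e x He'))|].
  specialize (Hm0 e x He); specialize (Hm1 e x He); specialize (Hm2 e x He); specialize (Hm3 e x He).
  repeat (split; [unfold m; lra|]).
  split; [exact (P0 e He' x)|].
  assert (R2 : Rabs (mu e x - mu0 - e * mu1 x) <= Rabs K * e ^ 2).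
  { replace (mu e x - mu0 - e * mu1 x) with (mu e x - (mu0 + e * mu1 x)) by ring.
    eapply Rle_trans; [now apply Hrem|]; apply Rmult_le_compat_r; [apply pow2_ge_0 | apply Rle_abs]. }
  pose proof (pow2_ge_0 e) as Pe; split; [|nra].
  replace (mu e x - mu0) with ((mu e x - mu0 - e * mu1 x) + e * mu1 x) by ring.
  rewrite <- (pow2_abs e) in R2; pose proof (Rabs_pos e).
  assert (Rabs (e * mu1 x) <= Rabs e * B) by (apply Rabs_mul_le; [lra | apply HB]).
  assert (Rabs e ^ 2 <= Rabs e) by nra.
  eapply Rle_trans; [apply Rabs_triang|]; nra.
- assert (Unif : forall f : R -> R -> R, (forall e x, Rabs e < e0 -> continuity_2d_pt f e x) ->
    (forall e, Rabs e < e0 -> forall x, f e (x + 2 * PI) = f e x) -> (forall x, f 0 x = 0) ->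
    forall w, 0 < w -> exists e2, 0 < e2 /\ forall e x, Rabs e < e2 -> Rabs (f e x) <= w).
  { intros f Cf Pf F0 w Hw.
    destruct (uniform_continuity_2d f (- e1) e1 0 (2 * PI)) with (eps := mkposreal w Hw) as [[d Hd] Hu].
    { intros e x He Hx; apply Cf, Rabs_lt_between; lra. }
    simpl in Hu; exists (Rmin d e1); split; [apply Rmin_pos; lra|]; intros e x He.
    pose proof (Rmin_l d e1); pose proof (Rmin_r d e1).
    destruct (reduce_2PI x) as [n Hn].
    rewrite <- (period_Z (f e) (Pf e ltac:(lra)) n).
    assert (He' : - e1 <= e <= e1) by (apply Rabs_le_between; lra).
    replace (f e (x + 2 * PI * IZR n)) with (f e (x + 2 * PI * IZR n) - f 0 (x + 2 * PI * IZR n))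
      by (rewrite F0; ring).
    left; apply Hu; try lra.
    + rewrite Rminus_0_r; lra.
    + rewrite Rminus_diag, Rabs_R0; lra. }
  intros w Hw.
  destruct (Unif d1 C1 P1 (fun x => proj1 (derivs_at_0 x)) w Hw) as [ea [Ha1 Ha2]].
  destruct (Unif d2 C2 P2 (fun x => proj2 (derivs_at_0 x)) w Hw) as [eb [Hb1 Hb2]].
  exists (Rmin ea eb); split; [now apply Rmin_pos|]; intros e x He.
  split; [apply Ha2 | apply Hb2]; (eapply Rlt_le_trans; [exact He|]); [apply Rmin_l | apply Rmin_r].
Qed.

Definition qpert (e : R) : curve := fun x => elliptic_point c (mu e x) x.

Let ch (e x : R) : R := c * cosh (mu e x).
Let sh (e x : R) : R := c * sinh (mu e x).

(** Closed forms of the derivatives of the two coordinates up to order three, the order at which the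
    perimeter estimate needs bounds uniform in e. *)
Definition qpert_x1 (e x : R) : R := d1 e x * sh e x * cos x - ch e x * sin x.
Definition qpert_x2 (e x : R) : R :=
  (d2 e x * sh e x + d1 e x * d1 e x * ch e x) * cos x - 2 * (d1 e x * sh e x) * sin x - ch e x * cos x.
Definition qpert_x3 (e x : R) : R :=
  (d3 e x * sh e x + 3 * (d1 e x * d2 e x * ch e x) + d1 e x * d1 e x * d1 e x * sh e x) * cos x
  - 3 * (d2 e x * sh e x + d1 e x * d1 e x * ch e x) * sin x - 3 * (d1 e x * sh e x) * cos x + ch e x * sin x.
Definition qpert_y1 (e x : R) : R := d1 e x * ch e x * sin x + sh e x * cos x.
Definition qpert_y2 (e x : R) : R :=
  (d2 e x * ch e x + d1 e x * d1 e x * sh e x) * sin x + 2 * (d1 e x * ch e x) * cos x - sh e x * sin x.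
Definition qpert_y3 (e x : R) : R :=
  (d3 e x * ch e x + 3 * (d1 e x * d2 e x * sh e x) + d1 e x * d1 e x * d1 e x * ch e x) * sin x
  + 3 * (d2 e x * ch e x + d1 e x * d1 e x * sh e x) * cos x - 3 * (d1 e x * ch e x) * sin x - sh e x * cos x.

Lemma qpert_derivs (e : R) :
  (forall x, is_derive (mu e) x (d1 e x) /\ is_derive (d1 e) x (d2 e x) /\ is_derive (d2 e) x (d3 e x)) ->
  forall x,
    is_derive (fun s => fst (qpert e s)) x (qpert_x1 e x) /\ is_derive (qpert_x1 e) x (qpert_x2 e x) /\
    is_derive (qpert_x2 e) x (qpert_x3 e x) /\
    is_derive (fun s => snd (qpert e s)) x (qpert_y1 e x) /\ is_derive (qpert_y1 e) x (qpert_y2 e x) /\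
    is_derive (qpert_y2 e) x (qpert_y3 e x).
Proof.
intros D x; destruct (D x) as [D1 [D2 D3]].
assert (Dch : is_derive (ch e) x (d1 e x * sh e x)).
{ unfold ch; apply (is_derive_ext (fun x => c * cosh (mu e x))); [easy|].
  evar_last; [apply is_derive_scal, (is_derive_comp (V := R_NormedModule) cosh (mu e));
    [apply is_derive_cosh | exact D1] |].
  unfold sh, scal; simpl; unfold mult; simpl; ring. }
assert (Dsh : is_derive (sh e) x (d1 e x * ch e x)).
{ unfold sh; evar_last; [apply is_derive_scal, (is_derive_comp (V := R_NormedModule) sinh (mu e));
    [apply is_derive_sinh | exact D1] |].
  unfold ch, scal; simpl; unfold mult; simpl; ring. }
assert (U1 := is_derive_unique _ _ _ Dch); assert (U2 := is_derive_unique _ _ _ Dsh).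
assert (U3 := is_derive_unique _ _ _ D2); assert (U4 := is_derive_unique _ _ _ D3).
set (f1 := d1 e) in *; set (f2 := d2 e) in *; set (f3 := d3 e) in *.
set (C := ch e) in *; set (S := sh e) in *.
assert (V1 : ex_derive C x) by (eexists; exact Dch).
assert (V2 : ex_derive S x) by (eexists; exact Dsh).
assert (V3 : ex_derive f1 x) by (eexists; exact D2).
assert (V4 : ex_derive f2 x) by (eexists; exact D3).
unfold qpert, elliptic_point; simpl fst; simpl snd.
change (is_derive (fun s => C s * cos s) x (qpert_x1 e x) /\ is_derive (qpert_x1 e) x (qpert_x2 e x) /\
    is_derive (qpert_x2 e) x (qpert_x3 e x) /\
    is_derive (fun s => S s * sin s) x (qpert_y1 e x) /\ is_derive (qpert_y1 e) x (qpert_y2 e x) /\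
    is_derive (qpert_y2 e) x (qpert_y3 e x)).
unfold qpert_x1, qpert_x2, qpert_x3, qpert_y1, qpert_y2, qpert_y3; fold f1 f2 f3 C S.
clearbody f1 f2 f3 C S; clear - U1 U2 U3 U4 V1 V2 V3 V4.
refine (conj _ (conj _ (conj _ (conj _ (conj _ _))))); (auto_derive; [repeat split; assumption |]);
  change (fun x0 : R => C x0) with C; change (fun x0 : R => S x0) with S;
  change (fun x0 : R => f1 x0) with f1; change (fun x0 : R => f2 x0) with f2;
  rewrite ?U1, ?U2, ?U3, ?U4; ring.
Qed.

(** Taylor expansion at mu0, where c cosh and c sinh take the values a and b and are each other's
    derivatives. *)
Lemma ch_sh_near : exists e1 m K, 0 < e1 /\ 0 <= m /\ 0 <= K /\
  forall e x, Rabs e <= e1 ->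
    (is_derive (mu e) x (d1 e x) /\ is_derive (d1 e) x (d2 e x) /\ is_derive (d2 e) x (d3 e x)) /\
    (Rabs (d1 e x) <= m /\ Rabs (d2 e x) <= m /\ Rabs (d3 e x) <= m) /\
    (Rabs (ch e x) <= m /\ Rabs (sh e x) <= m) /\ mu e (x + 2 * PI) = mu e x /\
    (Rabs (ch e x - a) <= K * Rabs e /\ Rabs (sh e x - b) <= K * Rabs e) /\
    (Rabs (ch e x - a - e * (mu1 x * b)) <= K * e ^ 2 /\
     Rabs (sh e x - b - e * (mu1 x * a)) <= K * e ^ 2).
Proof.
destruct mu_bounds as [e1 [m [K [He1 [Hm [HK [H _]]]]]]].
pose proof c_pos as Hc; destruct c_cosh_sinh as [Ca Cb].
assert (Hmu0 : Rabs mu0 <= m).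
{ rewrite <- (mu_at_0 0); apply (H 0 0); rewrite Rabs_R0; lra. }
set (B := c * exp m); assert (HB : 0 < B) by (apply Rmult_lt_0_compat; [easy | apply exp_pos]).
assert (Dch : forall z, is_derive (fun z => c * cosh z) z (c * sinh z)) by (intros; apply is_derive_scal, is_derive_cosh).
assert (Dsh : forall z, is_derive (fun z => c * sinh z) z (c * cosh z)) by (intros; apply is_derive_scal, is_derive_sinh).
exists e1, (m + B), (B * K + B * K ^ 2 + a * K); split; [easy|]; split; [lra|].
assert (HK2 : 0 <= K ^ 2) by apply pow2_ge_0.
assert (P1 : 0 <= B * K) by nra; assert (P2 : 0 <= B * K ^ 2) by nra; assert (P3 : 0 <= a * K) by nra.
split; [lra|]; intros e x He.
destruct (H e x He) as [D1 [D2 [D3 [B0 [B1 [B2 [B3 [Per [N1 N2]]]]]]]]].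
assert (Bz : forall z, Rmin mu0 (mu e x) <= z <= Rmax mu0 (mu e x) ->
  Rabs (c * cosh z) <= B /\ Rabs (c * sinh z) <= B).
{ intros z Hz; assert (Rabs z <= m).
  { apply Rabs_le_between in Hmu0, B0; apply Rabs_le; revert Hz; unfold Rmin, Rmax; destruct (Rle_dec _ _); lra. }
  destruct (cosh_sinh_le m z H0); unfold B; split; rewrite Rabs_mult, (Rabs_pos_eq c) by lra;
    apply Rmult_le_compat_l; lra. }
assert (Bx : Rabs (ch e x) <= B /\ Rabs (sh e x) <= B).
{ apply Bz; split; [apply Rmin_r | apply Rmax_r]. }
split; [easy|]; split; [repeat split; lra|]; split; [lra|]; split; [easy|].
pose proof (Rabs_pos e) as Pe; pose proof (pow2_ge_0 e) as Pe2.
assert (Sq : (mu e x - mu0) ^ 2 <= K ^ 2 * e ^ 2).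
{ rewrite <- (pow2_abs (mu e x - mu0)), <- (pow2_abs e), <- Rpow_mult_distr.
  apply pow_incr; split; [apply Rabs_pos | easy]. }
assert (Sq' : B * (mu e x - mu0) ^ 2 <= B * (K ^ 2 * e ^ 2)) by (apply Rmult_le_compat_l; lra).
assert (Q1 : 0 <= B * K * Rabs e) by (now apply Rmult_le_pos).
assert (Q2 : 0 <= B * K ^ 2 * Rabs e) by (now apply Rmult_le_pos).
assert (Q3 : 0 <= a * K * Rabs e) by (now apply Rmult_le_pos).
assert (Q4 : 0 <= B * K * e ^ 2) by (now apply Rmult_le_pos).
assert (Q5 : 0 <= a * K * e ^ 2) by (now apply Rmult_le_pos).
assert (BN : B * Rabs (mu e x - mu0) <= B * (K * Rabs e)) by (apply Rmult_le_compat_l; lra).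
assert (N2' : 0 <= K * e ^ 2) by (now apply Rmult_le_pos).
split; split.
- pose proof (mvt_bound _ _ B mu0 (mu e x) Dch (fun z Hz => proj2 (Bz z Hz))) as M.
  simpl in M; rewrite Ca in M; fold (ch e x) in M; lra.
- pose proof (mvt_bound _ _ B mu0 (mu e x) Dsh (fun z Hz => proj1 (Bz z Hz))) as M.
  simpl in M; rewrite Cb in M; fold (sh e x) in M; lra.
- pose proof (taylor_bound _ _ _ B mu0 (mu e x) ltac:(lra) Dch Dsh (fun z Hz => proj1 (Bz z Hz))) as M.
  cbv beta in M; rewrite Ca, Cb in M; fold (ch e x) in M.
  replace (ch e x - a - e * (mu1 x * b)) with
    ((ch e x - a - b * (mu e x - mu0)) + b * (mu e x - mu0 - e * mu1 x)) by ring.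
  eapply Rle_trans; [apply Rabs_triang|]; rewrite (Rabs_mult b), (Rabs_pos_eq b) by lra.
  assert (b * Rabs (mu e x - mu0 - e * mu1 x) <= a * (K * e ^ 2)).
  { apply Rmult_le_compat; try apply Rabs_pos; lra. }
  lra.
- pose proof (taylor_bound _ _ _ B mu0 (mu e x) ltac:(lra) Dsh Dch (fun z Hz => proj2 (Bz z Hz))) as M.
  cbv beta in M; rewrite Ca, Cb in M; fold (sh e x) in M.
  replace (sh e x - b - e * (mu1 x * a)) with
    ((sh e x - b - a * (mu e x - mu0)) + a * (mu e x - mu0 - e * mu1 x)) by ring.
  eapply Rle_trans; [apply Rabs_triang|]; rewrite (Rabs_mult a), (Rabs_pos_eq a) by lra.
  assert (a * Rabs (mu e x - mu0 - e * mu1 x) <= a * (K * e ^ 2)) by (apply Rmult_le_compat_l; lra).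
  lra.
Qed.

(** To first order the point moves by e mu1 (b cos x, a sin x), a vector normal to the ellipse: this
    is the advantage of elliptic coordinates. *)
Lemma qpert_bounds : exists e1 M K, 0 < e1 /\ 0 <= M /\ 0 <= K /\
  forall e x, Rabs e <= e1 ->
    (is_derive (fun s => fst (qpert e s)) x (qpert_x1 e x) /\ is_derive (qpert_x1 e) x (qpert_x2 e x) /\
     is_derive (qpert_x2 e) x (qpert_x3 e x) /\
     is_derive (fun s => snd (qpert e s)) x (qpert_y1 e x) /\ is_derive (qpert_y1 e) x (qpert_y2 e x) /\
     is_derive (qpert_y2 e) x (qpert_y3 e x)) /\
    (Rabs (qpert_x1 e x) <= M /\ Rabs (qpert_x2 e x) <= M /\ Rabs (qpert_x3 e x) <= M /\
     Rabs (qpert_y1 e x) <= M /\ Rabs (qpert_y2 e x) <= M /\ Rabs (qpert_y3 e x) <= M) /\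
    qpert e (x + 2 * PI) = qpert e x /\
    Cmod (qpert e x - ellipse a b x)%C <= K * Rabs e /\
    Rabs (fst (qpert e x) - a * cos x - e * (mu1 x * b * cos x)) <= K * e ^ 2 /\
    Rabs (snd (qpert e x) - b * sin x - e * (mu1 x * a * sin x)) <= K * e ^ 2.
Proof.
destruct ch_sh_near as [e1 [m [K [He1 [Hm [HK H]]]]]].
assert (BM : exists M, forall e x, Rabs e <= e1 ->
  Rabs (qpert_x1 e x) <= M /\ Rabs (qpert_x2 e x) <= M /\ Rabs (qpert_x3 e x) <= M /\
  Rabs (qpert_y1 e x) <= M /\ Rabs (qpert_y2 e x) <= M /\ Rabs (qpert_y3 e x) <= M).
{ assert (R2 : Rabs 2 <= 2) by (rewrite Rabs_pos_eq; lra).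
  assert (R3 : Rabs 3 <= 3) by (rewrite Rabs_pos_eq; lra).
  exists (m * m + m + (m * m + m * m * m + (2 * m * m + m)) +
    (m * m + 3 * (m * m * m) + m * m * m * m + (3 * (m * m + m * m * m) + (3 * (m * m) + m)))).
  intros e x He; destruct (H e x He) as [_ [[B1 [B2 B3]] [[Bc Bs] _]]].
  assert (P2 : 0 <= m * m) by nra; assert (P3 : 0 <= m * m * m) by nra; assert (P4 : 0 <= m * m * m * m) by nra.
  unfold qpert_x1, qpert_x2, qpert_x3, qpert_y1, qpert_y2, qpert_y3.
  refine (conj _ (conj _ (conj _ (conj _ (conj _ _))))); (eapply Rle_trans; [Rabs_bound; eassumption|]); lra. }
destruct BM as [M BM].
exists e1, (Rmax 0 M), (2 * K); split; [easy|]; split; [apply Rmax_l|]; split; [lra|]; intros e x He.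
destruct (H e x He) as [_ [_ [_ [Per [[N1 N2] [N3 N4]]]]]].
split; [apply qpert_derivs; intros y; apply (H e y He)|].
split.
{ destruct (BM e x He) as [B1 [B2 [B3 [B4 [B5 B6]]]]]; pose proof (Rmax_r 0 M); repeat split; lra. }
split; [unfold qpert, elliptic_point; rewrite Per, cos_plus_2PI, sin_plus_2PI; easy|].
assert (E : qpert e x = (ch e x * cos x, sh e x * sin x)) by reflexivity.
rewrite E; simpl fst; simpl snd.
pose proof (Rabs_cos_le x) as Lc; pose proof (Rabs_sin_le x) as Ls.
assert (One : forall u v B, Rabs v <= 1 -> Rabs u <= B -> Rabs (u * v) <= B).
{ intros u v B Hv Hu; replace B with (B * 1) by ring; now apply Rabs_mul_le. }
pose proof (Rabs_pos e); pose proof (pow2_ge_0 e).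
assert (0 <= K * e ^ 2) by (now apply Rmult_le_pos).
split; [|split].
- replace (((ch e x * cos x)%R, (sh e x * sin x)%R) - ellipse a b x)%C
    with (((ch e x - a) * cos x, (sh e x - b) * sin x) : C)
    by (unfold ellipse, Cminus, Cplus, Copp; simpl; f_equal; ring).
  eapply Rle_trans; [apply Cmod_pair|].
  pose proof (One _ _ _ Lc N1); pose proof (One _ _ _ Ls N2); lra.
- replace (ch e x * cos x - a * cos x - e * (mu1 x * b * cos x))
    with ((ch e x - a - e * (mu1 x * b)) * cos x) by ring.
  pose proof (One _ _ _ Lc N3); lra.
- replace (sh e x * sin x - b * sin x - e * (mu1 x * a * sin x))
    with ((sh e x - b - e * (mu1 x * a)) * sin x) by ring.
  pose proof (One _ _ _ Ls N4); lra.
Qed.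

Lemma velocity_qpert (e x : R) :
  is_derive (fun s => fst (qpert e s)) x (qpert_x1 e x) -> is_derive (fun s => snd (qpert e s)) x (qpert_y1 e x) ->
  velocity (qpert e) x = (qpert_x1 e x, qpert_y1 e x).
Proof. intros D1 D2; unfold velocity; f_equal; now apply is_derive_unique. Qed.

Lemma qpert_C2_near (w : R) : 0 < w -> exists e2, 0 < e2 /\ forall e x, Rabs e < e2 ->
  Rabs (qpert_x1 e x + a * sin x) <= w /\ Rabs (qpert_y1 e x - b * cos x) <= w /\
  Rabs (qpert_x2 e x + a * cos x) <= w /\ Rabs (qpert_y2 e x + b * sin x) <= w.
Proof.
intros Hw; destruct ch_sh_near as [e1 [m [K [He1 [Hm [HK H]]]]]].
destruct mu_bounds as [_ [_ [_ [_ [_ [_ [_ HU]]]]]]].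
(* The longest of the four estimates below is (4 m + 1) w'. *)
set (w' := Rmin 1 (w / (4 * m + 1))).
assert (Hw' : 0 < w') by (apply Rmin_pos; [lra | apply Rdiv_lt_0_compat; lra]).
assert (Hw1 : w' <= 1) by apply Rmin_l.
assert (Hw2 : w' * (4 * m + 1) <= w).
{ apply Rle_trans with (w / (4 * m + 1) * (4 * m + 1)); [apply Rmult_le_compat_r; [lra | apply Rmin_r]|].
  right; field; lra. }
destruct (HU w' Hw') as [e2 [He2 H2]].
exists (Rmin e2 (Rmin e1 (w' / (K + 1)))); split.
{ repeat apply Rmin_pos; try easy; apply Rdiv_lt_0_compat; lra. }
intros e x He.
assert (He' : Rabs e < e2 /\ Rabs e <= e1 /\ Rabs e <= w' / (K + 1)).
{ revert He; unfold Rmin; repeat destruct (Rle_dec _ _); lra. }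
destruct He' as [Ha [Hb Hc]].
destruct (H e x Hb) as [_ [_ [[Bc Bs] [_ [[N1 N2] _]]]]]; destruct (H2 e x Ha) as [B1 B2].
assert (Ke : K * Rabs e <= w').
{ apply Rle_trans with ((K + 1) * (w' / (K + 1))); [|right; field; lra].
  apply Rmult_le_compat; try apply Rabs_pos; lra. }
assert (N1' : Rabs (ch e x - a) <= w') by lra; assert (N2' : Rabs (sh e x - b) <= w') by lra.
assert (R2 : Rabs 2 <= 2) by (rewrite Rabs_pos_eq; lra).
assert (Hww : w' * w' * m <= w' * m) by (apply Rmult_le_compat_r; nra).
assert (0 <= w' * m) by nra.
unfold qpert_x1, qpert_x2, qpert_y1, qpert_y2; refine (conj _ (conj _ (conj _ _))).
- replace (d1 e x * sh e x * cos x - ch e x * sin x + a * sin x)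
    with (d1 e x * sh e x * cos x - (ch e x - a) * sin x) by ring.
  eapply Rle_trans.
  + apply Rabs_sub_le; [Rabs_bound; eassumption | apply Rabs_mul_le; [exact N1' | apply Rabs_sin_le]].
  + lra.
- replace (d1 e x * ch e x * sin x + sh e x * cos x - b * cos x)
    with (d1 e x * ch e x * sin x + (sh e x - b) * cos x) by ring.
  eapply Rle_trans.
  + apply Rabs_add_le; [Rabs_bound; eassumption | apply Rabs_mul_le; [exact N2' | apply Rabs_cos_le]].
  + lra.
- replace ((d2 e x * sh e x + d1 e x * d1 e x * ch e x) * cos x - 2 * (d1 e x * sh e x) * sin x - ch e x * cos x
    + a * cos x)
    with ((d2 e x * sh e x + d1 e x * d1 e x * ch e x) * cos x - 2 * (d1 e x * sh e x) * sin x
     - (ch e x - a) * cos x) by ring.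
  eapply Rle_trans.
  + apply Rabs_sub_le; [Rabs_bound; eassumption | apply Rabs_mul_le; [exact N1' | apply Rabs_cos_le]].
  + lra.
- replace ((d2 e x * ch e x + d1 e x * d1 e x * sh e x) * sin x + 2 * (d1 e x * ch e x) * cos x - sh e x * sin x
    + b * sin x)
    with ((d2 e x * ch e x + d1 e x * d1 e x * sh e x) * sin x + 2 * (d1 e x * ch e x) * cos x
     - (sh e x - b) * sin x) by ring.
  eapply Rle_trans.
  + apply Rabs_sub_le; [Rabs_bound; eassumption | apply Rabs_mul_le; [exact N2' | apply Rabs_sin_le]].
  + lra.
Qed.

(** Within 1 of s or s + 2 PI, where the cross product and its derivative vanish, the sign comes
    from the second derivative, close to a b cos (t - s). Elsewhere the cross product itself is
    close to a b (1 - cos (t - s)) and bounded away from 0. *)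
Lemma qpert_near_convex (w : R) : 0 < w -> exists e2, 0 < e2 /\ forall e, Rabs e < e2 ->
  (forall x, Cmod (velocity (qpert e) x - vel0 a b x)%C <= w) /\
  (forall s t, s < t < s + 2 * PI -> 0 < cross (velocity (qpert e) s) (qpert e t - qpert e s)%C).
Proof.
intros Hw; destruct qpert_bounds as [e1 [M [K [He1 [HM [HK H]]]]]].
pose proof PI_RGT_0 as HP; pose proof PI2_3_2 as HP2.
assert (C1 : 1 / 2 <= cos 1).
{ rewrite <- cos_PI3; apply Rlt_le, cos_decreasing_1; lra. }
assert (C1' : cos 1 < 1).
{ apply Rlt_le_trans with (cos 0); [apply cos_decreasing_1; lra | rewrite cos_0; lra]. }
(* The last two entries keep the error w' (8 a + 4) of the cross products below half of a b (1 - cos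
   1) and half of a b. *)
set (w' := Rmin (w / 2) (Rmin 1 (Rmin (a * b * (1 - cos 1) / (2 * (8 * a + 4))) (a * b / (8 * (2 * a + 2)))))).
assert (Hab : 0 < a * b) by nra.
assert (Q1 : 0 < a * b * (1 - cos 1) / (2 * (8 * a + 4))) by (apply Rdiv_lt_0_compat; nra).
assert (Q2 : 0 < a * b / (8 * (2 * a + 2))) by (apply Rdiv_lt_0_compat; nra).
assert (Hw' : 0 < w' /\ w' <= w / 2 /\ w' <= 1 /\ w' <= a * b * (1 - cos 1) / (2 * (8 * a + 4)) /\
  w' <= a * b / (8 * (2 * a + 2))).
{ unfold w', Rmin; repeat destruct (Rle_dec _ _); lra. }
destruct Hw' as [W0 [W1 [W2 [W3 W4]]]].
assert (W3' : w' * (2 * (8 * a + 4)) <= a * b * (1 - cos 1)).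
{ apply Rmult_le_compat_r with (r := 2 * (8 * a + 4)) in W3; [|lra].
  replace (a * b * (1 - cos 1) / (2 * (8 * a + 4)) * (2 * (8 * a + 4))) with (a * b * (1 - cos 1)) in W3 by (field; lra); easy. }
assert (W4' : w' * (8 * (2 * a + 2)) <= a * b).
{ apply Rmult_le_compat_r with (r := 8 * (2 * a + 2)) in W4; [|lra].
  replace (a * b / (8 * (2 * a + 2)) * (8 * (2 * a + 2))) with (a * b) in W4 by (field; lra); easy. }
destruct (qpert_C2_near w' W0) as [e2 [He2 H2]].
exists (Rmin e2 (Rmin e1 (w' / (K + 1)))); split.
{ repeat apply Rmin_pos; try easy; apply Rdiv_lt_0_compat; lra. }
intros e He.
assert (He' : Rabs e < e2 /\ Rabs e <= e1 /\ Rabs e <= w' / (K + 1)).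
{ revert He; unfold Rmin; repeat destruct (Rle_dec _ _); lra. }
destruct He' as [Ha [Hb Hc]]; clear He.
assert (Ke : K * Rabs e <= w').
{ apply Rle_trans with ((K + 1) * (w' / (K + 1))); [|right; field; lra].
  apply Rmult_le_compat; try apply Rabs_pos; lra. }
assert (DX : forall x, is_derive (fun s => fst (qpert e s)) x (qpert_x1 e x)).
{ intros x; exact (proj1 (proj1 (H e x Hb))). }
assert (DY : forall x, is_derive (fun s => snd (qpert e s)) x (qpert_y1 e x)).
{ intros x; exact (proj1 (proj2 (proj2 (proj2 (proj1 (H e x Hb)))))). }
assert (Per : forall x, qpert e (x + 2 * PI) = qpert e x).
{ intros x; exact (proj1 (proj2 (proj2 (H e x Hb)))). }
assert (Pq : forall y, Cmod (qpert e y - ellipse a b y)%C <= w').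
{ intros y; apply Rle_trans with (K * Rabs e); [exact (proj1 (proj2 (proj2 (proj2 (H e y Hb))))) | easy]. }
assert (V : forall x, velocity (qpert e) x = (qpert_x1 e x, qpert_y1 e x)).
{ intros x; now apply velocity_qpert. }
split.
- intros x; rewrite V; destruct (H2 e x Ha) as [B1 [B2 _]].
  replace ((qpert_x1 e x, qpert_y1 e x) - vel0 a b x)%C with ((qpert_x1 e x + a * sin x, qpert_y1 e x - b * cos x) : C)
    by (unfold vel0, Cminus, Cplus, Copp; simpl; f_equal; ring).
  eapply Rle_trans; [apply Cmod_pair | lra].
- intros s t Hst; rewrite V.
  set (F := fun t => cross (qpert_x1 e s, qpert_y1 e s) (qpert e t - qpert e s)%C).
  set (F1 := fun t => cross (qpert_x1 e s, qpert_y1 e s) (qpert_x1 e t, qpert_y1 e t)).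
  set (F2 := fun t => cross (qpert_x1 e s, qpert_y1 e s) (qpert_x2 e t, qpert_y2 e t)).
  assert (DF : forall t, is_derive F t (F1 t) /\ is_derive F1 t (F2 t)).
  { intros y; destruct (H e y Hb) as [[D1 [D2 [_ [D3 [D4 _]]]]] _].
    unfold F, F1, F2, cross; simpl fst; simpl snd; split.
    - apply (is_derive_minus (V := R_NormedModule)); apply is_derive_scal; evar_last.
      + apply (is_derive_minus (V := R_NormedModule)); [exact D3 | apply is_derive_const].
      + unfold minus, plus, opp, zero; simpl; ring.
      + apply (is_derive_minus (V := R_NormedModule)); [exact D1 | apply is_derive_const].
      + unfold minus, plus, opp, zero; simpl; ring.
    - apply (is_derive_minus (V := R_NormedModule)); apply is_derive_scal; assumption. }
  assert (MV : forall f f' : R -> R, (forall y, is_derive f y (f' y)) -> forall u v, u < v ->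
    exists z, u < z < v /\ f v - f u = f' z * (v - u)).
  { intros f f' D u v Huv; destruct (MVT_cor2 f f' u v Huv) as [z [E Hz]].
    - intros; now apply is_derive_Reals.
    - exists z; easy. }
  destruct (H2 e s Ha) as [S1 [S2 _]].
  pose proof (Rabs_sin_le s) as Ls; pose proof (Rabs_cos_le s) as Lc.
  assert (Pert : forall p r p' r', Rabs (p - p') <= w' -> Rabs (r - r') <= w' ->
    Rabs p' <= 2 * a -> Rabs r' <= 2 * a ->
    Rabs (cross (qpert_x1 e s, qpert_y1 e s) (p, r) - cross (vel0 a b s) (p', r')) <= w' * (8 * a + 4)).
  { intros p r p' r' Hp Hr Hp' Hr'; unfold cross, vel0; simpl fst; simpl snd.
    set (x := qpert_x1 e s + a * sin s) in *; set (y := qpert_y1 e s - b * cos s) in *.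
    replace (qpert_x1 e s) with (- a * sin s + x) by (unfold x; ring).
    replace (qpert_y1 e s) with (b * cos s + y) by (unfold y; ring).
    replace ((- a * sin s + x) * r - (b * cos s + y) * p - (- a * sin s * r' - b * cos s * p'))
      with ((x * (r - r') + x * r' - a * sin s * (r - r')) - (b * cos s * (p - p') + y * (p - p') + y * p')) by ring.
    assert (Ba : Rabs a <= a) by (rewrite Rabs_pos_eq; lra).
    assert (Bb : Rabs b <= a) by (rewrite Rabs_pos_eq; lra).
    eapply Rle_trans.
    - apply Rabs_sub_le.
      + apply Rabs_sub_le; [apply Rabs_add_le|]; apply Rabs_mul_le; try eassumption.
        apply Rabs_mul_le; eassumption.
      + apply Rabs_add_le; [apply Rabs_add_le|]; apply Rabs_mul_le; try eassumption.
        apply Rabs_mul_le; eassumption.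
    - nra. }
  assert (F2pos : forall y, cos (y - s) >= 1 / 2 -> 0 < F2 y).
  { intros y Hy; destruct (H2 e y Ha) as [_ [_ [T1 T2]]].
    assert (P := Pert (qpert_x2 e y) (qpert_y2 e y) (- a * cos y) (- b * sin y)).
    assert (E : cross (vel0 a b s) (- a * cos y, - b * sin y) = a * b * cos (y - s)).
    { rewrite cos_minus; unfold cross, vel0; simpl; ring. }
    rewrite E in P; fold (F2 y) in P.
    assert (P' : Rabs (F2 y - a * b * cos (y - s)) <= w' * (8 * a + 4)).
    { apply P.
      - replace (qpert_x2 e y - - a * cos y) with (qpert_x2 e y + a * cos y) by ring; easy.
      - replace (qpert_y2 e y - - b * sin y) with (qpert_y2 e y + b * sin y) by ring; easy.
      - rewrite Rabs_mult, Rabs_Ropp, (Rabs_pos_eq a) by lra; pose proof (Rabs_cos_le y); nra.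
      - rewrite Rabs_mult, Rabs_Ropp, (Rabs_pos_eq b) by lra; pose proof (Rabs_sin_le y); nra. }
    apply Rabs_le_between in P'; nra. }
  assert (Fs : F s = 0 /\ F1 s = 0).
  { unfold F, F1, cross, Cminus, Cplus, Copp; simpl; split; ring. }
  assert (Fs' : F (s + 2 * PI) = 0 /\ F1 (s + 2 * PI) = 0).
  { destruct Fs as [G1 G2]; rewrite <- G1, <- G2 at 1; unfold F, F1.
    rewrite Per; split; [easy|].
    rewrite <- !V; unfold velocity.
    rewrite !(Derive_period _ (2 * PI)).
    - easy.
    - intros y; now rewrite Per.
    - eexists; apply DY.
    - intros y; now rewrite Per.
    - eexists; apply DX. }
  assert (Cc : forall y, Rabs y <= 1 -> cos y >= 1 / 2).
  { intros y Hy; apply Rle_ge, Rle_trans with (cos 1); [easy|].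
    assert (E : cos y = cos (Rabs y)).
    { unfold Rabs; destruct (Rcase_abs y); [now rewrite cos_neg | easy]. }
    rewrite E; pose proof (Rabs_pos y).
    destruct Hy as [Hy | ->]; [|lra]; left; apply cos_decreasing_1; lra. }
  destruct (Rle_dec t (s + 1)) as [L1 | L1]; [|destruct (Rle_dec (s + 2 * PI - 1) t) as [L2 | L2]].
  + destruct (MV F F1 (fun y => proj1 (DF y)) s t) as [z [Hz Ez]]; [lra|].
    destruct (MV F1 F2 (fun y => proj2 (DF y)) s z) as [z' [Hz' Ez']]; [lra|].
    assert (0 < F2 z') by (apply F2pos, Cc; rewrite Rabs_pos_eq; lra).
    destruct Fs as [G1 G2].
    assert (P1 : 0 < F2 z' * (z - s)) by (apply Rmult_lt_0_compat; lra).
    assert (P2 : 0 < F1 z * (t - s)) by (apply Rmult_lt_0_compat; lra).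
    fold (F t); lra.
  + destruct (MV F F1 (fun y => proj1 (DF y)) t (s + 2 * PI)) as [z [Hz Ez]]; [lra|].
    destruct (MV F1 F2 (fun y => proj2 (DF y)) z (s + 2 * PI)) as [z' [Hz' Ez']]; [lra|].
    assert (0 < F2 z').
    { apply F2pos; replace (z' - s) with (z' - s - 2 * PI + 2 * PI) by ring.
      replace (cos (z' - s - 2 * PI + 2 * PI)) with (cos (z' - s - 2 * PI)).
      - apply Cc; rewrite Rabs_left; lra.
      - now rewrite cos_plus_2PI. }
    destruct Fs' as [G1 G2].
    assert (P1 : 0 < F2 z' * (s + 2 * PI - z)) by (apply Rmult_lt_0_compat; lra).
    assert (P2 : 0 < - F1 z * (s + 2 * PI - t)) by (apply Rmult_lt_0_compat; lra).
    fold (F t); lra.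
  + set (p := fst (qpert e t) - fst (qpert e s)); set (r := snd (qpert e t) - snd (qpert e s)).
    assert (Ep : F t = cross (qpert_x1 e s, qpert_y1 e s) (p, r)) by reflexivity.
    fold (F t); rewrite Ep.
    assert (Np : forall y, Rabs (fst (qpert e y) - a * cos y) <= w' /\ Rabs (snd (qpert e y) - b * sin y) <= w').
    { intros y; specialize (Pq y); split; (eapply Rle_trans; [|exact Pq]).
      - apply (re_le_Cmod (qpert e y - ellipse a b y)%C).
      - apply (im_le_Cmod (qpert e y - ellipse a b y)%C). }
    destruct (Np t) as [T1 T2]; destruct (Np s) as [T3 T4].
    assert (CC : cos (t - s) <= cos 1).
    { destruct (Rle_dec (t - s) PI) as [L | L].
      - left; apply cos_decreasing_1; lra.
      - replace (t - s) with (- (s + 2 * PI - t) + 2 * PI) by ring.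
        rewrite cos_plus_2PI, cos_neg; destruct (Req_dec (s + 2 * PI - t) 1) as [-> | N]; [lra|].
        left; apply cos_decreasing_1; lra. }
    assert (E : cross (vel0 a b s) (a * cos t - a * cos s, b * sin t - b * sin s) = a * b * (1 - cos (t - s))).
    { rewrite cos_minus; unfold cross, vel0; simpl.
      transitivity (a * b * (sin s ^ 2 + cos s ^ 2 - (cos t * cos s + sin t * sin s))); [ring|].
      rewrite trig2; ring. }
    set (x := qpert_x1 e s + a * sin s) in *; set (y := qpert_y1 e s - b * cos s) in *.
    set (dp := p - (a * cos t - a * cos s)); set (dr := r - (b * sin t - b * sin s)).
    assert (Hdp : Rabs dp <= 2 * w').
    { unfold dp, p; replace (fst (qpert e t) - fst (qpert e s) - (a * cos t - a * cos s))
        with ((fst (qpert e t) - a * cos t) - (fst (qpert e s) - a * cos s)) by ring.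
      replace (2 * w') with (w' + w') by ring; now apply Rabs_sub_le. }
    assert (Hdr : Rabs dr <= 2 * w').
    { unfold dr, r; replace (snd (qpert e t) - snd (qpert e s) - (b * sin t - b * sin s))
        with ((snd (qpert e t) - b * sin t) - (snd (qpert e s) - b * sin s)) by ring.
      replace (2 * w') with (w' + w') by ring; now apply Rabs_sub_le. }
    assert (Z : Rabs (cross (qpert_x1 e s, qpert_y1 e s) (p, r) - a * b * (1 - cos (t - s))) <= w' * (8 * a + 4)).
    { rewrite <- E; unfold cross, vel0; simpl fst; simpl snd.
      replace (qpert_x1 e s) with (- a * sin s + x) by (unfold x; ring).
      replace (qpert_y1 e s) with (b * cos s + y) by (unfold y; ring).
      replace p with (a * cos t - a * cos s + dp) by (unfold dp; ring).
      replace r with (b * sin t - b * sin s + dr) by (unfold dr; ring).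
      match goal with |- Rabs ?A <= _ => replace A with
        ((x * (b * sin t - b * sin s) + x * dr - a * sin s * dr) -
         (y * (a * cos t - a * cos s) + y * dp + b * cos s * dp)) by ring end.
      assert (Ba : Rabs a <= a) by (rewrite Rabs_pos_eq; lra).
      assert (Bb : Rabs b <= b) by (rewrite Rabs_pos_eq; lra).
      pose proof (Rabs_sin_le t) as Lst; pose proof (Rabs_cos_le t) as Lct.
      assert (Ld : forall k u v, 0 <= k -> Rabs u <= 1 -> Rabs v <= 1 -> Rabs (k * u - k * v) <= 2 * k).
      { intros k u v Hk Hu Hv; replace (k * u - k * v) with (k * (u - v)) by ring.
        rewrite Rabs_mult, (Rabs_pos_eq k), Rmult_comm by easy; apply Rmult_le_compat_r; [easy|].
        replace 2 with (1 + 1) by ring; now apply Rabs_sub_le. }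
      eapply Rle_trans.
      - apply Rabs_sub_le.
        + apply Rabs_sub_le; [apply Rabs_add_le|]; apply Rabs_mul_le; try eassumption.
          * apply Ld; [lra | easy | easy].
          * apply Rabs_mul_le; eassumption.
        + apply Rabs_add_le; [apply Rabs_add_le|]; apply Rabs_mul_le; try eassumption.
          * apply Ld; [lra | easy | easy].
          * apply Rabs_mul_le; eassumption.
      - assert (w' * b <= w' * a) by (apply Rmult_le_compat_l; lra).
        assert (w' * w' <= w' * 1) by (apply Rmult_le_compat_l; lra).
        lra. }
    apply Rabs_le_between in Z.
    assert (a * b * (1 - cos 1) <= a * b * (1 - cos (t - s))) by (apply Rmult_le_compat_l; lra).
    assert (0 < w' * (8 * a + 4)) by nra.
    lra.
Qed.

End Perturbation.

(** * Critical polygons *)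

Lemma mvt_unit (f f' : R -> R) (x y : R) : 0 <= x <= 1 -> 0 <= y <= 1 ->
  (forall u, 0 <= u <= 1 -> is_derive f u (f' u)) ->
  exists z, 0 <= z <= 1 /\ f y - f x = f' z * (y - x).
Proof.
intros Hx Hy D; destruct (MVT_gen f x y f') as [z [Hz E]].
- intros u Hu; apply D; revert Hu; unfold Rmin, Rmax; destruct (Rle_dec x y); lra.
- intros u Hu; apply continuity_pt_ex_derive; eexists; apply D.
  revert Hu; unfold Rmin, Rmax; destruct (Rle_dec x y); lra.
- exists z; split; [|easy]; revert Hz; unfold Rmin, Rmax; destruct (Rle_dec x y); lra.
Qed.

Lemma one_critical_bound (g g1 g2 : R -> R) (K : R) :
  (forall u, 0 <= u <= 1 -> is_derive g u (g1 u) /\ is_derive g1 u (g2 u) /\ Rabs (g2 u) <= K) ->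
  g1 0 = 0 -> Rabs (g 1 - g 0) <= K.
Proof.
intros H H0.
destruct (mvt_unit g g1 0 1) as [z [Hz ->]]; [lra | lra | intros; now apply H |].
destruct (mvt_unit g1 g2 0 z) as [z' [Hz' E]]; [lra | lra | intros; now apply H |].
rewrite H0, !Rminus_0_r in E; rewrite E, Rminus_0_r, Rmult_1_r, Rabs_mult, (Rabs_pos_eq z) by lra.
destruct (H z' Hz') as [_ [_ B]]; pose proof (Rabs_pos (g2 z')); nra.
Qed.

(** By Rolle g2 vanishes somewhere, so the bound of g3 passes to g2, then to g1 and g: one order
    more than with a single critical end. *)
Lemma two_critical_bound (g g1 g2 g3 : R -> R) (K : R) :
  (forall u, 0 <= u <= 1 -> is_derive g u (g1 u) /\ is_derive g1 u (g2 u) /\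
     is_derive g2 u (g3 u) /\ Rabs (g3 u) <= K) ->
  g1 0 = 0 -> g1 1 = 0 -> Rabs (g 1 - g 0) <= K.
Proof.
intros H H0 H1.
destruct (mvt_unit g1 g2 0 1) as [c [Hc Ec]]; [lra | lra | intros; now apply H |].
assert (Z : g2 c = 0) by lra.
apply (one_critical_bound g g1 g2); [|easy].
intros u Hu; destruct (H u Hu) as [D1 [D2 _]]; split; [easy|]; split; [easy|].
destruct (mvt_unit g2 g3 c u) as [z [Hz E]]; [lra | lra | intros; now apply H |].
rewrite Z, Rminus_0_r in E; rewrite E, Rabs_mult.
destruct (H z Hz) as [_ [_ [_ B]]]; pose proof (Rabs_pos (g3 z)).
assert (Rabs (u - c) <= 1) by (apply Rabs_le; lra); pose proof (Rabs_pos (u - c)); nra.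
Qed.

Lemma Rsum_ext (n : nat) (f g : nat -> R) :
  (forall j, (j < n)%nat -> f j = g j) -> Rsum n f = Rsum n g.
Proof. induction n as [|n IH]; intros H; simpl; [easy|]; rewrite IH, H; auto. Qed.

Lemma Rsum_abs (n : nat) (f : nat -> R) (K : R) :
  (forall j, (j < n)%nat -> Rabs (f j) <= K) -> Rabs (Rsum n f) <= INR n * K.
Proof.
induction n as [|n IH]; intros H; [simpl; rewrite Rabs_R0; lra|].
rewrite S_INR; simpl Rsum; eapply Rle_trans; [apply Rabs_triang|].
assert (Rabs (Rsum n f) <= INR n * K) by auto; assert (Rabs (f n) <= K) by auto; lra.
Qed.

Lemma Rsum_telescope (n : nat) (f : nat -> R) :
  Rsum n (fun j => f (S j) - f j) = f n - f 0%nat.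
Proof. induction n as [|n IH]; simpl; [ring | rewrite IH; ring]. Qed.

Lemma Rsum_minus (n : nat) (f g : nat -> R) :
  Rsum n f - Rsum n g = Rsum n (fun j => f j - g j).
Proof. induction n as [|n IH]; simpl; [ring | rewrite <- IH; ring]. Qed.

Lemma is_derive_Rsum (n : nat) (f f' : nat -> R -> R) (u : R) :
  (forall j, (j < n)%nat -> is_derive (f j) u (f' j u)) ->
  is_derive (fun u => Rsum n (fun j => f j u)) u (Rsum n (fun j => f' j u)).
Proof.
induction n as [|n IH]; intros H; simpl; [apply (is_derive_const (V := R_NormedModule))|].
apply (is_derive_plus (V := R_NormedModule)); auto.
Qed.

Definition len (q : curve) (s t : R) : R := Cmod (q t - q s)%C.

Definition perimeter (q : curve) (n : nat) (x : nat -> R) : R :=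
  Rsum n (fun j => len q (x j) (x (S j))).

(* The reflection law says that P is well defined: P j is the cosine of the angle with the
   curve at x j times the speed, computed from either adjacent side. *)
Definition critical (q : curve) (n : nat) (x : nat -> R) : Prop :=
  exists P : nat -> R, P n = P 0%nat /\ forall j, (j < n)%nat ->
    dot (velocity q (x j)) (q (x (S j)) - q (x j))%C / len q (x j) (x (S j)) = P j /\
    dot (velocity q (x (S j))) (q (x (S j)) - q (x j))%C / len q (x j) (x (S j)) = P (S j).

(** Term by term the bound of the third derivative of sqrt w in [sqrt_derivs], for |w^(i)| <= A
    eta^i and sqrt w >= r, without its factor eta^3; it also dominates the second derivative. A = 64
    M^2 is what the third derivative of the squared length requires. *)
Definition perimeter_const (M r : R) : R :=
  let A := 64 * M * M in
  A * / r / 2 + 3 / 4 * (A * A * (/ r * / r * / r)) + 3 / 8 * (A * A * A * (/ r * / r * / r * / r * / r)).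

Lemma sqrt_derivs (w w1 w2 w3 : R -> R) (u : R) : 0 < w u ->
  is_derive w u (w1 u) -> is_derive w1 u (w2 u) -> is_derive w2 u (w3 u) ->
  let i := fun u => / sqrt (w u) in
  let f1 := fun u => / 2 * (w1 u * i u) in
  let f2 := fun u => / 2 * (w2 u * i u) - / 4 * (w1 u * w1 u * (i u * i u * i u)) in
  let f3 := fun u => / 2 * (w3 u * i u) - 3 / 4 * (w1 u * w2 u * (i u * i u * i u))
    + 3 / 8 * (w1 u * w1 u * w1 u * (i u * i u * i u * i u * i u)) in
  is_derive (fun u => sqrt (w u)) u (f1 u) /\ is_derive f1 u (f2 u) /\ is_derive f2 u (f3 u).
Proof.
intros Hw D0 D1 D2 i f1 f2 f3.
assert (Hs : 0 < sqrt (w u)) by (now apply sqrt_lt_R0).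
assert (U0 := is_derive_unique _ _ _ D0); assert (U1 := is_derive_unique _ _ _ D1).
assert (U2 := is_derive_unique _ _ _ D2).
assert (V0 : ex_derive w u) by (eexists; exact D0).
assert (V1 : ex_derive w1 u) by (eexists; exact D1).
assert (V2 : ex_derive w2 u) by (eexists; exact D2).
unfold f1, f2, f3, i; refine (conj _ (conj _ _)).
- auto_derive; [repeat split; auto|]; change (fun x => w x) with w; rewrite U0; field; lra.
- auto_derive; [repeat split; auto; lra|]; change (fun x => w x) with w; change (fun x => w1 x) with w1.
  rewrite U0, U1; field; lra.
- auto_derive; [repeat split; auto; lra|].
  change (fun x => w x) with w; change (fun x => w1 x) with w1; change (fun x => w2 x) with w2.
  rewrite U0, U1, U2; field; lra.
Qed.

Section Length.

Context (q : curve) (X1 X2 X3 Y1 Y2 Y3 : R -> R) (M r : R) (Hr : 0 < r) (HM : 0 <= M)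
  (D : forall x, is_derive (fun s => fst (q s)) x (X1 x) /\ is_derive X1 x (X2 x) /\
     is_derive X2 x (X3 x) /\ is_derive (fun s => snd (q s)) x (Y1 x) /\
     is_derive Y1 x (Y2 x) /\ is_derive Y2 x (Y3 x))
  (B0 : forall x, Rabs (fst (q x)) <= M /\ Rabs (snd (q x)) <= M)
  (B : forall x, Rabs (X1 x) <= M /\ Rabs (X2 x) <= M /\ Rabs (X3 x) <= M /\
     Rabs (Y1 x) <= M /\ Rabs (Y2 x) <= M /\ Rabs (Y3 x) <= M).

Lemma chord_derivs (s s' d d' eta : R) : 0 <= eta -> Rabs d <= eta -> Rabs d' <= eta ->
  (forall u, 0 <= u <= 1 -> r <= len q (s + u * d) (s' + u * d')) ->
  exists f1 f2 f3, (forall u, 0 <= u <= 1 ->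
      is_derive (fun u => len q (s + u * d) (s' + u * d')) u (f1 u) /\
      is_derive f1 u (f2 u) /\ is_derive f2 u (f3 u) /\
      Rabs (f2 u) <= perimeter_const M r * eta ^ 2 /\ Rabs (f3 u) <= perimeter_const M r * eta ^ 3) /\
    forall u, f1 u = (dot (velocity q (s' + u * d')) (q (s' + u * d')%R - q (s + u * d)%R)%C * d' -
      dot (velocity q (s + u * d)) (q (s' + u * d')%R - q (s + u * d)%R)%C * d)
      / len q (s + u * d) (s' + u * d').
Proof.
intros He Hd Hd' Hlen.
(* The k-th derivative in u of a coordinate difference has this form, f being the k-th derivative of
   the coordinate; every differentiation brings out one more factor d or d'. *)
set (dif := fun f : R -> R => fun k u => f (s' + u * d') * d' ^ k - f (s + u * d) * d ^ k).
assert (Ddif : forall f f' : R -> R, (forall x, is_derive f x (f' x)) -> forall k u,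
  is_derive (dif f k) u (dif f' (S k) u)).
{ intros f f' Df k u; unfold dif.
  assert (U : forall x, Derive (fun x => f x) x = f' x) by (intros; apply is_derive_unique, Df).
  auto_derive; [repeat split; eexists; apply Df | rewrite !U; simpl; ring]. }
assert (Bdif : forall f, (forall x, Rabs (f x) <= M) -> forall k u, Rabs (dif f k u) <= 2 * M * eta ^ k).
{ intros f Bf k u; unfold dif; replace (2 * M * eta ^ k) with (M * eta ^ k + M * eta ^ k) by ring.
  apply Rabs_sub_le; apply Rabs_mul_le; try apply Bf; rewrite <- RPow_abs; apply pow_incr;
    (split; [apply Rabs_pos | easy]). }
set (U := dif (fun s => fst (q s)) 0%nat); set (V := dif (fun s => snd (q s)) 0%nat).
set (U1 := dif X1 1%nat); set (U2 := dif X2 2%nat); set (U3 := dif X3 3%nat).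
set (V1 := dif Y1 1%nat); set (V2 := dif Y2 2%nat); set (V3 := dif Y3 3%nat).
assert (DU : forall u, is_derive U u (U1 u)) by (intros; apply Ddif; apply D).
assert (DU1 : forall u, is_derive U1 u (U2 u)) by (intros; apply Ddif; apply D).
assert (DU2 : forall u, is_derive U2 u (U3 u)) by (intros; apply Ddif; apply D).
assert (DV : forall u, is_derive V u (V1 u)) by (intros; apply Ddif; apply D).
assert (DV1 : forall u, is_derive V1 u (V2 u)) by (intros; apply Ddif; apply D).
assert (DV2 : forall u, is_derive V2 u (V3 u)) by (intros; apply Ddif; apply D).
assert (BU : forall u, Rabs (U u) <= 2 * M) by (intros u; rewrite <- (Rmult_1_r (2 * M)); apply Bdif, B0).
assert (BV : forall u, Rabs (V u) <= 2 * M) by (intros u; rewrite <- (Rmult_1_r (2 * M)); apply Bdif, B0).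
assert (BU1 : forall u, Rabs (U1 u) <= 2 * M * eta ^ 1) by (apply Bdif, B).
assert (BU2 : forall u, Rabs (U2 u) <= 2 * M * eta ^ 2) by (apply Bdif, B).
assert (BU3 : forall u, Rabs (U3 u) <= 2 * M * eta ^ 3) by (apply Bdif, B).
assert (BV1 : forall u, Rabs (V1 u) <= 2 * M * eta ^ 1) by (apply Bdif, B).
assert (BV2 : forall u, Rabs (V2 u) <= 2 * M * eta ^ 2) by (apply Bdif, B).
assert (BV3 : forall u, Rabs (V3 u) <= 2 * M * eta ^ 3) by (apply Bdif, B).
set (w := fun u => U u * U u + V u * V u).
set (w1 := fun u => 2 * (U u * U1 u + V u * V1 u)).
set (w2 := fun u => 2 * (U1 u * U1 u + U u * U2 u + (V1 u * V1 u + V u * V2 u))).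
set (w3 := fun u => 2 * (3 * (U1 u * U2 u) + U u * U3 u + (3 * (V1 u * V2 u) + V u * V3 u))).
assert (Dw : forall u, is_derive w u (w1 u) /\ is_derive w1 u (w2 u) /\ is_derive w2 u (w3 u)).
{ assert (E : forall f f', (forall x, is_derive f x (f' x)) ->
    (forall x, ex_derive f x) /\ (forall x, Derive (fun y : R => f y) x = f' x)).
  { intros f f' Df; split; intros x; [eexists; apply Df | apply is_derive_unique, Df]. }
  destruct (E _ _ DU) as [e1 u1]; destruct (E _ _ DU1) as [e2 u2]; destruct (E _ _ DU2) as [e3 u3].
  destruct (E _ _ DV) as [e4 u4]; destruct (E _ _ DV1) as [e5 u5]; destruct (E _ _ DV2) as [e6 u6].
  clear - e1 e2 e3 e4 e5 e6 u1 u2 u3 u4 u5 u6.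
  clearbody U U1 U2 U3 V V1 V2 V3.
  intros x; unfold w, w1, w2, w3; refine (conj _ (conj _ _)); (auto_derive; [repeat split; auto|]);
    rewrite ?u1, ?u2, ?u3, ?u4, ?u5, ?u6; ring. }
set (A := 64 * M * M).
assert (R2 : Rabs 2 <= 2) by (rewrite Rabs_pos_eq; lra).
assert (R3 : Rabs 3 <= 3) by (rewrite Rabs_pos_eq; lra).
assert (Hmm : 0 <= M * M) by nra.
assert (Bw1 : forall u, Rabs (w1 u) <= A * eta).
{ intros u; unfold w1; eapply Rle_trans; [Rabs_bound; eauto|].
  unfold A; assert (0 <= M * M * eta) by nra; simpl; lra. }
assert (Bw2 : forall u, Rabs (w2 u) <= A * eta ^ 2).
{ intros u; unfold w2; eapply Rle_trans; [Rabs_bound; eauto|].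
  unfold A; assert (0 <= M * M * eta ^ 2) by (apply Rmult_le_pos; [easy | nra]); simpl in *; lra. }
assert (Bw3 : forall u, Rabs (w3 u) <= A * eta ^ 3).
{ intros u; unfold w3; eapply Rle_trans; [Rabs_bound; eauto|].
  unfold A; assert (0 <= M * M * eta ^ 3) by (apply Rmult_le_pos; [easy | now apply pow_le]); simpl in *; lra. }
assert (Elen : forall u, len q (s + u * d) (s' + u * d') = sqrt (w u)).
{ intros u; unfold len, Cmod; f_equal; unfold w, U, V, dif, Cminus, Cplus, Copp; simpl; ring. }
assert (Pw : forall u, 0 <= u <= 1 -> 0 < w u /\ r <= sqrt (w u)).
{ intros u Hu; specialize (Hlen u Hu); rewrite Elen in Hlen; split; [|easy].
  apply sqrt_lt_0_alt; rewrite sqrt_0; lra. }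
set (i := fun u => / sqrt (w u)).
exists (fun u => / 2 * (w1 u * i u)),
  (fun u => / 2 * (w2 u * i u) - / 4 * (w1 u * w1 u * (i u * i u * i u))),
  (fun u => / 2 * (w3 u * i u) - 3 / 4 * (w1 u * w2 u * (i u * i u * i u))
    + 3 / 8 * (w1 u * w1 u * w1 u * (i u * i u * i u * i u * i u))).
assert (Hir : 0 < / r) by (now apply Rinv_0_lt_compat).
assert (HA : 0 <= A) by (unfold A; nra).
split.
- intros u Hu; destruct (Pw u Hu) as [P1 P2]; destruct (Dw u) as [D1 [D2 D3]].
  destruct (sqrt_derivs w w1 w2 w3 u P1 D1 D2 D3) as [F1 [F2 F3]].
  split; [apply (is_derive_ext (fun u => sqrt (w u))); [intros; now rewrite Elen | exact F1]|].
  split; [exact F2|]; split; [exact F3|].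
  assert (Bi : Rabs (i u) <= / r).
  { unfold i; rewrite Rabs_pos_eq by (left; apply Rinv_0_lt_compat; lra); apply Rinv_le_contravar; lra. }
  assert (C2 : Rabs (/ 2) <= / 2) by (rewrite Rabs_pos_eq; lra).
  assert (C4 : Rabs (/ 4) <= / 4) by (rewrite Rabs_pos_eq; lra).
  assert (C34 : Rabs (3 / 4) <= 3 / 4) by (rewrite Rabs_pos_eq; lra).
  assert (C38 : Rabs (3 / 8) <= 3 / 8) by (rewrite Rabs_pos_eq; lra).
  assert (T1 : 0 <= A * / r) by (apply Rmult_le_pos; lra).
  assert (T2 : 0 <= A * A * (/ r * / r * / r)).
  { repeat apply Rmult_le_pos; lra. }
  assert (T3 : 0 <= A * A * A * (/ r * / r * / r * / r * / r)).
  { repeat apply Rmult_le_pos; lra. }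
  unfold perimeter_const; fold A.
  set (t1 := A * / r) in *; set (t2 := A * A * (/ r * / r * / r)) in *.
  set (t3 := A * A * A * (/ r * / r * / r * / r * / r)) in *.
  split.
  + eapply Rle_trans; [Rabs_bound; eauto|].
    assert (E2 : 0 <= eta ^ 2) by apply pow2_ge_0.
    replace (/ 2 * (A * eta ^ 2 * / r) + / 4 * (A * eta * (A * eta) * (/ r * / r * / r)))
      with ((t1 / 2 + t2 / 4) * eta ^ 2) by (unfold t1, t2; field; lra).
    apply Rmult_le_compat_r; lra.
  + eapply Rle_trans; [Rabs_bound; eauto|].
    assert (E2 : 0 <= eta ^ 3) by (now apply pow_le).
    right; unfold t1, t2, t3; field; lra.
- intros u; rewrite Elen; unfold w1, i, U, V, U1, V1, dif, dot, velocity; simpl fst; simpl snd.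
  rewrite !(is_derive_unique _ _ _ (proj1 (D _))).
  rewrite !(is_derive_unique _ _ _ (proj1 (proj2 (proj2 (proj2 (D _)))))).
  unfold Cminus, Cplus, Copp, Rdiv; simpl; set (m := sqrt (w u)); generalize (/ m); intros; field.
Qed.

(** The polygons are joined by linear interpolation of their parameters. At a critical polygon the
    derivative of the perimeter telescopes to P n d n - P 0 d 0, which vanishes because the first
    and the last vertex are displaced equally. *)
Lemma perimeter_near (n : nat) (x y : nat -> R) (eta : R) : 0 <= eta ->
  (forall j, (j <= n)%nat -> Rabs (y j - x j) <= eta) ->
  y n - x n = y 0%nat - x 0%nat ->
  (forall j u, (j < n)%nat -> 0 <= u <= 1 ->
     r <= len q (x j + u * (y j - x j)) (x (S j) + u * (y (S j) - x (S j)))) ->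
  critical q n x ->
  Rabs (perimeter q n y - perimeter q n x) <= INR n * (perimeter_const M r * eta ^ 2) /\
  (critical q n y -> Rabs (perimeter q n y - perimeter q n x) <= INR n * (perimeter_const M r * eta ^ 3)).
Proof.
intros He Hd Hn Hlen Cx.
set (d := fun j => y j - x j).
assert (N : forall j, exists F : (R -> R) * (R -> R) * (R -> R), (j < n)%nat ->
  let '(f1, f2, f3) := F in (forall u, 0 <= u <= 1 ->
      is_derive (fun u => len q (x j + u * d j) (x (S j) + u * d (S j))) u (f1 u) /\
      is_derive f1 u (f2 u) /\ is_derive f2 u (f3 u) /\
      Rabs (f2 u) <= perimeter_const M r * eta ^ 2 /\ Rabs (f3 u) <= perimeter_const M r * eta ^ 3) /\
    forall u, f1 u = (dot (velocity q (x (S j) + u * d (S j))) (q (x (S j) + u * d (S j))%R - q (x j + u * d j)%R)%C * d (S j) -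
      dot (velocity q (x j + u * d j)) (q (x (S j) + u * d (S j))%R - q (x j + u * d j)%R)%C * d j)
      / len q (x j + u * d j) (x (S j) + u * d (S j))).
{ intros j; destruct (le_lt_dec n j) as [L | L].
  - exists (fun _ => 0, fun _ => 0, fun _ => 0); lia.
  - destruct (chord_derivs (x j) (x (S j)) (d j) (d (S j)) eta He) as [f1 [f2 [f3 H]]].
    + apply Hd; lia.
    + apply Hd; lia.
    + intros u Hu; now apply Hlen.
    + exists (f1, f2, f3); intros _; exact H. }
destruct (choice _ N) as [F HF]; clear N.
set (f1 := fun j => fst (fst (F j))); set (f2 := fun j => snd (fst (F j))); set (f3 := fun j => snd (F j)).
assert (HF' : forall j, (j < n)%nat -> (forall u, 0 <= u <= 1 ->
      is_derive (fun u => len q (x j + u * d j) (x (S j) + u * d (S j))) u (f1 j u) /\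
      is_derive (f1 j) u (f2 j u) /\ is_derive (f2 j) u (f3 j u) /\
      Rabs (f2 j u) <= perimeter_const M r * eta ^ 2 /\ Rabs (f3 j u) <= perimeter_const M r * eta ^ 3) /\
    forall u, f1 j u = (dot (velocity q (x (S j) + u * d (S j))) (q (x (S j) + u * d (S j))%R - q (x j + u * d j)%R)%C * d (S j) -
      dot (velocity q (x j + u * d j)) (q (x (S j) + u * d (S j))%R - q (x j + u * d j)%R)%C * d j)
      / len q (x j + u * d j) (x (S j) + u * d (S j))).
{ intros j Hj; specialize (HF j Hj); unfold f1, f2, f3; destruct (F j) as [[g1 g2] g3]; exact HF. }
clearbody f1 f2 f3; clear HF F.
set (g := fun u => Rsum n (fun j => len q (x j + u * d j) (x (S j) + u * d (S j)))).
set (g1 := fun u => Rsum n (fun j => f1 j u)).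
assert (G0 : g 0 = perimeter q n x).
{ apply Rsum_ext; intros; f_equal; ring. }
assert (G1 : g 1 = perimeter q n y).
{ apply Rsum_ext; intros; unfold d; f_equal; ring. }
assert (Dg : forall u, 0 <= u <= 1 -> is_derive g u (g1 u)).
{ intros u Hu; apply (is_derive_Rsum n (fun j u => len q (x j + u * d j) (x (S j) + u * d (S j))) f1).
  intros j Hj; now apply HF'. }
assert (Dg1 : forall u, 0 <= u <= 1 -> is_derive g1 u (Rsum n (fun j => f2 j u))).
{ intros u Hu; apply is_derive_Rsum; intros j Hj; now apply HF'. }
assert (Dg2 : forall u, 0 <= u <= 1 -> is_derive (fun u => Rsum n (fun j => f2 j u)) u (Rsum n (fun j => f3 j u))).
{ intros u Hu; apply is_derive_Rsum; intros j Hj; now apply HF'. }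
assert (Z : forall u z, (forall j, x j + u * d j = z j) -> critical q n z -> g1 u = 0).
{ intros u z Ez [P [HP1 HP2]]; unfold g1.
  rewrite (Rsum_ext n _ (fun j => P (S j) * d (S j) - P j * d j)).
  - rewrite (Rsum_telescope n (fun j => P j * d j)), HP1; unfold d; rewrite Hn; ring.
  - intros j Hj; destruct (HP2 j Hj) as [Q1 Q2]; rewrite (proj2 (HF' j Hj)), !Ez, <- Q1, <- Q2.
    unfold Rdiv; ring. }
assert (Z0 : g1 0 = 0) by (apply (Z 0 x); [intros; ring | easy]).
rewrite <- G0, <- G1; split.
- apply (one_critical_bound g g1 (fun u => Rsum n (fun j => f2 j u))); [|easy].
  intros u Hu; split; [auto|]; split; [auto|]; apply Rsum_abs; intros j Hj; now apply HF'.
- intros Cy; assert (Z1 : g1 1 = 0) by (apply (Z 1 y); [intros; unfold d; ring | easy]).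
  apply (two_critical_bound g g1 (fun u => Rsum n (fun j => f2 j u)) (fun u => Rsum n (fun j => f3 j u)));
    [| easy | easy].
  intros u Hu; split; [auto|]; split; [auto|]; split; [auto|]; apply Rsum_abs; intros j Hj; now apply HF'.
Qed.

End Length.

Lemma billiard_critical (q : curve) (n : nat) (x : nat -> R) :
  billiard_trajectory q x -> (forall j, q (x (j + n)%nat) = q (x j)) ->
  velocity q (x n) = velocity q (x 0%nat) -> critical q n x.
Proof.
intros Hx Hp Hv.
exists (fun j => dot (velocity q (x j)) (q (x (S j)) - q (x j))%C / len q (x j) (x (S j))).
split.
- unfold len; rewrite Hv; pose proof (Hp 0%nat) as H0; pose proof (Hp 1%nat) as H1.
  simpl in H0, H1; rewrite H0, H1; easy.
- intros j Hj; split; [easy|].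
  destruct (Hx j) as [_ [H _]]; exact H.
Qed.

(** * Orbits tangent to the elliptical caustic *)

Lemma cos_pos_reduce (y : R) : 0 < cos y -> exists n : Z, Rabs (y + 2 * PI * IZR n) < PI / 2.
Proof.
intros Hc; pose proof PI_RGT_0 as HP.
destruct (reduce_2PI (y + PI)) as [n Hn]; exists n.
set (y' := y + 2 * PI * IZR n).
assert (Ec : cos y' = cos y) by (apply (period_Z cos cos_plus_2PI)).
rewrite <- Ec in Hc.
assert (Hy : - PI <= y' < PI) by (unfold y'; lra).
apply Rabs_lt_between; split.
- destruct (Rlt_dec (- (PI / 2)) y') as [|N]; [easy|].
  assert (cos (- y') <= 0) by (apply cos_le_0; lra).
  rewrite cos_neg in H; lra.
- destruct (Rlt_dec y' (PI / 2)) as [|N]; [easy|].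
  assert (cos y' <= 0) by (apply cos_le_0; lra); lra.
Qed.

(* alpha lifts the polar angles of points whose eccentric angles are x j. *)
Lemma winding_ellipse (a b : R) (m n : nat) (x : nat -> R) (N : Z) :
  0 < b -> b < a -> (forall j, 0 < x (S j) - x j < PI) ->
  x n = x 0%nat + 2 * PI * IZR N ->
  turns_around m n (fun j => ellipse a b (x j)) 0%C -> (1 <= n)%nat -> N = Z.of_nat m.
Proof.
intros Hb Hab Hx HN [al [rh [H1 [H2 H3]]]] Hn; pose proof PI_RGT_0 as HP.
assert (E : forall j, a * cos (x j) = rh j * cos (al j) /\ b * sin (x j) = rh j * sin (al j)).
{ intros j; destruct (H1 j) as [_ E].
  replace (ellipse a b (x j) - 0)%C with (ellipse a b (x j)) in E by ring.
  unfold ellipse in E; injection E as E1 E2; easy. }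
(* Polar and eccentric angle of a point of the ellipse lie in the same quadrant. *)
assert (K : forall j, exists k : Z, Rabs (al j - x j + 2 * PI * IZR k) < PI / 2).
{ intros j; apply cos_pos_reduce; destruct (E j) as [E1 E2]; destruct (H1 j) as [Hr _].
  apply Rmult_lt_reg_l with (rh j); [easy|]; rewrite Rmult_0_r.
  replace (rh j * cos (al j - x j)) with (rh j * cos (al j) * cos (x j) + rh j * sin (al j) * sin (x j))
    by (rewrite cos_minus; ring).
  rewrite <- E1, <- E2.
  pose proof (sin2_cos2 (x j)) as T; unfold Rsqr in T; nra. }
destruct (choice _ K) as [k Hk].
assert (Hal : forall j, 0 < al (S j) - al j < PI).
{ intros j; specialize (H2 j); apply Rabs_lt_between in H2; split; [|lra].
  destruct (E j) as [E1 E2]; destruct (E (S j)) as [E3 E4].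
  destruct (H1 j) as [R1 _]; destruct (H1 (S j)) as [R2 _].
  assert (S1 : 0 < sin (x (S j) - x j)) by (apply sin_gt_0; apply Hx).
  assert (S2 : rh j * rh (S j) * sin (al (S j) - al j) = a * b * sin (x (S j) - x j)).
  { rewrite !sin_minus.
    replace (rh j * rh (S j) * (sin (al (S j)) * cos (al j) - cos (al (S j)) * sin (al j)))
      with (rh (S j) * sin (al (S j)) * (rh j * cos (al j)) - rh (S j) * cos (al (S j)) * (rh j * sin (al j))) by ring.
    rewrite <- E1, <- E2, <- E3, <- E4; ring. }
  destruct (Rlt_dec 0 (al (S j) - al j)) as [|L]; [easy|exfalso].
  assert (0 <= sin (- (al (S j) - al j))) by (apply sin_ge_0; lra).
  rewrite sin_neg in H.
  assert (0 < a * b * sin (x (S j) - x j)) by (apply Rmult_lt_0_compat; nra).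
  assert (0 < rh j * rh (S j)) by nra; nra. }
(* Both angles advance by less than PI and stay within PI / 2 of each other up to 2 PI k, so k
   cannot jump. *)
assert (Hkj : forall j, k (S j) = k j).
{ intros j; pose proof (Hk j) as K1; pose proof (Hk (S j)) as K2.
  apply Rabs_lt_between in K1, K2; specialize (Hal j); specialize (Hx j).
  assert (F1 : IZR (k (S j)) - IZR (k j) < 1) by nra.
  assert (F2 : -1 < IZR (k (S j)) - IZR (k j)) by nra.
  rewrite <- minus_IZR in F1, F2; apply lt_IZR in F1; apply (lt_IZR (-1)) in F2; lia. }
assert (Hkn : k n = k 0%nat) by (clear - Hkj; induction n as [|n IH]; [easy | now rewrite Hkj]).
pose proof (Hk n) as K1; pose proof (Hk 0%nat) as K2; rewrite Hkn in K1.
apply Rabs_lt_between in K1, K2.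
assert (Pos : 0 < IZR N).
{ assert (x 0%nat < x n).
  { clear - Hx Hn; induction n as [|n IH]; [lia|]; destruct n as [|n].
    - specialize (Hx 0%nat); lra.
    - specialize (Hx (S n)); specialize (IH ltac:(lia)); lra. }
  nra. }
rewrite INR_IZR_INZ in H3; set (M := Z.of_nat m) in *.
assert (PM : 0 <= IZR M) by (apply IZR_le; lia).
assert (Pal : 0 < al n - al 0%nat).
{ clear - Hal Hn; induction n as [|n IH]; [lia|]; destruct n as [|n].
  - specialize (Hal 0%nat); lra.
  - specialize (Hal (S n)); specialize (IH ltac:(lia)); lra. }
rewrite Rabs_pos_eq in H3 by lra.
assert (F1 : IZR N - IZR M < 1) by nra.
assert (F2 : -1 < IZR N - IZR M) by nra.
rewrite <- minus_IZR in F1, F2; apply lt_IZR in F1; apply (lt_IZR (-1)) in F2; lia.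
Qed.

Section Orbits.

Context (a b l : R) (Hl : 0 < l) (Hlb : l < b) (Hba : b < a).

Let k := modulus a b l.
Let Hk : 0 < k < 1 := modulus_range a b l Hl Hlb Hba.
Let amp := am k Hk.

Context (delta : R) (Hdelta : forall t, Phi a b l (t + gam a b l t) - Phi a b l (t - gam a b l t) = delta).

Definition orbit (t : R) (j : nat) : R := PI / 2 + amp (t + INR j * delta).

Lemma Phi_orbit t j : Phi a b l (orbit t j) = t + INR j * delta.
Proof.
unfold Phi, orbit; replace (PI / 2 + amp (t + INR j * delta) - PI / 2) with (amp (t + INR j * delta)) by ring.
apply ellF_am.
Qed.

Lemma Phi_inj x y : Phi a b l x = Phi a b l y -> x = y.
Proof. intros E; apply (ellF_inj k Hk) in E; lra. Qed.

Lemma near_orbit x t j : Rabs (x - orbit t j) <= Rabs (Phi a b l x - (t + INR j * delta)).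
Proof.
replace x with (PI / 2 + amp (Phi a b l x)) at 1.
- unfold orbit; replace (PI / 2 + amp (Phi a b l x) - (PI / 2 + amp (t + INR j * delta)))
    with (amp (Phi a b l x) - amp (t + INR j * delta)) by ring.
  apply am_lipschitz.
- unfold Phi, amp; rewrite am_ellF; ring.
Qed.

Lemma orbit_lipschitz t s j : Rabs (orbit t j - orbit s j) <= Rabs (t - s).
Proof.
unfold orbit; replace (PI / 2 + amp (t + INR j * delta) - (PI / 2 + amp (s + INR j * delta)))
  with (amp (t + INR j * delta) - amp (s + INR j * delta)) by ring.
eapply Rle_trans; [apply am_lipschitz|]; right; f_equal; ring.
Qed.

Lemma orbit_chord t j : exists s,
  orbit t j = s - gam a b l s /\ orbit t (S j) = s + gam a b l s.
Proof.
destruct (chord_start a b l Hl Hlb Hba (orbit t j)) as [s Hs]; exists s; split; [easy|].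
apply Phi_inj; rewrite Phi_orbit, S_INR.
pose proof (Hdelta s) as E; rewrite Hs, Phi_orbit in E; lra.
Qed.

Lemma orbit_step t j : 0 < orbit t (S j) - orbit t j < PI.
Proof.
destruct (orbit_chord t j) as [s [-> ->]]; pose proof (gam_range a b l Hl Hlb Hba s); lra.
Qed.

Lemma small_0 : small a b l 0 0.
Proof. destruct (small_exists a b l Hl Hlb Hba) as [e [He H]]; apply H; lra. Qed.

Lemma velocity_ellipse t : velocity (ellipse a b) t = vel0 a b t.
Proof.
unfold velocity, ellipse, vel0; simpl; f_equal; apply is_derive_unique; auto_derive; trivial; ring.
Qed.

Lemma ellipse_convex s t : s < t < s + 2 * PI ->
  0 < cross (velocity (ellipse a b) s) (ellipse a b t - ellipse a b s)%C.
Proof.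
intros H; rewrite velocity_ellipse.
replace (cross (vel0 a b s) (ellipse a b t - ellipse a b s)%C) with (2 * (a * b) * sin ((t - s) / 2) ^ 2).
- assert (0 < sin ((t - s) / 2)) by (apply sin_gt_0; lra).
  assert (0 < a * b) by nra; assert (0 < sin ((t - s) / 2) ^ 2) by (apply pow_lt; easy); nra.
- assert (E : cos (t - s) = 1 - 2 * sin ((t - s) / 2) ^ 2).
  { replace (t - s) with (2 * ((t - s) / 2)) at 1 by field; rewrite cos_2a_sin; ring. }
  rewrite cos_minus in E.
  unfold cross, vel0, ellipse, Cminus, Cplus, Copp; simpl fst; simpl snd.
  transitivity (a * b * (sin s ^ 2 + cos s ^ 2 - (cos t * cos s + sin t * sin s))); [|ring].
  rewrite E, (trig2 s); ring.
Qed.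

Context (m n : nat) (Hn : (1 <= n)%nat).

(** The results for nearby tables, used with eta = om = 0, identify a true billiard trajectory of
    the ellipse with [orbit]. Closing up gives a multiple of 2 PI, and the winding number about the
    center identifies it. *)
Lemma orbit_resonant : resonant_caustic m n (ellipse a b) (confocal_ellipse a b l) ->
  forall t, orbit t n = orbit t 0%nat + 2 * PI * INR m.
Proof.
intros Hres t; pose proof small_0 as Sm.
destruct (chord_start a b l Hl Hlb Hba (orbit t 0)) as [s Hs].
destruct (resonant_orbit a b l Hl Hlb Hba (ellipse a b) (confocal_ellipse a b l) 0 0 Sm) with
  (delta := delta) (m := m) (n := n) (t := s) as [x [X0 [X1 [X2 [X3 [X4 X5]]]]]].
- intros u; unfold ellipse; rewrite cos_plus_2PI, sin_plus_2PI; easy.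
- intros u; unfold ellipse; simpl; split; auto_derive; easy.
- intros u; replace (ellipse a b u - ellipse a b u)%C with (RtoC 0) by ring; rewrite Cmod_0; lra.
- intros u; rewrite velocity_ellipse; replace (vel0 a b u - vel0 a b u)%C with (RtoC 0) by ring; rewrite Cmod_0; lra.
- apply ellipse_convex.
- apply Hres.
- intros u; replace (confocal_ellipse a b l u - confocal_ellipse a b l u)%C with (RtoC 0) by ring; rewrite Cmod_0; lra.
- exact Hdelta.
- exact Hres.
- rewrite Rmult_0_r in X0; rewrite Hs in X0.
  assert (Ex : forall j, x j = orbit t j).
  { intros j; apply Phi_inj; rewrite Phi_orbit; induction j as [|j IH].
    - replace (x 0%nat) with (orbit t 0) by (apply Rabs_le_between in X0; lra).
      rewrite Phi_orbit; easy.
    - specialize (X1 j); rewrite Rmult_0_r in X1; apply Rabs_le_between in X1.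
      rewrite S_INR; lra. }
  assert (Eq := X4 0%nat); simpl in Eq; unfold ellipse in Eq; injection Eq as E1 E2.
  apply Rmult_eq_reg_l in E1; [|lra]; apply Rmult_eq_reg_l in E2; [|lra].
  destruct (angle_unique _ _ E1 E2) as [N HN].
  assert (HNm : N = Z.of_nat m).
  { apply (winding_ellipse a b m n x N); try easy; try lra.
    - intros j; rewrite !Ex; apply orbit_step.
    - apply X5; intros u.
      unfold confocal_ellipse; set (A := sqrt (a ^ 2 - l ^ 2)); set (B := sqrt (b ^ 2 - l ^ 2)).
      assert (HA : 0 < A) by (apply sqrt_lt_R0; nra); assert (HB : 0 < B) by (apply sqrt_lt_R0; nra).
      replace (cross (velocity (ellipse A B) u) (0 - ellipse A B u)%C) with (A * B); [nra|].
      replace (velocity (ellipse A B) u) with ((- A * sin u, B * cos u) : C).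
      + unfold cross, ellipse, Cminus, Cplus, Copp, RtoC; simpl fst; simpl snd.
        transitivity (A * B * (sin u ^ 2 + cos u ^ 2)); [rewrite trig2; ring | ring].
      + unfold velocity, ellipse; simpl; f_equal; symmetry; apply is_derive_unique; auto_derive; trivial; ring. }
  rewrite <- !Ex, HN, HNm, <- INR_IZR_INZ; easy.
Qed.

End Orbits.

(** * The first-order variation of the perimeter *)

(** With s = |V + W| and v = |V| the remainder is exactly (|W|^2 - (s - v)^2) / (2 v), and |s - v|
    <= |W|. *)
Lemma Cmod_perturb (V W : C) : 0 < Cmod V ->
  Rabs (Cmod (V + W)%C - Cmod V - dot V W / Cmod V) <= Cmod W ^ 2 / (2 * Cmod V).
Proof.
intros Hv; set (v := Cmod V) in *; set (s := Cmod (V + W)%C).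
assert (E : s ^ 2 = v ^ 2 + 2 * dot V W + Cmod W ^ 2).
{ unfold s, v; rewrite !Cmod_sqr; unfold dot, Cplus; simpl; ring. }
assert (Hs : Rabs (s - v) <= Cmod W).
{ pose proof (Cmod_triangle V W) as T1; fold s v in T1.
  pose proof (Cmod_triangle (V + W)%C (- W)%C) as T2; rewrite Cmod_opp in T2.
  replace (V + W + - W)%C with V in T2 by ring; fold s v in T2; apply Rabs_le; lra. }
replace (s - v - dot V W / v) with ((Cmod W ^ 2 - (s - v) ^ 2) / (2 * v)).
- assert (P : 0 <= (s - v) ^ 2 <= Cmod W ^ 2).
  { split; [apply pow2_ge_0|]; rewrite <- (pow2_abs (s - v)); apply pow_incr; split; [apply Rabs_pos | easy]. }
  unfold Rdiv; rewrite Rabs_mult, (Rabs_pos_eq (/ (2 * v))) by (left; apply Rinv_0_lt_compat; lra).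
  apply Rmult_le_compat_r; [left; apply Rinv_0_lt_compat; lra|]; apply Rabs_le; lra.
- replace (Cmod W ^ 2) with (s ^ 2 - v ^ 2 - 2 * dot V W) by lra; field; lra.
Qed.

(** Letting N tend to infinity gives A = 0, and then B = 0 after multiplication by N. *)
Lemma quadratic_zero (A B K : R) (N0 : nat) :
  (forall N : nat, (N0 <= N)%nat -> (0 < N)%nat -> Rabs (A + / INR N * B) <= K * (/ INR N) ^ 2) ->
  B = 0.
Proof.
intros H.
assert (H1 : forall e, 0 < e -> exists N : nat, (N0 <= N)%nat /\ (0 < N)%nat /\ / INR N < e).
{ intros e He; destruct (INR_unbounded (/ e)) as [M HM].
  exists (S (M + N0)); split; [lia|]; split; [lia|].
  rewrite <- (Rinv_inv e); apply Rinv_lt_contravar.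
  - apply Rmult_lt_0_compat; [now apply Rinv_0_lt_compat | apply lt_0_INR; lia].
  - eapply Rlt_le_trans; [exact HM|]; apply le_INR; lia. }
assert (HA : A = 0).
{ destruct (Req_dec A 0) as [|NA]; [easy|exfalso]; apply Rabs_pos_lt in NA.
  destruct (H1 (Rmin 1 (Rabs A / (Rabs B + Rabs K + 1)))) as [N [N1 [N2 N3]]].
  { pose proof (Rabs_pos B); pose proof (Rabs_pos K).
    apply Rmin_pos; [lra | apply Rdiv_lt_0_compat; lra]. }
  specialize (H N N1 N2).
  assert (Hi : 0 < / INR N) by (apply Rinv_0_lt_compat, lt_0_INR; lia).
  set (i := / INR N) in *.
  assert (I1 : i < 1) by (eapply Rlt_le_trans; [exact N3 | apply Rmin_l]).
  assert (I2 : i < Rabs A / (Rabs B + Rabs K + 1)) by (eapply Rlt_le_trans; [exact N3 | apply Rmin_r]).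
  pose proof (Rabs_pos B) as PB; pose proof (Rabs_pos K) as PK; pose proof (Rle_abs K) as LK.
  apply Rmult_lt_compat_r with (r := Rabs B + Rabs K + 1) in I2; [|lra].
  replace (Rabs A / (Rabs B + Rabs K + 1) * (Rabs B + Rabs K + 1)) with (Rabs A) in I2 by (field; lra).
  pose proof (Rabs_triang_inv A (- (i * B))) as T; rewrite Rabs_Ropp, Rabs_mult, (Rabs_pos_eq i) in T by lra.
  replace (A - - (i * B)) with (A + i * B) in T by ring.
  assert (I3 : K * i ^ 2 <= Rabs K * i ^ 2) by (apply Rmult_le_compat_r; [apply pow2_ge_0 | easy]).
  assert (I4 : Rabs K * i ^ 2 <= Rabs K * i) by (apply Rmult_le_compat_l; nra).
  lra. }
subst A.
destruct (Req_dec B 0) as [|NB]; [easy|exfalso]; apply Rabs_pos_lt in NB.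
destruct (H1 (Rabs B / (Rabs K + 1))) as [N [N1 [N2 N3]]].
{ pose proof (Rabs_pos K); apply Rdiv_lt_0_compat; lra. }
specialize (H N N1 N2).
assert (Hi : 0 < / INR N) by (apply Rinv_0_lt_compat, lt_0_INR; lia).
set (i := / INR N) in *; pose proof (Rabs_pos K) as PK; pose proof (Rle_abs K) as LK.
apply Rmult_lt_compat_r with (r := Rabs K + 1) in N3; [|lra].
replace (Rabs B / (Rabs K + 1) * (Rabs K + 1)) with (Rabs B) in N3 by (field; lra).
rewrite Rplus_0_l, Rabs_mult, (Rabs_pos_eq i) in H by lra.
assert (Rabs B <= K * i); [|nra].
apply Rmult_le_reg_l with i; [easy|]; lra.
Qed.

Section Melnikov.

Context (a b c l mu0 : R) (mu : R -> R -> R) (mu1 : R -> R)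
  (Hl : 0 < l) (Hlb : l < b) (Hba : b < a) (hc : c = sqrt (a ^ 2 - b ^ 2))
  (hcosh : cosh mu0 = a / c) (hsinh : sinh mu0 = b / c)
  (hmu : smooth_perturbation mu mu0 mu1) (hper : periodic (2 * PI) mu1)
  (delta : R) (Hdelta : forall t, Phi a b l (t + gam a b l t) - Phi a b l (t - gam a b l t) = delta)
  (m n : nat) (Hn : (1 <= n)%nat).

Let orb := orbit a b l Hl Hlb Hba delta.
Let q := qpert c mu.

Context (Hrot : forall t, orb t n = orb t 0%nat + 2 * PI * INR m).

Lemma orbit_chord_dir t j : exists s v, 2 * b * l / a <= v /\
  (ellipse a b (orb t (S j)) - ellipse a b (orb t j))%C = (RtoC v * dir a b s)%C /\
  forall x y, dot (dir a b s) (b * cos (orb t j) * x, a * sin (orb t j) * x) = - (l * x) /\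
    dot (dir a b s) (b * cos (orb t (S j)) * y, a * sin (orb t (S j)) * y) = l * y.
Proof.
destruct (orbit_chord a b l Hl Hlb Hba delta Hdelta t j) as [s [E1 E2]]; fold orb in E1, E2.
rewrite E1, E2; clear E1 E2; exists s.
pose proof (rad_sin_gam a b l Hl Hlb Hba s) as RG; destruct (rad_range a b l Hl Hlb Hba s) as [R1 R2].
set (g := gam a b l s) in *; set (R := rad a b s) in *.
exists (2 * sin g * (a * b / R)); split; [|split].
- assert (Es : sin g = l / R) by (apply Rmult_eq_reg_l with R; [rewrite RG; field |]; lra).
  rewrite Es; apply Rle_trans with (2 * b * l / R * (a / R)); [|right; field; lra].
  assert (A1 : 2 * b * l / a <= 2 * b * l / R).
  { apply Rmult_le_compat_l; [|apply Rinv_le_contravar; lra]; repeat apply Rmult_le_pos; lra. }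
  assert (A2 : 1 <= a / R).
  { apply Rmult_le_reg_r with R; [lra|]; unfold Rdiv; rewrite Rmult_assoc, Rinv_l; lra. }
  assert (0 < 2 * b * l / R) by (apply Rdiv_lt_0_compat; [repeat apply Rmult_lt_0_compat|]; lra).
  nra.
- unfold ellipse, dir, Cminus, Cplus, Copp, Cmult, RtoC; fold R; simpl fst; simpl snd.
  rewrite sin_plus, sin_minus, cos_plus, cos_minus; f_equal; field; lra.
- intros x y; unfold dot, dir; fold R; simpl; rewrite sin_plus, sin_minus, cos_plus, cos_minus.
  assert (T : sin s ^ 2 = 1 - cos s ^ 2) by apply trig2.
  rewrite <- RG; split.
  + transitivity (- (R * sin g * (sin s ^ 2 + cos s ^ 2) * x)); [field; lra | rewrite T; ring].
  + transitivity (R * sin g * (sin s ^ 2 + cos s ^ 2) * y); [field; lra | rewrite T; ring].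
Qed.

Lemma orbit_len_lower t j : 2 * b * l / a <= len (ellipse a b) (orb t j) (orb t (S j)).
Proof.
destruct (orbit_chord_dir t j) as [s [v [Hv [E _]]]]; unfold len; rewrite E, Cmod_scal_pos, dir_unit with (l := l); try lra.
assert (0 <= 2 * b * l / a) by (apply Rdiv_le_0_compat; nra); lra.
Qed.

Lemma ellipse_lipschitz x y : Cmod (ellipse a b x - ellipse a b y)%C <= 2 * a * Rabs (x - y).
Proof.
assert (S : Rabs (sin x - sin y) <= 1 * Rabs (x - y)).
{ apply (mvt_bound sin cos); [intros; apply is_derive_sin | intros; apply Rabs_cos_le]. }
assert (T : Rabs (cos x - cos y) <= 1 * Rabs (x - y)).
{ apply (mvt_bound cos (fun z => - sin z)); [intros; apply is_derive_cos|].
  intros; apply Rabs_opp_le, Rabs_sin_le. }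
replace (ellipse a b x - ellipse a b y)%C with ((a * (cos x - cos y), b * (sin x - sin y)) : C)
  by (unfold ellipse, Cminus, Cplus, Copp; simpl; f_equal; ring).
eapply Rle_trans; [apply Cmod_pair|]; rewrite !Rabs_mult, !(Rabs_pos_eq a), !(Rabs_pos_eq b) by lra.
pose proof (Rabs_pos (x - y)); nra.
Qed.

(* First variation: each side contributes through its unit direction, which makes the
   product +-l with the normal field (b cos, a sin) at its two endpoints (Joachimsthal). *)
Lemma len_first_order : exists e1 K, 0 < e1 /\ 0 <= K /\ forall e t j, Rabs e <= e1 ->
  Rabs (len (q e) (orb t j) (orb t (S j)) - len (ellipse a b) (orb t j) (orb t (S j))
    - e * (l * (mu1 (orb t j) + mu1 (orb t (S j))))) <= K * e ^ 2.
Proof.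
destruct (qpert_bounds a b c mu0 mu mu1 ltac:(lra) Hba hc hcosh hsinh hmu)
  as [e1 [M [K [He1 [HM [HK H]]]]]]; fold q in H.
set (r := 2 * b * l / a); assert (Hr : 0 < r) by (apply Rdiv_lt_0_compat; [repeat apply Rmult_lt_0_compat|]; lra).
exists e1, ((2 * K) ^ 2 / (2 * r) + 4 * K); split; [easy|]; split.
{ assert (0 <= (2 * K) ^ 2 / (2 * r)) by (apply Rdiv_le_0_compat; [apply pow2_ge_0 | lra]); lra. }
intros e t j He.
destruct (orbit_chord_dir t j) as [s [v [Hv [E Ed]]]]; fold r in Hv.
destruct (H e (orb t j) He) as [_ [_ [_ [N1 [N2 N3]]]]].
destruct (H e (orb t (S j)) He) as [_ [_ [_ [N4 [N5 N6]]]]].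
set (p := orb t j) in *; set (p' := orb t (S j)) in *.
set (V := (ellipse a b p' - ellipse a b p)%C) in *.
set (W := ((q e p' - ellipse a b p') - (q e p - ellipse a b p))%C).
assert (HV : Cmod V = v).
{ rewrite E, Cmod_scal_pos by lra; fold dir; rewrite (dir_unit a b l Hl Hlb Hba); ring. }
assert (HW : Cmod W <= 2 * K * Rabs e).
{ unfold W, Cminus at 1; eapply Rle_trans; [apply Cmod_triangle|]; rewrite Cmod_opp.
  unfold Cminus in N1, N4 |- *; lra. }
pose proof (Cmod_perturb V W ltac:(lra)) as CP; rewrite HV in CP.
assert (L1 : len (q e) p p' = Cmod (V + W)%C) by (unfold len, V, W; f_equal; ring).
assert (L0 : len (ellipse a b) p p' = v) by (unfold len; fold V; easy).
rewrite L1, L0.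
set (R1 := fst (q e p') - a * cos p' - e * (mu1 p' * b * cos p')) in *.
set (R2 := snd (q e p') - b * sin p' - e * (mu1 p' * a * sin p')) in *.
set (R3 := fst (q e p) - a * cos p - e * (mu1 p * b * cos p)) in *.
set (R4 := snd (q e p) - b * sin p - e * (mu1 p * a * sin p)) in *.
assert (DW : dot V W / v = e * (l * (mu1 p + mu1 p')) + dot (dir a b s) (R1 - R3, R2 - R4)).
{ destruct (Ed (mu1 p) (mu1 p')) as [D1 D2].
  replace (dot V W / v) with (dot (dir a b s) W).
  2:{ rewrite E; transitivity (v * dot (dir a b s) W / v); [field; lra | f_equal].
      unfold dot, Cmult, RtoC; simpl; ring. }
  replace (e * (l * (mu1 p + mu1 p'))) with
    (e * (dot (dir a b s) (b * cos p' * mu1 p', a * sin p' * mu1 p') -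
          dot (dir a b s) (b * cos p * mu1 p, a * sin p * mu1 p))) by (rewrite D1, D2; ring).
  unfold W, R1, R2, R3, R4, dot, ellipse, Cminus, Cplus, Copp; simpl; ring. }
rewrite DW in CP.
assert (BR : Rabs (dot (dir a b s) (R1 - R3, R2 - R4)) <= 4 * K * e ^ 2).
{ eapply Rle_trans; [apply dot_bound|]; rewrite (dir_unit a b l Hl Hlb Hba), Rmult_1_l.
  eapply Rle_trans; [apply Cmod_pair|].
  pose proof (Rabs_sub_le _ _ _ _ N5 N2); pose proof (Rabs_sub_le _ _ _ _ N6 N3); lra. }
assert (BW : Cmod W ^ 2 / (2 * v) <= (2 * K) ^ 2 / (2 * r) * e ^ 2).
{ apply Rle_trans with ((2 * K * Rabs e) ^ 2 / (2 * r)).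
  - apply Rmult_le_compat.
    + apply pow2_ge_0.
    + left; apply Rinv_0_lt_compat; lra.
    + apply pow_incr; split; [apply Cmod_ge_0 | easy].
    + apply Rinv_le_contravar; lra.
  - right; rewrite <- (pow2_abs e); field; lra. }
apply Rabs_le_between in CP, BR; apply Rabs_le; lra.
Qed.

Context (geps : R -> curve) (Kg eg : R) (Heg : 0 < eg)
  (Hg : forall e, Rabs e < eg -> resonant_caustic m n (q e) (geps e) /\
     forall th, Cmod (geps e th - confocal_ellipse a b l th)%C <= Kg * Rabs e).

Lemma polygons_exist : exists e1 K, 0 < e1 /\ 0 <= K /\ forall e t, Rabs e <= e1 ->
  exists x : nat -> R, (forall j, (j <= n)%nat -> Rabs (x j - orb t j) <= K * Rabs e) /\
    x n = x 0%nat + 2 * PI * INR m /\ critical (q e) n x.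
Proof.
destruct (qpert_bounds a b c mu0 mu mu1 ltac:(lra) Hba hc hcosh hsinh hmu)
  as [ea [M [Kq [Hea [HM [HKq H]]]]]]; fold q in H.
destruct (small_exists a b l Hl Hlb Hba) as [es [Hes Hsm]].
destruct (qpert_near_convex a b c mu0 mu mu1 ltac:(lra) Hba hc hcosh hsinh hmu es Hes) as [ev [Hev Hvel]].
fold q in Hvel.
set (Kp := Rabs Kg + Kq); assert (HKp : 0 <= Kp) by (pose proof (Rabs_pos Kg); unfold Kp; lra).
set (L := / sqrt (1 - modulus a b l ^ 2)).
assert (HL : 0 < L).
{ apply Rinv_0_lt_compat, sqrt_lt_R0.
  pose proof (delta_am_arg _ (modulus_range a b l Hl Hlb Hba) 0); lra. }
assert (HK1 : 0 <= approx_const a b l).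
{ unfold approx_const; apply Rdiv_le_0_compat; [|lra].
  assert (0 < 4 * a / l) by (apply Rdiv_lt_0_compat; lra); lra. }
assert (HK2 : 0 <= step_const a b l) by (unfold step_const; fold L; apply Rmult_le_pos; lra).
(* The error at the first vertex, measured by [Phi], plus one step error for each of the n sides. *)
set (K := (L * approx_const a b l + INR n * step_const a b l) * Kp).
assert (HK : 0 <= K).
{ unfold K; apply Rmult_le_pos; [|easy]; apply Rplus_le_le_0_compat; apply Rmult_le_pos; try lra; apply pos_INR. }
pose proof PI_RGT_0 as HP.
set (e1 := Rmin (Rmin ea eg) (Rmin (Rmin ev (es / (Kp + 1))) (1 / (K + 1))) / 2).
assert (He1 : 0 < e1 /\ e1 < ea /\ e1 < eg /\ e1 < ev /\ e1 < es / (Kp + 1) /\ e1 < 1 / (K + 1)).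
{ assert (0 < es / (Kp + 1)) by (apply Rdiv_lt_0_compat; lra).
  assert (0 < 1 / (K + 1)) by (apply Rdiv_lt_0_compat; lra).
  unfold e1, Rmin; repeat destruct (Rle_dec _ _); lra. }
destruct He1 as [P0 [P1 [P2 [P3 [P4 P5]]]]].
exists e1, K; split; [easy|]; split; [easy|]; intros e t He.
destruct (Hg e ltac:(lra)) as [Hres Hnear].
destruct (Hvel e ltac:(lra)) as [Hv Hconv].
pose proof (Rabs_pos e) as Pe.
set (eta := Kp * Rabs e).
assert (Heta : 0 <= eta <= es).
{ unfold eta; split; [now apply Rmult_le_pos|].
  apply Rle_trans with ((Kp + 1) * (es / (Kp + 1))); [|right; field; lra].
  apply Rmult_le_compat; lra. }
assert (HeP : K * Rabs e < 1).
{ apply Rle_lt_trans with (K * (1 / (K + 1))); [apply Rmult_le_compat_l; lra|].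
  apply Rmult_lt_reg_r with (K + 1); [lra|].
  replace (K * (1 / (K + 1)) * (K + 1)) with K by (field; lra); lra. }
assert (Sm : small a b l eta es) by (apply Hsm; lra).
assert (Hec : Rabs e <= ea) by lra.
assert (Qper : forall x, q e (x + 2 * PI) = q e x) by (intros x; exact (proj1 (proj2 (proj2 (H e x Hec))))).
assert (Qd : forall x, ex_derive (fun s => fst (q e s)) x /\ ex_derive (fun s => snd (q e s)) x).
{ intros x; split; [eexists; exact (proj1 (proj1 (H e x Hec))) |
   eexists; exact (proj1 (proj2 (proj2 (proj2 (proj1 (H e x Hec))))))]. }
assert (Qn : forall x, Cmod (q e x - ellipse a b x)%C <= eta).
{ intros x; eapply Rle_trans; [exact (proj1 (proj2 (proj2 (proj2 (H e x Hec)))))|].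
  unfold eta, Kp; pose proof (Rabs_pos Kg); nra. }
assert (Gn : forall x, Cmod (geps e x - confocal_ellipse a b l x)%C <= eta).
{ intros x; eapply Rle_trans; [apply Hnear|]; unfold eta, Kp; pose proof (Rle_abs Kg); nra. }
destruct (chord_start a b l Hl Hlb Hba (orb t 0)) as [s Hs].
destruct (resonant_orbit a b l Hl Hlb Hba (q e) (geps e) eta es Sm Qper Qd Qn Hv Hconv
  (proj1 (proj1 Hres)) Gn delta m n s Hdelta Hres) as [x [X0 [X1 [X2 [X3 [X4 X5]]]]]].
rewrite Hs in X0.
assert (XP : forall j, Rabs (Phi a b l (x j) - (t + INR j * delta)) <= L * (approx_const a b l * eta) + INR j * (step_const a b l * eta)).
{ induction j as [|j IH].
  - simpl INR; rewrite !Rmult_0_l, !Rplus_0_r.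
    replace t with (Phi a b l (orb t 0)) by (unfold orb; rewrite Phi_orbit; simpl; ring).
    eapply Rle_trans; [apply (Phi_lipschitz a b l Hl Hlb Hba)|]; fold L; apply Rmult_le_compat_l; lra.
  - rewrite S_INR; specialize (X1 j).
    replace (Phi a b l (x (S j)) - (t + (INR j + 1) * delta))
      with ((Phi a b l (x (S j)) - Phi a b l (x j) - delta) + (Phi a b l (x j) - (t + INR j * delta))) by ring.
    eapply Rle_trans; [apply Rabs_triang|]; lra. }
assert (XN : forall j, (j <= n)%nat -> Rabs (x j - orb t j) <= K * Rabs e).
{ intros j Hj; eapply Rle_trans; [apply near_orbit|]; eapply Rle_trans; [apply XP|].
  replace (K * Rabs e) with (L * (approx_const a b l * eta) + INR n * (step_const a b l * eta)) by (unfold K, eta; ring).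
  apply Rplus_le_compat_l, Rmult_le_compat_r; [apply Rmult_le_pos; lra | now apply le_INR]. }
(* The curve is simple, so the closing polygon advances by a multiple of 2 PI; being within distance
   1 of the orbit at both ends, it makes as many turns as the orbit. *)
assert (XC : x n = x 0%nat + 2 * PI * INR m).
{ destruct (reduce_2PI (x n - x 0%nat)) as [N HN].
  assert (E0 : x n - x 0%nat + 2 * PI * IZR N = 0).
  { destruct (Req_dec (x n - x 0%nat + 2 * PI * IZR N) 0) as [|NE]; [easy|exfalso].
    apply (chord_neq (q e) Hconv (x 0%nat) (x n + 2 * PI * IZR N)); [lra|].
    rewrite (period_Z (q e) Qper); symmetry; exact (X4 0%nat). }
  pose proof (XN n (Nat.le_refl n)) as B1; pose proof (XN 0%nat ltac:(lia)) as B2.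
  rewrite Hrot in B1; apply Rabs_le_between in B1, B2.
  assert (HP3 : 3 < PI) by (pose proof PI2_3_2; lra).
  rewrite INR_IZR_INZ in *; set (m' := Z.of_nat m) in *.
  assert (F1 : IZR m' + IZR N < 1) by nra.
  assert (F2 : -1 < IZR m' + IZR N) by nra.
  rewrite <- plus_IZR in F1, F2; apply lt_IZR in F1; apply (lt_IZR (-1)) in F2.
  assert (EN : (m' = - N)%Z) by lia; rewrite EN, opp_IZR; lra. }
exists x; split; [exact XN|]; split; [exact XC|].
apply billiard_critical; [easy | exact X4 |].
rewrite XC, INR_IZR_INZ.
apply (period_Z (velocity (q e))); intros y.
destruct (Qd (y + 2 * PI)) as [Q1 Q2].
unfold velocity; f_equal; apply Derive_period; try assumption; intros z; now rewrite Qper.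
Qed.

Lemma perimeter_compare : exists e1 d C, 0 < e1 /\ 0 < d /\ 0 <= C /\ forall e t x y eta,
  Rabs e <= e1 -> 0 <= eta ->
  (forall j, (j <= n)%nat -> Rabs (x j - orb t j) <= d /\ Rabs (y j - orb t j) <= d /\
     Rabs (y j - x j) <= eta) ->
  x n = x 0%nat + 2 * PI * INR m -> y n = y 0%nat + 2 * PI * INR m -> critical (q e) n x ->
  Rabs (perimeter (q e) n y - perimeter (q e) n x) <= C * eta ^ 2 /\
  (critical (q e) n y -> Rabs (perimeter (q e) n y - perimeter (q e) n x) <= C * eta ^ 3).
Proof.
destruct (qpert_bounds a b c mu0 mu mu1 ltac:(lra) Hba hc hcosh hsinh hmu)
  as [ea [M [K [Hea [HM [HK H]]]]]]; fold q in H.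
set (r := 2 * b * l / a).
assert (Hr : 0 < r) by (apply Rdiv_lt_0_compat; [repeat apply Rmult_lt_0_compat|]; lra).
(* Moving the parameters by d displaces each endpoint by at most r / 8 on the ellipse, and the
   perturbation adds r / 16; a side of length r keeps a length of at least r - 3 r / 8. *)
set (d := r / (16 * a)); assert (Hd : 0 < d) by (apply Rdiv_lt_0_compat; lra).
set (e1 := Rmin ea (r / (16 * (K + 1)))).
assert (He1 : 0 < e1).
{ apply Rmin_pos; [easy | apply Rdiv_lt_0_compat; lra]. }
set (M' := M + a + K * ea).
assert (HKe : 0 <= K * ea) by (apply Rmult_le_pos; lra).
assert (HM' : 0 <= M') by (unfold M'; lra).
exists e1, d, (INR n * perimeter_const M' (r / 2)); split; [easy|]; split; [easy|]; split.
{ apply Rmult_le_pos; [apply pos_INR|]; unfold perimeter_const; set (i := / (r / 2)).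
  assert (0 < i) by (apply Rinv_0_lt_compat; lra).
  repeat apply Rplus_le_le_0_compat; repeat apply Rmult_le_pos; lra. }
intros e t x y eta He Heta Hxy Hx Hy Cx.
assert (Hec : Rabs e <= ea) by (eapply Rle_trans; [exact He | apply Rmin_l]).
assert (HeK : K * Rabs e <= r / 16).
{ assert (E : Rabs e <= r / (16 * (K + 1))) by (eapply Rle_trans; [exact He | apply Rmin_r]).
  apply Rle_trans with ((K + 1) * (r / (16 * (K + 1)))); [|right; field; lra].
  apply Rmult_le_compat; try lra; apply Rabs_pos. }
assert (Near : forall z, Cmod (q e z - ellipse a b z)%C <= K * Rabs e).
{ intros z; exact (proj1 (proj2 (proj2 (proj2 (H e z Hec))))). }
assert (B0 : forall z, Rabs (fst (q e z)) <= M' /\ Rabs (snd (q e z)) <= M').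
{ intros z; pose proof (Rmax_Cmod (q e z - ellipse a b z)%C) as RM.
  specialize (Near z); set (w := (q e z - ellipse a b z)%C) in *.
  assert (Kc : K * Rabs e <= K * ea) by (apply Rmult_le_compat_l; lra).
  pose proof (Rmax_l (Rabs (fst w)) (Rabs (snd w))); pose proof (Rmax_r (Rabs (fst w)) (Rabs (snd w))).
  assert (W1 : fst (q e z) = fst w + a * cos z) by (unfold w, ellipse; simpl; ring).
  assert (W2 : snd (q e z) = snd w + b * sin z) by (unfold w, ellipse; simpl; ring).
  rewrite W1, W2; unfold M'; pose proof (COS_bound z); pose proof (SIN_bound z).
  assert (- a <= a * cos z <= a) by nra; assert (- a <= b * sin z <= a) by nra.
  assert (A1 : Rabs (fst w) <= K * ea) by lra; assert (A2 : Rabs (snd w) <= K * ea) by lra.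
  apply Rabs_le_between in A1, A2; split; apply Rabs_le; lra. }
assert (DD := fun z => proj1 (H e z Hec)).
assert (BB : forall z, Rabs (qpert_x1 c mu e z) <= M' /\ Rabs (qpert_x2 c mu e z) <= M' /\ Rabs (qpert_x3 c mu e z) <= M' /\
     Rabs (qpert_y1 c mu e z) <= M' /\ Rabs (qpert_y2 c mu e z) <= M' /\ Rabs (qpert_y3 c mu e z) <= M').
{ intros z; pose proof (proj1 (proj2 (H e z Hec))) as BM; unfold M'; lra. }
assert (Hlen : forall j u, (j < n)%nat -> 0 <= u <= 1 ->
     r / 2 <= len (q e) (x j + u * (y j - x j)) (x (S j) + u * (y (S j) - x (S j)))).
{ intros j u Hj Hu.
  assert (Cv : forall i, (i <= n)%nat -> Rabs (x i + u * (y i - x i) - orb t i) <= d).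
  { intros i Hi; destruct (Hxy i Hi) as [U1 [U2 _]]; apply Rabs_le_between in U1, U2; apply Rabs_le; nra. }
  pose proof (Cv j ltac:(lia)) as V1; pose proof (Cv (S j) ltac:(lia)) as V2.
  set (z := x j + u * (y j - x j)) in *; set (z' := x (S j) + u * (y (S j) - x (S j))) in *.
  pose proof (orbit_len_lower t j) as L0; fold r in L0; unfold len in *.
  set (p := orb t j) in *; set (p' := orb t (S j)) in *.
  pose proof (ellipse_lipschitz z p) as E1; pose proof (ellipse_lipschitz z' p') as E2.
  pose proof (Near z) as N1; pose proof (Near z') as N2.
  assert (Ed : 2 * a * d = r / 8) by (unfold d; field; lra).
  assert (E1' : Cmod (ellipse a b z - ellipse a b p)%C <= r / 8) by (rewrite <- Ed; nra).
  assert (E2' : Cmod (ellipse a b z' - ellipse a b p')%C <= r / 8) by (rewrite <- Ed; nra).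
  assert (T : (ellipse a b p' - ellipse a b p = (q e z' - q e z) + ((q e z - ellipse a b z) +
    ((ellipse a b z - ellipse a b p) + (- (q e z' - ellipse a b z') + - (ellipse a b z' - ellipse a b p')))))%C) by ring.
  rewrite T in L0.
  pose proof (Cmod_triangle (q e z' - q e z) ((q e z - ellipse a b z) +
    ((ellipse a b z - ellipse a b p) + (- (q e z' - ellipse a b z') + - (ellipse a b z' - ellipse a b p'))))%C) as T1.
  pose proof (Cmod_triangle (q e z - ellipse a b z)
    ((ellipse a b z - ellipse a b p) + (- (q e z' - ellipse a b z') + - (ellipse a b z' - ellipse a b p')))%C) as T2.
  pose proof (Cmod_triangle (ellipse a b z - ellipse a b p)
    (- (q e z' - ellipse a b z') + - (ellipse a b z' - ellipse a b p'))%C) as T3.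
  pose proof (Cmod_triangle (- (q e z' - ellipse a b z')) (- (ellipse a b z' - ellipse a b p'))%C) as T4.
  rewrite !Cmod_opp in T4; lra. }
rewrite !Rmult_assoc.
apply (perimeter_near (q e) _ _ _ _ _ _ M' (r / 2) ltac:(lra) HM' DD B0 BB n x y eta Heta).
- intros j Hj; now apply Hxy.
- lra.
- exact Hlen.
- exact Cx.
Qed.

Let W t := Rsum n (fun j => mu1 (orb t j)).

Lemma perimeter_first_order : exists e1 K, 0 < e1 /\ 0 <= K /\ forall e t, Rabs e <= e1 ->
  Rabs (perimeter (q e) n (orb t) - perimeter (ellipse a b) n (orb t) - e * (2 * l * W t)) <= K * e ^ 2.
Proof.
destruct len_first_order as [e1 [K [He1 [HK H]]]].
exists e1, (INR n * K); split; [easy|]; split; [apply Rmult_le_pos; [apply pos_INR | easy]|].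
intros e t He.
(* Every vertex belongs to two sides, so its mu1 counts twice; the shift of the index costs a
   boundary term that vanishes by periodicity. *)
assert (EW : e * (2 * l * W t) = Rsum n (fun j => e * (l * (mu1 (orb t j) + mu1 (orb t (S j)))))).
{ transitivity (Rsum n (fun j => e * l * (2 * mu1 (orb t j)))
    + Rsum n (fun j => e * l * mu1 (orb t (S j)) - e * l * mu1 (orb t j))).
  - rewrite (Rsum_telescope n (fun j => e * l * mu1 (orb t j))), Hrot, INR_IZR_INZ, (period_Z mu1 hper).
    unfold W; clear; induction n as [|k IH]; simpl; [ring|].
    rewrite Rmult_plus_distr_l, Rmult_plus_distr_l, IH; ring.
  - clear; induction n as [|k IH]; simpl; [ring | rewrite <- IH; ring]. }
rewrite EW; unfold perimeter; rewrite !Rsum_minus.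
rewrite Rmult_assoc; apply Rsum_abs; intros j Hj; now apply H.
Qed.

(* The critical polygons of q (1/N) joining the orbits of t and s in N steps of size O(1/N) change
   the perimeter by N * O(1/N^3) only. *)
Lemma melnikov_const t s : W t = W s.
Proof.
destruct polygons_exist as [ea [Kp [Hea [HKp HP]]]].
destruct perimeter_compare as [eb [d [C [Heb [Hd [HC HL]]]]]].
destruct perimeter_first_order as [ef [K [Hef [HK HF]]]].
set (D := Rabs (s - t)); assert (HD : 0 <= D) by apply Rabs_pos.
set (E0 := Rmin (Rmin ea eb) (Rmin ef (d / (Kp + D + 1)))).
assert (HE0 : 0 < E0 /\ E0 <= ea /\ E0 <= eb /\ E0 <= ef /\ E0 <= d / (Kp + D + 1)).
{ assert (0 < d / (Kp + D + 1)) by (apply Rdiv_lt_0_compat; lra).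
  unfold E0, Rmin; repeat destruct (Rle_dec _ _); lra. }
destruct HE0 as [P0 [P1 [P2 [P3 P4]]]].
destruct (INR_unbounded (/ E0)) as [N0 HN0].
assert (Z : 2 * l * (W s - W t) = 0).
2:{ assert (W s - W t = 0); [|lra]; apply Rmult_eq_reg_l with (2 * l); lra. }
(* 2 K comes from the first-order expansions at t and s, 2 C Kp^2 from replacing the two orbits by
   critical polygons, and the last term from N steps of size (2 Kp + D) / N. The difference of the
   unperturbed perimeters is carried along as the constant term. *)
apply (quadratic_zero (perimeter (ellipse a b) n (orb s) - perimeter (ellipse a b) n (orb t)) _
  (2 * K + 2 * (C * Kp ^ 2) + C * (2 * Kp + D) ^ 3) N0).
intros N HN HN'.
assert (Hi : 0 < INR N) by (apply lt_0_INR; lia).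
assert (Hi' : 0 < / INR N) by (now apply Rinv_0_lt_compat).
assert (HiE : / INR N <= E0).
{ rewrite <- (Rinv_inv E0); apply Rinv_le_contravar; [now apply Rinv_0_lt_compat|].
  apply le_INR in HN; lra. }
set (e := / INR N) in *.
assert (He : Rabs e = e) by (apply Rabs_pos_eq; lra).
set (ti := fun i => t + (s - t) * (INR i * e)).
destruct (choice _ (fun i => HP e (ti i) ltac:(lra))) as [x Hx].
assert (Hed : (Kp + D) * e <= d).
{ apply Rle_trans with ((Kp + D + 1) * (d / (Kp + D + 1))); [|right; field; lra].
  apply Rmult_le_compat; lra. }
assert (Hti : forall i, Rabs (ti (S i) - ti i) = D * e).
{ intros i; unfold ti; rewrite S_INR; replace (_ - _) with ((s - t) * e) by ring.
  now rewrite Rabs_mult, He. }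
assert (HKe : 0 <= Kp * e) by (apply Rmult_le_pos; lra).
assert (HDe : 0 <= D * e) by (apply Rmult_le_pos; lra).
assert (St : forall i, Rabs (perimeter (q e) n (x (S i)) - perimeter (q e) n (x i)) <= C * ((2 * Kp + D) * e) ^ 3).
{ intros i; destruct (Hx i) as [X1 [X2 X3]]; destruct (Hx (S i)) as [Y1 [Y2 Y3]]; rewrite He in *.
  apply (HL e (ti i) (x i) (x (S i)) ((2 * Kp + D) * e)); try easy; try lra.
  intros j Hj; specialize (X1 j Hj); specialize (Y1 j Hj).
  pose proof (orbit_lipschitz a b l Hl Hlb Hba delta (ti (S i)) (ti i) j) as O; fold orb in O; rewrite Hti in O.
  apply Rabs_le_between in X1, Y1, O.
  split; [|split]; apply Rabs_le; lra. }
assert (Ch : Rabs (perimeter (q e) n (x N) - perimeter (q e) n (x 0%nat)) <= C * (2 * Kp + D) ^ 3 * e ^ 2).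
{ rewrite <- (Rsum_telescope N (fun i => perimeter (q e) n (x i))).
  eapply Rle_trans; [apply Rsum_abs; intros; apply St|].
  right; replace (C * (2 * Kp + D) ^ 3 * e ^ 2) with (C * (2 * Kp + D) ^ 3 * e ^ 2 * (INR N * e)).
  - ring.
  - unfold e at 2; rewrite Rinv_r; lra. }
(* The orbit is not critical for the perturbed table, so only the quadratic bound applies; it is
   used just at the two ends of the chain. *)
assert (Hend : forall i, Rabs (perimeter (q e) n (orb (ti i)) - perimeter (q e) n (x i)) <= C * Kp ^ 2 * e ^ 2).
{ intros i; destruct (Hx i) as [X1 [X2 X3]]; rewrite He in *.
  replace (C * Kp ^ 2 * e ^ 2) with (C * (Kp * e) ^ 2) by ring.
  apply (HL e (ti i) (x i) (orb (ti i)) (Kp * e)); try easy; try lra.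
  intros j Hj; specialize (X1 j Hj); rewrite Rminus_diag, Rabs_R0.
  split; [lra|]; split; [lra|]; now rewrite Rabs_minus_sym. }
assert (T0 : ti 0%nat = t) by (unfold ti; simpl; ring).
assert (TN : ti N = s) by (unfold ti, e; rewrite Rinv_r; lra).
pose proof (Hend 0%nat) as H0; rewrite T0 in H0.
pose proof (Hend N) as HN1; rewrite TN in HN1.
pose proof (HF e t ltac:(lra)) as F0; pose proof (HF e s ltac:(lra)) as F1.
apply Rabs_le_between in Ch, H0, HN1, F0, F1.
apply Rabs_le; lra.
Qed.

End Melnikov.

(** * Parity of n and the two conclusions *)

Lemma Derive_antiperiodic (f : R -> R) (p c : R) :
  (forall x, f x + f (x + p) = c) -> antiperiodic p (Derive f).
Proof.
intros H x; unfold Derive.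
(* The difference quotients at x + p and at x are opposite for every h. *)
rewrite (Lim_ext (fun h => - ((f (x + h) - f x) / h))).
- rewrite (Lim_opp (fun h => (f (x + h) - f x) / h)); destruct (Lim _ 0); simpl; ring.
- intros h; replace (f (x + p + h)) with (c - f (x + h))
    by (rewrite <- (H (x + h)); replace (x + p + h) with (x + h + p) by ring; ring).
  rewrite <- (H x); unfold Rdiv; ring.
Qed.

Lemma entire_shift (f : R -> R) (s : R) :
  (exists F, (forall z, cdiff F z) /\ forall x : R, F (RtoC x) = RtoC (f x)) ->
  exists F, (forall z, cdiff F z) /\ forall x : R, F (RtoC x) = RtoC (f (x + s)).
Proof.
intros [F [HF Hf]]; exists (fun z => F (z + RtoC s)%C); split.
- intros z; apply (cdiff_comp F (fun z => z + RtoC s)%C); [|apply HF].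
  apply cdiff_plus; [apply cdiff_id | apply cdiff_const].
- intros x; now rewrite <- RtoC_plus, Hf.
Qed.

Lemma Rsum_shift (n : nat) (f : nat -> R) : Rsum (S n) f = f 0%nat + Rsum n (fun j => f (S j)).
Proof. induction n as [|n IH]; [simpl; ring|]; simpl in *; rewrite IH; ring. Qed.

Section Rotation.

Context (k : R) (Hk : 0 < k < 1) (delta : R) (m n : nat)
  (Hgcd : Nat.gcd m n = 1%nat) (Hdelta : INR n * delta = 2 * INR m * ellF k PI).

Lemma am_plus_nat_period (p : nat) (t : R) :
  am k Hk (t + INR p * ellF k PI) = am k Hk t + INR p * PI.
Proof.
induction p as [|p IH]; [simpl; rewrite !Rmult_0_l, !Rplus_0_r; easy|].
rewrite S_INR; replace (t + (INR p + 1) * ellF k PI) with (t + INR p * ellF k PI + ellF k PI) by ring.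
rewrite am_plus_period, IH; ring.
Qed.

Lemma ellF_PI_pos : 0 < ellF k PI.
Proof.
pose proof PI_RGT_0; pose proof (ellF_expand k Hk 0 PI ltac:(lra)) as E.
rewrite ellF_0 in E; lra.
Qed.

Lemma ellF_Z_PI (p : Z) : ellF k (IZR p * PI) = IZR p * ellF k PI.
Proof.
assert (N : forall i : nat, ellF k (INR i * PI) = INR i * ellF k PI).
{ intros i; pose proof (am_plus_nat_period i 0) as E; rewrite am_0, !Rplus_0_l in E.
  now rewrite <- E, ellF_am. }
destruct (Z_le_gt_dec 0 p) as [L | L].
- rewrite <- (Z2Nat.id p L), <- INR_IZR_INZ; apply N.
- set (i := Z.to_nat (- p)); assert (E : IZR p = - INR i).
  { unfold i; rewrite INR_IZR_INZ, Z2Nat.id, opp_IZR by lia; ring. }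
  pose proof (am_plus_nat_period i (- INR i * ellF k PI)) as A.
  replace (- INR i * ellF k PI + INR i * ellF k PI) with 0 in A by ring; rewrite am_0 in A.
  rewrite E; rewrite <- (ellF_am k Hk (- INR i * ellF k PI)); f_equal; lra.
Qed.

(** If am (j delta) = p PI, then j delta is p periods [ellF k PI]; with n delta = 2 m periods this
    reads n p = 2 m j, and Gauss's lemma removes m, which is prime to n. *)
Lemma sin_am_rotation (j : nat) : sin (am k Hk (INR j * delta)) = 0 ->
  (Z.of_nat n | 2 * Z.of_nat j)%Z.
Proof.
intros H; apply sin_eq_0_0 in H; destruct H as [p Hp].
assert (E : INR j * delta = IZR p * ellF k PI) by (rewrite <- ellF_Z_PI, <- Hp, ellF_am; easy).
pose proof ellF_PI_pos as P0.
assert (E2 : INR n * IZR p = INR m * (2 * INR j)).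
{ apply Rmult_eq_reg_r with (ellF k PI); [|lra].
  transitivity (INR j * (INR n * delta)); [|rewrite Hdelta; ring].
  rewrite Rmult_assoc, <- E; ring. }
rewrite !INR_IZR_INZ, <- !mult_IZR in E2; apply eq_IZR in E2.
apply (f_equal Z.abs_nat) in E2; rewrite !Zabs2Nat.inj_mul, !Zabs2Nat.id in E2.
destruct (Nat.gauss n m (2 * j)) as [i Hi].
- exists (Z.abs_nat p); rewrite (Nat.mul_comm _ n), E2; reflexivity.
- now rewrite Nat.gcd_comm.
- exists (Z.of_nat i); lia.
Qed.

End Rotation.

Lemma orbit_sum_odd (k : R) (Hk : 0 < k < 1) (f : R -> R) (delta : R) (m n : nat) :
  Nat.gcd m n = 1%nat -> Nat.Odd n -> INR n * delta = 2 * INR m * ellF k PI ->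
  periodic (2 * PI) f ->
  (exists F, (forall z, cdiff F z) /\ forall x : R, F (RtoC x) = RtoC (f x)) ->
  (forall s t, Rsum n (fun j => f (am k Hk (t + INR j * delta))) =
     Rsum n (fun j => f (am k Hk (s + INR j * delta)))) ->
  forall x y, f x = f y.
Proof.
intros Hg [h Hh] Hd Hper Hent Hsum; destruct n as [|n]; [lia|].
apply (entire_shift_sum_const k Hk f n (fun j => INR (S j) * delta)
  (Rsum (S n) (fun j => f (am k Hk (0 + INR j * delta))))); [easy | easy | |].
(* The odd number S n would divide 2 S j, which lies strictly between 0 and 2 S n, and so would be
   equal to it. *)
- intros j Hj H; apply (sin_am_rotation k Hk delta m (S n) Hg Hd) in H.
  destruct H as [p Hp].
  assert (0 < p)%Z by nia; assert (p < 2)%Z by nia; lia.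
- intros t; rewrite <- (Hsum 0 t), Rsum_shift; simpl INR; now rewrite Rmult_0_l, Rplus_0_r.
Qed.

(* Half of the orbit is the image of the other half under the half-turn, so the sum runs over
   n / 2 points only, with f replaced by f + f (. + PI). *)
Lemma orbit_sum_even (k : R) (Hk : 0 < k < 1) (f : R -> R) (delta : R) (m n : nat) :
  Nat.gcd m n = 1%nat -> Nat.Even n -> (1 <= n)%nat -> INR n * delta = 2 * INR m * ellF k PI ->
  periodic (2 * PI) f ->
  (exists F, (forall z, cdiff F z) /\ forall x : R, F (RtoC x) = RtoC (f x)) ->
  (forall s t, Rsum n (fun j => f (am k Hk (t + INR j * delta))) =
     Rsum n (fun j => f (am k Hk (s + INR j * delta)))) ->
  forall x y, f x + f (x + PI) = f y + f (y + PI).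
Proof.
intros Hg [h Hh] Hn Hd Hper Hent Hsum.
(* m is prime to the even number n. Its oddness makes half an orbit a rotation by PI rather than 0
   modulo 2 PI. *)
assert (Hm : Nat.Odd m).
{ destruct (Nat.Even_or_Odd m) as [[i Hi]|]; [exfalso|easy].
  assert (D : Nat.divide 2 (Nat.gcd m n)).
  { apply Nat.gcd_greatest; [exists i | exists h]; lia. }
  rewrite Hg in D; destruct D as [z Hz]; lia. }
destruct Hm as [i Hi].
assert (Hh' : INR h * delta = INR m * ellF k PI).
{ apply Rmult_eq_reg_l with 2; [|lra].
  rewrite <- !Rmult_assoc, <- Hd, Hh, mult_INR; simpl; ring. }
assert (Half : forall t, f (am k Hk (t + INR h * delta)) = f (am k Hk t + PI)).
{ intros t; rewrite Hh', am_plus_nat_period, Hi, plus_INR, mult_INR, !INR_IZR_INZ.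
  rewrite <- (period_Z f Hper (Z.of_nat i) (am k Hk t + PI)); f_equal; simpl; ring. }
assert (Split : forall t, Rsum n (fun j => f (am k Hk (t + INR j * delta))) =
  Rsum h (fun j => f (am k Hk (t + INR j * delta)) + f (am k Hk (t + INR j * delta) + PI))).
{ intros t; rewrite Hh.
  assert (G : forall r : nat, Rsum (h + r) (fun j => f (am k Hk (t + INR j * delta))) =
    Rsum h (fun j => f (am k Hk (t + INR j * delta))) + Rsum r (fun j => f (am k Hk (t + INR j * delta) + PI))).
  { induction r as [|r IH]; [rewrite Nat.add_0_r; simpl; ring|].
    rewrite Nat.add_succ_r; simpl; rewrite IH, plus_INR.
    replace (t + (INR h + INR r) * delta) with (t + INR r * delta + INR h * delta) by ring.
    rewrite Half; ring. }
  replace (2 * h)%nat with (h + h)%nat by lia; rewrite G; clear.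
  induction h as [|h IH]; simpl; [ring | rewrite <- IH; ring]. }
destruct h as [|h]; [lia|].
apply (entire_shift_sum_const k Hk (fun x => f x + f (x + PI)) h (fun j => INR (S j) * delta)
  (Rsum n (fun j => f (am k Hk (0 + INR j * delta))))).
- intros x; rewrite Hper; replace (x + 2 * PI + PI) with (x + PI + 2 * PI) by ring; now rewrite Hper.
- destruct (entire_shift f PI Hent) as [F2 [HF2 Hf2]]; destruct Hent as [F [HF Hf]].
  exists (fun z => F z + F2 z)%C; split; [intros; now apply cdiff_plus|].
  intros x; now rewrite Hf, Hf2, RtoC_plus.
(* Here S j is less than n / 2, so 2 S j lies strictly between 0 and n. *)
- intros j Hj H; apply (sin_am_rotation k Hk delta m n Hg Hd) in H.
  destruct H as [p Hp]; assert (0 < p)%Z by nia; nia.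
- intros t; rewrite <- (Hsum 0 t), Split, Rsum_shift; simpl INR; now rewrite Rmult_0_l, Rplus_0_r.
Qed.

Lemma persistent_orbit_sum (a b c mu0 : R) (mu : R -> R -> R) (mu1 : R -> R)
  (hb : 0 < b) (hab : b < a) (hc : c = sqrt (a ^ 2 - b ^ 2))
  (hcosh : cosh mu0 = a / c) (hsinh : sinh mu0 = b / c)
  (hmu : smooth_perturbation mu mu0 mu1) (hper : periodic (2 * PI) mu1)
  (m n : nat) (l : R) : (1 <= n)%nat -> 0 < l < b ->
  resonant_caustic m n (ellipse a b) (confocal_ellipse a b l) ->
  persists m n (fun eps phi => elliptic_point c (mu eps phi) phi) (confocal_ellipse a b l) ->
  exists (k : R) (Hk : 0 < k < 1) (delta : R), INR n * delta = 2 * INR m * ellF k PI /\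
    forall s t, Rsum n (fun j => mu1 (am k Hk (t + INR j * delta) + PI / 2)) =
      Rsum n (fun j => mu1 (am k Hk (s + INR j * delta) + PI / 2)).
Proof.
intros Hn [Hl Hlb] Hres [geps [Kg [eg [Heg Hg]]]].
destruct (chord_delta a b l Hl Hlb hab) as [delta Hdelta].
pose proof (orbit_resonant a b l Hl Hlb hab delta Hdelta m n Hn Hres) as Hrot.
exists (modulus a b l), (modulus_range a b l Hl Hlb hab), delta; split.
(* At t = 0 the closing relation reads am (n delta) = 2 m PI, which is also the amplitude of 2 m
   periods. *)
- specialize (Hrot 0); unfold orbit in Hrot; simpl INR in Hrot.
  rewrite Rmult_0_l, !Rplus_0_l, am_0, Rplus_0_r in Hrot.
  set (H := modulus_range a b l Hl Hlb hab) in *; set (k := modulus a b l) in *.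
  assert (E : am k H (INR n * delta) = am k H (0 + INR (2 * m) * ellF k PI)).
  { rewrite am_plus_nat_period, am_0, mult_INR; simpl INR; lra. }
  apply (f_equal (ellF k)) in E; rewrite !ellF_am, mult_INR in E; simpl INR in E; lra.
- intros s t; rewrite !(Rsum_ext n (fun j => mu1 (am _ _ (_ + INR j * delta) + PI / 2))
    (fun j => mu1 (orbit a b l Hl Hlb hab delta _ j)))
    by (intros j Hj; unfold orbit; f_equal; ring).
  apply (melnikov_const a b c l mu0 mu mu1 Hl Hlb hab hc hcosh hsinh hmu hper delta Hdelta m n)
    with (geps := geps) (Kg := Kg) (eg := eg); assumption.
Qed.

Theorem theorem1 (a b c mu0 : R) (mu : R -> R -> R) (mu1 : R -> R)
  (hb : 0 < b) (hab : b < a)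
  (hc : c = sqrt (a ^ 2 - b ^ 2))
  (hcosh : cosh mu0 = a / c) (hsinh : sinh mu0 = b / c)
  (hmu : smooth_perturbation mu mu0 mu1)
  (hper : periodic (2 * PI) mu1)
  (hentire : extends_to_entire mu1) :
  let Q : curve := ellipse a b in
  let Qeps : R -> curve := fun eps phi => elliptic_point c (mu eps phi) phi in
  ((~ exists k : R, forall phi : R, mu1 phi = k) ->
     forall (m n : nat) (lambda : R),
       Nat.gcd m n = 1%nat -> (1 <= m)%nat -> (2 * m < n)%nat -> Nat.Odd n ->
       0 < lambda < b ->
       resonant_caustic m n Q (confocal_ellipse a b lambda) ->
       ~ persists m n Qeps (confocal_ellipse a b lambda)) /\
  ((~ antiperiodic PI (Derive mu1)) ->
     forall (m n : nat) (lambda : R),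
       Nat.gcd m n = 1%nat -> (1 <= m)%nat -> (2 * m < n)%nat -> Nat.Even n ->
       0 < lambda < b ->
       resonant_caustic m n Q (confocal_ellipse a b lambda) ->
       ~ persists m n Qeps (confocal_ellipse a b lambda)).
Proof.
intros Q Qeps.
(* The translation by PI / 2 absorbs the one between impact points and amplitudes. *)
assert (Hent : exists F, (forall z, cdiff F z) /\ forall x : R, F (RtoC x) = RtoC (mu1 (x + PI / 2))).
{ apply entire_shift; destruct hentire as [F [HF Hf]]; exists F; split; [|easy].
  intros z; apply cdiff_of_ex_derive, HF. }
assert (Hper : periodic (2 * PI) (fun x => mu1 (x + PI / 2))).
{ intros x; replace (x + 2 * PI + PI / 2) with (x + PI / 2 + 2 * PI) by ring; apply hper. }
split; intros H m n l Hg Hm Hmn Hpar Hl Hres Hpers; apply H;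
  destruct (persistent_orbit_sum a b c mu0 mu mu1 hb hab hc hcosh hsinh hmu hper m n l ltac:(lia) Hl Hres Hpers)
    as [k [Hk [delta [Hd Hsum]]]].
- exists (mu1 0); intros x.
  pose proof (orbit_sum_odd k Hk (fun x => mu1 (x + PI / 2)) delta m n Hg Hpar Hd Hper Hent Hsum
    (x - PI / 2) (0 - PI / 2)) as E; simpl in E.
  replace (x - PI / 2 + PI / 2) with x in E by ring.
  replace (0 - PI / 2 + PI / 2) with 0 in E by ring; exact E.
- apply Derive_antiperiodic with (mu1 0 + mu1 (0 + PI)); intros x.
  pose proof (orbit_sum_even k Hk (fun x => mu1 (x + PI / 2)) delta m n Hg Hpar ltac:(lia) Hd Hper Hent Hsum
    (x - PI / 2) (0 - PI / 2)) as E; simpl in E.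
  replace (x - PI / 2 + PI + PI / 2) with (x + PI) in E by ring.
  replace (0 - PI / 2 + PI + PI / 2) with (0 + PI) in E by ring.
  replace (x - PI / 2 + PI / 2) with x in E by ring.
  replace (0 - PI / 2 + PI / 2) with 0 in E by ring; exact E.
Qed.
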